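(* Let $d\ge3$ be an integer, $M$ a finite set, $r\ge1$ an integer and $p\in\mathcal I_{d,r}(M)$. If for all couplings $q\in\mathcal I_{d,r}(M^2)$ of $p$ and $p$ we have $\Sigma(q)\le2\Sigma(p)$, then $$\underline h(\mu(p))=\bar h(\mu(p))=\Sigma(p)$$ and $\mu(p)$ is strongly typical.
   Context: **Processes.** $T_d$ is the infinite $d$-regular tree with root $o$, whose neighbors are labeled $1,\dots,d$. $\mathcal I_d(M)$ is the set of probability measures on $M^{T_d}$ invariant under all automorphisms of $T_d$. $B_r(S)$ is the set of vertices of $T_d$ at distance at most $r$ from $S$; for $r\ge1$, $S_r=B_r(o)$ and $E_r=B_{r-1}(\{o,1\})$. **$r$-Markov processes.** A probability measure on $M^{T_d}$ is $r$-Markov if, for each edge $e$, conditioned on the values at $B_{r-1}(e)$, the processes on the left and right subtrees of $e$ are independent. $\mathcal I_{d,r}(M)$ is the set of probability measures on $M^{S_r}$ that are invariant under automorphisms of $S_r$ and whose restriction to $E_r$ is invariant by switching the two sides of the edge $\{o,1\}$. For $p\in\mathcal I_{d,r}(M)$, $\mu(p)\in\mathcal I_d(M)$ is the unique $r$-Markov process whose marginal on $S_r$ is $p$. $H$ is Shannon entropy (natural logarithm), and for $p\in\mathcal I_{d,r}(M)$, $\Sigma(p)=H(X_{S_r})-\frac d2H(X_{E_r})$ with $X\sim p$ ($X_S$ is the restriction of $X$ to $S$; same definition for color set $M^2$). A coupling of $p$ and $p$ is a probability measure on $M^{S_r}\times M^{S_r}\cong(M^2)^{S_r}$ with both marginals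 equal to $p$. **Random labeling and topology.** Let $\mathbb N=\{1,2,\dots\}$ and $\mathbb N^f=\bigcup_{k\ge0}\mathbb N^k$ with $\mathbb N^0=\{o\}$. A rooted $M$-colored graph $(G,f,v)$ is a connected graph $G$ with a map $f$ from its vertices to $M$ and a distinguished vertex $v$. If $G$ is locally finite, its randomly labeled version is the isomorphic random rooted colored graph on a subset of $\mathbb N^f$ given by the breadth-first search from the root with ties broken uniformly at random: the root gets label $o$, and the $j$-th offspring of the vertex labeled $(i_1,\dots,i_{k-1})$ gets label $(i_1,\dots,i_{k-1},j)$. $\mathcal G^\bullet_M$ is the set of rooted colored graphs arising as such labelings, with metric $\sum_{r\ge0}2^{-r}\mathbf 1_{g_r\ne g'_r}$, where $g_r$ is the restriction of $g$ to vertices at distance at most $r$ from the root. Fix a distance $\mathrm d$ on $\mathcal P(\mathcal G^\bullet_M)$ (probability measures) generating the weak topology (e.g. Lévy–Prohorov; the notions below do not depend on this choice). $T_d$ is built on a subset of $\mathbb N^f$ in this way, and $\mu\in\mathcal I_d(M)$ is identified with the law of $(T_d,X,o)$, $X\sim\mu$. For $\nu\in\mathcal P(\mathcal G^\bullet_M)$, $\nu_r$ is the law of the restriction to vertices at distance at most $r$ from the root. For a finite graph $G$ with vertex set $V$ and $f:V\to M$, $\mathrm{distr}_G(f)=\frac1{|V|}\sum_{v\in V}\mathrm{distr}_{G,v}(f)$, where $\mathrm{distr}_{G,v}(f)$ is the law of the randomly labeled version of the connected component of $v$ in $(G,f)$, rooted at $v$. **Sofic entropies and typicality.** For $n\ge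 d+1$ with $nd$ even, $\mathcal G_n(d)$ is the set of simple $d$-regular graphs on $[n]=\{1,\dots,n\}$ and $G_n$ is uniform on $\mathcal G_n(d)$; all limits in $n$ are along such $n$. For $\mu\in\mathcal I_d(M)$, $\epsilon>0$, $t\ge0$, set $\mathcal F_G(\mu,t,\epsilon)=\{f\in M^n:\mathrm d(\mathrm{distr}_G(f)_t,\mu_t)\le\epsilon\}$ and $H_G(\mu,t,\epsilon)=\frac1n\log|\mathcal F_G(\mu,t,\epsilon)|\in\{-\infty\}\cup[0,\infty)$. For $0<\alpha<1$, let $h_n(\mu,t,\epsilon,\alpha)=\sup\{h\in\{-\infty\}\cup[0,\infty):\mathbb P(H_{G_n}(\mu,t,\epsilon)\ge h)\ge\alpha\}$, $\bar h(\mu,t,\alpha)=\lim_{\epsilon\to0}\limsup_{n}h_n(\mu,t,\epsilon,\alpha)$ and $\underline h(\mu,t,\alpha)=\lim_{\epsilon\to0}\liminf_n h_n(\mu,t,\epsilon,\alpha)$. These do not depend on $\alpha\in(0,1)$; the common values are $\bar h(\mu,t)$ and $\underline h(\mu,t)$. They are non-increasing in $t$, and $\bar h(\mu)=\lim_{t\to\infty}\bar h(\mu,t)$, $\underline h(\mu)=\lim_{t\to\infty}\underline h(\mu,t)$. $\mu$ is strongly typical if $\lim_{\epsilon\to0}\lim_{n\to\infty}\mathbb P(\exists f\in M^n:\mathrm d(\mathrm{distr}_{G_n}(f),\mu)\le\epsilon)=1$. *)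

(* Defs.v *)
From HB Require Import structures.
From mathcomp Require Import all_boot all_order all_algebra fingroup perm finmap.
From mathcomp Require Import all_classical all_reals all_analysis.
From mathcomp Require Import lra.

Set Implicit Arguments.
Unset Strict Implicit.
Unset Printing Implicit Defensive.
Import Order.TTheory GRing.Theory Num.Theory.
Import numFieldNormedType.Exports.

Local Open Scope classical_set_scope.
Local Open Scope ring_scope.

(* A nonempty finite set; measurable types are pointed in the library. *)
#[short(type="pointedFinType")]
HB.structure Definition PointedFinite := {M of Finite M & Pointed M}.

Definition dist_le (T : eqType) (e : rel T) (k : nat) (x y : T) : Prop :=
  exists p : seq T, [/\ path e x p, last x p = y & (size p <= k)%N].

(* Words over {1, 2, ..} are words over [nat] without the letter 0; the
   breadth-first search explores vertices in the following order. *)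
Definition shortlex (s t : seq nat) : bool :=
  (size s < size t)%N ||
  ((size s == size t) && ((s : seqlexi nat) <= (t : seqlexi nat))%O).

Lemma shortlex_size s t : shortlex s t -> (size s <= size t)%N.
Proof. by case/orP => [/ltnW|/andP[/eqP->]]. Qed.

Lemma shortlex_total : total shortlex.
Proof.
move=> s t; rewrite /shortlex.
by case: (ltngtP (size s) (size t)) => //= _; exact: le_total.
Qed.

Lemma shortlex_trans : transitive shortlex.
Proof.
move=> t s u /orP[st|/andP[/eqP st le_st]] /orP[tu|/andP[/eqP tu le_tu]];
  rewrite /shortlex.
- by rewrite (ltn_trans st tu).
- by rewrite -tu st.
- by rewrite st tu.
- by rewrite st tu eqxx (le_trans le_st le_tu) orbT.
Qed.

(* [lcol g s] is the color of the vertex labeled [s], and [None] when no vertex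
   of [g] has label [s]. *)
Record lgraph (M : Type) := LGraph {
  lcol : seq nat -> option M;
  ladj : rel (seq nat) }.

Definition lvertex M (g : lgraph M) (s : seq nat) : bool := lcol g s.

(* The graphs produced by a breadth-first search: the vertex that discovers a
   non-root vertex is its shortlex-least neighbor, and the offspring of a vertex
   are numbered 1, 2, .. without gap.  Connectedness follows. *)
Record bfs_labeled M (g : lgraph M) : Prop := BfsLabeled {
  bfs_root : lvertex g [::];
  bfs_adj_vertex : forall s t, ladj g s t -> lvertex g s && lvertex g t;
  bfs_adj_sym : forall s t, ladj g s t = ladj g t s;
  bfs_adj_irr : forall s, ~~ ladj g s s;
  bfs_sibling : forall s j, lvertex g (rcons s j) ->
    (0 < j)%N /\ forall i, (0 < i <= j)%N -> lvertex g (rcons s i);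
  bfs_parent_adj : forall s j, lvertex g (rcons s j) -> ladj g s (rcons s j);
  bfs_parent_least : forall s j t, ladj g t (rcons s j) -> shortlex s t;
  bfs_locally_finite : forall s, finite_set [set t | ladj g s t] }.

Lemma lgraph_eq M (g g' : lgraph M) :
  lcol g = lcol g' -> ladj g = ladj g' -> g = g'.
Proof. by case: g g' => [? ?] [? ?] /= -> ->. Qed.

Definition lrestrict M (k : nat) (g : lgraph M) : lgraph M :=
  let inball s := `[< dist_le (ladj g) k [::] s >] in
  {| lcol := fun s => if inball s then lcol g s else None;
     ladj := fun s t => [&& ladj g s t, inball s & inball t] |}.

Section labeled_theory.
Variables (M : Type) (g : lgraph M).
Hypothesis gP : bfs_labeled g.

Lemma ladj_size s t : ladj g s t -> (size t <= (size s).+1)%N.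
Proof.
case/lastP: t => [//|t j] /(bfs_parent_least gP) /shortlex_size.
by rewrite size_rcons ltnS.
Qed.

Lemma dist_le_root k s :
  lvertex g s -> `[< dist_le (ladj g) k [::] s >] = (size s <= k)%N.
Proof.
move=> sg; apply/asboolP/idP => [[p [ep <- /(leq_trans _)]]|]; last first.
  elim/last_ind: s k sg => [|s j IH] k sg; first by move=> _; exists [::].
  rewrite size_rcons; case: k => // k; rewrite ltnS => sk.
  have sj := bfs_parent_adj gP sg.
  have /andP[vs _] := bfs_adj_vertex gP sj.
  have [p [ep lp sp]] := IH _ vs sk.
  exists (rcons p (rcons s j)).
  by rewrite rcons_path ep lp sj last_rcons size_rcons ltnS sp.
apply; elim/last_ind: p ep => [//|p x IH].
rewrite rcons_path last_rcons size_rcons => /andP[/IH h /ladj_size].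
by move/leq_trans; apply; rewrite ltnS.
Qed.

Lemma lrestrict_col k s :
  lcol (lrestrict k g) s = if (size s <= k)%N then lcol g s else None.
Proof.
rewrite /=; case E : (lcol g s) => [c|]; last by case: asbool; case: leq.
by rewrite dist_le_root // /lvertex E.
Qed.

Lemma lrestrict_vertex k s :
  lvertex (lrestrict k g) s = (size s <= k)%N && lvertex g s.
Proof. by rewrite /lvertex lrestrict_col; case: ifP. Qed.

Lemma lrestrict_adj k s t :
  ladj (lrestrict k g) s t = [&& ladj g s t, (size s <= k)%N & (size t <= k)%N].
Proof.
rewrite /=; case E : (ladj g s t) => //=.
by have /andP[vs vt] := bfs_adj_vertex gP E; rewrite !dist_le_root.
Qed.

Lemma lrestrict_bfs k : bfs_labeled (lrestrict k g).
Proof.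
split.
- by rewrite lrestrict_vertex (bfs_root gP).
- move=> s t; rewrite lrestrict_adj => /and3P[st sk tk].
  by rewrite !lrestrict_vertex sk tk (bfs_adj_vertex gP st).
- by move=> s t; rewrite !lrestrict_adj (bfs_adj_sym gP) [X in _ && X]andbC.
- by move=> s; rewrite lrestrict_adj (negbTE (bfs_adj_irr gP s)).
- move=> s j; rewrite lrestrict_vertex size_rcons => /andP[sk /(bfs_sibling gP)].
  move=> [j0 h]; split => // i /h; rewrite lrestrict_vertex size_rcons sk.
  by [].
- move=> s j; rewrite lrestrict_vertex lrestrict_adj size_rcons.
  by move=> /andP[sk /(bfs_parent_adj gP) ->]; rewrite sk (ltnW sk).
- by move=> s j t; rewrite lrestrict_adj => /and3P[/(bfs_parent_least gP)].
- move=> s; apply: sub_finite_set (bfs_locally_finite gP s) => t /=.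
  by case/and3P.
Qed.

End labeled_theory.

Lemma lrestrict_eqP M (g g' : lgraph M) (k : nat) :
  bfs_labeled g -> bfs_labeled g' ->
  lrestrict k g = lrestrict k g' <->
  (forall s, (size s <= k)%N -> lcol g s = lcol g' s) /\
  (forall s t, (size s <= k)%N -> (size t <= k)%N -> ladj g s t = ladj g' s t).
Proof.
move=> gP gP'; split=> [gg'|[hc ha]].
  split=> [s sk|s t sk tk].
    by move: (lrestrict_col gP k s) (lrestrict_col gP' k s); rewrite gg' sk => -> ->.
  move: (lrestrict_adj gP k s t) (lrestrict_adj gP' k s t).
  by rewrite gg' sk tk !andbT => -> ->.
apply: lgraph_eq.
  by apply/funext => s; rewrite !lrestrict_col//; case: ifP => // /hc.
apply/funext => s; apply/funext => t; rewrite !lrestrict_adj//.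
by case sk: (size s <= k)%N; case tk : (size t <= k)%N; rewrite ?andbF// ha.
Qed.

HB.instance Definition _ (M : Type) := gen_eqMixin (lgraph M).
HB.instance Definition _ (M : Type) := gen_choiceMixin (lgraph M).

(* [R] is only a phantom: it is the field of values of the metric below. *)
Record rcgraph (R : realType) (M : Type) := RCGraph {
  rcgraph_val :> lgraph M;
  rcgraph_bfs : `[< bfs_labeled rcgraph_val >] }.

HB.instance Definition _ R M := [isSub for @rcgraph_val R M].
HB.instance Definition _ R M := [Choice of rcgraph R M by <:].

Lemma rcgraphP (R : realType) M (g : rcgraph R M) : bfs_labeled g.
Proof. exact/asboolP/rcgraph_bfs. Qed.

Definition mk_rcgraph (R : realType) M (g : lgraph M) (gP : bfs_labeled g) :
  rcgraph R M := RCGraph R (asboolT gP).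

Definition one_vertex M (c : M) : lgraph M :=
  {| lcol := fun s => if s is [::] then Some c else None;
     ladj := fun _ _ => false |}.

Lemma one_vertex_bfs M (c : M) : bfs_labeled (one_vertex c).
Proof.
split=> //; try by move=> s j; case: s.
by move=> s; apply: sub_finite_set (finite_set0 _).
Qed.

HB.instance Definition _ R (M : pointedType) :=
  isPointed.Build (rcgraph R M) (mk_rcgraph R (one_vertex_bfs (point : M))).

Definition restrict (R : realType) M (k : nat) (g : rcgraph R M) : rcgraph R M :=
  mk_rcgraph R (lrestrict_bfs (rcgraphP g) k).

Lemma restrict_eq (R : realType) M k (g g' : rcgraph R M) :
  restrict k g = restrict k g' <-> lrestrict k g = lrestrict k g'.
Proof. by split => [/(congr1 val)|h]; [exact|exact: val_inj]. Qed.

Lemma restrict_eqW (R : realType) M j k (g g' : rcgraph R M) : (j <= k)%N ->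
  restrict k g = restrict k g' -> restrict j g = restrict j g'.
Proof.
move=> jk; rewrite !restrict_eq !lrestrict_eqP; do ?exact: rcgraphP.
have sz (s : seq nat) : (size s <= j -> size s <= k)%N by move/leq_trans; apply.
by move=> [hc ha]; split => [s /sz/hc|s t /sz sk /sz]; last exact: ha.
Qed.

Section metric.
Context {R : realType} {M : Type}.
Implicit Types g h : rcgraph R M.

Definition gdist_term g g' (k : nat) : R :=
  2^-1 ^+ k * (restrict k g != restrict k g')%:R.

Definition gdist g g' : R := limn (series (gdist_term g g')).

Lemma gdist_term_ge0 g g' k : 0 <= gdist_term g g' k.
Proof. by rewrite mulr_ge0// exprn_ge0// invr_ge0. Qed.

Lemma gdist_term_le g g' k : gdist_term g g' k <= geometric 1 2^-1 k.
Proof.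
rewrite /gdist_term /geometric /= mul1r ler_piMr ?exprn_ge0 ?invr_ge0//.
by case: (_ != _).
Qed.

Let half1 : `|2^-1 : R| < 1.
Proof. by rewrite ger0_norm ?invr_ge0// invf_lt1// ltr1n. Qed.

Lemma gdist_cvg g g' : cvgn (series (gdist_term g g')).
Proof.
apply: (series_le_cvg (gdist_term_ge0 g g') _ (gdist_term_le g g')).
  by move=> k; rewrite /geometric /= mul1r exprn_ge0 ?invr_ge0.
exact: is_cvg_geometric_series.
Qed.

Lemma gdist_term_gdist g g' k : gdist_term g g' k <= gdist g g'.
Proof.
have nd : {homo series (gdist_term g g') : n m / (n <= m)%N >-> n <= m}.
  by apply: nondecreasing_series => i _ _; exact: gdist_term_ge0.
have := nondecreasing_cvgn_le nd (@gdist_cvg g g') k.+1.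
apply: le_trans.
by rewrite /series /= big_nat_recr//= lerDr sumr_ge0// => i _; exact: gdist_term_ge0.
Qed.

Lemma gdistxx g : gdist g g = 0.
Proof.
rewrite /gdist (_ : series _ = cst 0) ?lim_cst//.
by apply/funext => n; rewrite /series /= big1// => i _; rewrite /gdist_term eqxx mulr0.
Qed.

Lemma gdist_restrict g g' k :
  gdist g g' < 2^-1 ^+ k -> restrict k g = restrict k g'.
Proof.
move=> lt; apply/eqP; apply: contraTT lt => ne; rewrite -leNgt.
by apply: le_trans (gdist_term_gdist g g' k); rewrite /gdist_term ne mulr1.
Qed.

Lemma restrict_inj g g' : (forall k, restrict k g = restrict k g') -> g = g'.
Proof.
move=> gg'; apply: val_inj; apply: lgraph_eq.
  apply/funext => s; have /restrict_eq := gg' (size s).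
  by rewrite lrestrict_eqP; [case=> h _; exact: h|exact: rcgraphP..].
apply/funext => s; apply/funext => t.
have /restrict_eq := gg' (maxn (size s) (size t)).
rewrite lrestrict_eqP; [case=> _ h|exact: rcgraphP..].
by apply: h; rewrite ?leq_maxl ?leq_maxr.
Qed.

Lemma gdist_eq0 g g' : gdist g g' = 0 -> g = g'.
Proof.
move=> g0; apply: restrict_inj => k; apply: gdist_restrict.
by rewrite g0 exprn_gt0// invr_gt0.
Qed.

Lemma gdist_sym g g' : gdist g g' = gdist g' g.
Proof.
by congr (limn (series _)); apply/funext => k; rewrite /gdist_term eq_sym.
Qed.

Lemma gdist_triangle g' g h : gdist g h <= gdist g g' + gdist g' h.
Proof.
rewrite /gdist -limD; [|exact: gdist_cvg..].
have -> : series (gdist_term g g') + series (gdist_term g' h) =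
    series (fun k => gdist_term g g' k + gdist_term g' h k).
  by apply/funext => n; rewrite /series /= big_split.
apply: lim_series_le; first exact: gdist_cvg.
  rewrite (_ : series _ = series (gdist_term g g') + series (gdist_term g' h)).
    by apply: is_cvgD; exact: gdist_cvg.
  by apply/funext => n; rewrite /series /= big_split.
move=> k; rewrite /gdist_term -mulrDr ler_wpM2l ?exprn_ge0 ?invr_ge0//.
rewrite -natrD ler_nat.
have [->|ne] := eqVneq (restrict k g) (restrict k g'); first by [].
by case: (_ != _).
Qed.

Lemma gdist_le g g' k : restrict k g = restrict k g' -> gdist g g' <= 2^-1 ^+ k.
Proof.
move=> gk; apply: limr_le; first exact: gdist_cvg.
have bound n : series (gdist_term g g') (k.+1 + n)%N <=
    2^-1 ^+ k - 2^-1 ^+ (k + n).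
  elim: n => [|n IH].
    rewrite !addn0 subrr /series /= big_nat big1// => i /= ik.
    by rewrite /gdist_term (restrict_eqW _ gk) ?eqxx ?mulr0.
  rewrite addnS /series /= big_nat_recr//=.
  apply: le_trans (lerD IH (gdist_term_le g g' _)) _.
  rewrite /geometric /= mul1r addSn addnS [in leRHS]exprS exprS.
  set x := 2^-1 ^+ (k + n); rewrite -addrA lerD2l.
  by have : x = 2^-1 * x + 2^-1 * x; lra.
near=> n; have kn : (k.+1 <= n)%N by near: n; exists k.+1.
rewrite -(subnKC kn); apply: le_trans (bound _) _.
by rewrite gerBl exprn_ge0// invr_ge0.
Unshelve. all: end_near. Qed.

HB.instance Definition _ := @isMetric.Build R (rcgraph R M) gdist
  gdistxx gdist_eq0 gdist_sym gdist_triangle.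

End metric.

Notation borel_rcgraph R M := (g_sigma_algebraType (@open (rcgraph R M))).

Notation law R M := (probability (borel_rcgraph R M) R).

Section restrict_measurable.
Variables (R : realType) (M : pointedType) (k : nat).

Let restrict_measurable :
  measurable_fun [set: borel_rcgraph R M]
    (restrict k : borel_rcgraph R M -> borel_rcgraph R M).
Proof.
apply: (@measurability _ _ (borel_rcgraph R M) (borel_rcgraph R M) _ _
  (@open (rcgraph R M))) => // _ [B oB <-]; rewrite setTI.
apply: sub_sigma_algebra; rewrite /= openE => g gB.
apply/nbhs_ballP; exists (2^-1 ^+ k); first by rewrite /= exprn_gt0// invr_gt0.
move=> h; rewrite ballEmdist => /gdist_restrict gh.
by rewrite /preimage /= -gh.
Qed.

HB.instance Definition _ := isMeasurableFun.Build _ _ _ _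
  (restrict k : borel_rcgraph R M -> borel_rcgraph R M) restrict_measurable.

Definition restrict_law (nu : law R M) : law R M :=
  distribution nu (restrict k : borel_rcgraph R M -> borel_rcgraph R M).

End restrict_measurable.

(* Vertices of [T_d] are words over {1, 2, ..}: the root is the empty word, it
   has the d children [1; ..; d], and every other vertex has d - 1 children. *)
Definition tree_label (d : nat) (s : seq nat) : bool :=
  if s is i :: t then (0 < i <= d)%N && all (fun j => 0 < j < d)%N t else true.

Definition is_child (s t : seq nat) : bool :=
  if t is i :: t' then s == belast i t' else false.

Lemma is_child_rcons s t j : is_child s (rcons t j) = (s == t).
Proof. by case: t => //= i t; rewrite belast_rcons. Qed.

Lemma is_child_size s t : is_child s t -> size t = (size s).+1.
Proof. by case: t => //= i t /eqP->; rewrite size_belast. Qed.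

Record tree (d : nat) := Tree {
  tree_val :> seq nat;
  tree_valP : tree_label d tree_val }.

HB.instance Definition _ d := [isSub for @tree_val d].
HB.instance Definition _ d := [Countable of tree d by <:].

Definition tadj (d : nat) (u v : tree d) : bool := is_child u v || is_child v u.

Lemma tree_label_rcons d s j : tree_label d (rcons s j) =
  tree_label d s && (if s is [::] then 0 < j <= d else 0 < j < d)%N.
Proof.
case: s => [|i s] /=; first by rewrite andbT.
by rewrite all_rcons -[RHS]andbA; congr (_ && _); exact: andbC.
Qed.

Lemma tree_label_le d s : tree_label d s -> all (fun i => i <= d)%N s.
Proof.
case: s => //= i s /andP[/andP[_ ->] /=]; apply: sub_all => j.
by move=> /andP[_ /ltnW].
Qed.

Lemma finite_words d n :
  finite_set [set s : seq nat | (size s <= n)%N /\ all (fun i => i <= d)%N s].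
Proof.
elim: n => [|n IH].
  apply: (@sub_finite_set _ _ [set [::]]); last exact: finite_set1.
  by move=> [|? ?] //= [].
apply: (@sub_finite_set _ _ ([set [::]] `|`
  [set z.1 :: z.2 | z in `I_d.+1 `*` [set s | (size s <= n)%N /\ all (fun i => i <= d)%N s]])).
  move=> [|i s] /=; first by left.
  by rewrite ltnS => -[sn /andP[id sd]]; right; exists (i, s).
rewrite finite_setU; split; first exact: finite_set1.
exact/finite_image/finite_setX.
Qed.

Definition root (d : nat) : tree d := Tree (isT : tree_label d [::]).

Lemma finite_tree d n : finite_set [set u : tree d | (size u <= n)%N].
Proof.
apply: (sub_finite_set _ (finite_image (insubd (root d)) (finite_words d n))).
move=> u /= un; exists (tree_val u); last by rewrite (valKd (root d) u).
by split => //; exact/tree_label_le/tree_valP.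
Qed.

(* [tree_ball k S] is B_k(S), for finite [S]. *)
Definition tree_ball (d k : nat) (S : set (tree d)) : {fset tree d} :=
  fset_set [set u | exists2 s, S s & dist_le (@tadj d) k s u].

Lemma finite_ball d k (S : set (tree d)) : finite_set S ->
  finite_set [set u | exists2 s, S s & dist_le (@tadj d) k s u].
Proof.
move=> Sfin; have [n Sn] : exists n, forall s, S s -> (size s <= n)%N.
  exists (\max_(s <- fset_set S) size s)%N => s Ss.
  by apply: (leq_bigmax_seq (F := fun s : tree d => size s)); rewrite ?in_fset_set ?inE.
apply: sub_finite_set (finite_tree d (n + k)) => u /= [s /Sn sn [p [ep <- pk]]].
apply: (@leq_trans (size s + size p)); last exact: leq_add.
elim: p s {sn pk} ep => [|v p IH] s /=; first by rewrite addn0.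
move=> /andP[sv /IH /leq_trans]; apply; rewrite addnS -addSn leq_add2r.
by case/orP: sv => /is_child_size-> //; rewrite leqW.
Qed.

Lemma in_tree_ball d k (S : set (tree d)) u : finite_set S ->
  (u \in tree_ball k S) <-> exists2 s, S s & dist_le (@tadj d) k s u.
Proof. by move=> /(finite_ball k) fS; rewrite in_fset_set// inE. Qed.

Section tree_graph.
Variables (d : nat) (M : Type) (X : tree d -> M).

Definition tree_lgraph : lgraph M :=
  {| lcol := fun s => omap X (insub s);
     ladj := fun s t => if (insub s : option (tree d), insub t) is (Some u, Some v)
                        then tadj u v else false |}.

Lemma tree_vertex s : lvertex tree_lgraph s = tree_label d s.
Proof. by rewrite /lvertex /=; case: insubP => [u -> _|/negbTE->]. Qed.

Lemma tree_ladj s t : ladj tree_lgraph s t =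
  [&& tree_label d s, tree_label d t & is_child s t || is_child t s].
Proof.
rewrite /=; case: insubP => [u -> <-|/negbTE->]//.
by case: insubP => [v -> <-|/negbTE->].
Qed.

Lemma tree_lgraph_bfs : bfs_labeled tree_lgraph.
Proof.
split.
- by rewrite tree_vertex.
- by move=> s t; rewrite tree_ladj !tree_vertex => /and3P[-> ->].
- by move=> s t; rewrite !tree_ladj orbC andbCA.
- move=> s; rewrite tree_ladj orbb; apply/and3P => -[_ _ /is_child_size].
  by move/n_Sn.
- move=> s j; rewrite tree_vertex tree_label_rcons => /andP[sd jd].
  split=> [|i ij]; first by case: s jd {sd} => [|? ?] /andP[].
  rewrite tree_vertex tree_label_rcons sd; case/andP: ij => i0 ij.
  by case: s jd {sd} => [|? ?] /andP[_ jd]; rewrite i0; [exact: leq_trans jd|exact: leq_ltn_trans jd].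
- move=> s j; rewrite tree_vertex tree_ladj => sj; rewrite sj is_child_rcons eqxx.
  by move: sj; rewrite tree_label_rcons => /andP[->].
- move=> s j t; rewrite tree_ladj is_child_rcons => /and3P[_ _ /orP[/eqP->|]].
    by case/orP: (shortlex_total s s).
  by move=> /is_child_size; rewrite size_rcons /shortlex => ->; rewrite !ltnS leqW.
- move=> s; apply: sub_finite_set (finite_words d (size s).+1) => t.
  rewrite /mkset tree_ladj => /and3P[_ /tree_label_le td st]; split => //.
  by case/orP: st => /is_child_size-> //; rewrite !leqW.
Qed.

End tree_graph.

Definition tree_rcgraph (R : realType) d M (X : tree d -> M) : rcgraph R M :=
  mk_rcgraph R (tree_lgraph_bfs X).

Definition coordinate_events (d : nat) (M : Type) (S : set (tree d)) :
    set (set (tree d -> M)) :=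
  [set A | exists2 v, S v & exists c, A = [set X | X v = c]].

(* M^{T_d} with its product sigma-algebra *)
Notation config d M := (g_sigma_algebraType (@coordinate_events d M setT)).

Section tree_law.
Variables (R : realType) (d : nat) (M : pointedFinType).

Let agree k (X Y : tree d -> M) := forall u : tree d, (size u <= k)%N -> X u = Y u.

Let restrict_tree k X Y : agree k X Y ->
  restrict k (tree_rcgraph R X) = restrict k (tree_rcgraph R Y).
Proof.
move=> XY; apply/restrict_eq; apply/lrestrict_eqP; do ?exact: rcgraphP.
split => //= s sk; case: insubP => //= u _ us.
by rewrite XY// [tree_val u]us.
Qed.

Let measurable_agree k (P : set (tree d -> M)) :
  (forall X Y, agree k X Y -> P X -> P Y) -> measurable (P : set (config d M)).
Proof.
move=> Pk; pose B := fset_set [set u : tree d | (size u <= k)%N].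
have inB (u : tree d) : (size u <= k)%N -> u \in B.
  by move=> uk; rewrite in_fset_set ?inE//; exact: finite_tree.
pose C (c : {ffun B -> M}) : set (tree d -> M) :=
  \bigcap_(v in [set: B]) [set X | X (val v) = c v].
have CP X : C [ffun v => X (val v)] X by move=> v _ /=; rewrite ffunE.
have -> : P = \bigcup_(c in [set c | C c `&` P !=set0]) C c.
  apply/seteqP; split => [X PX|X [c [Y [CY PY]] CX]].
    by exists [ffun v => X (val v)] => //; exists X.
  apply: Pk PY => u uk.
  by have := CY [` inB _ uk]%fset I; have := CX [` inB _ uk]%fset I => /= -> ->.
apply: fin_bigcup_measurable => [|c _]; first exact: finite_finset.
apply: fin_bigcap_measurable => [|v _]; first exact: finite_finset.
by apply: sub_sigma_algebra; exists (val v) => //; exists (c v).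
Qed.

Let tree_rcgraph_measurable : measurable_fun [set: config d M]
  (@tree_rcgraph R d M : config d M -> borel_rcgraph R M).
Proof.
apply: (@measurability _ _ (config d M) (borel_rcgraph R M) _ _
  (@open (rcgraph R M))) => // _ [U oU <-]; rewrite setTI.
pose A k : set (tree d -> M) :=
  [set X | forall Y, agree k X Y -> U (tree_rcgraph R Y)].
have -> : @tree_rcgraph R d M @^-1` U = \bigcup_k A k.
  apply/seteqP; split => [X UX|X [k _]]; last exact.
  move: oU; rewrite openE => /(_ _ UX) /nbhs_ballP[e /= e0 eU].
  have [k ke] : exists k, 2^-1 ^+ k < e.
    have [k _ /(_ k (leqnn k))/= h] := near_infty_natSinv_expn_lt (PosNum e0).
    by exists k; rewrite exprVn -div1r.
  exists k => // Y XY; apply: eU; rewrite ballEmdist /=.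
  by apply: le_lt_trans ke; apply: gdist_le; exact: restrict_tree.
apply: bigcup_measurable => k _; apply: (@measurable_agree k) => X Y XY AX Z YZ.
by apply: AX => u uk; rewrite XY// YZ.
Qed.

HB.instance Definition _ := isMeasurableFun.Build _ _ _ _
  (@tree_rcgraph R d M : config d M -> borel_rcgraph R M) tree_rcgraph_measurable.

(* the law of (T_d, X, o) for X of law [mu] *)
Definition tree_law (mu : probability (config d M) R) : law R M :=
  distribution mu (@tree_rcgraph R d M : config d M -> borel_rcgraph R M).

End tree_law.

Section bfs.
Variables (V : finType) (e : rel V) (v : V).
(* [tau u] is the order in which [u] numbers its offspring; averaging over
   uniform independent [tau u] breaks all ties uniformly at random. *)
Variable tau : {ffun V -> {perm V}}.

Definition bfs_parent (lab : V -> option (seq nat)) (w : V) : option V :=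
  [pick u | e u w && (lab u != None) &
    [forall u', e u' w && (lab u' != None) ==>
      shortlex (odflt [::] (lab u)) (odflt [::] (lab u'))]].

Definition bfs_sibling_rank (lab : V -> option (seq nat)) (u w : V) : nat :=
  #|[pred w' | [&& lab w' == None, bfs_parent lab w' == Some u &
               (enum_rank (tau u w') <= enum_rank (tau u w))%N]]|.

(* the labels of the vertices at distance at most [k] from [v] *)
Fixpoint bfs_upto (k : nat) : V -> option (seq nat) :=
  if k is k'.+1 then
    let lab := bfs_upto k' in
    fun w => if lab w is Some s then Some s else
      if bfs_parent lab w is Some u then
        omap (fun s => rcons s (bfs_sibling_rank lab u w)) (lab u)
      else None
  else fun w => if w == v then Some [::] else None.

Definition bfs_label : V -> option (seq nat) := bfs_upto #|V|.

Definition bfs_lgraph (M : Type) (f : V -> M) : lgraph M :=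
  {| lcol := fun s => omap f [pick w | bfs_label w == Some s];
     ladj := fun s t => [exists a, exists b,
       [&& bfs_label a == Some s, bfs_label b == Some t & e a b]] |}.

Hypothesis e_sym : symmetric e.
Hypothesis e_irr : irreflexive e.

Let bfs_uptoS k w s : bfs_upto k w = Some s -> bfs_upto k.+1 w = Some s.
Proof. by move=> /= ->. Qed.

Let bfs_uptoW j k w s : (j <= k)%N ->
  bfs_upto j w = Some s -> bfs_upto k w = Some s.
Proof. by move=> /subnK <- h; elim: (k - j)%N => // n; exact: bfs_uptoS. Qed.

Let bfs_parentP lab w u : bfs_parent lab w = Some u ->
  exists s, [/\ e u w, lab u = Some s &
    forall u' s', e u' w -> lab u' = Some s' -> shortlex s s'].
Proof.
rewrite /bfs_parent; case: pickP => // u' /andP[/andP[uw lu] /forallP lt] [<-].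
case E : (lab u') lu lt => [s|]//= _ lt; exists s; split => // a s' aw la.
by have := lt a; rewrite aw la.
Qed.

Let bfs_parent_ex lab w u : e u w -> lab u != None -> exists a, bfs_parent lab w = Some a.
Proof.
move=> uw lu; rewrite /bfs_parent; case: pickP => [a _|no]; first by exists a.
pose P := [pred a | e a w && (lab a != None)].
have Pu : P u by rewrite /= uw.
have [a Pa amin] : exists2 a, P a & forall b, P b -> shortlex (odflt [::] (lab a)) (odflt [::] (lab b)).
  pose r a b := shortlex (odflt [::] (lab a)) (odflt [::] (lab b)).
  have rt : total r by move=> ? ?; exact: shortlex_total.
  have rtr : transitive r by move=> ? ? ?; exact: shortlex_trans.
  have := sort_sorted rt (enum P).
  case E : (sort r (enum P)) => [|a l] so.
    by have := mem_enum P u; rewrite -(mem_sort r) E [in RHS]/in_mem /= uw lu.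
  exists a.
    by have := mem_enum P a; rewrite -(mem_sort r) E mem_head => /esym.
  move=> b Pb; have : b \in a :: l by rewrite -E mem_sort mem_enum.
  rewrite inE => /orP[/eqP->|bl]; first by case/orP: (rt a a).
  by have /allP := order_path_min rtr so; exact.
have /negP[] := negbT (no a); apply/andP; split; first exact: Pa.
by apply/forallP => b; apply/implyP; exact: amin.
Qed.

Let bfs_new k w s : bfs_upto k w = None -> bfs_upto k.+1 w = Some s ->
  exists u t, [/\ bfs_parent (bfs_upto k) w = Some u, bfs_upto k u = Some t &
    s = rcons t (bfs_sibling_rank (bfs_upto k) u w)].
Proof.
move=> /= ->; case E : (bfs_parent _ _) => [u|]//.
have [t [_ ut _]] := bfs_parentP E; rewrite ut /= => -[<-]; by exists u, t.
Qed.

Let bfs_nbr k u w : e u w -> bfs_upto k u != None -> bfs_upto k.+1 w != None.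
Proof.
move=> uw uk /=; case: (bfs_upto k w) => //.
have [a E] := bfs_parent_ex uw uk; rewrite E.
by have [t [_ -> _]] := bfs_parentP E.
Qed.

Let bfs_size k w s : bfs_upto k w = Some s -> (size s <= k)%N.
Proof.
elim: k w s => [|k IH] w s /=; first by case: eqP => // _ [<-].
case E : (bfs_upto k w) => [t|]; first by move=> [<-]; rewrite leqW// (IH w).
case E' : (bfs_parent _ _) => [u|]//.
by have [t [_ /[dup] ut -> _]] := bfs_parentP E' => -[<-]; rewrite size_rcons ltnS (IH u).
Qed.

Let bfs_new_size k w s : bfs_upto k w = None -> bfs_upto k.+1 w = Some s ->
  size s = k.+1.
Proof.
elim: k w s => [|k IH] w s wN ws.
  have [u [t [_ + ->]]] := bfs_new wN ws.
  by rewrite size_rcons /=; case: eqP => // _ [<-].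
have [u [t [pu ut ->]]] := bfs_new wN ws; rewrite size_rcons; congr _.+1.
have [_ [uw _ _]] := bfs_parentP pu.
apply: IH ut; case E : (bfs_upto k u) => //.
by have := bfs_nbr uw (k := k); rewrite E wN => /(_ isT).
Qed.

Let rank_lt k u a b : bfs_upto k b = None -> bfs_parent (bfs_upto k) b = Some u ->
  (enum_rank (tau u a) < enum_rank (tau u b))%N ->
  (bfs_sibling_rank (bfs_upto k) u a < bfs_sibling_rank (bfs_upto k) u b)%N.
Proof.
move=> bN bu ab; apply/proper_card/properP; split.
  apply/fintype.subsetP => x; rewrite !inE => /and3P[h1 h2 xa]; apply/and3P; split => //.
  exact/ltnW/(leq_ltn_trans xa).
by exists b; rewrite inE bN bu eqxx ?leqnn//= -ltnNge.
Qed.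

Let bfs_inj k a b s : bfs_upto k a = Some s -> bfs_upto k b = Some s -> a = b.
Proof.
elim: k a b s => [|k IH] a b s as_ bs.
  by move: as_ bs => /=; case: eqP => // -> _; case: eqP.
case aE : (bfs_upto k a) => [s1|]; case bE : (bfs_upto k b) => [s2|].
- by move: (bfs_uptoS aE) (bfs_uptoS bE); rewrite as_ bs => -[E1] [E2]; apply: IH aE _; rewrite bE -E1 -E2.
- have := bfs_new_size bE bs; have := bfs_size aE.
  by move: (bfs_uptoS aE); rewrite as_ => -[<-] /[swap] ->; rewrite ltnn.
- have := bfs_new_size aE as_; have := bfs_size bE.
  by move: (bfs_uptoS bE); rewrite bs => -[<-] /[swap] ->; rewrite ltnn.
have [u [t [pu ut E1]]] := bfs_new aE as_.
have [u' [t' [pu' ut' E2]]] := bfs_new bE bs.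
move: E2; rewrite E1 => /eqP; rewrite eqseq_rcons => /andP[/eqP tt /eqP rk].
move: ut'; rewrite -tt => ut'; have uu := IH _ _ _ ut' ut; subst u'.
case: (ltngtP (enum_rank (tau u a)) (enum_rank (tau u b))) => [lt|lt|].
- by have := rank_lt bE pu' lt; rewrite rk ltnn.
- by have := rank_lt aE pu lt; rewrite rk ltnn.
- by move=> /val_inj /enum_rank_inj /perm_inj.
Qed.

Let rank_fill k u w i : bfs_upto k w = None ->
  bfs_parent (bfs_upto k) w = Some u ->
  (0 < i <= bfs_sibling_rank (bfs_upto k) u w)%N ->
  exists w', [/\ bfs_upto k w' = None, bfs_parent (bfs_upto k) w' = Some u &
    bfs_sibling_rank (bfs_upto k) u w' = i].
Proof.
move=> + + /andP[i0]; move n : (bfs_sibling_rank _ u w) => m.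
elim: m w n => [|m IH] w wm wN pw; first by case: (i) i0.
rewrite leq_eqVlt => /orP[/eqP->|]; first by exists w.
rewrite ltnS => im.
pose A := [pred w' | [&& bfs_upto k w' == None, bfs_parent (bfs_upto k) w' == Some u &
               (enum_rank (tau u w') < enum_rank (tau u w))%N]].
have Am : #|A| = m.
  apply: succn_inj; rewrite -wm /bfs_sibling_rank.
  set B := [pred _ | _]; rewrite (cardD1 w B) inE wN pw eqxx leqnn /= add1n.
  congr _.+1; apply: eq_card => x; rewrite !inE ltn_neqAle.
  case: (x =P w) => [->|/eqP xw]; first by rewrite eqxx /= !andbF.
  suff -> : (enum_rank (tau u x) : nat) != enum_rank (tau u w) by [].
  by apply: contra xw => /eqP /val_inj /enum_rank_inj /perm_inj ->.
have [w0 w0A] : exists w0, w0 \in A.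
  by apply/existsP; rewrite -[[exists _, _]]/(~~ pred0b A) /pred0b Am -lt0n (leq_trans i0).
case: (@arg_maxnP _ w0 (mem A) (fun x => enum_rank (tau u x)) w0A) => x.
rewrite !inE => /and3P[/eqP xN /eqP px xw] xmax.
apply: (IH x) => //; rewrite -Am /bfs_sibling_rank; apply: eq_card => y.
rewrite !inE; case yN : (_ == None) => //=; case py : (_ == Some u) => //=.
apply/idP/idP => [yx|yw]; first exact: leq_ltn_trans xw.
by apply: xmax; rewrite !inE yN py.
Qed.

Let bfs_discover k w t j : bfs_upto k w = Some (rcons t j) ->
  exists2 i, (i < k)%N & exists u, [/\ bfs_upto i w = None,
    bfs_parent (bfs_upto i) w = Some u, bfs_upto i u = Some t,
    j = bfs_sibling_rank (bfs_upto i) u w & size t = i].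
Proof.
elim: k => [|k IH] ws; first by move: ws => /=; case: eqP => // _; case: t.
case E : (bfs_upto k w) => [s|].
  move: (bfs_uptoS E); rewrite ws => -[ss]; rewrite -ss in E.
  by have [i ik h] := IH E; exists i => //; exact: ltnW.
have [u [t' [pu ut']]] := bfs_new E ws.
move=> /eqP; rewrite eqseq_rcons => /andP[/eqP tt /eqP jj]; subst t'.
exists k => //; exists u; split => //.
by have := bfs_new_size E ws; rewrite size_rcons => -[].
Qed.

Lemma bfs_label_inj a b s : bfs_label a = Some s -> bfs_label b = Some s -> a = b.
Proof. exact: bfs_inj. Qed.

Lemma bfs_lgraph_bfs (M : Type) (f : V -> M) : bfs_labeled (bfs_lgraph f).
Proof.
have vertexP s : reflect (exists w, bfs_label w = Some s) (lvertex (bfs_lgraph f) s).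
  rewrite /lvertex /=; case: pickP => [w /eqP ws|no].
    by apply: ReflectT; exists w.
  by apply: ReflectF => -[w ws]; have := no w; rewrite ws eqxx.
have adjP s t : reflect (exists a b, [/\ bfs_label a = Some s, bfs_label b = Some t & e a b])
    (ladj (bfs_lgraph f) s t).
  apply: (iffP existsP) => [[a /existsP[b /and3P[/eqP ? /eqP ? ?]]]|[a [b [sa tb ab]]]].
    by exists a, b.
  by exists a; apply/existsP; exists b; rewrite sa tb !eqxx.
have lab0 : bfs_label v = Some [::].
  by apply: (@bfs_uptoW 0) => //=; rewrite eqxx.
split.
- by apply/vertexP; exists v.
- by move=> s t /adjP[a [b [sa tb _]]]; apply/andP; split; apply/vertexP; [exists a|exists b].
- by move=> s t; apply/adjP/adjP => -[a [b [sa tb ab]]]; exists b, a; split => //; rewrite e_sym.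
- move=> s; apply/adjP => -[a [b [sa sb]]].
  by rewrite (bfs_label_inj sa sb) e_irr.
- move=> s j /vertexP[w /bfs_discover[k kV [u [wN pu us jE sk]]]].
  have rank_gt0 : (0 < bfs_sibling_rank (bfs_upto k) u w)%N.
    by apply/card_gt0P; exists w; rewrite inE wN pu eqxx leqnn.
  split=> [|i]; first by rewrite jE.
  rewrite jE => /(rank_fill wN pu)[w' [w'N pu' <-]]; apply/vertexP; exists w'.
  by apply: (@bfs_uptoW k.+1) => //=; rewrite w'N pu' us.
- move=> s j /vertexP[w /[dup] ws /bfs_discover[k kV [u [wN pu us jE sk]]]].
  apply/adjP; exists u, w; split => //; last by have [? []] := bfs_parentP pu.
  exact: bfs_uptoW (ltnW kV) us.
- move=> s j t /adjP[a [w [at_ /bfs_discover[k kV [u [wN pu us jE sk]]] aw]]].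
  have [s' [_ us' min]] := bfs_parentP pu; move: us'; rewrite us => -[ss].
  rewrite -ss in min; case aE : (bfs_upto k a) => [t'|].
    suff -> : t = t' by exact: min aE.
    by have := bfs_uptoW (ltnW kV) aE; rewrite -/bfs_label at_ => -[].
  rewrite /shortlex sk; suff -> : (k < size t)%N by [].
  case: (lastP t) at_ => [|t0 i] at_.
    have av : a = v by exact: bfs_label_inj at_ lab0.
    by have := @bfs_uptoW 0 k v [::] (leq0n _); rewrite /= eqxx -av aE => /(_ erefl).
  have [i' _ [b [_ _ bt0 _ szt]]] := bfs_discover at_; rewrite size_rcons szt ltnS.
  rewrite leqNgt; apply/negP => i'k.
  have := bfs_discover at_ => -[i2 _ [b2 [_ pb2 bt2 j2 sz2]]].
  have : bfs_upto k a != None.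
    have ba : e b2 a by have [? []] := bfs_parentP pb2.
    have := bfs_nbr (k := i2) ba; rewrite bt2 => /(_ isT).
    case E : (bfs_upto i2.+1 a) => [z|]// _.
    by rewrite (@bfs_uptoW i2.+1 k a z)// -sz2 szt.
  by rewrite aE.
- move=> s; apply: (@sub_finite_set _ _ ((fun w => odflt [::] (bfs_label w)) @` [set: V])).
    by move=> t /adjP[a [b [_ tb _]]]; exists b => //; rewrite tb.
  exact/finite_image/finite_finset.
Qed.

End bfs.

Section average.
Context {disp} {T : measurableType disp} {R : realType} {I : finType}.
Implicit Types (m : I -> probability T R) (A : set T).

(* The first argument only witnesses that [I] is not empty. *)
Definition average (_ : I) m A : \bar R :=
  ((#|I|%:R^-1)%:E * \sum_(i : I) m i A)%E.

Variables (i0 : I) (m : I -> probability T R).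

Let average0 : average i0 m set0 = 0%E.
Proof. by rewrite /average big1 ?mule0. Qed.

Let average_ge0 A : (0 <= average i0 m A)%E.
Proof. by rewrite mule_ge0 ?lee_fin ?invr_ge0// sume_ge0. Qed.

Let average_sigma_additive : semi_sigma_additive (average i0 m).
Proof.
move=> F mF tF mUF; rewrite [X in _ --> X](_ : _ =
    lim ((fun n => \sum_(0 <= k < n) average i0 m (F k))%E @ \oo)).
  by apply: is_cvg_ereal_nneg_natsum => k _; exact: average_ge0.
rewrite /average nneseriesZl//; last first.
  by move=> k _; exact: sume_ge0.
by rewrite nneseries_sum//; congr (_ * _)%E; apply: eq_bigr => i _; exact: measure_semi_bigcup.
Qed.

HB.instance Definition _ := isMeasure.Build _ _ _ (average i0 m)
  average0 average_ge0 average_sigma_additive.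

Let averageT : average i0 m [set: T] = 1%E.
Proof.
rewrite /average; under eq_bigr do rewrite probability_setT.
have I0 : (0 < #|I|)%N by apply/card_gt0P; exists i0.
rewrite sumEFin big_const iter_addr_0 -EFinM mulVf//.
by rewrite pnatr_eq0 -lt0n.
Qed.

HB.instance Definition _ := Measure_isProbability.Build _ _ _
  (average i0 m) averageT.

End average.

(* A simple graph on a vertex set of n + 1 elements is given by its set of
   edges; see [regular_graphs]. *)
Definition graph (n : nat) := {set {set 'I_n.+1}}.

Definition gadj (n : nat) (E : graph n) : rel 'I_n.+1 :=
  fun u w => (u != w) && ([set u; w]%SET \in E).

Lemma gadj_sym n (E : graph n) : symmetric (gadj E).
Proof. by move=> u w; rewrite /gadj eq_sym finset.setUC. Qed.

Lemma gadj_irr n (E : graph n) : irreflexive (gadj E).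
Proof. by move=> u; rewrite /gadj eqxx. Qed.

Section distr.
Variables (R : realType) (M : pointedFinType) (n : nat) (E : graph n).
Variable f : {ffun 'I_n.+1 -> M}.

Definition random_labeling (v : 'I_n.+1) (tau : {ffun 'I_n.+1 -> {perm 'I_n.+1}}) :
    rcgraph R M :=
  mk_rcgraph R (bfs_lgraph_bfs v tau (@gadj_sym n E) (@gadj_irr n E) f).

Definition distr_at (v : 'I_n.+1) : law R M :=
  average [ffun=> 1%g] (fun tau => \d_(random_labeling v tau : borel_rcgraph R M)).

Definition distr : law R M := average ord0 distr_at.

End distr.

Definition regular_graphs (d n : nat) : {set graph n} :=
  [set E : graph n | [forall (e | e \in E), #|e| == 2%N] &&
     [forall v, #|[set e in E | v \in e]| == d]]%SET.

(* P(G_N satisfies Q) for the uniform d-regular graph G_N on N = n + 1 vertices *)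
Definition regular_proba (R : realType) (d n : nat) (Q : pred (graph n)) : R :=
  #|[set E in regular_graphs d n | Q E]%SET|%:R / #|regular_graphs d n|%:R.

(* N = n + 1 tends to infinity with N >= d + 1 and N d even. *)
Definition admissible (d : nat) : set_system nat :=
  within [set n | (d <= n)%N && ~~ odd (n.+1 * d)] \oo.

Section weak.
Variables (R : realType) (M : pointedFinType).

Definition bounded_continuous (F : rcgraph R M -> R) : Prop :=
  continuous F /\ exists C, forall g, `|F g| <= C.

Definition expect (nu : law R M) (F : rcgraph R M -> R) : R :=
  \int[nu]_x F x.

Definition weak_nbhs (nu : law R M) (U : set (law R M)) : Prop :=
  exists (k : nat) (F : 'I_k -> rcgraph R M -> R) (delta : R),
    [/\ 0 < delta, forall i, bounded_continuous (F i) &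
      [set nu' | forall i, `|expect nu' (F i) - expect nu (F i)| < delta] `<=` U].

(* [dist] is a distance on probability measures inducing the weak topology.
   Two elements of [law R M] are the same probability measure as soon as they
   agree on measurable sets: their values elsewhere are junk, so Leibniz
   equality would be too fine. *)
Record generates_weak_topology (dist : law R M -> law R M -> R) : Prop := {
  dist_eq0 : forall nu nu',
    dist nu nu' = 0 <-> forall A, measurable A -> nu A = nu' A;
  dist_sym : forall nu nu', dist nu nu' = dist nu' nu;
  dist_triangle : forall nu1 nu2 nu3,
    dist nu1 nu3 <= dist nu1 nu2 + dist nu2 nu3;
  dist_weak_nbhs : forall nu U, weak_nbhs nu U <->
    exists2 eps, 0 < eps & [set nu' | dist nu nu' < eps] `<=` U }.

End weak.

(* the neighbor of the root labeled 1, provided [0 < d] *)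
Definition first_nbr (d : nat) : tree d := insubd (root d) [:: 1%N].

Definition S_ball (d r : nat) : {fset tree d} := tree_ball r [set root d].

Definition E_ball (d r : nat) : {fset tree d} :=
  tree_ball r.-1 [set root d; first_nbr d].

(* automorphism of the subgraph of [T_d] induced on [B] *)
Definition ball_aut (d : nat) (B : {fset tree d}) (phi : {perm B}) : Prop :=
  forall u w : B, tadj (val (phi u)) (val (phi w)) = tadj (val u) (val w).

(* A probability measure on the finite set M^B is given by its mass function. *)
Definition mass (R : realType) (d : nat) (M : finType) (B : {fset tree d}) :=
  {ffun {ffun B -> M} -> R}.

Section finite_marginals.
Variables (R : realType) (d : nat) (M : finType).

(* the law of X_B for X of law [p], for B included in A *)
Definition marginal (A B : {fset tree d}) (p : mass R M A) : mass R M B :=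
  [ffun y : {ffun B -> M} => \sum_(x : {ffun A -> M} |
    [forall u : A, forall w : B, (val u == val w) ==> (x u == y w)]) p x].

Definition entropy (B : {fset tree d}) (p : mass R M B) : R :=
  - \sum_x p x * ln (p x).

(* p belongs to I_{d,r}(M) *)
Record invariant_mass (r : nat) (p : mass R M (S_ball d r)) : Prop := {
  mass_ge0 : forall x, 0 <= p x;
  mass_sum1 : \sum_x p x = 1;
  mass_aut : forall phi : {perm S_ball d r}, ball_aut phi ->
    forall x : {ffun S_ball d r -> M}, p [ffun u => x (phi u)] = p x;
  mass_switch : forall psi : {perm E_ball d r}, ball_aut psi ->
    (forall u w : E_ball d r, val u = root d -> val w = first_nbr d ->
       psi u = w /\ psi w = u) ->
    forall y : {ffun E_ball d r -> M},
              marginal (E_ball d r) p [ffun u => y (psi u)] =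
              marginal (E_ball d r) p y }.

Definition Sigma (r : nat) (p : mass R M (S_ball d r)) : R :=
  entropy p - d%:R / 2 * entropy (marginal (E_ball d r) p).

End finite_marginals.

Definition self_coupling (R : realType) (d : nat) (M : finType) (B : {fset tree d})
    (p : mass R M B) (q : mass R (M * M)%type B) : Prop :=
  (forall x, \sum_(z : {ffun B -> M * M} | [ffun u => (z u).1] == x) q z = p x) /\
  (forall x, \sum_(z : {ffun B -> M * M} | [ffun u => (z u).2] == x) q z = p x).

(* the side of [u] in [T_d] minus the edge {u, v} *)
Definition side (d : nat) (u v : tree d) : set (tree d) :=
  [set w | exists k, dist_le (fun a b => tadj a b &&
     ~~ ((a == u) && (b == v) || (a == v) && (b == u))) k u w].

Section processes.
Variables (R : realType) (d : nat) (M : pointedFinType).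
Implicit Types mu : probability (config d M) R.

Definition tree_aut (phi : tree d -> tree d) : Prop :=
  bijective phi /\ forall u v, tadj (phi u) (phi v) = tadj u v.

Definition invariant mu : Prop := forall phi, tree_aut phi ->
  forall A : set (config d M), measurable A ->
    mu [set X | A (fun v => X (phi v))] = mu A.

Definition cylinder (B : {fset tree d}) (x : {ffun B -> M}) : set (config d M) :=
  [set X | forall u : B, X (val u) = x u].

(* P(A, B | X_W = x) = P(A | X_W = x) P(B | X_W = x), W = B_{r-1}({u, v}),
   after multiplication by P(X_W = x)^2 *)
Definition r_markov (r : nat) mu : Prop := forall u v : tree d, tadj u v ->
  forall (x : {ffun tree_ball r.-1 [set u; v] -> M}) (A B : set (config d M)),
    <<s @coordinate_events d M (side u v) >> A ->
    <<s @coordinate_events d M (side v u) >> B ->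
    let C := cylinder x in
    (mu (A `&` B `&` C) * mu C = mu (A `&` C) * mu (B `&` C))%E.

(* mu is the process mu(p) *)
Record markov_extension (r : nat) (p : mass R M (S_ball d r)) mu : Prop := {
  ext_invariant : invariant mu;
  ext_markov : r_markov r mu;
  ext_marginal : forall x, mu (cylinder x) = (p x)%:E }.

End processes.

Section sofic.
Variables (R : realType) (d : nat) (M : pointedFinType).
Variable dist : law R M -> law R M -> R.
Variable mu : probability (config d M) R.

Definition good_colorings (n : nat) (E : graph n) (t : nat) (eps : R) :
    {set {ffun 'I_n.+1 -> M}} :=
  [set f | dist (restrict_law t (distr R E f)) (restrict_law t (tree_law mu))
           <= eps]%SET.

Definition graph_entropy (n : nat) (E : graph n) (t : nat) (eps : R) : \bar R :=
  let F := good_colorings E t eps in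
  if #|F| == 0%N then -oo%E else (ln #|F|%:R / n.+1%:R)%:E.

Definition h_ (t : nat) (eps alpha : R) (n : nat) : \bar R :=
  ereal_sup [set h : \bar R | (h = -oo \/ 0 <= h < +oo)%E /\
    alpha <= regular_proba R d (fun E : graph n => h <= graph_entropy E t eps)%E].

(* The sofic entropies computed with a given [alpha] in (0, 1). *)
Definition upper_sofic_at (t : nat) (alpha : R) : \bar R :=
  lim (limf_esup (h_ t eps alpha) (admissible d) @[eps --> 0^'+]).

Definition lower_sofic_at (t : nat) (alpha : R) : \bar R :=
  lim (limf_einf (h_ t eps alpha) (admissible d) @[eps --> 0^'+]).

Definition upper_sofic (alpha : R) : \bar R :=
  limn (fun t => upper_sofic_at t alpha).

Definition lower_sofic (alpha : R) : \bar R :=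
  limn (fun t => lower_sofic_at t alpha).

Definition strongly_typical : Prop :=
  exists L : R -> R,
    (forall eps, 0 < eps ->
       regular_proba R d (fun E : graph n =>
         [exists f, dist (distr R E f) (tree_law mu) <= eps])
         @[n --> admissible d] --> L eps) /\
    L eps @[eps --> 0^'+] --> (1 : R).

End sofic.

(* Main.v *)
Require Import Defs.
From mathcomp Require Import all_boot all_order all_algebra fingroup perm finmap.
From mathcomp Require Import all_classical all_reals all_analysis.
From mathcomp Require Import lra zify.

(* A uniform simple d-regular graph with an ordering of each neighborhood is a
   uniform simple fixed-point-free involution (matching) of the half-edges, and
   simple matchings are at least an exp(-o(n)) fraction of all matchings.
   Counting matchings whose half-edges are typed by the coloring seen from
   them, the expected number of colorings with local statistics close to q is
   exp(n (Sigma(q) + o(1))). The upper bound is Stirling's formula; for the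
   lower bound one matches half-edges greedily so that the graph is locally a
   tree around most vertices, and completes the last few by switchings. By the
   Markov property, Sigma of the marginal of mu(p) on S_t does not depend on t
   >= r, so that the first moment has the same exponential rate at every level
   t. The second moment counts pairs of colorings, whose joint statistics are,
   by compactness, close to couplings of p with itself: the hypothesis on
   couplings bounds it by the square of the first moment up to exp(o(n)). The
   Paley-Zygmund inequality then gives good colorings with a probability that
   is at least exp(-o(n)), and concentration of the free energy ln sum_f
   exp(-beta n dev(f)), a Lipschitz function of the matching, makes it tend to
   1. *)

Set Implicit Arguments.
Unset Strict Implicit.
Unset Printing Implicit Defensive.
Import Order.TTheory GRing.Theory Num.Theory.
Import numFieldNormedType.Exports.
Local Open Scope ring_scope.
Local Notation root := Defs.root.

(** * Real analysis and counting *)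

(** A coloring is read in two ways. [profile] averages over all tie-breaking orders: it is exactly
    invariant under automorphisms and is what [distr] sees, but it misses the vertices whose ball is
    not a tree. [walk_mass] reads colors along the numbered half-edges of one matching: it always
    has total mass 1 and the matching flips its edge types exactly, which makes it countable, but it
    need not be invariant. Upper bounds are counted with [walk_mass] and carried over to [profile]
    by [transfer]: an order sorts exactly one matching of each graph, and most orders give counts
    close to their average. The factor d/2 of Sigma is the trace of a square root: m half-edges have
    about sqrt(m!) matchings, so matchings are counted through the squares of their numbers. Good
    colorings are wanted at a large level t, whereas couplings are controlled at level r only; hence
    the first moment is taken at t and the second at r. *)

Section real_analysis.
Local Open Scope classical_set_scope.
Local Open Scope ring_scope.

Section real_bounds.
Variable R : realType.
Implicit Types (x y d : R) (k n : nat).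

Lemma ln_sub1 x : 0 < x -> ln x <= x - 1.
Proof.
move=> x0; have := @le_ln1Dx R (x - 1).
by rewrite [1 + _]addrC subrK; apply; lra.
Qed.

Lemma ln_1subV x : 0 < x -> 1 - x^-1 <= ln x.
Proof.
move=> x0; have xV0 : 0 < x^-1 by rewrite invr_gt0.
by have := ln_sub1 xV0; rewrite lnV//; lra.
Qed.

Lemma natS_gt0 k : 0 < k.+1%:R :> R.
Proof. by rewrite ltr0n. Qed.

Lemma ln_natS_diff_le k : k%:R * (ln k.+1%:R - ln k%:R) <= 1 :> R.
Proof.
case: k => [|k]; first by rewrite mul0r.
rewrite -ln_div ?posrE ?natS_gt0//.
have h : 0 < k.+2%:R / k.+1%:R :> R by rewrite divr_gt0// natS_gt0.
apply: le_trans (ler_wpM2l _ (ln_sub1 h)) _ => //.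
rewrite mulrBr mulrCA mulfV ?pnatr_eq0// !mulr1.
by rewrite -natr1; lra.
Qed.

Lemma ln_natS_diff_ge k : 1 - k.+1%:R^-1 <= k%:R * (ln k.+1%:R - ln k%:R) :> R.
Proof.
case: k => [|k]; first by rewrite mul0r invr1 subrr.
rewrite -ln_div ?posrE ?natS_gt0//.
have h : 0 < k.+2%:R / k.+1%:R :> R by rewrite divr_gt0// natS_gt0.
apply: le_trans (ler_wpM2l _ (ln_1subV h)) => //.
rewrite invf_div; move: (k.+1%:R) (k.+2%:R) (@natr1 R k.+1) (natS_gt0 k.+1) => x y xy y0.
have -> : x = y - 1 by rewrite -xy addrK.
have yy : y * y^-1 = 1 by rewrite mulfV// gt_eqF.
rewrite [(y - 1) / y]mulrBl yy mul1r opprB addrCA subrr addr0.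
by rewrite mulrBl yy mul1r.
Qed.

Lemma lnfact_ge k : k%:R * ln k%:R - k%:R <= ln (k`!)%:R :> R.
Proof.
elim: k => [|k IH]; first by rewrite mul0r subr0 ln1.
rewrite factS natrM lnM ?posrE ?ltr0n ?fact_gt0//.
have := ln_natS_diff_le k; rewrite -[X in X * ln _ - _]natr1 -[X in _ - X <= _]natr1.
by move: IH; lra.
Qed.

(** Summing the increments of k ln k - k leaves a harmonic error, which the term [2 * ln k.+1%:R]
    absorbs. *)
Lemma lnfact_le k : ln (k`!)%:R <= k%:R * ln k%:R - k%:R + 2 * ln k.+1%:R + 1 :> R.
Proof.
elim: k => [|k IH]; first by rewrite mul0r subr0 ln1 mulr0 !add0r ler01.
rewrite factS natrM lnM ?posrE ?ltr0n ?fact_gt0//.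
have h1 := ln_natS_diff_ge k.
have h : 0 < k.+2%:R / k.+1%:R :> R by rewrite divr_gt0// natS_gt0.
have := ln_1subV h; rewrite ln_div ?posrE ?natS_gt0// invf_div => h2.
(* The harmonic term is at most twice the next increment of [ln], so that the errors telescope. *)
have h3 : k.+1%:R^-1 <= 2 * (1 - k.+1%:R / k.+2%:R) :> R.
  have -> : 1 - k.+1%:R / k.+2%:R = k.+2%:R^-1 :> R.
    rewrite -[X in X - _](@mulfV _ k.+2%:R) ?pnatr_eq0// -mulrBl -[X in X - _]natr1.
    by rewrite [_ + 1]addrC addrK mul1r.
  rewrite -invf_div lef_pV2 ?posrE ?natS_gt0 ?divr_gt0 ?natS_gt0//.
  by rewrite ler_pdivrMr// -natrM ler_nat; lia.
move: IH h1 h2 h3; move: (ln k.+1%:R) (ln k.+2%:R) (ln k%:R) (ln _) => a b c f.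
move: (1 - k.+1%:R / k.+2%:R) (k.+1%:R^-1) => q i.
by rewrite -(natr1 k) => h0 h1 h2 h3; lra.
Qed.

(** The exponential is at most 1 / (1 - x) = 1 + x + x^2 / (1 - x), and 1 - x is at least 1/2. *)
Lemma expR_quad x : x <= 2^-1 -> expR x <= 1 + x + 2 * x ^+ 2.
Proof.
move=> x2; have x1 : 0 < 1 - x by lra.
have h : 1 - x <= expR (- x) by exact: expR_ge1Dx.
have e0 := expR_gt0 x.
have h2 : expR x * (1 - x) <= 1.
  by apply: le_trans (ler_wpM2l (ltW e0) h) _; rewrite -expRD subrr expR0.
rewrite -(ler_pM2r x1); apply: le_trans h2 _.
have : 0 <= x ^+ 2 * (1 - 2 * x) by rewrite mulr_ge0// ?sqr_ge0//; lra.
by rewrite expr2; lra.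
Qed.

Lemma ln_le_sqrt x : 0 < x -> ln x <= 2 * Num.sqrt x.
Proof.
move=> x0; have s0 : 0 < Num.sqrt x by rewrite sqrtr_gt0.
rewrite -[in ln x](sqr_sqrtr (ltW x0)) lnXn// mulr2n.
by have := ln_sub1 s0; lra.
Qed.

(** The losses in all the counts are polynomial in n, that is, of the form [C + k * ln n.+1%:R] in
    the exponent; this absorbs them into an arbitrarily small exponential rate. *)
Lemma log_poly_le (C k d : R) : 0 < d -> exists n0, forall n, (n0 <= n)%N ->
  C + k * ln n.+1%:R <= d * n.+1%:R.
Proof.
move=> d0; pose K := `|C| + 2 * `|k|; have K0 : 0 <= K by rewrite addr_ge0// mulr_ge0.
pose n0 := Num.bound ((K / d) ^+ 2); exists n0 => n n0n.
set s := Num.sqrt n.+1%:R : R.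
have s2 : s ^+ 2 = n.+1%:R by rewrite sqr_sqrtr.
have s1 : 1 <= s by rewrite -[leLHS]sqrtr1 ler_wsqrtr// ler1n.
have hs : K / d <= s.
  rewrite -[leLHS]ger0_norm ?divr_ge0 ?(ltW d0)// -sqrtr_sqr ler_wsqrtr//.
  have := archi_boundP (sqr_ge0 (K / d)) => /ltW/le_trans; apply.
  by rewrite ler_nat ltnW.
have hK : K <= d * s by rewrite mulrC -ler_pdivrMr.
have l0 : 0 <= ln n.+1%:R :> R by rewrite ln_ge0// ler1n.
have h1 : k * ln n.+1%:R <= `|k| * (2 * s).
  by apply: le_trans (ler_wpM2r l0 (ler_norm k)) _; rewrite ler_wpM2l// ln_le_sqrt// natS_gt0.
have h2 : C <= `|C| * s by apply: le_trans (ler_norm C) _; rewrite ler_peMr.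
rewrite -s2 expr2 mulrA; apply: le_trans (ler_wpM2r _ hK); last by lra.
by rewrite -expr2 s2 /K; move: h1 h2; lra.
Qed.

(** Masses may vanish, so continuity at 0 matters. As [ln] is 0 on nonpositive numbers, only y > 0
    is at stake there, and [ln_le_sqrt] at 1/y gives -2 sqrt y <= y ln y. *)
Lemma xlnx_continuous : continuous (fun x : R => x * ln x).
Proof.
move=> x; have [x0|x0|->] := ltgtP x 0.
- have nbx : \forall y \near x, 0 = y * ln y.
    near=> y; rewrite ln0 ?mulr0//; apply: ltW; near: y; exact: lt_nbhsl.
  rewrite /continuous_at [X in _ --> X](_ : _ = 0) ?ln0 ?(ltW x0) ?mulr0//.
  exact: cvg_trans (near_eq_cvg nbx) (cvg_cst 0).
- by apply: cvgM; [exact: cvg_id|exact: continuous_ln].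
- have n0 : (fun y : R => `|y|) @ (0 : R) --> (0 : R).
    by rewrite -[X in _ --> X](@normr0 _ R); exact: (@norm_continuous _ R).
  rewrite /continuous_at mul0r.
  apply: (@squeeze_cvgr _ _ _ _ (fun y => - (2 * Num.sqrt `|y|)) (fun y => `|y|)).
  + near=> y; have y1 : `|y| < 1.
      by near: y; exists 1 => //= z /=; rewrite sub0r normrN.
    have [y0|y0] := leP y 0; first by rewrite ln0// mulr0 oppr_le0 mulr_ge0 ?sqrtr_ge0//=.
    have yy : `|y| = y by rewrite gtr0_norm.
    rewrite yy in y1 *; apply/andP; split; last first.
      apply: (@le_trans _ _ 0); last exact: ltW.
      by rewrite mulr_ge0_le0 ?ln_le0// ltW.
    have := @ln_le_sqrt y^-1; rewrite invr_gt0 => /(_ y0); rewrite lnV ?posrE// sqrtrV ?(ltW y0)//.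
    set s := Num.sqrt y => h; have s0 : 0 < s by rewrite sqrtr_gt0.
    have ys : y = s * s by rewrite -expr2 sqr_sqrtr// ltW.
    have := ler_wpM2l (ltW y0) h; rewrite mulrN [in leRHS]ys mulrCA -!mulrA mulfV ?gt_eqF//.
    by rewrite mulr1; lra.
  + rewrite -[X in _ --> X]oppr0 -[X in - X](mulr0 2) -[X in 2 * X]sqrtr0.
    apply: cvgN; apply: cvgMr; apply: continuous_cvg; first exact: sqrt_continuous.
    exact: n0.
  + exact: n0.
Unshelve. all: by end_near. Qed.

(** On the compact set where [S] is at least [s + e], [D] attains a positive minimum; half of it
    serves as [eta]. The use is with [D] the defect of a mass from being an invariant coupling. *)
Lemma compact_defect (X : topologicalType) (K : set X) (S D : X -> R) (s : R) :
  compact K -> continuous S -> continuous D ->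
  (forall x : X, K x -> D x <= 0 -> S x <= s) ->
  forall e, 0 < e -> exists2 eta, 0 < eta & forall x : X, K x -> D x <= eta -> S x <= s + e.
Proof.
move=> cK cS cD h e e0; pose A := (K `&` [set x | s + e <= S x])%classic.
have cA : compact A.
  apply: compact_closedI => //.
  rewrite (_ : [set _ | _] = S @^-1` [set y | s + e <= y])%classic//.
  by apply: closed_comp => [x _|]; [exact: cS|exact: closed_ge].
have [A0|/nonemptyPn A0] := pselect (A !=set0)%classic; last first.
  exists 1 => // x Kx _; rewrite leNgt; apply/negP => sx.
  have Ax : A x by split => //=; exact: ltW.
  by rewrite A0 in Ax.
have [c /set_mem[Kc sc] cmin] := compact_EVT_min A0 cA (continuous_subspaceT cD).
have Dc : 0 < D c.
  by rewrite ltNge; apply/negP => /(h _ Kc); move: sc => /=; lra.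
exists (D c / 2) => [|x Kx Dx]; first lra.
rewrite leNgt; apply/negP => sx.
have := cmin x; rewrite inE => /(_ (conj Kx (ltW sx))).
lra.
Qed.

End real_bounds.

Section counting.
Variables (R : realType).

Lemma prod_fact_dec (X : finType) (c : X -> nat) a : (0 < c a)%N ->
  (\prod_x (c x)`! = c a * \prod_x (c x - (x == a))`!)%N.
Proof.
move=> ca; rewrite (bigD1 a)//= [in RHS](bigD1 a)//= mulnA; congr muln.
  by rewrite eqxx subn1 -[in LHS](prednK ca) factS prednK.
by apply: eq_bigr => i /negbTE ia; rewrite ia subn0.
Qed.

(** The multinomial coefficient, by induction on the length: removing the head [a] takes the factor
    [c a] out of the product of factorials, and these factors add up to the length. *)
Lemma card_tuple_count (X : finType) m (c : X -> nat) :
  (\sum_x c x = m)%N ->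
  (#|[set t : m.-tuple X | [forall x, count_mem x t == c x]]%SET| *
   \prod_x (c x)`! = m`!)%N.
Proof.
elim: m c => [|m IH] c cm.
  have c0 x : c x = 0%N.
    by apply/eqP; rewrite -leqn0 -cm (bigD1 x)//= leq_addr.
  rewrite big1 => [|x _]; last by rewrite c0.
  rewrite muln1; apply/eqP/cards1P; exists [tuple]; apply/setP => t.
  by rewrite !inE tuple0 eqxx; apply/forallP => x; rewrite c0.
pose A := [set t : m.+1.-tuple X | [forall x, count_mem x t == c x]]%SET.
pose c' a := fun x => (c x - (x == a))%N.
have cc' a x : (0 < c a)%N -> c x = (c' a x + (x == a))%N.
  by move=> ca; rewrite subnK//; case: eqP => // ->.
have sumc' a : (0 < c a)%N -> (\sum_x c' a x = m)%N.
  move=> ca; apply/eqP; rewrite -(eqn_add2r 1) !addn1 -cm; apply/eqP.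
  under [RHS]eq_bigr do rewrite (cc' a)//.
  by rewrite big_split /= -addn1; congr addn; rewrite (bigD1 a)//= eqxx big1 ?addn0// => i /negbTE ->.
have prodc' a : (0 < c a)%N -> (\prod_x (c x)`! = c a * \prod_x (c' a x)`!)%N.
  exact: prod_fact_dec.
have cardA a : #|[set t in A | thead t == a]%SET| =
    (#|[set t : m.-tuple X | [forall x, count_mem x t == c' a x]]%SET| * (0 < c a))%N.
  case: (posnP (c a)) => ca.
    rewrite muln0; apply: eq_card0 => t; rewrite !inE.
    apply/negP => /andP[/forallP/(_ a)]; rewrite ca; case/tupleP: t => b t.
    by rewrite theadE /= => + /eqP ba; rewrite ba eqxx.
  rewrite muln1 -(card_imset _ (_ : injective (fun t : m.-tuple X => [tuple of a :: t]))); last first.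
    by move=> t t' /(congr1 val) [] /val_inj.
  apply: eq_card => t; apply/idP/imsetP => [|[t' + ->]]; rewrite !inE.
    case/tupleP: t => b t; rewrite theadE => /andP[/forallP h /eqP ba]; subst b.
    exists t; rewrite // inE; apply/forallP => x; have := h x => /=.
    by rewrite (cc' a)// addnC [a == x]eq_sym eqn_add2r.
  move=> /forallP h; rewrite theadE eqxx andbT; apply/forallP => x /=.
  by rewrite (cc' a)// addnC [a == x]eq_sym eqn_add2r.
have -> : #|A| = (\sum_a #|[set t in A | thead t == a]%SET|)%N.
  rewrite -sum1_card (partition_big (fun t : m.+1.-tuple X => thead t) xpredT)//=.
  apply: eq_bigr => a _; rewrite -sum1_card; apply: eq_bigl => t.
  by rewrite [in RHS]inE.
have e : (m.+1 * m`! = \sum_a c a * m`!)%N by rewrite -big_distrl /= cm.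
rewrite big_distrl /= factS e; apply: eq_bigr => a _.
rewrite cardA; case: (posnP (c a)) => ca; first by rewrite ca !muln0.
by rewrite muln1 (prodc' a)// mulnCA IH// sumc'.
Qed.

Lemma card_ffun_count (X : finType) m (c : X -> nat) :
  (\sum_x c x = m)%N ->
  (#|[set g : {ffun 'I_m -> X} | [forall x, #|[set i | g i == x]%SET| == c x]]%SET| *
   \prod_x (c x)`! = m`!)%N.
Proof.
move=> cm; rewrite -(card_tuple_count cm); congr muln.
pose F (g : {ffun 'I_m -> X}) : m.-tuple X := tuple_of_finfun g.
have Fc x g : count_mem x (F g) = #|[set i | g i == x]%SET|.
  by rewrite /F /tuple_of_finfun /= -sum1_count big_map big_enum_cond -sum1_card; apply: eq_bigl => i; rewrite /= !inE.
rewrite -(card_imset _ (can_inj (@tuple_of_finfunK X m))).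
apply: eq_card => t; apply/imsetP/idP => [[g + ->]|]; rewrite !inE.
  by move=> /forallP h; apply/forallP => x; rewrite Fc.
move=> /forallP h; exists (finfun_of_tuple t); last by rewrite finfun_of_tupleK.
by rewrite inE; apply/forallP => x; rewrite -Fc /F finfun_of_tupleK.
Qed.

(** Size of a Hamming ball: a function is decoded from the list of its at most [k] changes, padded
    with [None]. *)
Lemma card_ffun_near (A B : finType) (g0 : {ffun A -> B}) k :
  (#|[set g : {ffun A -> B} | #|[set a | g a != g0 a]%SET| <= k]%SET|
    <= (#|A| * #|B|).+1 ^ k)%N.
Proof.
pose dec (t : k.-tuple (option (A * B))) : {ffun A -> B} :=
  [ffun a => if [pick p : A * B | (p.1 == a) && (Some p \in t)] is Some p then p.2 else g0 a].
have cardt : #|{: k.-tuple (option (A * B))}| = ((#|A| * #|B|).+1 ^ k)%N.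
  by rewrite card_tuple card_option card_prod.
rewrite -cardt -cardsT; apply: leq_trans (leq_imset_card dec _).
apply/subset_leq_card/fintype.subsetP => g; rewrite inE => gk; apply/imsetP.
pose s := [seq Some (a, g a) | a <- enum [set a | g a != g0 a]%SET] ++
  nseq (k - #|[set a | g a != g0 a]%SET|) None.
have ss : size s == k.
  by rewrite size_cat size_map -cardE size_nseq subnKC.
exists (Tuple ss) => //; apply/ffunP => a; rewrite ffunE; case: pickP => [[a' b] /=|no].
  rewrite mem_cat => /andP[/eqP -> /orP[/mapP[x _ [-> ->]]//|]].
  by rewrite mem_nseq andbC.
case: (eqVneq (g a) (g0 a)) => // ne.
have := no (a, g a) => /=; rewrite eqxx mem_cat => /negbT; rewrite negb_or => /andP[/mapP h _].
by exfalso; apply: h; exists a => //; rewrite mem_enum inE.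
Qed.

(** Under the product law with marginals [w], every function with counts [c] has the same
    probability, and the total is at most 1. With [w] proportional to [c] this is the entropy bound
    on multinomial coefficients. *)
Lemma card_ffun_weight (V X : finType) (w : X -> R) (c : X -> nat) :
  (forall x, 0 <= w x) -> \sum_x w x = 1 ->
  #|[set g : {ffun V -> X} | [forall x, #|[set i | g i == x]%SET| == c x]]%SET|%:R *
   \prod_x w x ^+ c x <= 1.
Proof.
move=> w0 w1; set A := [set g | _]%SET.
have e : \sum_(g : {ffun V -> X}) \prod_v w (g v) = 1.
  by rewrite -(bigA_distr_bigA (fun=> w)) big1.
have ge (g : {ffun V -> X}) : 0 <= \prod_v w (g v) by rewrite prodr_ge0.
have eA : \sum_(g in A) \prod_v w (g v) <= 1.
  apply: (@le_trans _ _ (\sum_(g : {ffun V -> X}) \prod_v w (g v))); last by rewrite e.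
  by rewrite [leRHS](bigID (mem A))/= lerDl sumr_ge0.
suff h : \sum_(g in A) \prod_v w (g v) = \sum_(g in A) \prod_x w x ^+ c x.
  by move: eA; rewrite h sumr_const mulr_natl.
apply: eq_bigr => g; rewrite inE => /forallP h; rewrite (partition_big g xpredT)//=.
apply: eq_bigr => x _; rewrite -(eqP (h x)) -prodr_const.
by apply: eq_big => [v|v]; rewrite ?inE// => /eqP ->.
Qed.

End counting.

End real_analysis.

(** * Uniform matchings *)

Section matching_counts.
Local Open Scope group_scope.
Local Open Scope ring_scope.

Section matchings.
Variable H : finType.
Implicit Types (U : {set H}) (s t : {perm H}) (h g : H).

(** A matching of [U] fixes the points outside [U]; partial matchings thus live in one group, and
    adding an edge is a product with a transposition. *)
Definition matchings U : {set {perm H}} :=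
  [set s : {perm H} | [forall h, s (s h) == h] && [forall h, (s h != h) == (h \in U)]].

Lemma matchingsP U s :
  reflect ((forall h, s (s h) = h) /\ (forall h, (s h != h) = (h \in U)))
    (s \in matchings U).
Proof.
rewrite inE; apply: (iffP andP) => -[h1 h2]; split.
- by move=> h; apply/eqP/(forallP h1).
- by move=> h; move/forallP: h2 => /(_ h)/eqP.
- by apply/forallP => h; rewrite h1.
- by apply/forallP => h; rewrite h2.
Qed.

Lemma matchings_tperm U h g s : h \in U -> g \in U :\ h ->
  ((tperm h g * s)%g \in matchings U) && ((tperm h g * s)%g h == g) =
  (s \in matchings (U :\ h :\ g)).
Proof.
move=> hU; rewrite 2!inE => /andP[gh gU].
have E x : (tperm h g * s)%g x = s (tperm h g x) by rewrite permM.
rewrite E tpermL; apply/andP/matchingsP => [[/matchingsP[inv sup] /eqP sg]|[inv sup]].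
  have sh : s h = h.
    by have := inv h; rewrite !E tpermL sg tpermR.
  have o x : x != h -> x != g -> (tperm h g * s)%g x = s x.
    by move=> xh xg; rewrite E tpermD// eq_sym.
  have nsx x : x != h -> x != g -> (s x != h) && (s x != g).
    by move=> xh xg; rewrite -{1}sh -{1}sg !(inj_eq perm_inj) xh.
  split=> x.
    have [->|xh] := eqVneq x h; first by rewrite !sh.
    have [->|xg] := eqVneq x g; first by rewrite !sg.
    have /andP[h1 h2] := nsx _ xh xg.
    by have := inv x; rewrite (o x)// (o (s x)).
  rewrite !inE; have [->|xg] := eqVneq x g; first by rewrite sg eqxx.
  have [->|xh] := eqVneq x h; first by rewrite sh eqxx.
  by rewrite -o// sup.
have sg : s g = g by apply/eqP; rewrite -[_ == _]negbK sup !inE eqxx.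
have sh : s h = h by apply/eqP; rewrite -[_ == _]negbK sup !inE eqxx andbF.
rewrite sg eqxx; split=> //; apply/matchingsP.
have o x : x != h -> x != g -> (tperm h g * s)%g x = s x.
  by move=> xh xg; rewrite E tpermD// eq_sym.
split=> x.
  have [->|xh] := eqVneq x h; first by rewrite !E tpermL sg tpermR sh.
  have [->|xg] := eqVneq x g; first by rewrite !E tpermR sh tpermL sg.
  rewrite (o x)// o ?inv//; first by rewrite -[X in _ != X]sh (inj_eq perm_inj).
  by rewrite -[X in _ != X]sg (inj_eq perm_inj).
have [->|xh] := eqVneq x h; first by rewrite E tpermL sg hU.
have [->|xg] := eqVneq x g; first by rewrite E tpermR sh eq_sym gh gU.
by rewrite o// sup !inE xh xg.
Qed.

(** Decomposition according to the partner [g] of one half-edge [h], the recursion behind every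
    count of matchings and behind the concentration inequality. *)
Lemma big_matchings (T : Type) (idx : T) (op : Monoid.com_law idx) U h (F : {perm H} -> T) : h \in U ->
  \big[op/idx]_(s in matchings U) F s =
  \big[op/idx]_(g in U :\ h) \big[op/idx]_(s in matchings (U :\ h :\ g)) F (tperm h g * s)%g.
Proof.
move=> hU; rewrite (partition_big (fun s : {perm H} => s h) (mem (U :\ h)))/=.
  apply: eq_bigr => g gU; rewrite (reindex_inj (mulgI (tperm h g))) /=.
  by apply: eq_bigl => s; rewrite matchings_tperm.
move=> s /matchingsP[inv sup]; have sh : s h != h by rewrite sup.
by rewrite !inE sh -sup inv eq_sym.
Qed.

(** The double factorial (k - 1)!! for even k, and 0 for odd k. *)
Fixpoint mcount (k : nat) : nat :=
  if k is k'.+1 then if k' is k''.+1 then k' * mcount k'' else 0 else 1.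

Lemma cardD2 U h g : h \in U -> g \in U :\ h -> #|U| = #|U :\ h :\ g|.+2.
Proof. by move=> hU gU; rewrite (cardsD1 h) hU (cardsD1 g) gU. Qed.

Lemma card_matchings U : #|matchings U| = mcount #|U|.
Proof.
move: {2}#|U| (leqnn #|U|) => m; elim: m U => [|m IH] U.
  rewrite leqn0 cards_eq0 => /eqP ->; rewrite cards0 /=.
  apply/eqP/cards1P; exists 1%g; apply/setP => s; rewrite !inE.
  apply/andP/eqP => [[_ /forallP h]|->].
    by apply/permP => x; have := h x; rewrite inE perm1 => /eqP/negbFE/eqP.
  by split; apply/forallP => x; rewrite !perm1// inE eqxx.
have [->|[h hU]] := set_0Vmem U; first by move=> _; apply: IH; rewrite cards0.
move=> Um; rewrite -sum1_card (big_matchings _ _ hU).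
case E : #|U :\ h| => [|k].
  have E0 : U :\ h = finset.set0 by apply/eqP; rewrite -cards_eq0 E.
  by rewrite E0 big_set0 (cardsD1 h) hU E0 cards0.
rewrite (eq_bigr (fun=> mcount k)) => [|g gU].
  by rewrite sum_nat_const E (cardsD1 h U) hU E.
rewrite sum1_card IH; last by move: Um; rewrite (cardD2 hU gU); lia.
by congr mcount; move: E; rewrite (cardsD1 g) gU => -[].
Qed.

Lemma mcount_odd k : odd k -> mcount k = 0.
Proof.
move: {2}k (leqnn k) => m; elim: m k => [|m IH] [|[|k]]//=.
rewrite ltnS negbK => km ok; rewrite IH ?muln0//; exact: ltnW.
Qed.

(** Because k! = (k - 1)!! k!! and k!! <= (k + 1) (k - 1)!!: the number of matchings is at least
    sqrt(k!) up to a polynomial factor. *)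
Lemma mcount_even k : ~~ odd k -> (k`! <= k.+1 * mcount k ^ 2)%N.
Proof.
move: {2}k (leqnn k) => m; elim: m k => [|m IH] [|[|k]]// km.
rewrite oddS oddS negbK => /IH h; have {}h := h (ltnW km).
rewrite !factS /mcount -/mcount expnMn.
have := leq_mul (leqnn (k.+3 * k.+1)) h; nia.
Qed.

Lemma matchingsJ U s t : s \in matchings U -> (s ^ t)%g \in matchings (t @: U)%SET.
Proof.
move=> /matchingsP[inv sup]; apply/matchingsP; split=> x.
  by rewrite -[x](permKV t) !permJ inv.
by rewrite -[x](permKV t) permJ (inj_eq perm_inj) sup (mem_imset _ _ perm_inj).
Qed.

Section typed.
Variables (Y : finType) (flip : Y -> Y) (yt : H -> Y).
Hypothesis flipK : involutive flip.

Definition ycount U y := #|[set h in U | yt h == y]|.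

Lemma ycountD1 U h y : h \in U -> ycount (U :\ h) y = (ycount U y - (y == yt h))%N.
Proof.
move=> hU; rewrite /ycount [in RHS](cardsD1 h) !inE hU /= [yt h == y]eq_sym.
rewrite addnC addnK; apply: eq_card => x; rewrite !inE.
by case: (x == h) => //=; rewrite andbF.
Qed.

(** Stated for the square because the types y and [flip y], matched with each other, have a
    factorial each. By induction on [U], summing over the partners of a well chosen half-edge and
    bounding all terms by the largest one. *)
Lemma card_typed_matchings U :
  (#|[set s in matchings U | [forall h in U, yt (s h) == flip (yt h)]]| ^ 2
    <= \prod_y (ycount U y)`!)%N.
Proof.
move: {2}#|U| (leqnn #|U|) => m; elim: m U => [|m IH] U Um; last first.
  have [U0|[h0 h0U]] := set_0Vmem U; first by apply: IH; rewrite U0 cards0.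
  (* The half-edge is taken in the larger of two opposite classes: its number of partners is then at
     most the size of its own class, and the square of that number is at most the product of the two
     factors that leave the factorials. *)
  have [h [hU hle]] : exists h, h \in U /\ (ycount U (flip (yt h)) <= ycount U (yt h))%N.
    have [le|lt] := leqP (ycount U (flip (yt h0))) (ycount U (yt h0)); first by exists h0.
    have : (0 < ycount U (flip (yt h0)))%N by exact: leq_ltn_trans lt.
    move=> /card_gt0P[h]; rewrite inE => /andP[hU /eqP yh]; exists h; split => //.
    by rewrite yh flipK ltnW.
  pose T V := [set s in matchings V | [forall x in V, yt (s x) == flip (yt x)]].
  have -> : #|T U| = (\sum_(g in [set g in U :\ h | yt g == flip (yt h)]) #|T (U :\ h :\ g)|)%N.
    rewrite -sum1_card big_mkcond /= [LHS](_ : _ = \sum_(s in matchings U)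
      if [forall x in U, yt (s x) == flip (yt x)] then 1 else 0)%N; last first.
      by rewrite [RHS]big_mkcond /=; apply: eq_bigr => s _; rewrite inE; case: (s \in _).
    rewrite (big_matchings _ _ hU) [RHS]big_mkcond /= [LHS]big_mkcond /=.
    apply: eq_bigr => g _; rewrite [in RHS]inE; case gU : (g \in U :\ h) => //=.
    rewrite -big_mkcondr /= sum1_card; case: ifP => yg; last first.
      apply: eq_card0 => s; rewrite unfold_in; apply/negP => /andP[].
      move=> sM /forall_inP/(_ h hU).
      by move: sM; rewrite -(matchings_tperm _ hU gU) => /andP[_ /eqP ->]; rewrite yg.
    apply: eq_card => s; rewrite [RHS]inE [LHS]unfold_in /=; case sM : (s \in matchings _) => //=.
    have /andP[_ /eqP sh] : ((tperm h g * s)%g \in matchings U) && ((tperm h g * s)%g h == g).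
      by rewrite matchings_tperm.
    move/matchingsP : sM => [inv sup].
    have sg : s g = g by move: sh; rewrite permM tpermL.
    have sh' : s h = h by apply/eqP; rewrite -[_ == _]negbK sup !inE eqxx andbF.
    apply/forall_inP/forall_inP => hx x xU.
      have := hx x; move: xU; rewrite !inE => /and3P[xg xh ->] /(_ isT).
      by rewrite permM tpermD// eq_sym.
    have [->|xh] := eqVneq x h; first by rewrite sh.
    have [->|xg] := eqVneq x g; first by rewrite permM tpermR sh' (eqP yg) flipK.
    rewrite permM tpermD; [|by rewrite eq_sym..].
    by apply: hx; rewrite !inE xh xg.
  set K := [set g in U :\ h | yt g == flip (yt h)].
  have [K0|[g0 g0K]] := set_0Vmem K; first by rewrite K0 big_set0 exp0n.
  pose P := (\prod_y (ycount (U :\ h :\ g0) y)`!)%N.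
  have [hK P_e] : ycount (U :\ h) (flip (yt h)) = #|K| /\
      (\prod_y (ycount U y)`! = ycount U (yt h) * (#|K| * P))%N.
    split=> //.
    have yh0 : (0 < ycount U (yt h))%N by apply/card_gt0P; exists h; rewrite inE hU eqxx.
    rewrite (prod_fact_dec yh0); congr muln.
    have g0Uh : g0 \in U :\ h by move: g0K; rewrite inE => /andP[].
    have yg0 : yt g0 = flip (yt h) by move: g0K; rewrite inE => /andP[_ /eqP].
    have kp : (0 < ycount U (flip (yt h)) - (flip (yt h) == yt h))%N.
      by rewrite -ycountD1//; apply/card_gt0P; exists g0.
    rewrite (prod_fact_dec (c := fun y => (ycount U y - (y == yt h))%N) kp).
    rewrite -ycountD1//; congr muln; apply: eq_bigr => y _.
    by rewrite ycountD1// ycountD1// yg0.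
  have Kle : (#|K| <= ycount U (yt h))%N.
    by rewrite -hK ycountD1//; apply: leq_trans (leq_subr _ _) hle.
  have Tle g : g \in K -> (#|T (U :\ h :\ g)| ^ 2 <= P)%N.
    move=> gK; have gU : g \in U :\ h by move: gK; rewrite inE => /andP[].
    have g0U : g0 \in U :\ h by move: g0K; rewrite inE => /andP[].
    apply: leq_trans (IH _ _) _; first by move: Um; rewrite (cardD2 hU gU); lia.
    rewrite /P; apply: eq_leq; apply: eq_bigr => y _; rewrite ycountD1// [in RHS]ycountD1//.
    by move: gK g0K; rewrite !inE => /andP[_ /eqP ->] /andP[_ /eqP ->].
  rewrite P_e.
  have [g1 g1K g1max] : exists2 g1, g1 \in K & forall g, g \in K -> (#|T (U :\ h :\ g)| <= #|T (U :\ h :\ g1)|)%N.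
    by case: (@arg_maxnP _ g0 (mem K) (fun g => #|T (U :\ h :\ g)|) g0K) => g1 ? ?; exists g1.
  have : (\sum_(g in K) #|T (U :\ h :\ g)| <= #|K| * #|T (U :\ h :\ g1)|)%N.
    by rewrite -sum_nat_const; apply: leq_sum => g /g1max.
  rewrite -(leq_sqr) => /leq_trans; apply; rewrite expnMn mulnA leq_mul ?Tle//.
  by rewrite -mulnn leq_mul.
move: Um; rewrite leqn0 cards_eq0 => /eqP ->.
have : (#|[set s in matchings finset.set0 | [forall h in finset.set0, yt (s h) == flip (yt h)]]| <= #|matchings finset.set0|)%N.
  by apply/subset_leq_card/fintype.subsetP => s; rewrite inE => /andP[].
rewrite card_matchings cards0 /= => le1.
apply: (@leq_trans 1); first by rewrite -(exp1n 2) leq_exp2r.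
by apply: prodn_gt0 => y; rewrite fact_gt0.
Qed.

End typed.

Section concentration.
Variable R : realType.

Definition mavg U (F : {perm H} -> R) : R :=
  (\sum_(s in matchings U) F s) / #|matchings U|%:R.

(** The martingale method: the partner of one half-edge is revealed at a time. The conditional
    averages differ by at most [c], so [expR_quad] costs 2 (lam c)^2 for each of the at most [m]
    edges. *)
Lemma matchings_mgf U (F : {perm H} -> R) (c lam : R) m : (#|U| <= m.*2)%N ->
  (forall s, s \in matchings U -> {in U &, forall a b, `|F (s ^ tperm a b)%g - F s| <= c}) ->
  `|lam| * c <= 2^-1 ->
  \sum_(s in matchings U) expR (lam * F s) <=
    #|matchings U|%:R * expR (lam * mavg U F + 2 * (lam * c) ^+ 2 *+ m).
Proof.
elim: m U F => [|m IH] U F Um Lip lamc.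
  move: Um; rewrite leqn0 cards_eq0 => /eqP U0; rewrite U0.
  have M1 : #|matchings finset.set0| = 1%N by rewrite card_matchings cards0.
  rewrite /mavg M1 divr1 mul1r mulr0n addr0.
  by move/eqP/cards1P: M1 => [s ->]; rewrite !big_set1.
have [U0|[h hU]] := set_0Vmem U.
  apply: le_trans (IH _ _ _ Lip lamc) _; first by rewrite U0 cards0.
  by rewrite ler_wpM2l// ler_expR lerD2l (mulrS (2 * _)) lerDr mulr_ge0// sqr_ge0.
case: (posnP #|matchings U|) => [M0|Mpos].
  by rewrite (cards0_eq M0) big_set0 cards0 mul0r.
pose N := mcount #|U|.-2.
have cN g : g \in U :\ h -> #|matchings (U :\ h :\ g)| = N.
  by move=> gU; rewrite card_matchings /N (cardD2 hU gU).
pose K := #|U :\ h|.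
have MK : #|matchings U| = (K * N)%N.
  rewrite -sum1_card (big_matchings _ _ hU) (eq_bigr (fun=> N)) ?sum_nat_const// => g gU.
  by rewrite sum1_card cN.
have [K0 N0] : (0 < K)%N /\ (0 < N)%N by apply/andP; rewrite -muln_gt0 -MK.
have K0R : 0 < K%:R :> R by rewrite ltr0n.
have N0R : 0 < N%:R :> R by rewrite ltr0n.
have c0 : 0 <= c.
  have /card_gt0P[s sM] := Mpos.
  exact: le_trans (normr_ge0 _) (Lip _ sM h h hU hU).
pose Fg g s := F (tperm h g * s)%g.
pose a g := mavg (U :\ h :\ g) (Fg g).
pose b := mavg U F.
have bE : b * K%:R = \sum_(g in U :\ h) a g.
  rewrite /b /mavg (big_matchings _ _ hU) MK natrM invfM mulrA mulrAC mulfVK ?gt_eqF//.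
  rewrite mulr_suml; apply: eq_bigr => g gU.
  by rewrite /a /mavg cN// mulrC.
have inU g s : g \in U :\ h -> s \in matchings (U :\ h :\ g) -> (tperm h g * s)%g \in matchings U.
  by move=> gU; rewrite -(matchings_tperm _ hU gU) => /andP[].
(* Conjugation by [tperm g g'] carries the matchings in which [h] has partner [g] to those in which
   it has partner [g'], and changes [F] by at most [c]. *)
have aa g g' : g \in U :\ h -> g' \in U :\ h -> a g - a g' <= c.
  move=> gU gU'; have [->|gg'] := eqVneq g g'; first by rewrite subrr.
  rewrite /a /mavg !cN// -mulrBl ler_pdivrMr//.
  have tU : (tperm g g' @: (U :\ h :\ g) = U :\ h :\ g')%SET.
    apply/setP => x; rewrite -{1}[x](tpermK g g') (mem_imset _ _ perm_inj).
    move: gU gU'; rewrite !inE => /andP[gh gU] /andP[g'h g'U].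
    have [->|xg] := eqVneq x g; first by rewrite tpermL eq_sym gg' g'h g'U gh gU.
    have [->|xg'] := eqVneq x g'; first by rewrite tpermR eqxx.
    by rewrite tpermD ?xg ?xg'//; rewrite eq_sym.
  have -> : \sum_(s in matchings (U :\ h :\ g')) Fg g' s =
      \sum_(s in matchings (U :\ h :\ g)) F ((tperm h g * s) ^ tperm g g')%g.
    rewrite (reindex_inj (conjg_inj (tperm g g'))) /=; apply: eq_big => [s|s _].
      apply/idP/idP => [|sM]; last by rewrite -tU matchingsJ.
      move=> /(@matchingsJ _ _ (tperm g g')); rewrite -tU -imset_comp.
      by rewrite -conjgM tperm2 conjg1 (eq_imset (g := id)) ?imset_id// => x /=; rewrite tpermK.
    rewrite /Fg conjMg tpermJ tpermL tpermD//.
      by move: gU; rewrite !inE eq_sym => /andP[].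
    by move: gU'; rewrite !inE eq_sym => /andP[].
  rewrite -sumrB mulr_natr -(cN g)// -sumr_const; apply: ler_sum => s sM.
  apply: le_trans (ler_norm _) _; rewrite distrC; apply: Lip; first exact: inU.
    by move: gU; rewrite !inE => /andP[].
  by move: gU'; rewrite !inE => /andP[].
have ab g : g \in U :\ h -> `|a g - b| <= c.
  move=> gU; rewrite ler_norml; apply/andP; split.
    rewrite -(ler_pM2r K0R) mulrBl bE mulNr mulr_natr -sumr_const.
    rewrite mulr_natr -[in a g *+ _](sumr_const) -sumrB -sumrN ler_sum// => g' g'U.
    by have := aa _ _ g'U gU; lra.
  rewrite -(ler_pM2r K0R) mulrBl bE mulr_natr -sumr_const mulr_natr -[in leRHS]sumr_const.
  by rewrite -sumrB ler_sum// => g' g'U; exact: aa.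
rewrite (big_matchings _ _ hU) MK.
apply: (@le_trans _ _ (\sum_(g in U :\ h) N%:R * expR (lam * a g + 2 * (lam * c) ^+ 2 *+ m))).
  apply: ler_sum => g gU; rewrite -(cN g)//; apply: (IH _ (Fg g)) => //.
    by move: Um; rewrite (cardD2 hU gU) doubleS.
  move=> s sM x y xU yU; rewrite /Fg.
  have h1 z : z \in U :\ h :\ g -> [&& z != h, z != g & z \in U].
    by rewrite !inE => /and3P[-> -> ->].
  have /and3P[xh xg xU'] := h1 _ xU; have /and3P[yh yg yU'] := h1 _ yU.
  have <- : ((tperm h g * s) ^ tperm x y = tperm h g * s ^ tperm x y)%g.
    by rewrite conjMg tpermJ !tpermD.
  by apply: Lip => //; exact: inU.
rewrite -mulr_sumr natrM [X in _ <= X * _]mulrC -mulrA ler_pM2l//.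
rewrite (mulrS (2 * _)) addrA -/b -addrA.
under eq_bigr do rewrite expRD.
rewrite -mulr_suml [X in _ <= _ * expR X]addrA expRD mulrA ler_pM2r ?expR_gt0//.
have -> : \sum_(g in U :\ h) expR (lam * a g) = expR (lam * b) * \sum_(g in U :\ h) expR (lam * (a g - b)).
  by rewrite mulr_sumr; apply: eq_bigr => g _; rewrite -expRD mulrBr addrC subrK.
rewrite expRD [leRHS]mulrCA ler_pM2l ?expR_gt0//.
apply: (@le_trans _ _ (\sum_(g in U :\ h) (1 + lam * (a g - b) + 2 * (lam * c) ^+ 2))).
  apply: ler_sum => g gU; have abg := ab _ gU.
  have le1 : `|lam * (a g - b)| <= `|lam| * c by rewrite normrM ler_wpM2l.
  apply: le_trans (expR_quad _) _.
    by apply: le_trans (ler_norm _) _; apply: le_trans lamc.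
  rewrite lerD2l ler_pM2l// -[leLHS](real_normK (num_real _)) -[leRHS](real_normK (num_real _)) ler_sqr ?nnegrE//.
  by rewrite [leRHS]normrM [X in _ <= _ * X]ger0_norm.
(* The linear terms of the expansion cancel, [b] being the mean of the conditional averages. *)
have h2 : \sum_(g in U :\ h) (a g - b) = 0.
  by rewrite sumrB -bE sumr_const mulr_natr subrr.
rewrite !big_split /= -mulr_sumr h2 mulr0 addr0 !sumr_const -/K -mulr_natl -[X in _ + X]mulr_natl.
rewrite -[X in X + _]mulr1 -mulrDr ler_pM2l//; exact: expR_ge1Dx.
Qed.

Lemma matchings_tail U (F : {perm H} -> R) (c lam u : R) m : (#|U| <= m.*2)%N ->
  (forall s, s \in matchings U -> {in U &, forall a b, `|F (s ^ tperm a b)%g - F s| <= c}) ->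
  0 <= lam -> lam * c <= 2^-1 ->
  #|[set s in matchings U | u <= F s - mavg U F]|%:R <=
    #|matchings U|%:R * expR (2 * (lam * c) ^+ 2 *+ m - lam * u).
Proof.
move=> Um Lip lam0 lamc.
have := matchings_mgf Um Lip; rewrite -(ger0_norm lam0) => /(_ lam); rewrite (ger0_norm lam0) => /(_ lamc) mgf.
set A := [set s in _ | _].
have hA : #|A|%:R * expR (lam * (mavg U F + u)) <= \sum_(s in matchings U) expR (lam * F s).
  rewrite mulr_natl -sumr_const big_mkcond /= [leRHS]big_mkcond /=; apply: ler_sum => s _.
  rewrite inE; case: (s \in matchings U) => //=; case: ifP => [us|_]; last exact: expR_ge0.
  by rewrite ler_expR ler_wpM2l//; move: us; lra.
set q := 2 * (lam * c) ^+ 2 *+ m in mgf *.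
rewrite -(ler_pM2r (expR_gt0 (lam * (mavg U F + u)))) -mulrA -expRD.
apply: le_trans hA (le_trans mgf _).
by rewrite le_eqVlt; apply/orP; left; apply/eqP; congr (_ * expR _); lra.
Qed.

End concentration.

End matchings.

End matching_counts.

(** * Automorphisms of the regular tree *)

Section tree_words.
Variable d : nat.
Hypothesis d3 : (3 <= d)%N.
Implicit Types u v w : tree d.

Definition mkT (s : seq nat) : tree d := insubd (root d) s.

Lemma mkTK s : tree_label d s -> tree_val (mkT s) = s.
Proof. by move=> sd; exact: (insubdK (root d)). Qed.

Lemma mkT_val u : mkT (tree_val u) = u.
Proof. exact: valKd. Qed.

Lemma tree_inj u v : tree_val u = tree_val v -> u = v.
Proof. exact: val_inj. Qed.

Lemma tree_label_catl s t : tree_label d (s ++ t) -> tree_label d s.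
Proof. by case: s => //= i s; rewrite all_cat => /and3P[-> ->]. Qed.

Lemma tree_label_take s k : tree_label d s -> tree_label d (take k s).
Proof. by rewrite -{1}(cat_take_drop k s); exact: tree_label_catl. Qed.

Lemma tree_label_cat_nz s s' t : s <> [::] -> tree_label d (s ++ t) -> tree_label d s' ->
  s' <> [::] -> tree_label d (s' ++ t).
Proof.
case: s => //= i s _; rewrite all_cat => /and3P[_ _ ht].
by case: s' => //= i' s' /andP[-> h] _; rewrite all_cat h.
Qed.

Lemma rcons_ex (s : seq nat) : s <> [::] -> exists s' k, s = rcons s' k.
Proof. by case: (lastP s) => // s' k _; exists s', k. Qed.

Definition child u k : tree d := mkT (rcons u k).
Definition parent u : tree d := mkT (take (size u).-1 u).

Lemma is_childP u w : reflect (exists k, tree_val w = rcons u k) (is_child u w).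
Proof.
apply: (iffP idP) => [|[k ->]]; last by rewrite is_child_rcons eqxx.
case: (lastP (tree_val w)) => // s k; rewrite is_child_rcons => /eqP <-.
by exists k.
Qed.

Lemma parentE u w : is_child u w -> parent w = u.
Proof.
case/is_childP => k wk; apply: tree_inj; rewrite /parent wk size_rcons /=.
by rewrite -cats1 take_size_cat// mkTK//; exact: tree_valP.
Qed.

Lemma is_child_parent w : tree_val w <> [::] -> is_child (parent w) w.
Proof.
move=> /rcons_ex[s [k wk]].
have sd : tree_label d s by have := tree_valP w; rewrite wk tree_label_rcons => /andP[].
by rewrite /parent wk is_child_rcons size_rcons /= -cats1 take_size_cat// mkTK.
Qed.

Lemma tadj_sym u w : tadj u w = tadj w u.
Proof. by rewrite /tadj orbC. Qed.

Lemma is_child_asym u w : is_child u w -> is_child w u = false.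
Proof.
move=> /is_child_size h; apply/negP => /is_child_size; rewrite h; lia.
Qed.

Lemma is_child_inj u u' w : is_child u w -> is_child u' w -> u = u'.
Proof. by move=> /parentE <- /parentE. Qed.

Definition under1 (s : seq nat) : bool := if s is i :: _ then i == 1%N else false.

Lemma under1_rcons s k : s <> [::] -> under1 (rcons s k) = under1 s.
Proof. by case: s. Qed.

Lemma under1_take s k : (0 < k)%N -> under1 (take k s) = under1 s.
Proof. by case: s k => [|i s] [|k]. Qed.

Lemma first_nbrE : tree_val (first_nbr d) = [:: 1%N].
Proof. by rewrite /first_nbr; apply: (mkTK (s := [:: 1%N])) => /=; lia. Qed.

Lemma in_S_ball r u : (u \in S_ball d r) = (size u <= r)%N.
Proof.
have fs : finite_set [set root d]%classic by exact: finite_set1.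
apply/idP/idP => [/(in_tree_ball _ _ fs)[_ -> [p [ep <- pr]]]|].
  apply: leq_trans pr; elim/last_ind: p ep => [//|p x IH].
  rewrite rcons_path last_rcons size_rcons => /andP[/IH h].
  by case/orP => /is_child_size; lia.
move=> ur; apply/(in_tree_ball _ _ fs); exists (root d) => //.
elim: r u ur => [|r IH] u ur.
  exists [::]; split => //=; apply: tree_inj; symmetry.
  by apply/size0nil/eqP; rewrite -leqn0.
case: (boolP (size u <= r)%N) => [/IH [p [? ? /leqW ?]]|]; first by exists p.
move=> un; have unz : tree_val u <> [::] by move=> u0; rewrite u0 in un.
have cu := is_child_parent unz; have := is_child_size cu => su.
have [|p [ep lp pr]] := IH (parent u); first by move: ur; rewrite su.
exists (rcons p u); rewrite rcons_path last_rcons size_rcons ltnS; split => //.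
by rewrite ep lp /tadj cu.
Qed.

(** In the branch of the first neighbor the nearer endpoint of the edge is that neighbor, which
    allows one more letter. *)
Lemma in_E_ball r u : (0 < r)%N -> (u \in E_ball d r) = (size u <= r.-1 + under1 u)%N.
Proof.
case: r => // r _ /=.
have fs : finite_set [set root d; first_nbr d]%classic.
  by rewrite finite_setU; split; exact: finite_set1.
rewrite /E_ball /=; apply/idP/idP.
  move=> /(in_tree_ball _ _ fs)[s sE [p [ep <- pr]]].
  have : (size (last s p) <= size p + under1 (last s p))%N.
    have s0 : (size s <= under1 s)%N by case: sE => /= ->; rewrite ?first_nbrE.
    clear pr; elim/last_ind: p ep => [//|p x IH].
    rewrite rcons_path last_rcons size_rcons => /andP[/IH h].
    case/orP => /is_childP[k e]; move: h; rewrite ?e ?size_rcons.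
      by case: (tree_val (last _ p)) => [|i t] //=; lia.
    by case: (tree_val x) => [|i t] //=; rewrite ?size_rcons; lia.
  by move=> h; apply: leq_trans h _; rewrite leq_add2r.
move=> ur; apply/(in_tree_ball _ _ fs).
case u1 : (under1 u) ur => /=; last first.
  rewrite addn0 => ur; exists (root d); first by left.
  by have := in_S_ball r u; rewrite ur => /(in_tree_ball _ _ (finite_set1 _))[_ ->].
rewrite addn1 => ur; exists (first_nbr d); first by right.
elim: r u u1 ur => [|r IH] u u1 ur.
  exists [::]; split => //=; apply: tree_inj; rewrite first_nbrE.
  by case: (tree_val u) u1 ur => [|i [|? ?]]//= /eqP ->.
case: (boolP (size u <= r.+1)%N) => [/(IH _ u1) [p [? ? /leqW ?]]|]; first by exists p.
move=> un; have unz : tree_val u <> [::] by move=> u0; rewrite u0 in un.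
have cu := is_child_parent unz; have su := is_child_size cu.
have pu1 : under1 (parent u).
  case/is_childP : cu u1 => k ->; rewrite under1_rcons// => p0.
  by move: su un; rewrite p0 /= => ->.
have [|p [ep lp pr]] := IH (parent u) pu1; first by move: ur; rewrite su.
exists (rcons p u); rewrite rcons_path last_rcons size_rcons ltnS; split => //.
by rewrite ep lp /tadj cu.
Qed.

(* The automorphism of [T_d] that reverses the edge {o, 1}. *)
Definition flipw (s : seq nat) : seq nat :=
  match s with
  | [::] => [:: 1%N]
  | i :: s' => if i == 1%N then (if s' is k :: s'' then k.+1 :: s'' else [::])
               else 1%N :: i.-1 :: s'
  end.

Lemma flipw_label s : tree_label d s -> tree_label d (flipw s).
Proof.
case: s => [|i s] /=; first by move=> _; lia.
case: eqP => [->|/eqP i1]; first by case: s => //= k s /and3P[_ /andP[k0 kd] ->]; rewrite andbT; lia.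
by move=> /= /andP[h ->] /=; rewrite andbT; lia.
Qed.

Lemma flipwK s : tree_label d s -> flipw (flipw s) = s.
Proof.
case: s => [|i s] //=; case: eqP => [->|/eqP i1] /=.
  by case: s => //= k s /and3P[_ /andP[k0 _] _]; case: k k0.
by case: i i1 => [|[|i]].
Qed.

Definition flipT u : tree d := mkT (flipw u).

Lemma flipTE u : tree_val (flipT u) = flipw u.
Proof. by rewrite mkTK//; exact/flipw_label/tree_valP. Qed.

Lemma flipTK : involutive flipT.
Proof. by move=> u; apply: tree_inj; rewrite !flipTE flipwK//; exact: tree_valP. Qed.

Lemma flipT_child u w : is_child u w -> tadj (flipT u) (flipT w).
Proof.
case/is_childP => k e; rewrite /tadj !flipTE e.
have := tree_valP w; rewrite e; case: (tree_val u) => [|i s] /=.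
  by move=> wd; case: eqP => [kk|/eqP k1] //=; rewrite ?eqxx ?orbT.
case: eqP => [_|/eqP i1] /=; last by rewrite -!rcons_cons !belast_rcons !eqxx.
by case: s => [|j s] _ /=; rewrite ?eqxx ?orbT// ?belast_rcons ?eqxx.
Qed.

Lemma flipT_adj u w : tadj (flipT u) (flipT w) = tadj u w.
Proof.
have h x y : tadj x y -> tadj (flipT x) (flipT y).
  by case/orP => /flipT_child//; rewrite tadj_sym.
by apply/idP/idP => [/h|/h//]; rewrite !flipTK.
Qed.

Lemma flipT_aut : tree_aut flipT.
Proof. by split; [exists flipT; exact: flipTK|exact: flipT_adj]. Qed.

(* [rotT i] moves the i-th child of the root in first position, preserving the
   order of the others. *)
Definition rotl (i k : nat) : nat :=
  if k == 1%N then i else if (k <= i)%N then k.-1 else k.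
Definition rotlV (i j : nat) : nat :=
  if j == i then 1%N else if (j < i)%N then j.+1 else j.
Definition rotw (i : nat) (s : seq nat) : seq nat :=
  if s is k :: s' then rotl i k :: s' else [::].
Definition rotwV (i : nat) (s : seq nat) : seq nat :=
  if s is k :: s' then rotlV i k :: s' else [::].
Definition rotT i u : tree d := mkT (rotw i u).
Definition rotTV i u : tree d := mkT (rotwV i u).

Lemma rotwP i s : (0 < i <= d)%N -> tree_label d s ->
  tree_label d (rotw i s) /\ rotwV i (rotw i s) = s.
Proof.
move=> id; case: s => [|k s] //= /andP[kd ->]; rewrite andbT /rotl /rotlV.
case: (k =P 1%N) => [->|/eqP k1]; first by rewrite id eqxx.
case: (leqP k i) => ki; last first.
  by split; [lia|rewrite (gtn_eqF ki) ltnNge (ltnW ki)].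
split; first by lia.
have ki' : (k.-1 < i)%N by lia.
by rewrite (ltn_eqF ki') ki' prednK//; lia.
Qed.

Lemma rotwVP i s : (0 < i <= d)%N -> tree_label d s ->
  tree_label d (rotwV i s) /\ rotw i (rotwV i s) = s.
Proof.
move=> id; case: s => [|k s] //= /andP[kd ->]; rewrite andbT /rotl /rotlV.
case: (k =P i) => [->|/eqP k1]; first by split => //; lia.
case: (ltnP k i) => ki.
  split; first by lia.
  by rewrite (_ : (k.+1 == 1%N) = false) ?ki//; lia.
split; first by lia.
rewrite (_ : (k == 1%N) = false); last by lia.
by rewrite leqNgt ltn_neqAle eq_sym k1 ki.
Qed.

Lemma rotTE i u : (0 < i <= d)%N -> tree_val (rotT i u) = rotw i u.
Proof. by move=> id; rewrite mkTK//; have [] := rotwP id (tree_valP u). Qed.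

Lemma rotTVE i u : (0 < i <= d)%N -> tree_val (rotTV i u) = rotwV i u.
Proof. by move=> id; rewrite mkTK//; have [] := rotwVP id (tree_valP u). Qed.

Lemma rotT_aut i : (0 < i <= d)%N -> tree_aut (rotT i).
Proof.
move=> id; split.
  exists (rotTV i) => u; apply: tree_inj.
    by rewrite rotTVE// rotTE//; have [] := rotwP id (tree_valP u).
  by rewrite rotTE// rotTVE//; have [] := rotwVP id (tree_valP u).
have h (f : nat -> nat) (s t : seq nat) : injective f -> is_child (if s is k :: s' then f k :: s' else [::])
     (if t is k :: s' then f k :: s' else [::]) = is_child s t.
  move=> fi; case: t => [|k t] /=; first by case: s.
  case: s => [|j s]; first by case: t.
  by case: t => [|k' t] //=; rewrite !eqseq_cons (inj_eq fi).
have rotl_inj (k k' : nat) : (0 < k)%N -> (0 < k')%N -> rotl i k = rotl i k' -> k = k'.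
  by rewrite /rotl; do !case: ifP; lia.
have hc u w : is_child (rotT i u) (rotT i w) = is_child u w.
  rewrite !rotTE//; have := tree_valP u; have := tree_valP w.
  case: (tree_val w) => [|k t] /=; first by case: (tree_val u).
  case: (tree_val u) => [|j s]; first by case: t.
  case: t => [|k' t] //= /andP[k0 _] /andP[j0 _]; rewrite !eqseq_cons; congr andb.
  by apply/eqP/eqP => [/rotl_inj ->//|->//]; lia.
by move=> u w; rewrite /tadj !hc.
Qed.

End tree_words.

Section tree_automorphisms.
Variable d : nat.
Hypothesis d3 : (3 <= d)%N.
Implicit Types u v w : tree d.

Lemma parent_size u : tree_val u <> [::] -> size u = (size (parent u)).+1.
Proof. by move=> /is_child_parent/is_child_size. Qed.

(** By induction on the depth: were [f u] the parent of [f (parent u)], it would be the image of the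
    grandparent of [u], against injectivity. The domain [D], closed under parents, is the whole tree
    or a ball. *)
Lemma fixing_root_depth (D : tree d -> Prop) (f : tree d -> tree d) :
  (forall u, D u -> tree_val u <> [::] -> D (parent u)) ->
  (forall u w, D u -> D w -> f u = f w -> u = w) ->
  (forall u w, D u -> D w -> tadj u w -> tadj (f u) (f w)) ->
  f (root d) = root d ->
  forall u, D u -> size (f u) = size u /\
    (tree_val u <> [::] -> is_child (f (parent u)) (f u)).
Proof.
move=> Dp finj fadj f0 u; move: {2}(size u) (leqnn (size u)) => n.
elim: n u => [|n IH] u un Du.
  have u0 : u = root d by apply: tree_inj; apply/size0nil/eqP; rewrite -leqn0.
  by rewrite u0 f0; split.
have [u0|] := eqVneq (tree_val u) [::].
  by have -> : u = root d; [exact: tree_inj|rewrite f0].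
move/eqP => unz; have cu := is_child_parent unz; have pu := parent_size unz.
have Dpu := Dp _ Du unz.
have [spu cpu] : size (f (parent u)) = size (parent u) /\
  (tree_val (parent u) <> [::] -> is_child (f (parent (parent u))) (f (parent u))).
  by apply: IH => //; move: un; rewrite pu.
have h : is_child (f (parent u)) (f u).
  have /orP[//|hc] : tadj (f (parent u)) (f u) by apply: fadj => //; rewrite /tadj cu.
  have pnz : tree_val (parent u) <> [::].
    by move=> p0; move: (is_child_size hc); rewrite spu p0.
  have := is_child_inj hc (cpu pnz) => /(finj _ _ Du (Dp _ Dpu pnz)) e.
  by have := parent_size pnz; move: pu; rewrite -e; lia.
by split => //; rewrite (is_child_size h) spu -pu.
Qed.

Lemma tree_aut_depth (F : tree d -> tree d) : tree_aut F -> F (root d) = root d ->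
  forall u, size (F u) = size u.
Proof.
move=> [/bij_inj Finj Fadj] F0 u.
by have [] := @fixing_root_depth (fun=> True) F (fun _ _ _ => I)
  (fun u w _ _ => Finj u w) (fun u w _ _ => etrans (Fadj u w)) F0 u I.
Qed.

Lemma ball_perm (B : {fset tree d}) (F : tree d -> tree d) :
  injective F -> (forall u, u \in B -> F u \in B) ->
  exists phi : {perm B}, forall u : B, val (phi u) = F (val u).
Proof.
move=> Finj FB.
have vF (u : B) : val (insubd u (F (val u))) = F (val u).
  by rewrite insubdK//; apply: FB; exact: valP.
have inj : injective (fun u : B => insubd u (F (val u))).
  by move=> u w /(congr1 val); rewrite !vF => /Finj/val_inj.
by exists (perm inj) => u; rewrite permE vF.
Qed.

Lemma tree_aut_ball (F : tree d -> tree d) t : tree_aut F -> F (root d) = root d ->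
  exists phi : {perm S_ball d t}, ball_aut phi /\ forall u : S_ball d t, val (phi u) = F (val u).
Proof.
move=> aF F0; have [phi phiE] := @ball_perm (S_ball d t) F (bij_inj aF.1)
  (fun u => etrans (etrans (in_S_ball d3 _ _) (congr1 (fun k => k <= t)%N (tree_aut_depth aF F0 u)))
    \o etrans (esym (in_S_ball d3 t u))).
by exists phi; split => // u w; rewrite !phiE aF.2.
Qed.

Section extension.
Variables (B : {fset tree d}) (m : nat) (b : bool).

(** Treats both kinds of balls at once: [b = false] gives [S_ball], and [b = true] gives [E_ball],
    whose depth is larger by one in the branch of the first neighbor. *)
Let cut (s : seq nat) := (m + (b && under1 s))%N.

Hypothesis BE : forall u, (u \in B) = (size u <= cut u)%N.

Definition fixes_ball (phi : {perm B}) : Prop :=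
  [/\ ball_aut phi, forall u : B, val u = root d -> val (phi u) = root d &
    b -> forall u : B, val u = first_nbr d -> val (phi u) = first_nbr d].

Let rootB : root d \in B.
Proof. by rewrite BE. Qed.

Let fun_of (phi : {perm B}) u : tree d := if insub u is Some u' then val (phi u') else u.

Let fun_ofE phi (u : B) : fun_of phi (val u) = val (phi u).
Proof. by rewrite /fun_of valK. Qed.

Let cut_rcons s k : s <> [::] -> cut (rcons s k) = cut s.
Proof. by move=> s0; rewrite /cut under1_rcons. Qed.

Let parentB u : u \in B -> tree_val u <> [::] -> parent u \in B.
Proof.
rewrite !BE => + unz; have := parent_size unz; have /is_childP[k e] := is_child_parent unz.
have [p0|/eqP p0] := eqVneq (tree_val (parent u)) [::]; first by rewrite p0.
by rewrite e cut_rcons// size_rcons => _; lia.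
Qed.

Section one.
Variable phi : {perm B}.
Hypothesis phiP : fixes_ball phi.
Let f := fun_of phi.

Let f0 : f (root d) = root d.
Proof. by case: phiP => _ h _; rewrite -[root d]/(val [` rootB]%fset) /f fun_ofE; exact: h. Qed.

Let finj u w : u \in B -> w \in B -> f u = f w -> u = w.
Proof.
move=> uB wB; rewrite -[u]/(val [` uB]%fset) -[w]/(val [` wB]%fset) /f !fun_ofE.
by move=> /val_inj/perm_inj ->.
Qed.

Let fadj u w : u \in B -> w \in B -> tadj u w -> tadj (f u) (f w).
Proof.
move=> uB wB; case: phiP => h _ _; rewrite -[u]/(val [` uB]%fset) -[w]/(val [` wB]%fset).
by rewrite /f !fun_ofE h.
Qed.

Let f_depth u : u \in B -> size (f u) = size u /\
    (tree_val u <> [::] -> is_child (f (parent u)) (f u)).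
Proof. exact: (fixing_root_depth parentB finj fadj f0). Qed.

(** When [b] holds, [f] fixes the first neighbor and therefore its branch; [cut] is then the same
    before and after the extension, which makes the latter invertible. *)
Let f_under1 u : u \in B -> b && under1 (f u) = b && under1 u.
Proof.
case: (boolP b) => // bt; move: {2}(size u) (leqnn (size u)) => n.
elim: n u => [|n IH] u un uB.
  by have -> : u = root d; [apply: tree_inj; apply/size0nil/eqP; rewrite -leqn0|rewrite f0].
have [u0|/eqP unz] := eqVneq (tree_val u) [::].
  by have -> : u = root d; [exact: tree_inj|rewrite f0].
have [sf cf] := f_depth uB; have := cf unz; have /is_childP[k e] := is_child_parent unz.
move=> /is_childP[k' e']; have pu := parent_size unz.
have [p0|/eqP pnz] := eqVneq (tree_val (parent u)) [::].
  have p0' : parent u = root d by exact: tree_inj.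
  move: e e'; rewrite p0' f0 /= => e e'; rewrite e e' /=.
  have B1 : first_nbr d \in B by rewrite BE first_nbrE// /cut bt /= addn1.
  have f1 : f (first_nbr d) = first_nbr d.
    by case: phiP => _ _ /(_ bt [` B1]%fset erefl); rewrite -fun_ofE.
  apply/eqP/eqP => [k1|k1].
    suff : u = first_nbr d by move=> uE; move: e; rewrite uE first_nbrE// => -[].
    by apply: finj => //; rewrite f1; apply: tree_inj; rewrite e' k1 first_nbrE.
  have uE : u = first_nbr d by apply: tree_inj; rewrite e k1 first_nbrE.
  by move: e'; rewrite uE f1 first_nbrE// => -[].
have pB := parentB uB unz.
rewrite e e' !under1_rcons//; last first.
  by move=> fp0; have [] := f_depth pB; rewrite fp0 => /esym/size0nil/pnz.
by apply: IH => //; move: un; rewrite pu.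
Qed.

Let pre w : tree d := mkT d (take (cut w) w).

Let preE w : tree_val (pre w) = take (cut w) w.
Proof. by rewrite mkTK//; apply: tree_label_take; exact: tree_valP. Qed.

Let preB w : pre w \in B.
Proof.
rewrite BE preE size_take_min; have [|k0] := posnP (cut w); first by move=> ->; rewrite min0n.
by rewrite /cut under1_take// geq_minl.
Qed.

(** [f] acts on the prefix that lies in the ball and the remaining letters are copied: below all
    vertices other than the root, children bear the same labels. *)
Definition ball_extension w : tree d := mkT d (f (pre w) ++ drop (cut w) w).

Let extE w : tree_val (ball_extension w) = f (pre w) ++ drop (cut w) w.
Proof.
rewrite mkTK//; have [pw0|/eqP pwnz] := eqVneq (tree_val (pre w)) [::].
  have -> : pre w = root d by exact: tree_inj.
  rewrite f0 /=; have := cat_take_drop (cut w) w; rewrite -preE pw0 /= => ->.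
  exact: tree_valP.
apply: (@tree_label_cat_nz _ (take (cut w) w)); first by rewrite -preE.
- by rewrite cat_take_drop; exact: tree_valP.
- exact: tree_valP.
- move=> fp0; have [] := f_depth (preB w); rewrite fp0 => /esym/size0nil.
  by move/pwnz.
Qed.

Let pre_in w : w \in B -> pre w = w.
Proof. by rewrite BE => wB; apply: tree_inj; rewrite preE take_oversize. Qed.

Lemma ball_extension_in w : w \in B -> ball_extension w = f w.
Proof.
move=> wB; apply: tree_inj; rewrite extE pre_in//.
by move: wB; rewrite BE => /drop_oversize ->; rewrite cats0.
Qed.

Lemma ball_extension_child u w : is_child u w -> is_child (ball_extension u) (ball_extension w).
Proof.
move=> uw; have /is_childP[k e] := uw.
have wnz : tree_val w <> [::] by rewrite e; case: (tree_val u).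
have pw := parentE uw.
have [wB|wB] := boolP (w \in B).
  have uB : u \in B by rewrite -pw; exact: parentB.
  by rewrite !ball_extension_in// -pw; exact: (f_depth wB).2.
apply/is_childP; exists k; rewrite !extE.
have [u0|/eqP unz] := eqVneq (tree_val u) [::].
  have uE : u = root d by exact: tree_inj.
  move: wB e; rewrite uE BE /= -ltnNge => + e; rewrite e /= ltnS leqn0 => /eqP c0.
  have -> : pre w = root d by apply: tree_inj; rewrite preE e /= c0.
  have -> : pre (root d) = root d by apply: tree_inj; rewrite preE.
  by rewrite c0 f0.
have cc : cut w = cut u by rewrite e cut_rcons.
have su : (cut u <= size u)%N.
  by move: wB; rewrite BE -ltnNge cc e size_rcons ltnS.
have -> : pre w = pre u by apply: tree_inj; rewrite !preE cc e -cats1 takel_cat.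
by rewrite cc e drop_rcons// rcons_cat.
Qed.

Lemma ball_extension_root : ball_extension (root d) = root d.
Proof. by rewrite ball_extension_in. Qed.

Lemma ball_extension_cut w : cut (ball_extension w) = cut w /\
  take (cut w) (ball_extension w) = f (pre w) /\ drop (cut w) (ball_extension w) = drop (cut w) w.
Proof.
have [sp _] := f_depth (preB w); have up := f_under1 (preB w).
have [wB|wB] := boolP (w \in B).
  rewrite ball_extension_in// pre_in// in sp up *.
  move: wB; rewrite BE => wB; rewrite /cut up -/(cut w).
  by rewrite take_oversize ?drop_oversize ?sp.
have sc : size (pre w) = cut w.
  by rewrite preE size_take; case: ifP => //; move: wB; rewrite BE; case: ltngtP.
rewrite extE take_size_cat ?sp// drop_size_cat ?sp//; split=> //; rewrite /cut; congr addn.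
have [pw0|/eqP pwnz] := eqVneq (tree_val (pre w)) [::].
  have -> : pre w = root d by exact: tree_inj.
  by rewrite f0 /=; move: sc; rewrite pw0 /cut /= => <-; rewrite drop0.
have c0 : (0 < cut w)%N by rewrite -sc; case: (tree_val (pre w)) pwnz.
move: up; rewrite preE (under1_take _ c0) => <-.
have : size (f (pre w)) <> 0%N by rewrite sp sc; lia.
by case: (tree_val (f (pre w))).
Qed.

End one.

Lemma ball_extensionK phi : fixes_ball phi -> fixes_ball phi^-1%g ->
  cancel (ball_extension phi) (ball_extension phi^-1%g).
Proof.
move=> phiP phiVP w; apply: tree_inj; have [c1 [c2 c3]] := ball_extension_cut phiP w.
have lab := tree_valP (ball_extension phi w).
rewrite {1}/ball_extension c1 c2 c3.
set p := mkT d (take (cut w) w).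
have pB : p \in B.
  rewrite BE mkTK//; last by apply: tree_label_take; exact: tree_valP.
  rewrite size_take_min; have [|k0] := posnP (cut w); first by move=> ->; rewrite min0n.
  by rewrite /cut under1_take// geq_minl.
have -> : mkT d (tree_val (fun_of phi p)) = fun_of phi p by exact: mkT_val.
have -> : fun_of phi^-1%g (fun_of phi p) = p.
  by rewrite -[p]/(val [` pB]%fset) !fun_ofE permK.
rewrite /p (mkTK (tree_label_take _ (tree_valP w))) cat_take_drop.
by rewrite mkT_val.
Qed.

Lemma fixes_ballV phi : fixes_ball phi -> fixes_ball phi^-1%g.
Proof.
move=> [h1 h2 h3]; split.
- by move=> u w; rewrite -[in RHS](permKV phi u) -[in RHS](permKV phi w) h1.
- move=> u u0; have := h2 u u0; rewrite -u0 => /val_inj e.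
  by rewrite -{1}e permK u0.
- move=> bt u u0; have := h3 bt u u0; rewrite -u0 => /val_inj e.
  by rewrite -{1}e permK u0.
Qed.

(** Links the two notions of invariance: that of finite marginals under automorphisms of a ball, and
    that of the process under automorphisms of the tree. *)
Lemma ball_extensionP phi : fixes_ball phi -> exists F : tree d -> tree d,
  [/\ tree_aut F, F (root d) = root d & forall u : B, F (val u) = val (phi u)].
Proof.
move=> phiP; have phiVP := fixes_ballV phiP.
exists (ball_extension phi); split.
- split.
    exists (ball_extension phi^-1%g); first exact: ball_extensionK.
    by have := @ball_extensionK phi^-1%g; rewrite invgK; exact.
  have h psi u w : fixes_ball psi -> tadj u w -> tadj (ball_extension psi u) (ball_extension psi w).
    by move=> psiP /orP[] /(ball_extension_child psiP) h; rewrite /tadj h ?orbT.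
  move=> u w; apply/idP/idP => [/(h _ _ _ phiVP)|]; last exact: h.
  by rewrite !ball_extensionK.
- exact: ball_extension_root.
- by move=> u; rewrite ball_extension_in ?fun_ofE//; exact: valP.
Qed.

End extension.

Lemma S_ball_extension t (phi : {perm S_ball d t}) : ball_aut phi ->
  (forall u : S_ball d t, val u = root d -> val (phi u) = root d) ->
  exists F : tree d -> tree d,
  [/\ tree_aut F, F (root d) = root d & forall u : S_ball d t, F (val u) = val (phi u)].
Proof.
move=> h1 h2; apply: (@ball_extensionP (S_ball d t) t false).
  by move=> u; rewrite in_S_ball// addn0.
by split.
Qed.

Lemma E_ball_extension r (phi : {perm E_ball d r}) : (0 < r)%N -> ball_aut phi ->
  (forall u : E_ball d r, val u = root d -> val (phi u) = root d) ->
  (forall u : E_ball d r, val u = first_nbr d -> val (phi u) = first_nbr d) ->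
  exists F : tree d -> tree d,
  [/\ tree_aut F, F (root d) = root d & forall u : E_ball d r, F (val u) = val (phi u)].
Proof.
move=> r0 h1 h2 h3; apply: (@ball_extensionP (E_ball d r) r.-1 true).
  by move=> u; rewrite in_E_ball.
by split.
Qed.

(** Interior vertices have full degree in the ball. In a graph of degree at most [d], all neighbors
    of the image of an interior vertex therefore belong to the embedded ball ([embedding_nbrs]). *)
Lemma card_tree_nbrs t (u : S_ball d t) : (size (val u) < t)%N ->
  (d <= #|[set w : S_ball d t | tadj (val u) (val w)]|)%N.
Proof.
move=> ut; have uS : (size (val u) <= t)%N := ltnW ut.
have inS s : tree_label d s -> (size s <= t)%N -> mkT d s \in S_ball d t.
  by move=> sd st; rewrite in_S_ball// mkTK.
have letter k : (0 < k < d)%N -> tree_label d (rcons (val u) k).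
  by move=> kd; rewrite tree_label_rcons tree_valP; case: (tree_val _) => [|? ?] /=; lia.
(* The neighbor that is not one of the children 1, .., d - 1: the child d at the root, the parent
   elsewhere. *)
have [F0 F0adj F0child] : exists2 w0 : S_ball d t, tadj (val u) (val w0) &
    forall k, (0 < k < d)%N -> tree_val (val w0) <> rcons (val u) k.
  have [u0|/eqP unz] := eqVneq (tree_val (val u)) [::].
    have dl : tree_label d [:: d] by rewrite /=; lia.
    have dt : (size [:: d] <= t)%N by move: ut; rewrite u0.
    exists [` inS _ dl dt]%fset; rewrite /= ?mkTK//.
      by rewrite /tadj mkTK//= u0.
    by move=> k kd; rewrite u0 /= => -[dk]; move: kd; lia.
  have pS : parent (val u) \in S_ball d t.
    by rewrite in_S_ball//; have := parent_size unz; move: ut; lia.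
  exists [` pS]%fset; first by rewrite /tadj /= is_child_parent// orbT.
  move=> k _ /= e; move: (congr1 size e) (parent_size unz) => /=.
  by rewrite size_rcons => -> ; lia.
pose F (i : 'I_d) : S_ball d t := if (i : nat) is k.+1 then insubd u (mkT d (rcons (val u) k.+1)) else F0.
have FE (i : 'I_d) k : i = k.+1 :> nat -> tree_val (val (F i)) = rcons (val u) k.+1.
  move=> ik; have kd : (0 < k.+1 < d)%N by rewrite -ik ltn_ord ik.
  by rewrite /F ik insubdK ?mkTK ?letter// inS ?letter// size_rcons.
have Finj : injective F.
  move=> i j; case Ei: (i : nat) => [|k]; case Ej: (j : nat) => [|l] e; apply: val_inj; rewrite /= ?Ei ?Ej//.
  - exfalso; apply: (F0child l.+1); first by rewrite -Ej ltn_ord Ej.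
    by rewrite -(FE _ _ Ej) -e /F Ei.
  - exfalso; apply: (F0child k.+1); first by rewrite -Ei ltn_ord Ei.
    by rewrite -(FE _ _ Ei) e /F Ej.
  - have := FE _ _ Ei; rewrite e (FE _ _ Ej) => /eqP.
    by rewrite eqseq_rcons => /andP[_ /eqP ->].
rewrite -[leqLHS]card_ord -(card_imset _ Finj); apply/subset_leq_card/fintype.subsetP.
move=> w /imsetP[i _ ->]; rewrite inE.
case Ei: (i : nat) => [|k]; first by rewrite /F Ei.
by rewrite /tadj; apply/orP; left; apply/is_childP; exists k.+1; exact: FE.
Qed.

End tree_automorphisms.

(** * Embedded balls *)

Lemma sum_sqr_dev (R : realType) (I : finType) (Q : I -> R) (m T : R) :
  #|I|%:R = T -> \sum_i Q i = m * T ->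
  \sum_i (Q i - m) ^+ 2 = \sum_i Q i ^+ 2 - T * m ^+ 2.
Proof.
move=> cI sQ; transitivity (\sum_i (Q i ^+ 2 + (- (2 * m) * Q i + m ^+ 2))).
  by apply: eq_bigr => i _; rewrite !expr2; lra.
rewrite big_split /= big_split /= -mulr_sumr sumr_const -[_ *+ #|_|]mulr_natl cI sQ.
by move: (\sum_i _) => s; rewrite !expr2; lra.
Qed.

Lemma leq_expW m n k : (m <= n)%N -> (m ^ k <= n ^ k)%N.
Proof. by move=> mn; case: k => // k; rewrite leq_exp2r. Qed.

(** The permutation is corrected at one point at a time by a transposition. *)
Lemma perm_extend (S V : finType) (b b' : S -> V) : injective b -> injective b' ->
  exists psi : {perm V}, forall u, psi (b u) = b' u.
Proof.
move=> bi bi'; suff h (s : seq S) : exists psi : {perm V}, {in s, forall u, psi (b u) = b' u}.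
  by have [psi psiP] := h (enum S); exists psi => u; apply: psiP; rewrite mem_enum.
elim: s => [|u s [psi IH]]; first by exists 1%g.
have [us|us] := boolP (u \in s).
  by exists psi => w; rewrite inE => /orP[/eqP ->|]; exact: IH.
exists (psi * tperm (psi (b u)) (b' u))%g => w; rewrite inE permM => /orP[/eqP ->|ws].
  by rewrite tpermL.
rewrite (IH _ ws); apply: tpermD; last by rewrite (inj_eq bi'); apply: contraNneq us => ->.
by rewrite -(IH _ ws) (inj_eq perm_inj) (inj_eq bi); apply: contraNneq us => ->.
Qed.

(* Resampling the coordinates outside [D] decouples events determined by
   complementary sets of coordinates. *)
Lemma card_ffun_indep (V P : finType) (D : {set V}) (A B : pred {ffun V -> P}) :
  (forall tau tau' : {ffun V -> P}, {in D, tau =1 tau'} -> A tau = A tau') ->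
  (forall tau tau' : {ffun V -> P}, {in ~: D, tau =1 tau'} -> B tau = B tau') ->
  (#|[set tau | A tau && B tau]| * #|{: {ffun V -> P}}| =
   #|[set tau | A tau]| * #|[set tau | B tau]|)%N.
Proof.
move=> hA hB; pose mix (tau tau' : {ffun V -> P}) := [ffun v => if v \in D then tau v else tau' v].
pose F (z : {ffun V -> P} * {ffun V -> P}) := (mix z.1 z.2, mix z.2 z.1).
have FK : involutive F.
  by move=> [x y]; congr pair; apply/ffunP => v; rewrite !ffunE /=; case: ifP => // ->.
rewrite -cardsT -!cardsX -(card_imset _ (inv_inj FK)); apply: eq_card => -[x y].
rewrite -[(x, y)]FK (mem_imset _ _ (inv_inj FK)) !inE /= andbT.
have Fx (x' y' : {ffun V -> P}) : mix (mix x' y') (mix y' x') = x'.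
  by have := FK (x', y') => -[].
rewrite !Fx (hA (mix x y) x) ?(hB (mix x y) y)// => v; rewrite ?inE !ffunE; first by move=> /negbTE ->.
by move=> ->.
Qed.

Section graph_balls.
Variables (V : finType) (e : rel V) (D : nat).
Hypothesis esym : symmetric e.
Hypothesis edeg : forall v, (#|[set w | e v w]| <= D)%N.

Fixpoint gball (k : nat) (v : V) : {set V} :=
  if k is k'.+1 then \bigcup_(w in gball k' v) (w |: [set x | e w x]) else [set v].

Lemma card_gball k v : (#|gball k v| <= D.+1 ^ k)%N.
Proof.
elim: k => [|k IH] /=; first by rewrite cards1.
apply: (@leq_trans (\sum_(w in gball k v) D.+1)); last first.
  by rewrite sum_nat_const expnSr leq_mul2r IH orbT.
elim/big_rec2: _ => [|w m A _ mA]; first by rewrite cards0.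
apply: leq_trans (leq_card_setU _ _) _; apply: leq_add mA.
by apply: leq_trans (leq_card_setU _ _) _; rewrite cards1 add1n ltnS.
Qed.

Lemma gball_self k v : v \in gball k v.
Proof.
elim: k => [|k IH] /=; first by rewrite inE.
by apply/bigcupP; exists v => //; rewrite !inE eqxx.
Qed.

Lemma gball_step k v w x : w \in gball k v -> e w x -> x \in gball k.+1 v.
Proof. by move=> wv wx /=; apply/bigcupP; exists w; rewrite ?inE ?wx ?orbT. Qed.

Lemma gballS k v w : w \in gball k v -> w \in gball k.+1 v.
Proof. by move=> wv /=; apply/bigcupP; exists w; rewrite ?inE ?eqxx. Qed.

Lemma gballW j k v w : (j <= k)%N -> w \in gball j v -> w \in gball k v.
Proof. by move=> /subnK <-; elim: (k - j)%N => //= m IH /IH /gballS. Qed.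

Lemma gball_trans j k v w x : w \in gball j v -> x \in gball k w -> x \in gball (j + k) v.
Proof.
move=> wv; elim: k x => [|k IH] x /=; first by rewrite inE addn0 => /eqP ->.
move=> /bigcupP[y /IH yv]; rewrite !inE addnS => /orP[/eqP ->|]; first exact: gballS.
exact: gball_step.
Qed.

Lemma gball_sym k v w : w \in gball k v -> v \in gball k w.
Proof.
elim: k w => [|k IH] w /=; first by rewrite !inE eq_sym.
move=> /bigcupP[y /IH vy]; rewrite !inE => /orP[/eqP ->|yw]; first exact: gballS.
rewrite -/gball -/(gball k.+1 w) -[k.+1]add1n; apply: gball_trans vy.
by apply: (@gball_step 0 w w); rewrite ?inE// esym.
Qed.

End graph_balls.

Section embeddings.
Variables (d : nat) (t n : nat).
Hypothesis d3 : (3 <= d)%N.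
Local Notation S := (S_ball d t).
Local Notation V := 'I_n.+1.
Implicit Types (E : graph n) (b : {ffun S -> V}) (tau : {ffun V -> {perm V}}).

(** Induced copies of the ball of the tree. The set is locked so that [inE] does not expand it;
    [embeddingsP] does. *)
Definition embeddings E : {set {ffun S -> V}} :=
  locked [set b : {ffun S -> V} | injectiveb b &&
    [forall u : S, forall w : S, gadj E (b u) (b w) == tadj (val u) (val w)]].

Lemma embeddingsP E b : reflect (injective b /\
  forall u w : S, gadj E (b u) (b w) = tadj (val u) (val w)) (b \in embeddings E).
Proof.
rewrite /embeddings -lock inE; apply: (iffP andP) => -[/injectiveP h1 h2]; split=> //.
  by move=> u w; apply/eqP; move/forallP: h2 => /(_ u)/forallP/(_ w).
by apply/forallP => u; apply/forallP => w; rewrite h2.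
Qed.

Definition rank_lt (tau : {ffun V -> {perm V}}) (v w w' : V) : bool :=
  (enum_rank (tau v w) < enum_rank (tau v w'))%N.

(** Says that the search driven by [tau] numbers siblings as in the tree, so that it gives [b u] the
    label [u] ([bfs_label_increasing] and its converse). *)
Definition increasing b tau : bool :=
  [forall u : S, forall w : S, forall w' : S,
    [&& is_child (val u) (val w), is_child (val u) (val w') &
        (last 0 (tree_val (val w)) < last 0 (tree_val (val w')))%N] ==>
    rank_lt tau (b u) (b w) (b w')].

Lemma increasingP b tau : reflect (forall u w w' : S,
    is_child (val u) (val w) -> is_child (val u) (val w') ->
    (last 0 (tree_val (val w)) < last 0 (tree_val (val w')))%N ->
    rank_lt tau (b u) (b w) (b w')) (increasing b tau).
Proof.
apply: (iffP forallP) => [h u w w' h1 h2 h3|h u].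
  by have /forallP/(_ w)/forallP/(_ w')/implyP := h u; apply; rewrite h1 h2 h3.
apply/forallP => w; apply/forallP => w'; apply/implyP => /and3P[]; exact: h.
Qed.

Lemma increasing_local b tau tau' : {in [set b u | u : S], tau =1 tau'} ->
  increasing b tau = increasing b tau'.
Proof.
move=> h; apply: eq_forallb => u; apply: eq_forallb => w; apply: eq_forallb => w'.
by rewrite /rank_lt h//; apply: imset_f.
Qed.

(** By symmetry: a permutation of the vertices that carries [b] to [b'] acts on the orders and
    exchanges the two conditions. *)
Lemma card_increasing b b' : injective b -> injective b' ->
  #|[set tau | increasing b tau]| = #|[set tau | increasing b' tau]|.
Proof.
move=> bi bi'; have [psi psiE] := perm_extend bi bi'.
pose F (tau : {ffun V -> {perm V}}) : {ffun V -> {perm V}} :=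
  [ffun v => (psi^-1 * tau (psi^-1 v))%g].
pose G (tau : {ffun V -> {perm V}}) : {ffun V -> {perm V}} :=
  [ffun v => (psi * tau (psi v))%g].
have FK : cancel F G.
  by move=> tau; apply/ffunP => v; rewrite !ffunE permK mulgA mulgV mul1g.
rewrite -(card_imset _ (can_inj FK)); apply: eq_card => tau.
have GK : F (G tau) = tau.
  by apply/ffunP => v; rewrite !ffunE permKV mulgA mulVg mul1g.
rewrite -{1}GK (mem_imset _ _ (can_inj FK)) !inE.
apply: eq_forallb => u; apply: eq_forallb => w; apply: eq_forallb => w'.
by rewrite /rank_lt !ffunE !permM !psiE.
Qed.

Section bounded_degree.
Variable E : graph n.
Hypothesis degE : forall v, (#|[set w | gadj E v w]| <= d)%N.

Lemma embedding_nbrs b (u : S) x : b \in embeddings E -> (size (val u) < t)%N ->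
  gadj E (b u) x -> exists2 w : S, tadj (val u) (val w) & x = b w.
Proof.
move=> /embeddingsP[bi badj] ut ux.
have : [set b w | w in [set w : S | tadj (val u) (val w)]] == [set w | gadj E (b u) w].
  rewrite eqEcard; apply/andP; split.
    by apply/fintype.subsetP => y /imsetP[w]; rewrite !inE => uw ->; rewrite badj.
  by rewrite card_imset//; apply: leq_trans (degE _) _; exact: card_tree_nbrs.
move=> /eqP/setP/(_ x); rewrite [in RHS]inE ux => /imsetP[w]; rewrite inE => uw ->.
by exists w.
Qed.

Lemma root_in_S : root d \in S.
Proof. by rewrite in_S_ball. Qed.

Definition rootS : S := [` root_in_S]%fset.

Lemma S_ind (P : S -> Prop) : P rootS ->
  (forall u w : S, is_child (val u) (val w) -> P u -> P w) -> forall u, P u.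
Proof.
move=> P0 Pc u; move: {2}(size (val u)) (leqnn (size (val u))) => k.
elim: k u => [|k IH] u uk.
  have -> // : u = rootS.
  by apply: val_inj; apply: tree_inj; apply/size0nil/eqP; rewrite -leqn0.
have [u0|/eqP unz] := eqVneq (tree_val (val u)) [::].
  by have -> // : u = rootS; apply: val_inj; apply: tree_inj; rewrite u0.
have pS : parent (val u) \in S.
  rewrite in_S_ball//; have := parent_size unz; have := valP u.
  by rewrite /= in_S_ball// => + e; rewrite e; exact: ltnW.
apply: (Pc [` pS]%fset); first exact: is_child_parent.
by apply: IH; rewrite /= -ltnS -parent_size.
Qed.

Lemma embedding_gball b (u : S) : b \in embeddings E -> b u \in gball (gadj E) t (b rootS).
Proof.
move=> /embeddingsP[bi badj]; have uS := valP u; rewrite /= in_S_ball// in uS.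
apply: gballW uS _; elim/S_ind: u => [|u w uw IH]; first exact: gball_self.
by rewrite (is_child_size uw); apply: gball_step IH _; rewrite badj /tadj uw.
Qed.

Definition emb_bound : nat := ((d.+1 ^ (t + t)) ^ #|{: S}|)%N.

(** All vertices of a copy are within [t] of its center, hence within [t + t] of [v]. *)
Lemma card_embeddings_through v :
  (#|[set b in embeddings E | [exists u : S, b u == v]]| <= emb_bound)%N.
Proof.
apply: (@leq_trans #|[pred b : {ffun S -> V} | b \in ffun_on (gball (gadj E) (t + t) v)]|).
  apply/subset_leq_card/fintype.subsetP => b; rewrite inE => /andP[bE /existsP[u /eqP <-]].
  rewrite inE; apply/ffun_onP => w.
  apply: gball_trans (embedding_gball w bE).
  by apply: gball_sym; [exact: gadj_sym|exact: embedding_gball].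
by rewrite card_ffun_on leq_expW// card_gball.
Qed.


Section profile.
Variables (M : finType) (f : {ffun V -> M}).
Implicit Type x : {ffun S -> M}.

Definition color b : {ffun S -> M} := [ffun u => f (b u)].

(* [tau_count tau x] counts the vertices whose ball of radius t, numbered
   according to [tau], is a copy of the tree with coloring [x]. *)
Definition tau_count tau x : nat :=
  #|[set b in embeddings E | increasing b tau && (color b == x)]|.

Definition ntau : nat := #|{: {ffun V -> {perm V}}}|.

Lemma ntau_gt0 : (0 < ntau)%N.
Proof. by apply/card_gt0P; exists [ffun=> 1%g]. Qed.

Lemma card_embeddings : (#|embeddings E| <= n.+1 * emb_bound)%N.
Proof.
apply: (@leq_trans (\sum_(v : V) #|[set b in embeddings E | [exists u : S, b u == v]]|)).
  rewrite -sum1_card (partition_big (fun b : {ffun S -> V} => b rootS) xpredT)//=.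
  apply: leq_sum => v _; rewrite -sum1_card big_mkcond /= [leqRHS]big_mkcond /=.
  apply: leq_sum => b _; rewrite inE; case: (b \in _) => //=; case: ifP => // bv.
  by case: ifP => // /existsP[]; exists rootS.
apply: (@leq_trans (\sum_(v : V) emb_bound)); last by rewrite sum_nat_const card_ord.
by apply: leq_sum => v _; exact: card_embeddings_through.
Qed.

Definition meets b b' : bool := [exists u : S, exists w : S, b u == b' w].

Definition meet_bound : nat := (emb_bound * (#|{: S}| * emb_bound))%N.

Lemma card_meeting_embeddings :
  (#|[set z in finset.setX (embeddings E) (embeddings E) | meets z.1 z.2]| <= n.+1 * meet_bound)%N.
Proof.
rewrite /meet_bound mulnA; apply: (@leq_trans (\sum_(b in embeddings E) (#|{: S}| * emb_bound))); last first.
  by rewrite sum_nat_const leq_mul2r card_embeddings orbT.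
rewrite -sum1_card (partition_big (fun z : {ffun S -> V} * {ffun S -> V} => z.1) (mem (embeddings E)))/=; last first.
  by move=> [b b']; rewrite !inE => /andP[/andP[]].
apply: leq_sum => b bE; rewrite sum1_card.
apply: (@leq_trans #|\bigcup_(u : S) [set b' in embeddings E | [exists w : S, b' w == b u]]|).
  rewrite -(card_in_imset (f := fun z : {ffun S -> V} * {ffun S -> V} => z.2)); last first.
    move=> [b1 b1'] [b2 b2']; rewrite !unfold_in /= => /andP[_ /eqP ->] /andP[_ /eqP ->] /= ->.
    by [].
  apply/subset_leq_card/fintype.subsetP => b'' /imsetP[[b1 b']]; rewrite unfold_in inE /=.
  move=> /andP[/andP[]]; rewrite inE /= => /andP[_ b'E] /existsP[u /existsP[w /eqP bw]] /eqP b1b -> /=.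
  apply/bigcupP; exists u => //; rewrite inE b'E; apply/existsP; exists w.
  by rewrite -b1b bw.
rewrite -sum_nat_const.
elim/big_rec2: _ => [|u m A _ mA]; first by rewrite cards0.
apply: leq_trans (leq_card_setU _ _) _; apply: leq_add mA.
exact: card_embeddings_through.
Qed.

Lemma increasing_indep b b' : ~~ meets b b' ->
  (#|[set tau | increasing b tau && increasing b' tau]| * ntau =
   #|[set tau | increasing b tau]| * #|[set tau | increasing b' tau]|)%N.
Proof.
move=> nm; apply: (@card_ffun_indep _ _ [set b u | u : S] (increasing b) (increasing b')).
  by move=> tau tau' h; exact: increasing_local.
move=> tau tau' h; apply: increasing_local => v /imsetP[u _ ->]; apply: h.
rewrite inE; apply: contra nm => /imsetP[w _ e]; apply/existsP; exists w.
by apply/existsP; exists u; rewrite e.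
Qed.

(** The mass that [distr] gives to the balls that are copies of the tree colored by [x]
    ([distr_copies]). The total over [x] can be less than 1. *)
Definition profile (R : realType) x : R :=
  (\sum_tau tau_count tau x)%:R / (ntau * n.+1)%:R.

Lemma sum_tau_count x : (\sum_tau tau_count tau x =
  \sum_(b in embeddings E | color b == x) #|[set tau | increasing b tau]|)%N.
Proof.
under eq_bigr do rewrite /tau_count -sum1_card big_mkcond /=.
rewrite exchange_big /= [RHS]big_mkcond /=; apply: eq_bigr => b _.
case: ifP => [/andP[bE bx]|nb].
  rewrite -sum1_card [RHS]big_mkcond /=; apply: eq_bigr => tau _.
  by rewrite !inE bE bx andbT.
by apply: big1 => tau _; rewrite inE andbCA nb andbF.
Qed.

(** Disjoint embeddings are increasing independently of each other, and only O(n) pairs of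
    embeddings meet. *)
Lemma tau_count_variance x :
  (ntau * (\sum_tau tau_count tau x ^ 2) <=
   (\sum_tau tau_count tau x) ^ 2 + ntau ^ 2 * (n.+1 * meet_bound))%N.
Proof.
pose F := [set b in embeddings E | color b == x].
pose c2 b b' := #|[set tau | increasing b tau && increasing b' tau]|.
pose c1 b := #|[set tau | increasing b tau]|.
have e1 : (\sum_tau tau_count tau x ^ 2 = \sum_(b in F) \sum_(b' in F) c2 b b')%N.
  transitivity (\sum_tau \sum_(b in F) \sum_(b' in F) (increasing b tau && increasing b' tau))%N.
    apply: eq_bigr => tau _.
    have -> : tau_count tau x = (\sum_(b in F) increasing b tau)%N.
      rewrite /tau_count -sum1_card big_mkcond [RHS]big_mkcond /=; apply: eq_bigr => b _.
      by rewrite /F !inE; case: (b \in _); case: increasing; case: eqP.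
    rewrite -mulnn big_distrl /=; apply: eq_bigr => b _; rewrite big_distrr /=.
    by apply: eq_bigr => b' _; rewrite mulnb.
  rewrite exchange_big /=; apply: eq_bigr => b _; rewrite exchange_big /=.
  apply: eq_bigr => b' _; rewrite /c2 -sum1_card [RHS]big_mkcond /=.
  by apply: eq_bigr => tau _; rewrite inE; case: (_ && _).
have e2 : ((\sum_tau tau_count tau x) ^ 2 = \sum_(b in F) \sum_(b' in F) c1 b * c1 b')%N.
  rewrite sum_tau_count -mulnn (eq_bigl (mem F)) => [|b]; last by rewrite !inE.
  by rewrite big_distrl /=; apply: eq_bigr => b _; rewrite big_distrr.
rewrite e1 e2 big_distrr /=.
pose K := [set z in finset.setX (embeddings E) (embeddings E) | meets z.1 z.2].
apply: (@leq_trans (\sum_(b in F) \sum_(b' in F) (c1 b * c1 b' + ntau ^ 2 * (meets b b')))%N).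
  apply: leq_sum => b bF; rewrite big_distrr /=; apply: leq_sum => b' b'F.
  case: (boolP (meets b b')) => [_|nm].
    by rewrite muln1 -mulnn mulnC; apply: (@leq_trans (ntau * ntau)); rewrite ?leq_addl// leq_mul2r max_card orbT.
  by rewrite muln0 addn0 mulnC increasing_indep.
under eq_bigr do rewrite big_split /=.
rewrite big_split /= leq_add2l.
under eq_bigr do rewrite -big_distrr /=.
rewrite -big_distrr /= leq_mul2l; apply/orP; right.
apply: leq_trans card_meeting_embeddings.
rewrite -sum1_card pair_big /= big_mkcond /= [leqRHS]big_mkcond /=; apply: leq_sum => -[b b'] _ /=.
rewrite !inE /=; case: (b \in embeddings E); case: (b' \in embeddings E); rewrite ?andbF//=.
by case: (meets b b'); case: (_ && _).
Qed.

(** Chebyshev's inequality: for most orders, the count given by a single order is close to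
    [profile]. *)
Lemma card_tau_far (R : realType) x (eps : R) : 0 < eps ->
  #|[set tau | eps < `|(tau_count tau x)%:R / n.+1%:R - profile R x|]|%:R <=
    ntau%:R * (meet_bound%:R / (eps ^+ 2 * n.+1%:R)).
Proof.
have alg (a b c : R) : (a * b) ^+ 2 + b ^+ 2 * c = b * (b * a ^+ 2) + b * (b * c).
  by rewrite !expr2; lra.
move=> e0; set A := [set tau | _].
pose N : R := n.+1%:R; pose T : R := ntau%:R.
have N0 : 0 < N by rewrite ltr0n.
have T0 : 0 < T by rewrite ltr0n ntau_gt0.
pose Q tau : R := (tau_count tau x)%:R.
pose m : R := (\sum_tau Q tau) / T.
have pm : profile R x * N = m.
  by rewrite /profile /m natr_sum natrM -/N -/T invfM mulrA mulfVK ?gt_eqF.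
have var : \sum_tau (Q tau - m) ^+ 2 <= T * (N * meet_bound%:R).
  have sQ : \sum_tau Q tau = m * T by rewrite /m mulfVK// gt_eqF.
  rewrite (sum_sqr_dev (T := T) _ sQ)//.
  have := tau_count_variance x; move: meet_bound => mb.
  rewrite -(ler_nat R) natrD natrX [(ntau * _)%:R]natrM [(ntau ^ 2 * _)%:R]natrM.
  rewrite [(n.+1 * _)%:R]natrM [(ntau ^ 2)%:R]natrX !natr_sum -/T -/N.
  under eq_bigr do rewrite natrX -/(Q _).
  rewrite [\sum_tau (tau_count tau x)%:R]sQ => h.
  rewrite -(ler_pM2l T0) mulrBr lerBlDl; apply: le_trans h _.
  by rewrite alg.
have hA : #|A|%:R * (eps * N) ^+ 2 <= \sum_tau (Q tau - m) ^+ 2.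
  rewrite mulr_natl -sumr_const big_mkcond /=; apply: ler_sum => tau _.
  case: ifP => [|_]; last exact: sqr_ge0.
  rewrite inE => lt; rewrite -[leRHS](real_normK (num_real _)) ler_sqr ?nnegrE ?mulr_ge0 ?(ltW e0) ?(ltW N0)//.
  have -> : Q tau - m = (Q tau / N - profile R x) * N.
    by rewrite mulrBl mulfVK ?gt_eqF// pm.
  by rewrite normrM (gtr0_norm N0) ler_pM2r// ltW.
have := le_trans hA var.
rewrite -ler_pdivlMr ?exprn_gt0 ?mulr_gt0// => /le_trans; apply.
rewrite exprMn -!mulrA ler_pM2l// mulrCA ler_wpM2l//.
have -> : eps * (eps * N ^+ 2) = eps * (eps * N) * N by rewrite expr2 !mulrA.
by rewrite invfM mulrCA mulfV ?mulr1// gt_eqF.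
Qed.

End profile.

End bounded_degree.

End embeddings.
Arguments embeddings {d t n} E.

(** Averaging over all orders forgets the labels of siblings: [b] and its composition with [phi] are
    increasing for equally many orders. *)
Lemma profile_aut (R : realType) d t n (d3 : (3 <= d)%N) (E : graph n) (M : finType)
    (f : {ffun 'I_n.+1 -> M}) (phi : {perm S_ball d t}) (x : {ffun S_ball d t -> M}) :
  ball_aut phi -> profile E f R [ffun u => x (phi u)] = profile E f R x.
Proof.
move=> phiP; rewrite /profile; congr (_%:R / _).
pose h (b : {ffun S_ball d t -> 'I_n.+1}) : {ffun S_ball d t -> 'I_n.+1} := [ffun u => b (phi u)].
have hinj : injective h.
  move=> b b' /ffunP e; apply/ffunP => u.
  by have := e (phi^-1%g u); rewrite !ffunE permKV.
rewrite !sum_tau_count (reindex_inj hinj) /=.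
apply: eq_big => [b|b /andP[bE _]].
  congr andb.
    apply/embeddingsP/embeddingsP => -[bi badj]; split=> u w.
    - move=> buw; apply: (@perm_inj _ phi^-1%g); apply: bi; rewrite !ffunE !permKV.
      by [].
    - by have := badj (phi^-1%g u) (phi^-1%g w); rewrite !ffunE -phiP !permKV.
    - by rewrite !ffunE => /bi /perm_inj.
    - by rewrite !ffunE badj phiP.
  apply/eqP/eqP => [e|<-]; last by apply/ffunP => u; rewrite !ffunE.
  by apply/ffunP => u; have := congr1 (fun g : {ffun _} => g (phi^-1%g u)) e; rewrite !ffunE permKV.
move: bE => /embeddingsP[bi _]; apply: card_increasing => // u w e.
apply: (@perm_inj _ phi^-1%g); apply: bi; rewrite !ffunE !permKV.
by [].
Qed.

(** * Breadth-first search *)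

Section breadth_first.
Variables (d t n : nat).
Hypothesis d3 : (3 <= d)%N.
Local Notation S := (S_ball d t).
Local Notation V := 'I_n.+1.
Variable E : graph n.
Hypothesis degE : forall v, (#|[set w | gadj E v w]| <= d)%N.
Variables (v : V) (tau : {ffun V -> {perm V}}).

Local Notation upto k := (bfs_upto (gadj E) v tau k).

Lemma bfs_upto_mono j k w s : (j <= k)%N -> upto j w = Some s -> upto k w = Some s.
Proof. by move=> /subnK <- h; elim: (k - j)%N => //= m ->. Qed.

Lemma shortlex_refl s : shortlex s s.
Proof. by have := shortlex_total s s; rewrite orbb. Qed.

Section labels.
Variable b : {ffun S -> V}.
Hypothesis bE : b \in embeddings E.
Hypothesis bv : b (rootS t d3) = v.

Let bi : injective b. Proof. by case/embeddingsP: bE. Qed.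
Let badj (u w : S) : gadj E (b u) (b w) = tadj (val u) (val w).
Proof. by case/embeddingsP: bE. Qed.

Definition bfs_domain k := forall w,
  (upto k w != None) = [exists u : S, (size (val u) <= k)%N && (b u == w)].

Let dom_b k (u : S) : bfs_domain k -> (upto k (b u) != None) = (size (val u) <= k)%N.
Proof.
move=> ->; apply/existsP/idP => [[u' /andP[uk /eqP /bi <-]]//|uk].
by exists u; rewrite uk eqxx.
Qed.

Let dom_parent k (u c : S) : bfs_domain k -> size (val u) = k -> is_child (val u) (val c) ->
  bfs_parent (gadj E) (upto k) (b c) = Some (b u).
Proof.
move=> dom uk uc.
have only x : gadj E x (b c) -> upto k x != None -> x = b u.
  move=> + xk; move: xk; rewrite dom => /existsP[u' /andP[u'k /eqP <-]].
  rewrite badj => /orP[/is_child_inj h|/is_child_size]; last by rewrite (is_child_size uc) uk; lia.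
  by congr (b _); apply: val_inj; exact: h uc.
rewrite /bfs_parent; case: pickP => [x /andP[/andP[xc xk] _]|/(_ (b u))]; first by rewrite (only x).
rewrite badj /tadj uc dom_b// uk leqnn /= => /negbT/forallPn[x].
rewrite negb_imply => /andP[/andP[xc xk]]; rewrite (only x)//.
by rewrite shortlex_refl.
Qed.

(** Rounds of the search and levels of the copy coincide, since a new vertex is a neighbor of an
    interior vertex of the copy. *)
Lemma bfs_domainP k : (k <= t)%N -> bfs_domain k.
Proof.
elim: k => [|k IH] kt w.
  rewrite [upto 0 w]/=; have [->|/eqP wv] := eqVneq w v.
    by symmetry; apply/existsP; exists (rootS t d3); rewrite bv eqxx.
  symmetry; apply/negbTE/existsPn => u; apply/negP => /andP[].
  rewrite leqn0 => /eqP/size0nil u0 /eqP bw; apply: wv; rewrite -bw -bv.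
  by congr (b _); apply: val_inj; apply: tree_inj.
have dom := IH (ltnW kt); rewrite /=.
case wk : (upto k w) => [s|].
  have : upto k w != None by rewrite wk.
  rewrite dom => /existsP[u /andP[uk bu]]; symmetry; apply/existsP; exists u.
  by rewrite (leq_trans uk).
have wN : ~~ [exists u : S, (size (val u) <= k)%N && (b u == w)] by rewrite -dom wk.
apply/idP/existsP => [|[u /andP[]]].
  rewrite /bfs_parent; case: pickP => // x /andP[/andP[xw]]; rewrite dom => /existsP[u /andP[uk /eqP ux]] _ _.
  have [|w' uw' e] := embedding_nbrs d3 degE bE (leq_ltn_trans uk kt) (x := w); first by rewrite ux.
  exists w'; rewrite e eqxx andbT; move: uk; case/orP: uw' => /is_child_size /=; lia.
rewrite leq_eqVlt ltnS => /orP[/eqP uk /eqP bw|uk bw]; last first.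
  by case/negP: wN; apply/existsP; exists u; rewrite uk.
have unz : tree_val (val u) <> [::] by move=> u0; move: uk; rewrite u0.
have pS : parent (val u) \in S.
  by rewrite in_S_ball//; move: (parent_size unz) uk kt => /=; lia.
pose p : S := [` pS]%fset; have pu : is_child (val p) (val u) by exact: is_child_parent.
have pk : size (val p) = k by have := is_child_size pu; rewrite uk => -[].
rewrite -bw (dom_parent dom pk pu); have : upto k (b p) != None by rewrite dom_b// pk.
by case: (upto k (b p)).
Qed.

Definition children_upto (u c : S) : {set S} :=
  [set c' : S | is_child (val u) (val c') &&
    (enum_rank (tau (b u) (b c')) <= enum_rank (tau (b u) (b c)))%N].

Lemma bfs_label_child (u c : S) : is_child (val u) (val c) ->
  upto (size (val c)) (b c) =
  omap (fun s => rcons s #|children_upto u c|) (upto (size (val u)) (b u)).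
Proof.
move=> uc; have ct : (size (val c) <= t)%N by have := valP c; rewrite /= in_S_ball.
move: ct; rewrite (is_child_size uc); set k := size (val u) => kt.
have dom := bfs_domainP (ltnW kt); rewrite /=.
have -> : upto k (b c) = None.
  by apply/eqP; rewrite -[_ == _]negbK dom_b// (is_child_size uc) ltnn.
rewrite (dom_parent dom _ uc)//.
suff -> : bfs_sibling_rank (gadj E) tau (upto k) (b u) (b c) = #|children_upto u c| by [].
rewrite /bfs_sibling_rank -(card_imset _ bi); apply: eq_card => w; rewrite inE.
apply/and3P/imsetP => [[/eqP wN /eqP pw rk]|[c']].
  have : gadj E (b u) w && (upto k (b u) != None).
    by move: pw; rewrite /bfs_parent; case: pickP => // x /andP[+ _] [<-].
  move=> /andP[uw _]; have [w' uw' e] := embedding_nbrs d3 degE bE kt uw.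
  exists w' => //; rewrite inE -e rk andbT; case/orP: uw' => // /is_child_size h.
  have : upto k w != None by rewrite e dom_b// -ltnS -h leqW.
  by rewrite wN.
rewrite inE => /andP[uc' rk] ->; rewrite rk (dom_parent dom _ uc')// eqxx; split => //.
by rewrite -[_ == _]negbK dom_b// (is_child_size uc') ltnn.
Qed.

(** Children are numbered from 1 without gap, so the last letter of a child is its rank among its
    siblings, which is what the search computes. *)
Lemma card_siblings_le (u c : S) : is_child (val u) (val c) ->
  #|[set c' : S | is_child (val u) (val c') && (last 0 (tree_val (val c')) <= last 0 (tree_val (val c)))%N]|
  = last 0 (tree_val (val c)).
Proof.
move=> uc; have /is_childP[j cj] := uc; rewrite cj last_rcons.
have cl := tree_valP (val c); rewrite cj tree_label_rcons in cl.
have ct : (size (val c) <= t)%N by have := valP c; rewrite /= in_S_ball.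
have lab (i : 'I_j) : tree_label d (rcons (val u) i.+1).
  rewrite tree_label_rcons; have := ltn_ord i; move: cl => /andP[->].
  by case: (tree_val (val u)) => [|? ?] /=; lia.
have inS (i : 'I_j) : mkT d (rcons (val u) i.+1) \in S.
  by rewrite in_S_ball// mkTK// size_rcons -(is_child_size uc).
pose F i : S := [` inS i]%fset.
have FE i : tree_val (val (F i)) = rcons (val u) i.+1 by rewrite /F /= mkTK.
have Finj : injective F.
  move=> i i' /(congr1 (fun w : S => tree_val (val w))); rewrite !FE => /eqP.
  by rewrite eqseq_rcons => /andP[_ /eqP[]] /ord_inj.
rewrite -[RHS]card_ord -(card_imset _ Finj); apply: eq_card => c'; rewrite inE.
apply/andP/imsetP => [[/is_childP[i ci]]|[i _ ->]]; last first.
  by rewrite {2}FE last_rcons; split => //; apply/is_childP; exists i.+1; rewrite FE.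
rewrite ci last_rcons => ij; have := tree_valP (val c'); rewrite ci tree_label_rcons.
move=> /andP[_ ipos]; have i0 : (0 < i)%N by case: (tree_val (val u)) ipos => [|? ?] /andP[].
have ij' : (i.-1 < j)%N by rewrite prednK.
exists (Ordinal ij') => //; apply: val_inj; apply: tree_inj.
by rewrite FE /= prednK.
Qed.

Lemma bfs_label_increasing : increasing b tau ->
  forall u : S, upto (size (val u)) (b u) = Some (tree_val (val u)).
Proof.
move=> /increasingP inc; apply: (@S_ind d t d3) => [|u c uc IH].
  by rewrite bv /= eqxx.
rewrite (bfs_label_child uc) IH /=; have /is_childP[j cj] := uc.
rewrite cj; congr (Some (rcons _ _)).
have <- : last 0 (tree_val (val c)) = j by rewrite cj last_rcons.
rewrite -(card_siblings_le uc); apply: eq_card => c'; rewrite !inE.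
case uc' : (is_child _ _) => //=; apply/idP/idP; last first.
  rewrite leq_eqVlt => /orP[/eqP e|/(inc _ _ _ uc' uc) /ltnW//].
  suff -> : c' = c by [].
  apply: val_inj; apply: tree_inj; have /is_childP[j' cj'] := uc'.
  by move: e; rewrite cj cj' !last_rcons => ->.
by apply: contraTT; rewrite -!ltnNge => /(inc _ _ _ uc uc').
Qed.

Lemma increasing_bfs_label :
  (forall u : S, upto t (b u) = Some (tree_val (val u))) -> increasing b tau.
Proof.
move=> lab; have lab' (u : S) : upto (size (val u)) (b u) = Some (tree_val (val u)).
  have ut : (size (val u) <= t)%N by have := valP u; rewrite /= in_S_ball.
  have := dom_b u (bfs_domainP ut); rewrite leqnn.
  case e : (upto _ _) => [s|]// _.
  by have := bfs_upto_mono ut e; rewrite lab => -[->].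
have rk (u c : S) : is_child (val u) (val c) -> last 0 (tree_val (val c)) = #|children_upto u c|.
  by move=> uc; have := bfs_label_child uc; rewrite !lab' => -[->]; rewrite last_rcons.
apply/increasingP => u w w' uw uw'; rewrite (rk _ _ uw) (rk _ _ uw').
rewrite /rank_lt !ltnNge; apply: contra => le; apply/subset_leq_card/fintype.subsetP => x.
by rewrite !inE => /andP[-> /leq_trans]; apply.
Qed.

End labels.

(** A search lasts as many rounds as there are vertices; this ensures that it passes through round
    [t]. *)
Lemma card_S_ge (b : {ffun S -> V}) : injective b -> (t <= n.+1)%N.
Proof.
move=> bi; have lab i : tree_label d (nseq i 1%N).
  by case: i => //= i; rewrite all_nseq; lia.
have inS (i : 'I_t) : mkT d (nseq i 1%N) \in S.
  by rewrite in_S_ball// mkTK// size_nseq ltnW.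
have inj : injective (fun i : 'I_t => b [` inS i]%fset).
  move=> i j /bi/(congr1 (fun w : S => size (tree_val (val w)))) /=.
  by rewrite !mkTK// !size_nseq => /ord_inj.
by have := leq_card _ inj; rewrite !card_ord.
Qed.

Lemma bfs_label_upto (b : {ffun S -> V}) w s : injective b ->
  upto t w = Some s -> bfs_label (gadj E) v tau w = Some s.
Proof. by move=> /card_S_ge tn; apply: bfs_upto_mono; rewrite card_ord. Qed.

Section colored.
Variables (M : Type) (f : V -> M) (X : tree d -> M).
Let g := bfs_lgraph (gadj E) v tau f.
Let gP : bfs_labeled g := bfs_lgraph_bfs v tau (@gadj_sym n E) (@gadj_irr n E) f.
Let label_inj := @bfs_label_inj _ (gadj E) v tau.

Let lcolE w s : bfs_label (gadj E) v tau w = Some s -> lcol g s = Some (f w).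
Proof.
move=> ws; rewrite /= ; case: pickP => [w' /eqP w's|/(_ w)]; last by rewrite ws eqxx.
by rewrite (label_inj ws w's).
Qed.

Let ladjE w w' s s' : bfs_label (gadj E) v tau w = Some s ->
  bfs_label (gadj E) v tau w' = Some s' -> ladj g s s' = gadj E w w'.
Proof.
move=> ws w's; apply/existsP/idP => [[x /existsP[y /and3P[/eqP xs /eqP ys]]]|ww'].
  by rewrite -(label_inj ws xs) -(label_inj w's ys).
by exists w; apply/existsP; exists w'; rewrite ws w's !eqxx.
Qed.

Lemma bfs_of_embedding (b : {ffun S -> V}) : b \in embeddings E -> b (rootS t d3) = v ->
  increasing b tau -> (forall u : S, X (val u) = f (b u)) ->
  lrestrict t g = lrestrict t (tree_lgraph X).
Proof.
move=> bE bv inc Xf; have [bi badj] := embeddingsP _ _ bE.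
have lab (u : S) : bfs_label (gadj E) v tau (b u) = Some (tree_val (val u)).
  apply: (bfs_label_upto bi); apply: bfs_upto_mono (bfs_label_increasing bE bv inc u).
  by have := valP u; rewrite /= in_S_ball.
have toS s : (size s <= t)%N -> tree_label d s -> exists u : S, tree_val (val u) = s.
  move=> st sd; have uS : mkT d s \in S by rewrite in_S_ball// mkTK.
  by exists [` uS]%fset; rewrite /= mkTK.
(* No label is foreign to the tree: the parent of the vertex labeled [s] is an interior vertex of
   the copy, whose neighbors are all in the copy. *)
have vert s : (size s <= t)%N -> lvertex g s -> tree_label d s.
  elim/last_ind: s => // s j IH; rewrite size_rcons => st sj.
  have adj := bfs_parent_adj gP sj; have /andP[vs _] := bfs_adj_vertex gP adj.
  have [u us] := toS _ (ltnW st) (IH (ltnW st) vs).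
  move: adj => /existsP[x /existsP[y /and3P[/eqP xs /eqP ys xy]]].
  have xb : x = b u by apply: label_inj xs _; rewrite lab us.
  have ut : (size (val u) < t)%N by rewrite us.
  rewrite xb in xy; have [w _ yw] := embedding_nbrs d3 degE bE ut xy.
  by move: ys; rewrite yw lab => -[<-]; exact: tree_valP.
apply/lrestrict_eqP => //; first exact: tree_lgraph_bfs.
split=> [s st|s s' st s't].
  case: (boolP (tree_label d s)) => sd.
    have [u us] := toS _ st sd; rewrite -us (lcolE (lab u)) -Xf.
    by have := tree_vertex X (tree_val (val u)); rewrite /lvertex /= valK.
  have -> : lcol (tree_lgraph X) s = None.
    by have := tree_vertex X s; rewrite /lvertex (negbTE sd); case: (lcol _ _).
  have : ~~ lvertex g s by apply: contra sd; exact: vert.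
  by rewrite /lvertex; case: (lcol g s).
rewrite tree_ladj; case: (boolP (tree_label d s)) => sd; last first.
  by apply/negbTE; apply: contra sd => /(bfs_adj_vertex gP)/andP[]; move/(vert _ st).
case: (boolP (tree_label d s')) => s'd; last first.
  by apply/negbTE; apply: contra s'd => /(bfs_adj_vertex gP)/andP[_]; move/(vert _ s't).
have [u us] := toS _ st sd; have [w ws] := toS _ s't s'd.
by rewrite -us -ws (ladjE (lab u) (lab w)) badj.
Qed.

Lemma embedding_of_bfs : lrestrict t g = lrestrict t (tree_lgraph X) ->
  exists b : {ffun S -> V}, [/\ b \in embeddings E, b (rootS t d3) = v,
  increasing b tau & forall u : S, X (val u) = f (b u)].
Proof.
move=> /(lrestrict_eqP _ gP (tree_lgraph_bfs X))[hcol hadj].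
pose b : {ffun S -> V} := [ffun u => odflt v [pick w | bfs_label (gadj E) v tau w == Some (tree_val (val u))]].
have st (u : S) : (size (tree_val (val u)) <= t)%N by have := valP u; rewrite /= in_S_ball.
have colu (u : S) : lcol g (tree_val (val u)) = Some (X (val u)).
  by rewrite hcol ?st//= (valK (val u)).
have lab (u : S) : bfs_label (gadj E) v tau (b u) = Some (tree_val (val u)).
  by rewrite ffunE; have := colu u; rewrite /=; case: pickP => [w /eqP|].
have bX (u : S) : X (val u) = f (b u).
  by apply: Some_inj; rewrite -colu (lcolE (lab u)).
have bi : injective b.
  move=> u w uw; apply: val_inj; apply: tree_inj; apply: Some_inj.
  by rewrite -!lab uw.
have bE : b \in embeddings E.
  apply/embeddingsP; split=> // u w.
  by rewrite -(ladjE (lab u) (lab w)) hadj// tree_ladj !tree_valP.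
have bv : b (rootS t d3) = v.
  apply: label_inj (lab _) _ => /=.
  by apply: (@bfs_upto_mono 0) => //=; rewrite eqxx.
exists b; split => //; apply: increasing_bfs_label => // u.
have := bfs_domainP bE bv (leqnn t) (b u).
have -> : [exists u0 : S, (size (val u0) <= t)%N && (b u0 == b u)].
  by apply/existsP; exists u; rewrite st eqxx.
case e : (bfs_upto _ _ _ _ _) => [s|]// _.
by have := bfs_label_upto bi e; rewrite lab => ->.
Qed.

End colored.

Lemma increasing_uniq (b b' : {ffun S -> V}) : b \in embeddings E -> b' \in embeddings E ->
  b (rootS t d3) = v -> b' (rootS t d3) = v -> increasing b tau -> increasing b' tau -> b = b'.
Proof.
move=> bE b'E bv b'v inc inc'; apply/ffunP => u.
have [bi _] := embeddingsP _ _ bE; have [bi' _] := embeddingsP _ _ b'E.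
have ut : (size (tree_val (val u)) <= t)%N by have := valP u; rewrite /= in_S_ball.
apply: (@bfs_label_inj _ (gadj E) v tau).
  apply: (bfs_label_upto bi); apply: bfs_upto_mono (bfs_label_increasing bE bv inc u).
  exact: ut.
apply: (bfs_label_upto bi); apply: bfs_upto_mono (bfs_label_increasing b'E b'v inc' u).
exact: ut.
Qed.

End breadth_first.

Section tau_count_bfs.
Variables (R : realType) (d t n : nat) (M : pointedFinType).
Hypothesis d3 : (3 <= d)%N.
Variable E : graph n.
Hypothesis degE : forall v, (#|[set w | gadj E v w]| <= d)%N.
Variable f : {ffun 'I_n.+1 -> M}.

(** For a given order, a center carries at most one increasing embedding, which is read off the
    labels of the search. *)
Lemma tau_count_bfs (X : tree d -> M) (tau : {ffun 'I_n.+1 -> {perm 'I_n.+1}}) :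
  tau_count E f tau [ffun u : S_ball d t => X (val u)] =
  #|[set v | `[< Defs.restrict t (random_labeling R E f v tau) = Defs.restrict t (tree_rcgraph R X) >]]|.
Proof.
rewrite /tau_count -(card_in_imset (f := fun b : {ffun S_ball d t -> 'I_n.+1} => b (rootS t d3))).
  apply: eq_card => v; rewrite inE; apply/imsetP/asboolP => [[b]|].
    rewrite inE => /and3P[bE inc /eqP bX] bv; apply/restrict_eq.
    apply: (bfs_of_embedding degE bE (esym bv) inc).
    by move=> u; have := congr1 (fun x : {ffun _} => x u) bX; rewrite !ffunE => ->.
  move=> /restrict_eq /(embedding_of_bfs d3 degE)[b [bE bv inc bX]].
  by exists b => //; rewrite inE bE inc; apply/eqP/ffunP => u; rewrite !ffunE bX.
move=> b b'; rewrite !inE => /and3P[bE inc _] /and3P[b'E inc' _] e.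
exact: (increasing_uniq degE bE b'E erefl (esym e) inc inc').
Qed.

Lemma sum_tau_count_le (tau : {ffun 'I_n.+1 -> {perm 'I_n.+1}}) :
  (\sum_x tau_count E f tau (x : {ffun S_ball d t -> M}) <= n.+1)%N.
Proof.
have -> : (\sum_x tau_count E f tau (x : {ffun S_ball d t -> M}) =
   #|[set b in embeddings E | increasing (b : {ffun S_ball d t -> 'I_n.+1}) tau]|)%N.
  rewrite -[RHS]sum1_card (partition_big (color f) xpredT)//=; apply: eq_bigr => x _.
  by rewrite /tau_count -sum1_card; apply: eq_bigl => b; rewrite !inE andbA.
rewrite -(card_in_imset (f := fun b : {ffun S_ball d t -> 'I_n.+1} => b (rootS t d3))).
  by rewrite -[leqRHS]card_ord max_card.
move=> b b'; rewrite !inE => /andP[bE inc] /andP[b'E inc'] e.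
exact: (increasing_uniq degE bE b'E erefl (esym e) inc inc').
Qed.

End tau_count_bfs.

(** * Regular graphs as simple matchings *)

Section half_edges.
Variables (d n : nat).
Hypothesis d3 : (3 <= d)%N.
Local Notation V := 'I_n.+1.
Local Notation H := ('I_n.+1 * 'I_d)%type.
Implicit Types (s : {perm H}) (v w : V) (i j : 'I_d) (h : H).

Definition edges_of s : graph n :=
  [set e : {set V} | (#|e| == 2%N) && [exists h : H, e == [set h.1; (s h).1]%SET]]%SET.

Definition nbr s v i : V := (s (v, i)).1.

Definition simple_matching s : bool :=
  [forall h : H, (s h).1 != h.1] &&
  [forall h : H, forall h' : H, (h.1 == h'.1) && ((s h).1 == (s h').1) ==> (h == h')].

Definition simple_matchings : {set {perm H}} :=
  [set s in matchings finset.setT | simple_matching s].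

Section involution.
Variable s : {perm H}.
Hypothesis sK : forall h, s (s h) = h.

Lemma gadj_edges_of v w :
  gadj (edges_of s) v w = (v != w) && [exists i, nbr s v i == w].
Proof.
rewrite /gadj inE; have [//|vw] /= := eqVneq v w.
rewrite cards2 vw /=; apply/existsP/existsP => [[[a i] /= /eqP e]|[i /eqP <-]]; last first.
  by exists (v, i); rewrite eqxx.
have : v \in [set v; w]%SET by rewrite !inE eqxx.
have : w \in [set v; w]%SET by rewrite !inE eqxx orbT.
rewrite e !inE => /orP[]/eqP we /orP[]/eqP ve.
- by move: vw; rewrite we ve eqxx.
- by exists (s (a, i)).2; rewrite /nbr ve -surjective_pairing sK we.
- by exists i; rewrite /nbr ve we.
- by move: vw; rewrite we ve eqxx.
Qed.

Lemma card_gadj_edges_of v : (#|[set w | gadj (edges_of s) v w]| <= d)%N.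
Proof.
apply: (@leq_trans #|[set nbr s v i | i : 'I_d]|); last first.
  by apply: leq_trans (leq_imset_card _ _) _; rewrite card_ord.
apply/subset_leq_card/fintype.subsetP => w; rewrite inE gadj_edges_of => /andP[_ /existsP[i /eqP <-]].
exact: imset_f.
Qed.

End involution.

Lemma simple_matchingsP s : reflect [/\ forall h, s (s h) = h,
   forall v i, nbr s v i != v & forall v, injective (nbr s v)] (s \in simple_matchings).
Proof.
rewrite inE; apply: (iffP andP) => [[/matchingsP[inv sup] /andP[/forallP h1 /forallP h2]]|[inv h1 h2]].
  split=> // [v i|v i j ij]; first exact: h1 (v, i).
  have /forallP/(_ (v, j))/implyP/= := h2 (v, i); rewrite eqxx /=.
  by move=> /(_ (introT eqP ij))/eqP[].
split.
  apply/matchingsP; split=> // h; rewrite inE; apply/negP => /eqP sh.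
  by have := h1 h.1 h.2; rewrite /nbr -surjective_pairing sh eqxx.
apply/andP; split; apply/forallP => -[v i]; first exact: h1.
apply/forallP => -[w j]; apply/implyP => /= /andP[/eqP <- /eqP e].
by apply/eqP; congr pair; apply: (h2 v).
Qed.

Section simple.
Variable s : {perm H}.
Hypothesis sM : s \in simple_matchings.

Let sK : forall h, s (s h) = h. Proof. by case/simple_matchingsP: sM. Qed.

Lemma gadj_simple v w : gadj (edges_of s) v w = [exists i, nbr s v i == w].
Proof.
rewrite gadj_edges_of//; case: existsP => [[i /eqP <-]|]; last by rewrite andbF.
by case/simple_matchingsP: sM => _ /(_ v i) + _; rewrite eq_sym => ->.
Qed.

Lemma edges_of_regular : edges_of s \in regular_graphs d n.
Proof.
have [_ h1 h2] := simple_matchingsP _ sM; rewrite inE; apply/andP; split.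
  by apply/forall_inP => e; rewrite inE => /andP[].
apply/forallP => v; apply/eqP.
have inj : injective (fun i => [set v; nbr s v i]%SET).
  move=> i j /setP e; apply: (h2 v).
  have := e (nbr s v i); rewrite !inE eqxx orbT => /esym/orP[|/eqP//].
  by rewrite (negbTE (h1 v i)).
rewrite -[RHS]card_ord -(card_imset _ inj); apply: eq_card => e; rewrite inE.
apply/andP/imsetP => [[]|[i _ ->]]; last first.
  rewrite !inE eqxx; split => //; rewrite cards2 [v == nbr s v i]eq_sym (h1 v i) /=.
  by apply/existsP; exists (v, i).
rewrite inE => /andP[_ /existsP[[a i] /= /eqP ->]]; rewrite !inE => /orP[/eqP ->|/eqP ->].
  by exists i.
exists (s (a, i)).2 => //.
by rewrite /nbr -surjective_pairing sK /= finset.setUC.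
Qed.

End simple.

(** Half-edges at each vertex are numbered in the order given by [tau]. A regular graph and an order
    determine exactly one such simple matching ([sorted_by_ex], [sorted_by_uniq]). *)
Definition sorted_by (s : {perm H}) (tau : {ffun V -> {perm V}}) : bool :=
  [forall v : V, forall i : 'I_d, forall j : 'I_d, (i < j)%N ==> rank_lt tau v (nbr s v i) (nbr s v j)].

Lemma sorted_byP s (tau : {ffun V -> {perm V}}) : reflect
  (forall v i j, (i < j)%N -> rank_lt tau v (nbr s v i) (nbr s v j)) (sorted_by s tau).
Proof.
apply: (iffP forallP) => [h v i j|h v].
  by have /forallP/(_ i)/forallP/(_ j)/implyP := h v.
by apply/forallP => i; apply/forallP => j; apply/implyP; exact: h.
Qed.

Lemma sorted_by_lt s tau v i j : sorted_by s tau ->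
  rank_lt tau v (nbr s v i) (nbr s v j) = (i < j)%N.
Proof.
move=> /sorted_byP h; apply/idP/idP => [|/h//].
apply: contraTT; rewrite -leqNgt leq_eqVlt => /orP[/eqP/ord_inj ->|/(h v)].
  by rewrite /rank_lt ltnn.
by rewrite /rank_lt -leqNgt; exact: ltnW.
Qed.

Lemma card_sorted_by s s' : s \in simple_matchings -> s' \in simple_matchings ->
  #|[set tau | sorted_by s tau]| = #|[set tau | sorted_by s' tau]|.
Proof.
move=> /simple_matchingsP[_ _ si] /simple_matchingsP[_ _ si'].
have [psi psiE] := fin_all_exists (fun v => perm_extend (@si v) (@si' v)).
pose F (tau : {ffun V -> {perm V}}) : {ffun V -> {perm V}} := [ffun v => ((psi v)^-1 * tau v)%g].
pose G (tau : {ffun V -> {perm V}}) : {ffun V -> {perm V}} := [ffun v => (psi v * tau v)%g].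
have FK : cancel F G by move=> tau; apply/ffunP => v; rewrite !ffunE mulgA mulgV mul1g.
have GK : cancel G F by move=> tau; apply/ffunP => v; rewrite !ffunE mulgA mulVg mul1g.
rewrite -(card_imset _ (can_inj FK)); apply: eq_card => tau.
rewrite -{1}[tau]GK (mem_imset _ _ (can_inj FK)) !inE.
apply: eq_forallb => v; apply: eq_forallb => i; apply: eq_forallb => j.
by rewrite /rank_lt !ffunE !permM !psiE.
Qed.

Lemma sorted_by_ex E (tau : {ffun V -> {perm V}}) : E \in regular_graphs d n ->
  exists2 s, s \in simple_matchings & (edges_of s == E) && sorted_by s tau.
Proof.
move=> Ereg; have E2 e : e \in E -> #|e| = 2%N.
  by move: Ereg; rewrite inE => /andP[/forall_inP h _] /h/eqP.
have deg v : #|[set w | gadj E v w]| = d.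
  move: Ereg; rewrite inE => /andP[_ /forallP/(_ v)/eqP <-].
  have inj : {in [set w | gadj E v w] &, injective (fun w => [set v; w]%SET)}.
    move=> w w'; rewrite !inE => /andP[vw _] /andP[vw' _] /setP/(_ w).
    by rewrite !inE eqxx orbT [w == v]eq_sym (negbTE vw) /= => /esym/eqP.
  rewrite -(card_in_imset inj); apply: eq_card => e; rewrite inE.
  apply/imsetP/andP => [[w + ->]|[eE ve]].
    by rewrite inE => /andP[vw wE]; rewrite wE !inE eqxx.
  have e2 : #|e| == 2%N by apply/eqP; exact: E2.
  move/cards2P: e2 => [a [b [ab eab]]].
  move: ve eE; rewrite eab !inE => /orP[]/eqP -> eE.
    by exists b; rewrite // inE /gadj ab.
  by exists a; rewrite ?inE /gadj; rewrite finset.setUC// eE eq_sym ab.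
pose le v w w' := (enum_rank (tau v w) <= enum_rank (tau v w'))%N.
pose l v := sort (le v) (enum [set w | gadj E v w]).
have mem_l v w : (w \in l v) = gadj E v w by rewrite mem_sort mem_enum inE.
have size_l v : size (l v) = d by rewrite size_sort -cardE deg.
have uniq_l v : uniq (l v) by rewrite sort_uniq enum_uniq.
have sorted_l v : path.sorted (le v) (l v).
  by apply: sort_sorted => x y; exact: leq_total.
have idx v w : gadj E v w -> (index w (l v) < d)%N by rewrite -mem_l -index_mem size_l.
pose nb v i := nth v (l v) i.
have nbE v (i : 'I_d) : gadj E v (nb v i) by rewrite -mem_l mem_nth// size_l.
(* The i-th half-edge at v leads to the i-th neighbor of v in the order [tau], and arrives there at
   the half-edge whose index is the rank of v. *)
pose g (h : H) : H := (nb h.1 h.2, insubd h.2 (index h.1 (l (nb h.1 h.2)))).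
have g2 h : (g h).2 = index h.1 (l (g h).1) :> nat.
  by rewrite /g /= val_insubd idx// gadj_sym.
have gK : involutive g.
  move=> [v i]; have nv : nb (g (v, i)).1 (g (v, i)).2 = v.
    by rewrite /nb g2 nth_index// mem_l gadj_sym; exact: nbE.
  rewrite [LHS]surjective_pairing; congr pair; first exact: nv.
  apply: ord_inj; rewrite g2 -[(g (g (v, i))).1]/(nb (g (v, i)).1 (g (v, i)).2) nv.
  by rewrite -[(g (v, i)).1]/(nth v (l v) i) index_uniq ?size_l.
pose s : {perm H} := perm (inv_inj gK).
have sE h : s h = g h by rewrite permE.
have nbrE v i : nbr s v i = nb v i by rewrite /nbr sE.
have sM : s \in simple_matchings.
  apply/simple_matchingsP; split=> [h|v i|v i j].
  - by rewrite !sE gK.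
  - by rewrite nbrE; have := nbE v i; rewrite /gadj eq_sym => /andP[].
  - by rewrite !nbrE => /eqP; rewrite nth_uniq ?size_l// => /eqP/ord_inj.
exists s => //; apply/andP; split.
  have adj v w : gadj (edges_of s) v w = gadj E v w.
    rewrite gadj_simple//; apply/existsP/idP => [[i /eqP <-]|vw]; first by rewrite nbrE.
    exists (Ordinal (idx _ _ vw)); rewrite nbrE /nb /= nth_index ?mem_l//.
  apply/eqP/setP => e; apply/idP/idP => eE.
    have /cards2P[a [b [ab eab]]] : #|e| == 2%N by move: eE; rewrite inE => /andP[].
    by have := adj a b; rewrite /gadj ab /= -eab eE => /esym.
  have e2 : #|e| == 2%N by apply/eqP; exact: E2.
  move/cards2P: e2 => [a [b [ab eab]]].
  by have := adj a b; rewrite /gadj ab /= -eab eE.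
apply/sorted_byP => v i j ij; rewrite !nbrE /rank_lt ltn_neqAle; apply/andP; split.
  apply/negP => /eqP/ord_inj/enum_rank_inj/perm_inj/eqP.
  by rewrite nth_uniq ?size_l// ltn_eqF.
have tr : transitive (le v) by move=> x y z; exact: leq_trans.
have rf : reflexive (le v) by move=> x; exact: leqnn.
apply: (sorted_leq_nth tr rf v (sorted_l v)); rewrite ?inE ?size_l//.
exact: ltnW.
Qed.

Lemma sorted_by_uniq s s' (tau : {ffun V -> {perm V}}) :
  s \in simple_matchings -> s' \in simple_matchings ->
  edges_of s = edges_of s' -> sorted_by s tau -> sorted_by s' tau -> s = s'.
Proof.
move=> sM s'M ss' so so'.
have [sK _ si] := simple_matchingsP _ sM; have [s'K _ si'] := simple_matchingsP _ s'M.
have idxE (r : {perm H}) (v : V) (i : 'I_d) : r \in simple_matchings -> sorted_by r tau ->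
    #|[set w | gadj (edges_of r) v w && rank_lt tau v w (nbr r v i)]| = i.
  move=> rM ro; have [_ _ ri] := simple_matchingsP _ rM.
  transitivity #|[set j : 'I_d | (j < i)%N]|.
    rewrite -(card_imset _ (ri v)); apply: eq_card => w; rewrite inE gadj_simple//.
    apply/andP/imsetP => [[/existsP[j /eqP <-]]|[j + ->]].
      by rewrite sorted_by_lt// => ji; exists j => //; rewrite inE.
    by rewrite inE => ji; rewrite sorted_by_lt//; split => //; apply/existsP; exists j.
  rewrite -sum1_card (eq_bigl (fun j : 'I_d => (j < i)%N)) => [|j]; last by rewrite inE.
  by rewrite -(big_ord_widen d (fun=> 1%N) (ltnW (ltn_ord i))) sum1_card card_ord.
have nn v i : nbr s v i = nbr s' v i.
  have : gadj (edges_of s) v (nbr s v i) by rewrite gadj_simple//; apply/existsP; exists i.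
  rewrite ss' gadj_simple// => /existsP[k /eqP e].
  have := idxE s v i sM so; rewrite -e ss' (idxE s' v k s'M so') => /ord_inj ki.
  by rewrite -ki.
apply/permP => -[v i].
have f1 : (s (v, i)).1 = (s' (v, i)).1 by exact: nn.
rewrite [LHS]surjective_pairing [RHS]surjective_pairing f1; congr pair.
apply: (si' (s' (v, i)).1); rewrite -nn -f1 /nbr -surjective_pairing sK f1.
by rewrite -surjective_pairing s'K.
Qed.

(** A pair of a regular graph and an order amounts to a pair of a simple matching and an order that
    sorts it. *)
Lemma sum_graph_tau (T : Type) (idx : T) (op : Monoid.com_law idx) (F : graph n -> {ffun V -> {perm V}} -> T) :
  \big[op/idx]_(E in regular_graphs d n) \big[op/idx]_tau F E tau =
  \big[op/idx]_(s in simple_matchings) \big[op/idx]_(tau | sorted_by s tau) F (edges_of s) tau.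
Proof.
rewrite exchange_big /= [RHS](exchange_big_dep xpredT)//=; apply: eq_bigr => tau _.
rewrite [RHS](partition_big edges_of (mem (regular_graphs d n)))/=; last first.
  by move=> s /andP[sM _]; exact: edges_of_regular.
apply: eq_bigr => E EE; have [s sM /andP[/eqP sE so]] := sorted_by_ex tau EE.
rewrite (big_pred1 s) ?sE// => s'; apply/idP/eqP => [/andP[/andP[s'M s'o] /eqP s'E]|->].
  by apply: (sorted_by_uniq (tau := tau)) => //; rewrite sE.
by rewrite sM so sE eqxx.
Qed.

(** The common number of orders that sort a simple matching, see [card_sorted]; the maximum is 0 if
    there is no simple matching. *)
Definition nsorted : nat := \max_(s in simple_matchings) #|[set tau | sorted_by s tau]|.

Lemma card_sorted s : s \in simple_matchings -> #|[set tau | sorted_by s tau]| = nsorted.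
Proof.
move=> sM; apply/eqP; rewrite eqn_leq; apply/andP; split.
  by rewrite /nsorted (leq_bigmax_cond s).
by apply/bigmax_leqP => s' s'M; rewrite (card_sorted_by sM s'M).
Qed.

(* The uniform simple regular graph is the graph of a uniform simple matching. *)
Lemma sum_regular_graphs (F : graph n -> nat) :
  (ntau n * (\sum_(E in regular_graphs d n) F E) =
   nsorted * (\sum_(s in simple_matchings) F (edges_of s)))%N.
Proof.
have := @sum_graph_tau _ _ addn (fun E _ => F E).
under eq_bigr do rewrite sum_nat_const.
under [RHS]eq_bigr => s sM.
  rewrite sum_nat_const (_ : #|_| = nsorted); last first.
    by rewrite -(card_sorted sM) cardsE.
  over.
by rewrite /= -!big_distrr.
Qed.

End half_edges.

(** * Reading a matching along the words of the tree *)

Section walks.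
Variables (d n : nat).
Hypothesis d3 : (3 <= d)%N.
Local Notation V := 'I_n.+1.
Local Notation H := ('I_n.+1 * 'I_d)%type.
Implicit Types (s : {perm H}) (v w : V) (i j : 'I_d) (h : H) (u : seq nat).

Definition ordd (k : nat) : 'I_d := insubd (Ordinal (ltn_trans (ltn0Sn 1) d3)) k.

Lemma ordd_val k : (k < d)%N -> ordd k = k :> nat.
Proof. by move=> kd; rewrite val_insubd kd. Qed.

Lemma ordd_ord i : ordd i = i.
Proof. by apply: val_inj; rewrite /= ordd_val. Qed.

(* Arriving through the half-edge [h], the k-th child of the current vertex is
   reached through its k-th half-edge other than [h]. *)
Definition wstep s h (k : nat) : H := s (h.1, ordd (bump h.2 k.-1)).

(** Defined for every permutation of the half-edges, whether or not the graph is a tree around [v].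
    Letters start at 1 and half-edges at 0, whence [i.-1]. *)
Definition walk s v u : V :=
  if u is i :: u' then (foldl (wstep s) (s (v, ordd i.-1)) u').1 else v.

(** The rotations put [h] and [s h] in first position, so that [flipw] exchanges the views from both
    ends of their edge; [bump] skips the half-edge of arrival just as [rotl] skips the rotated
    child. *)
Lemma walk_flip s h u : (forall h, s (s h) = h) -> tree_label d u ->
  walk s (s h).1 (rotw (s h).2.+1 u) = walk s h.1 (rotw h.2.+1 (flipw u)).
Proof.
move=> sK; have bumpE (i : 'I_d) k : (0 < k)%N -> (rotl i.+1 k.+1).-1 = bump i k.-1.
  by rewrite /rotl /bump; case: k => // k _; case: ltnP => /=; case: ltnP; lia.
case: h => v i; case e : (s (v, i)) => [w j] /=.
have e' : s (w, j) = (v, i) by rewrite -e sK.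
case: u => [_|k u] /=; first by rewrite /= ordd_ord e.
have [->|k1] := eqVneq k 1%N.
  case: u => [_|k' u] /=; first by rewrite /= ordd_ord e'.
  move=> /and3P[_ /andP[k'0 _] _].
  by rewrite ordd_ord e' /wstep /= bumpE.
move=> /andP[/andP[k0 _] _].
have -> : k = k.-1.+1 by rewrite prednK.
rewrite bumpE; last by lia.
by rewrite /= ordd_ord e /wstep /=.
Qed.

Lemma foldl_rcons_step s h u k : foldl (wstep s) h (rcons u k) = wstep s (foldl (wstep s) h u) k.
Proof. by rewrite -cats1 foldl_cat. Qed.

Section increasing_walk.
Variables (t : nat) (s : {perm H}) (tau : {ffun V -> {perm V}}).
Hypothesis sM : s \in simple_matchings d n.
Hypothesis so : sorted_by s tau.
Variable b : {ffun S_ball d t -> V}.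
Hypothesis bE : b \in embeddings (edges_of s).
Hypothesis binc : increasing b tau.

Let sK : forall h, s (s h) = h. Proof. by case/simple_matchingsP: sM. Qed.
Let si v : injective (nbr s v). Proof. by case/simple_matchingsP: sM. Qed.
Let bi : injective b. Proof. by case/embeddingsP: bE. Qed.
Let badj (u w : S_ball d t) : gadj (edges_of s) (b u) (b w) = tadj (val u) (val w).
Proof. by case/embeddingsP: bE. Qed.

Let nbr_index (u w : S_ball d t) : tadj (val u) (val w) -> exists i, nbr s (b u) i = b w.
Proof. by rewrite -badj gadj_simple// => /existsP[i /eqP]; exists i. Qed.

(** The index of a half-edge is the number of neighbors that come earlier in the order: the
    preceding siblings of [c], and possibly the parent of [u]. *)
Let child_index (u c : S_ball d t) (i : 'I_d) : is_child (val u) (val c) -> nbr s (b u) i = b c ->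
  i = ((last 0 (tree_val (val c))).-1 +
    [exists w : S_ball d t, is_child (val w) (val u) && rank_lt tau (b u) (b w) (b c)])%N :> nat.
Proof.
move=> uc ic; have ut : (size (val u) < t)%N.
  by have := valP c; rewrite /= in_S_ball// (is_child_size uc).
pose A := [set w : S_ball d t | tadj (val u) (val w) && rank_lt tau (b u) (b w) (b c)].
have -> : i = #|A| :> nat.
  transitivity #|[set j : 'I_d | (j < i)%N]|.
    rewrite -sum1_card (eq_bigl (fun j : 'I_d => (j < i)%N)) => [|j]; last by rewrite inE.
    by rewrite -(big_ord_widen d (fun=> 1%N) (ltnW (ltn_ord i))) sum1_card card_ord.
  rewrite -(card_imset _ (@si (b u))) -(card_imset (mem A) bi); apply: eq_card => x.
  apply/imsetP/imsetP => [[j + ->]|[w + ->]]; rewrite inE.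
    move=> ji; have : gadj (edges_of s) (b u) (nbr s (b u) j).
      by rewrite gadj_simple//; apply/existsP; exists j.
    move=> /(embedding_nbrs d3 (card_gadj_edges_of sK) bE ut)[w uw e].
    by exists w => //; rewrite inE uw -e -ic sorted_by_lt.
  move=> /andP[/nbr_index[j jw] +]; rewrite -jw -ic sorted_by_lt// => ji.
  by exists j; rewrite // inE.
have -> : A = [set w in A | is_child (val u) (val w)] :|: [set w in A | is_child (val w) (val u)].
  by apply/setP => w; rewrite !inE -andb_orr /tadj; case: (is_child (val u)); case: is_child; rewrite ?andbT//= andbF.
rewrite cardsU (_ : _ :&: _ = finset.set0) ?cards0 ?subn0; last first.
  apply/setP => w; rewrite !inE; case uw : (is_child (val u) (val w)); last by rewrite andbF.
  by rewrite is_child_asym// andbF andbF.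
congr addn.
  rewrite -(card_siblings_le d3 bE uc) [in RHS](cardsD1 c) !inE uc leqnn /=.
  apply: eq_card => w; rewrite !inE; case uw : (is_child (val u) (val w)); last by rewrite !andbF.
  rewrite /tadj uw /= andbT.
  have lastE (x y : S_ball d t) : is_child (val u) (val x) -> is_child (val u) (val y) ->
     last 0 (tree_val (val x)) = last 0 (tree_val (val y)) -> x = y.
    move=> /is_childP[k xk] /is_childP[l yl]; rewrite xk yl !last_rcons => kl.
    by apply: val_inj; apply: tree_inj; rewrite xk yl kl.
  move/increasingP: binc => inc; apply/idP/andP => [wc|[wc]].
    split; first by apply: contraTneq wc => ->; rewrite /rank_lt ltnn.
    by rewrite leqNgt; apply: contraTN wc => /(inc _ _ _ uc uw); rewrite /rank_lt -leqNgt; exact: ltnW.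
  rewrite leq_eqVlt => /orP[/eqP/(lastE _ _ uw uc) wE|/(inc _ _ _ uw uc)//].
  by rewrite wE eqxx in wc.
case: existsP => [[w /andP[wu wc]]|no]; last first.
  apply/eqP; rewrite cards_eq0; apply/eqP/setP => w; rewrite !inE.
  by apply/negbTE/negP => /andP[/andP[_ wc] wu]; apply: no; exists w; rewrite wu.
apply/eqP/cards1P; exists w; apply/setP => w'; rewrite !inE.
apply/andP/eqP => [[_ w'u]|->]; first by apply: val_inj; exact: is_child_inj w'u wu.
by rewrite /tadj wu orbT wc.
Qed.

Let foldl_walk (u : S_ball d t) (i : nat) u' : tree_val (val u) = i :: u' ->
  let h := foldl (wstep s) (s (b (rootS t d3), ordd i.-1)) u' in
  h.1 = b u /\ forall p : S_ball d t, is_child (val p) (val u) -> (s h).1 = b p.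
Proof.
move: u i u'; apply: (@S_ind d t d3) => // p u pu IH i u' ue.
have [k uk] := is_childP _ _ pu.
have [j ju] : exists j, nbr s (b p) j = b u by apply: nbr_index; rewrite /tadj pu.
have jE := child_index pu ju.
have k0 : (0 < k)%N.
  have := tree_valP (val u); rewrite uk tree_label_rcons => /andP[_].
  by case: (tree_val (val p)) => [|? ?] /andP[].
rewrite uk last_rcons in jE.
have only (p' : S_ball d t) : is_child (val p') (val u) -> p' = p.
  by move=> p'u; apply: val_inj; exact: is_child_inj p'u pu.
case pe : (tree_val (val p)) => [|i0 u0].
  move: ue; rewrite uk pe /= => -[ik <-]; subst k.
  have pr : p = rootS t d3 by apply: val_inj; apply: tree_inj; rewrite pe.
  have je : ordd i.-1 = j.
    rewrite -[RHS]ordd_ord jE; case: existsP => [[w /andP[/is_child_size]]|]; last by rewrite addn0.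
    by rewrite pe.
  rewrite /= je -pr; split; first exact: ju.
  move=> p' p'u; have -> : p' = p by apply: only; move: p'u; rewrite uk pe.
  by rewrite sK.
have uE : u' = rcons u0 k /\ i = i0 by move: ue; rewrite uk pe rcons_cons => -[-> ->].
case: uE => -> ->; have [h1 h2] := IH _ _ pe.
rewrite foldl_rcons_step; set h := foldl _ _ u0 in h1 h2 *.
have pnz : tree_val (val p) <> [::] by rewrite pe.
have qS : parent (val p) \in S_ball d t.
  by rewrite in_S_ball//; move: (parent_size pnz) (valP p) => /=; rewrite in_S_ball//; lia.
pose q : S_ball d t := [` qS]%fset; have qp : is_child (val q) (val p) by exact: is_child_parent.
have hq := h2 _ qp.
have qE : nbr s (b p) h.2 = b q by rewrite /nbr -h1 -surjective_pairing.
have exE : [exists w : S_ball d t, is_child (val w) (val p) && rank_lt tau (b p) (b w) (b u)] = (h.2 < j)%N.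
  rewrite -(sorted_by_lt (b p) h.2 j so) qE ju; apply/existsP/idP => [[w /andP[wp]]|qu].
    by have -> : w = q by apply: val_inj; exact: is_child_inj wp qp.
  by exists q; rewrite qp.
have hj : h.2 != j.
  apply/eqP => e; have : b q = b u by rewrite -qE -ju e.
  move=> /bi qu; have := is_child_size qp; rewrite qu (is_child_size pu).
  by move=> /=; lia.
have je : ordd (bump h.2 k.-1) = j.
  rewrite -[RHS]ordd_ord; congr ordd; rewrite jE exE /bump addnC; congr (_ + _)%N.
  rewrite exE in jE; move: hj; rewrite -(inj_eq val_inj) /= => hj.
  by move: jE; case: ltnP => h2j; case: leqP; lia.
rewrite /wstep je h1; split; first exact: ju.
by move=> p' /only ->; rewrite sK.
Qed.

(** When the order sorts the matching, an increasing embedding is given by the walks from its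
    center. Hence every copy counted by [tau_count] is also seen by [walk_mass]. *)
Lemma increasing_walk (u : S_ball d t) : b u = walk s (b (rootS t d3)) (tree_val (val u)).
Proof.
rewrite /walk; case e : (tree_val (val u)) => [|i u'].
  by congr (b _); apply: val_inj; apply: tree_inj; rewrite e.
by have [-> _] := foldl_walk e.
Qed.

End increasing_walk.

End walks.

(** * Types of half-edges and their flip *)

Section edge_types.
Variables (d r : nat) (M : finType).
Hypothesis d3 : (3 <= d)%N.
Hypothesis r0 : (0 < r)%N.
Local Notation X := {ffun S_ball d r -> M}.
Local Notation Y := {ffun E_ball d r -> M}.

Definition toS (u : tree d) : S_ball d r := insubd (rootS r d3) u.

Lemma toSK (u : tree d) : (size u <= r)%N -> val (toS u) = u.
Proof. by move=> ur; rewrite insubdK// in_S_ball. Qed.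

Lemma E_size (u : E_ball d r) : (size (val u) <= r)%N.
Proof.
by have := valP u; rewrite /= in_E_ball//; move: r0; case: under1 => /=; lia.
Qed.

Lemma root_in_E : root d \in E_ball d r.
Proof. by rewrite in_E_ball. Qed.

Definition toE (u : tree d) : E_ball d r := insubd [` root_in_E]%fset u.

Lemma flipT_E (u : E_ball d r) : val (toE (flipT (val u))) = flipT (val u).
Proof.
rewrite insubdK//; have := valP u; rewrite /= !in_E_ball// !flipTE//.
case: (tree_val (val u)) => [|i w] /=; first by rewrite addn1.
have [_|_] := eqVneq i 1%N; last by move=> /=; lia.
by case: w => [|k w] //=; case: eqP; lia.
Qed.

(* The coloring, seen from the i-th half-edge at the root, of the ball around it. *)
Definition ytype (i : 'I_d) (x : X) : Y := [ffun u => x (toS (rotT i.+1 (val u)))].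

Definition yflip (y : Y) : Y := [ffun u => y (toE (flipT (val u)))].

Lemma yflipK : involutive yflip.
Proof.
move=> y; apply/ffunP => u; rewrite !ffunE; congr (y _); apply: val_inj.
by rewrite flipT_E flipT_E flipTK.
Qed.

Lemma rotT_size i (u : tree d) : (0 < i <= d)%N -> size (rotT i u) = size u.
Proof. by move=> id; rewrite rotTE//; case: (tree_val u). Qed.

Lemma ord_rot (i : 'I_d) : (0 < i.+1 <= d)%N. Proof. by rewrite ltn_ord. Qed.

Definition xwalk n (s : {perm 'I_n.+1 * 'I_d}) (f : {ffun 'I_n.+1 -> M}) (v : 'I_n.+1) : X :=
  [ffun u => f (walk d3 s v (tree_val (val u)))].

Lemma ytype_flip n (s : {perm 'I_n.+1 * 'I_d}) (f : {ffun 'I_n.+1 -> M}) h :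
  (forall h, s (s h) = h) ->
  ytype (s h).2 (xwalk s f (s h).1) = yflip (ytype h.2 (xwalk s f h.1)).
Proof.
move=> sK; apply/ffunP => u; rewrite !ffunE.
have eS := flipT_E u; have uE := E_size u; have u'E := E_size (toE (flipT (val u))).
rewrite eS in u'E; rewrite eS !toSK ?rotT_size ?ord_rot//.
rewrite !rotTE ?ord_rot// flipTE//; congr (f _); apply: walk_flip => //.
exact: tree_valP.
Qed.

Section marginals.
Variable R : realType.

Lemma marginal_E (q : mass R M (S_ball d r)) y :
  marginal (E_ball d r) q y = \sum_(x : X | [ffun u : E_ball d r => x (toS (val u))] == y) q x.
Proof.
rewrite ffunE; apply: eq_bigl => x; apply/forallP/eqP => [h|<- u].
  apply/ffunP => w; rewrite ffunE; have /forallP/(_ w)/implyP := h (toS (val w)).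
  by rewrite toSK ?E_size// eqxx => /(_ isT)/eqP.
apply/forallP => w; apply/implyP => /eqP uw; rewrite ffunE; apply/eqP; congr (x _).
by apply: val_inj; rewrite toSK ?E_size.
Qed.

Definition aut_invariant (q : mass R M (S_ball d r)) : Prop :=
  forall phi : {perm S_ball d r}, ball_aut phi ->
    forall x : X, q [ffun u => x (phi u)] = q x.

(** The type of the i-th half-edge is the restriction to [E_ball] up to a rotation of the tree,
    under which [q] is invariant. *)
Lemma marginal_ytype (q : mass R M (S_ball d r)) i y : aut_invariant q ->
  \sum_(x : X | ytype i x == y) q x = marginal (E_ball d r) q y.
Proof.
move=> qinv; rewrite marginal_E.
have Fr : rotT i.+1 (root d) = root d by apply: tree_inj; rewrite rotTE ?ord_rot.
have [phi [phiA phiE]] := tree_aut_ball d3 r (rotT_aut d3 (ord_rot i)) Fr.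
pose h (x : X) : X := [ffun u => x (phi u)].
have hinj : injective h.
  move=> x x' /ffunP e; apply/ffunP => u.
  by have := e (phi^-1%g u); rewrite !ffunE permKV.
rewrite [RHS](reindex_inj hinj) /=; apply: eq_big => [x|x _]; last by rewrite qinv.
congr (_ == _); apply/ffunP => u; rewrite !ffunE; congr (x _); apply: val_inj.
by rewrite phiE !toSK ?rotT_size ?ord_rot// E_size.
Qed.

(** The single switch [yflip] suffices: any other one differs from it by an automorphism of [E_ball]
    that fixes both ends of the edge, and such an automorphism extends to the tree, hence to
    [S_ball]. *)
Lemma invariant_mass_flip (q : mass R M (S_ball d r)) :
  (forall x, 0 <= q x) -> \sum_x q x = 1 -> aut_invariant q ->
  (forall y, marginal (E_ball d r) q (yflip y) = marginal (E_ball d r) q y) ->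
  invariant_mass q.
Proof.
move=> q0 q1 qinv qflip; split => // psi psiA psw y.
have EB (u : tree d) : u \in E_ball d r -> flipT u \in E_ball d r.
  by move=> uE; have := flipT_E [` uE]%fset => /= <-; exact: valP.
have [phi0 phi0E] := ball_perm (bij_inj (flipT_aut d3).1) EB.
have phi0A : ball_aut phi0 by move=> u w; rewrite !phi0E flipT_adj.
pose eta := (phi0 * psi)%g.
have etaA : ball_aut eta by move=> u w; rewrite !permM psiA phi0A.
have oneE : first_nbr d \in E_ball d r by rewrite in_E_ball// first_nbrE//; case: (r) r0 => //= k _; lia.
have flip0 : flipT (root d) = first_nbr d by apply: tree_inj; rewrite flipTE// first_nbrE.
have flip1 : flipT (first_nbr d) = root d by rewrite -flip0 flipTK.
have [psw1 psw2] := psw [` root_in_E]%fset [` oneE]%fset erefl erefl.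
have eta0 (u : E_ball d r) : val u = root d -> val (eta u) = root d.
  move=> u0; rewrite permM; have -> : phi0 u = [` oneE]%fset.
    by apply: val_inj; rewrite phi0E u0 flip0.
  by rewrite psw2.
have eta1 (u : E_ball d r) : val u = first_nbr d -> val (eta u) = first_nbr d.
  move=> u1; rewrite permM; have -> : phi0 u = [` root_in_E]%fset.
    by apply: val_inj; rewrite phi0E u1 flip1.
  by rewrite psw1.
have [F [FA F0 FE]] := E_ball_extension d3 r0 etaA eta0 eta1.
have [phi [phiA phiE]] := tree_aut_ball d3 r FA F0.
have etainv (z : Y) : marginal (E_ball d r) q [ffun u => z (eta u)] = marginal (E_ball d r) q z.
  rewrite !marginal_E; pose h (x : X) : X := [ffun u => x (phi u)].
  have hinj : injective h.
    move=> x x' /ffunP e; apply/ffunP => u.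
    by have := e (phi^-1%g u); rewrite !ffunE permKV.
  rewrite (reindex_inj hinj) /=; apply: eq_big => [x|x _]; last by rewrite qinv.
  have e (u : E_ball d r) : phi (toS (val u)) = toS (val (eta u)).
    by apply: val_inj; rewrite phiE !toSK ?E_size// FE.
  apply/eqP/eqP => /ffunP hx; apply/ffunP => u.
    have := hx (eta^-1%g u); rewrite !ffunE permKV => <-.
    by rewrite e permKV.
  by rewrite !ffunE e -hx ffunE.
rewrite -[RHS]etainv -qflip; congr (marginal _ _ _); apply/ffunP => u; rewrite !ffunE.
congr (y _); rewrite permM; congr (psi _); apply: val_inj; rewrite phi0E flipT_E.
by [].
Qed.

Lemma invariant_mass_yflip (q : mass R M (S_ball d r)) y : invariant_mass q ->
  marginal (E_ball d r) q (yflip y) = marginal (E_ball d r) q y.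
Proof.
move=> qI.
have EB (u : tree d) : u \in E_ball d r -> flipT u \in E_ball d r.
  by move=> uE; have := flipT_E [` uE]%fset => /= <-; exact: valP.
have [phi0 phi0E] := ball_perm (bij_inj (flipT_aut d3).1) EB.
have phi0A : ball_aut phi0 by move=> u w; rewrite !phi0E flipT_adj.
have flip0 : flipT (root d) = first_nbr d by apply: tree_inj; rewrite flipTE// first_nbrE.
rewrite -(mass_switch qI phi0A) => [|u w u0 w1]; last first.
  by split; apply: val_inj; rewrite phi0E ?u0 ?w1 ?flip0// -flip0 flipTK.
congr (marginal _ _ _); apply/ffunP => u; rewrite !ffunE; congr (y _); apply: val_inj.
by rewrite phi0E flipTK// insubdK//; exact: valP.
Qed.

End marginals.

End edge_types.

(** * First moment: upper bound *)

Section factorials.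
Variable R : realType.

Lemma ln_ratio (k m : nat) : (k <= m)%N ->
  k%:R * ln k%:R = k%:R * ln m%:R + m%:R * (k%:R / m%:R * ln (k%:R / m%:R)) :> R.
Proof.
case: k => [_|k km]; first by rewrite !mul0r mulr0 addr0.
have mp : (0 < m)%N by exact: leq_trans km.
have m0 : (0 : R) < m%:R by rewrite ltr0n.
rewrite mulrA [m%:R * _]mulrC divfK ?gt_eqF// ln_div ?posrE ?ltr0n//.
by rewrite mulrBr addrC subrK.
Qed.

Variables (Y : finType) (e : Y -> nat) (m : nat).
Hypothesis em : (\sum_y e y = m)%N.

Let e_le y : (e y <= m)%N. Proof. by rewrite -em (bigD1 y)//= leq_addr. Qed.

Let sum_ratio : \sum_y ((e y)%:R * ln (e y)%:R - (e y)%:R) =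
  m%:R * ln m%:R - m%:R + m%:R * \sum_y (e y)%:R / m%:R * ln ((e y)%:R / m%:R) :> R.
Proof.
rewrite big_split /= sumrN -natr_sum em.
rewrite (eq_bigr (fun y => (e y)%:R * ln m%:R + m%:R * ((e y)%:R / m%:R * ln ((e y)%:R / m%:R)))) => [|y _]; last exact: ln_ratio.
rewrite big_split /= -mulr_suml -natr_sum em -mulr_sumr.
by rewrite addrAC.
Qed.

(** Stirling: the multinomial coefficient is at least the exponential of [m] times the entropy of
    [e / m], up to a polynomial factor. *)
Lemma sum_lnfact_le : \sum_y ln (e y)`!%:R <= ln m`!%:R +
  m%:R * (\sum_y (e y)%:R / m%:R * ln ((e y)%:R / m%:R)) + #|Y|%:R * (2 * ln m.+1%:R + 1) :> R.
Proof.
have h : \sum_y ln (e y)`!%:R <= \sum_y (((e y)%:R * ln (e y)%:R - (e y)%:R) + (2 * ln m.+1%:R + 1)) :> R.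
  apply: ler_sum => y _; apply: le_trans (lnfact_le R (e y)) _.
  rewrite -[leLHS]addrA lerD2l lerD2r ler_wpM2l// ler_ln ?posrE ?ltr0n// ler_nat ltnS.
  exact: e_le.
apply: le_trans h _; rewrite big_split /= sum_ratio sumr_const -[X in _ + X]mulr_natl.
by rewrite lerD2r lerD2r lnfact_ge.
Qed.

Lemma sum_lnfact_ge : ln m`!%:R +
  m%:R * (\sum_y (e y)%:R / m%:R * ln ((e y)%:R / m%:R)) - (2 * ln m.+1%:R + 1) <=
  \sum_y ln (e y)`!%:R :> R.
Proof.
have h : \sum_y ((e y)%:R * ln (e y)%:R - (e y)%:R) <= \sum_y ln (e y)`!%:R :> R.
  by apply: ler_sum => y _; exact: lnfact_ge.
apply: le_trans h; rewrite sum_ratio; have := lnfact_le R m; lra.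
Qed.

End factorials.

Section first_moment.
Variables (R : realType) (d r : nat) (M : finType).
Hypothesis d3 : (3 <= d)%N.
Hypothesis r0 : (0 < r)%N.
Local Notation X := {ffun S_ball d r -> M}.
Local Notation Y := {ffun E_ball d r -> M}.

(** Law of the type of a uniform half-edge at the root. For an invariant mass it is the marginal on
    [E_ball]; it also makes sense for [walk_mass], which need not be invariant. *)
Definition edge_mass (q : mass R M (S_ball d r)) : mass R M (E_ball d r) :=
  [ffun y => d%:R^-1 * \sum_(i < d) \sum_(x : X | ytype d3 i x == y) q x].

Definition edge_Sigma (q : mass R M (S_ball d r)) : R :=
  entropy q - d%:R / 2 * entropy (edge_mass q).

Lemma edge_mass_marginal q : aut_invariant q -> edge_mass q = marginal (E_ball d r) q.
Proof.
move=> qinv; apply/ffunP => y; rewrite [LHS]ffunE.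
under eq_bigr do rewrite (marginal_ytype d3 r0 _ _ qinv).
by rewrite sumr_const card_ord -[marginal _ _ _ *+ _]mulr_natl mulrA mulVf ?mul1r// pnatr_eq0; lia.
Qed.

Lemma edge_Sigma_Sigma q : aut_invariant q -> edge_Sigma q = Sigma q.
Proof. by move=> qinv; rewrite /edge_Sigma edge_mass_marginal. Qed.

Section counts.
Variable n : nat.
Local Notation V := 'I_n.+1.
Local Notation H := ('I_n.+1 * 'I_d)%type.
Local Notation N := (n.+1%:R : R).

(** Empirical law of the colorings seen along walks; its total mass is 1 even when the graph has
    short cycles. *)
Definition walk_mass (s : {perm H}) (f : {ffun V -> M}) : mass R M (S_ball d r) :=
  [ffun x => #|[set v | xwalk r d3 s f v == x]|%:R / N].

Definition count_mass (c : X -> nat) : mass R M (S_ball d r) := [ffun x => (c x)%:R / N].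

Definition ecount (c : X -> nat) (y : Y) : nat :=
  (\sum_(i < d) \sum_(x : X | ytype d3 i x == y) c x)%N.

Lemma edge_count_mass c y : edge_mass (count_mass c) y = (ecount c y)%:R / (n.+1 * d)%:R.
Proof.
rewrite ffunE natr_sum natrM invfM mulrA mulr_suml mulr_sumr mulr_suml.
apply: eq_bigr => i _; rewrite natr_sum mulr_suml mulrC.
by congr (_ * _); apply: eq_bigr => x _; rewrite ffunE.
Qed.

Lemma sum_ecount c : (\sum_x c x = n.+1)%N -> (\sum_y ecount c y = n.+1 * d)%N.
Proof.
move=> cN; rewrite exchange_big /= (eq_bigr (fun=> n.+1)).
  by rewrite sum_nat_const card_ord mulnC.
by move=> i _; rewrite -cN [RHS](partition_big (ytype d3 i) xpredT).
Qed.

Definition xcount (g : {ffun V -> X}) (x : X) : nat := #|[set v | g v == x]|.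

Lemma sum_xcount g : (\sum_x xcount g x = n.+1)%N.
Proof.
rewrite -[RHS](card_ord n.+1) -[RHS]sum1_card (partition_big (fun v => g v) xpredT)//=.
by apply: eq_bigr => x _; rewrite /xcount -sum1_card; apply: eq_bigl => v; rewrite inE.
Qed.

Lemma ycount_xcount (g : {ffun V -> X}) y :
  ycount (fun h : H => ytype d3 h.2 (g h.1)) finset.setT y = ecount (xcount g) y.
Proof.
rewrite /ycount /ecount -sum1_card.
rewrite (partition_big (fun h : H => h.2) xpredT)//=; apply: eq_bigr => i _.
transitivity (\sum_(v | ytype d3 i (g v) == y) 1)%N.
  rewrite (reindex_onto (fun v => (v, i)) fst) => [|[v j] /= /andP[_ /eqP ->]//].
  by apply: eq_bigl => v; rewrite !inE /= !eqxx !andbT.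
rewrite (partition_big (fun v => g v) (fun x => ytype d3 i x == y))//=.
apply: eq_bigr => x xy; rewrite sum1_card; apply: eq_card => v; rewrite !inE unfold_in /=.
by have [->|] := eqVneq (g v) x; rewrite ?xy ?andbF.
Qed.

Lemma entropy_weight (c : X -> nat) :
  \prod_x (count_mass c x) ^+ c x = expR (- (N * entropy (count_mass c))).
Proof.
rewrite /entropy mulrN opprK mulr_sumr expR_sum; apply: eq_bigr => x _.
rewrite !ffunE mulrA [N * _]mulrC divfK ?pnatr_eq0//.
case: (c x) => [|k]; first by rewrite !mul0r expr0 expR0.
by rewrite expRM_natl lnK// posrE divr_gt0 ?ltr0n.
Qed.

Lemma card_xcount_le c : (\sum_x c x = n.+1)%N ->
  #|[set g : {ffun V -> X} | [forall x, xcount g x == c x]]|%:R <= expR (N * entropy (count_mass c)).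
Proof.
move=> cN; have := @card_ffun_weight R V X (count_mass c) c _ _.
rewrite entropy_weight expRN ler_pdivrMr ?expR_gt0// mul1r; apply.
  by move=> x; rewrite ffunE divr_ge0.
under eq_bigr do rewrite ffunE.
by rewrite -mulr_suml -natr_sum cN divff// pnatr_eq0.
Qed.

Definition typed (g : {ffun V -> X}) : {set {perm H}} :=
  [set s in matchings finset.setT |
    [forall h in finset.setT, ytype d3 (s h).2 (g (s h).1) == yflip d3 r0 (ytype d3 h.2 (g h.1))]].

(** The square of the left side is at most the product of the factorials of the type counts, about
    m! times the exponential of minus m times the edge entropy, while m! is at most m + 1 times the
    square of the number of matchings. Square roots give d/2. *)
Lemma card_typed_le g : ~~ odd (n.+1 * d) ->
  #|typed g|%:R <= #|matchings [set: H]%SET|%:R *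
    expR (N * - (d%:R / 2 * entropy (edge_mass (count_mass (xcount g)))) +
          (ln (n.+1 * d).+1%:R + #|{: Y}|%:R * (2 * ln (n.+1 * d).+1%:R + 1))).
Proof.
move=> ev; set c := xcount g; set m := (n.+1 * d)%N.
have cN : (\sum_x c x = n.+1)%N by exact: sum_xcount.
have /= h1 := card_typed_matchings (fun h : H => ytype d3 h.2 (g h.1)) (@yflipK d r M d3 r0) finset.setT.
rewrite -/(typed g) in h1; move: h1; under eq_bigr do rewrite ycount_xcount; move=> h1.
have cH : #|[set: H]%SET| = m by rewrite cardsT card_prod !card_ord.
have h2 := card_matchings [set: H]%SET; have h3 := mcount_even ev; rewrite -/m -cH -h2 cH in h3.
have h4 := sum_lnfact_le R (sum_ecount cN).
set L := ln m.+1%:R in h4 *; have m1 : (0 : R) < m.+1%:R by rewrite ltr0n.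
have L0 : 0 <= L by rewrite ln_ge0// ler1n.
set K := L + _; rewrite -ler_sqr ?nnegrE ?mulr_ge0 ?expR_ge0//.
rewrite exprMn -expRM_natl mulrDr.
have eS : \sum_y (ecount c y)%:R / m%:R * ln ((ecount c y)%:R / m%:R) =
    - entropy (edge_mass (count_mass c)).
  by rewrite /entropy opprK; apply: eq_bigr => y _; rewrite edge_count_mass.
rewrite -/m eS in h4; set S := - entropy _ in h4 eS.
have -> : 2 * (N * - (d%:R / 2 * entropy (edge_mass (count_mass c)))) = m%:R * S.
  by rewrite /S /m natrM; lra.
have m2 : (0 : R) < m`!%:R by rewrite ltr0n fact_gt0.
apply: (@le_trans _ _ (\prod_y (ecount c y)`!)%:R); first by rewrite -natrX ler_nat.
have -> : (\prod_y (ecount c y)`!)%:R = expR (\sum_y ln (ecount c y)`!%:R) :> R.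
  by rewrite natr_prod expR_sum; apply: eq_bigr => y _; rewrite lnK// posrE ltr0n fact_gt0.
apply: (@le_trans _ _ (m`!%:R * expR (m%:R * S + 2 * K - L))).
  rewrite -[X in _ <= X * _](lnK m2) -expRD ler_expR; apply: le_trans h4 _.
  have : 0 <= #|{: Y}|%:R * (2 * L + 1) by rewrite mulr_ge0// addr_ge0// mulr_ge0.
  rewrite /K; set YY := #|_|%:R * _; set lm := ln _; clearbody lm YY; clear -L0; lra.
have -> : expR (m%:R * S + 2 * K - L) = expR (m%:R * S + 2 * K) / m.+1%:R.
  by rewrite expRD expRN lnK// posrE.
rewrite mulrCA mulrC ler_pM2r ?expR_gt0// ler_pdivrMr//.
by rewrite -natrX -natrM ler_nat mulnC.
Qed.

End counts.

(** There are polynomially many vectors of counts. For each of them, the choices of the colored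
    balls contribute the vertex entropy, and those of a matching compatible with their types
    contribute minus d/2 times the edge entropy. *)
Lemma first_moment_le (delta : R) : 0 < delta -> exists n0, forall n, (n0 <= n)%N ->
  ~~ odd (n.+1 * d) -> forall (A : {set {perm 'I_n.+1 * 'I_d} * {ffun 'I_n.+1 -> M}}) (s0 : R),
  (forall z, z \in A -> z.1 \in matchings finset.setT /\ edge_Sigma (walk_mass z.1 z.2) <= s0) ->
  #|A|%:R <= #|matchings [set: 'I_n.+1 * 'I_d]%SET|%:R * expR (n.+1%:R * (s0 + delta)).
Proof.
move=> delta0.
pose a : R := #|{: Y}|%:R; pose b : R := #|{: X}|%:R.
pose k := 1 + 2 * a + b; pose C := k * ln d.+1%:R + a + b * ln 2.
have [n0 n0P] := log_poly_le C k delta0; exists n0 => n n0n ev A s0 AP.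
have {n0P n0n}h := n0P _ n0n.
pose cnt (z : {perm 'I_n.+1 * 'I_d} * {ffun 'I_n.+1 -> M}) : {ffun X -> 'I_n.+2} :=
  [ffun x => inord #|[set v | xwalk r d3 z.1 z.2 v == x]|].
have cntE z x : cnt z x = #|[set v | xwalk r d3 z.1 z.2 v == x]| :> nat.
  by rewrite ffunE inordK// ltnS (leq_trans (max_card _))// card_ord.
pose xw (z : {perm 'I_n.+1 * 'I_d} * {ffun 'I_n.+1 -> M}) : {ffun 'I_n.+1 -> X} :=
  [ffun v => xwalk r d3 z.1 z.2 v].
have xwE z x : xcount (xw z) x = cnt z x.
  by rewrite cntE; apply: eq_card => v; rewrite !inE ffunE.
pose W : R := #|matchings [set: 'I_n.+1 * 'I_d]%SET|%:R.
pose L : R := ln (n.+1 * d).+1%:R.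
have Ac c : #|[set z in A | cnt z == c]|%:R <=
    W * expR (n.+1%:R * s0 + (L + a * (2 * L + 1))).
  have [->|[z0]] := set_0Vmem [set z in A | cnt z == c].
    by rewrite cards0 mulr_ge0// expR_ge0.
  rewrite inE => /andP[z0A /eqP z0c].
  have cN : (\sum_x c x = n.+1)%N.
    by rewrite -z0c; under eq_bigr do rewrite -xwE; exact: sum_xcount.
  (* Injective, since the coloring is recovered from the colors at the roots of the balls. *)
  pose F z := (xw z, z.1).
  have Finj : injective F.
    move=> [s f] [s' f'] [e1 /= e2]; subst s'; congr pair; apply/ffunP => v.
    have := congr1 (fun g : {ffun 'I_n.+1 -> X} => g v (rootS r d3)) e1.
    by rewrite !ffunE.
  rewrite -(card_imset _ Finj).
  pose G := [set g : {ffun 'I_n.+1 -> X} | [forall x, xcount g x == c x]].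
  have sub : F @: [set z in A | cnt z == c] \subset
      [set z : {ffun 'I_n.+1 -> X} * {perm 'I_n.+1 * 'I_d} | (z.1 \in G) && (z.2 \in typed z.1)].
    apply/fintype.subsetP => _ /imsetP[z + ->]; rewrite inE => /andP[zA /eqP zc].
    have [zM _] := AP z zA; rewrite finset.in_set; apply/andP; split.
      by rewrite finset.in_set; apply/forallP => x; rewrite xwE zc.
    rewrite finset.in_set; apply/andP; split => //; apply/forall_inP => h' _; rewrite !ffunE; apply/eqP; apply: ytype_flip => //.
    by case/matchingsP: zM.
  apply: le_trans (_ : _ <= \sum_(g in G) #|typed g|%:R) _.
    rewrite -natr_sum ler_nat; apply: leq_trans (subset_leq_card sub) _.
    rewrite -sum1_card (partition_big (fun z : {ffun 'I_n.+1 -> X} * {perm 'I_n.+1 * 'I_d} => z.1) (mem G))/=; last first.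
      by move=> z; rewrite inE => /andP[].
    apply: leq_sum => g gG; rewrite sum1_card.
    have pinj : injective (fun s : {perm 'I_n.+1 * 'I_d} => (g, s)) by move=> s s' [].
    rewrite -(card_imset (mem (typed g)) pinj); apply/subset_leq_card/fintype.subsetP => -[g' s]; rewrite unfold_in /= finset.in_set => /andP[/andP[_ sg] /eqP /= e].
    by apply/imsetP; exists s; rewrite -e.
  have cmE g : g \in G -> count_mass n (xcount g) = walk_mass z0.1 z0.2.
    rewrite inE => /forallP gc; apply/ffunP => x; rewrite !ffunE; congr (_%:R / _).
    by rewrite (eqP (gc x)) -z0c cntE.
  have cmE' : count_mass n (fun x => c x) = walk_mass z0.1 z0.2.
    by apply/ffunP => x; rewrite !ffunE -z0c cntE.
  have hs := (AP _ z0A).2; rewrite /edge_Sigma in hs.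
  apply: le_trans (_ : _ <= \sum_(g in G) W * expR (n.+1%:R * - (d%:R / 2 * entropy (edge_mass (walk_mass z0.1 z0.2))) + (L + a * (2 * L + 1)))) _.
    by apply: ler_sum => g gG; rewrite -(cmE g gG); exact: card_typed_le.
  rewrite sumr_const -[leLHS]mulr_natl mulrCA ler_wpM2l//.
  apply: le_trans (ler_wpM2r (expR_ge0 _) (card_xcount_le cN)) _.
  rewrite -expRD ler_expR addrA lerD2r -mulrDr ler_wpM2l//.
  by rewrite cmE'.
have -> : #|A|%:R = \sum_c #|[set z in A | cnt z == c]|%:R :> R.
  rewrite -natr_sum; congr _%:R; rewrite -sum1_card (partition_big cnt xpredT)//=.
  by apply: eq_bigr => c _; rewrite -sum1_card; apply: eq_bigl => z; rewrite inE.
apply: le_trans (ler_sum _ (fun c _ => Ac c)) _.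
rewrite sumr_const -[leLHS]mulr_natl mulrCA ler_wpM2l//.
rewrite card_ffun card_ord natrX.
have -> : n.+2%:R ^+ #|{: X}| = expR (b * ln n.+2%:R) :> R.
  by rewrite /b expRM_natl lnK// posrE ltr0n.
rewrite -expRD ler_expR.
have L1 : L <= ln d.+1%:R + ln n.+1%:R.
  rewrite -lnM ?posrE ?ltr0n// ler_ln ?posrE ?mulr_gt0 ?ltr0n// -natrM ler_nat.
  by rewrite (mulSn d) [ltnLHS]mulnC -[ltnLHS]add0n ltn_add2r.
have L2 : ln n.+2%:R <= ln 2 + ln n.+1%:R :> R.
  by rewrite -lnM ?posrE ?ltr0n// ler_ln ?posrE ?mulr_gt0 ?ltr0n// -natrM ler_nat; lia.
have a0 : 0 <= a by []. have b0 : 0 <= b by [].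
have p1 : a * L <= a * (ln d.+1%:R + ln n.+1%:R) by rewrite ler_wpM2l.
have p2 : b * ln n.+2%:R <= b * (ln 2 + ln n.+1%:R) by rewrite ler_wpM2l.
have p3 : 0 <= b * ln d.+1%:R by rewrite mulr_ge0// ln_ge0// ler1n.
move: h p1 p2 p3 L1 L2; rewrite /C /k mulrDr [delta * _]mulrC.
set NN := n.+1%:R; set lN := ln NN; set ld := ln d.+1%:R; set l2 := ln 2; set lN2 := ln n.+2%:R.
clearbody lN ld l2 lN2 L; clear; lra.
Qed.

End first_moment.

(** * Matchings that are locally trees *)

Section nonbacktracking.
Variable V : finType.
Implicit Types (e : rel V) (p v w : V) (o : seq V).

(* [o] continues a non-backtracking path that has just gone from [p] to [v]. *)
Fixpoint nbpath e p v o : bool :=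
  if o is w :: o' then [&& w != p, e v w & nbpath e v w o'] else true.

(** Excludes short cycles near [v]: a non-backtracking path is determined by its endpoint. For
    irreflexive [e], the dummy predecessor [v] is compatible with every first step. *)
Definition treelike e (L : nat) v : Prop := forall o o',
  (size o <= L)%N -> (size o' <= L)%N -> nbpath e v v o -> nbpath e v v o' ->
  last v o = last v o' -> o = o'.

Lemma nbpath_gball e p v o : nbpath e p v o -> last v o \in gball e (size o) v.
Proof.
elim: o p v => [|w o IH] p v; first by rewrite inE.
move=> /and3P[_ vw /IH h].
exact: gball_trans (gball_step (gball_self _ 0 v) vw) h.
Qed.

Lemma nbpath_start e p v o : irreflexive e -> nbpath e p v o -> nbpath e v v o.
Proof.
move=> eirr; case: o => //= w o /and3P[_ vw ->]; rewrite vw !andbT.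
by apply: contraTneq vw => ->; rewrite eirr.
Qed.

Lemma nbpath_sub e e' L k p v w o :
  (forall x, x \in gball e' L v -> e x =1 e' x) ->
  w \in gball e' k v -> (k + size o <= L)%N -> nbpath e p w o -> nbpath e' p w o.
Proof.
move=> ee'; elim: o k p w => [//|x o IH] k p w wv /= ko /and3P[-> wx ho].
have wx' : e' w x by rewrite -ee'//; apply: gballW wv; lia.
rewrite wx' /=; apply: (IH k.+1) => //; last by lia.
exact: gball_step wv wx'.
Qed.

Lemma treelike_sub e e' L v : (forall x, x \in gball e' L v -> e x =1 e' x) ->
  treelike e' L v -> treelike e L v.
Proof.
move=> ee' tr o o' oL o'L ho ho'; apply: tr => //.
  by apply: (nbpath_sub ee' (gball_self _ 0 v)) => //; rewrite add0n.
by apply: (nbpath_sub ee' (gball_self _ 0 v)) => //; rewrite add0n.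
Qed.

Section add_edge.
Variables (e e' : rel V) (a b : V) (L : nat).
Hypothesis esym : symmetric e.
Hypothesis eirr : irreflexive e.
Hypothesis etree : forall v, treelike e L v.
Hypothesis far : b \notin gball e (3 * L) a.
Hypothesis e'E : forall v w, e' v w = e v w || ((v == a) && (w == b) || (v == b) && (w == a)).

Let new x y := (x == a) && (y == b) || (x == b) && (y == a).

Let new_far x y k : new x y -> (k <= 3 * L)%N -> y \notin gball e k x.
Proof.
move=> xy kL; apply: contra far => /(gballW kL).
by case/orP: xy => /andP[/eqP -> /eqP ->]// /(gball_sym esym).
Qed.

Let new2 x y x' y' : new x y -> new x' y' -> (x' = x /\ y' = y) \/ (x' = y /\ y' = x).
Proof.
by case/orP=> /andP[/eqP -> /eqP ->]; case/orP=> /andP[/eqP -> /eqP ->]; [left|right|right|left].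
Qed.

(* A short path cannot use the new edge twice. *)
Let nbpath_split p v o : (size o <= L)%N -> nbpath e' p v o ->
  nbpath e p v o \/ exists a1 x y a2, [/\ o = a1 ++ y :: a2, new x y, last v a1 = x,
    nbpath e p v a1 & nbpath e x y a2 /\ (a1 = [::] -> y != p)].
Proof.
elim: o p v => [|w o IH] p v oL; first by left.
move=> /= /and3P[wp vw ho]; have := IH v w (ltnW oL) ho => -[{}ho|].
  move: vw; rewrite e'E => /orP[vw|vw]; first by left; rewrite wp vw.
  by right; exists [::], v, w, o; split.
move=> [a1 [x [y [a2 [oE xy xl h1 [h2 yv]]]]]].
move: vw; rewrite e'E => /orP[vw|vw].
  by right; exists (w :: a1), x, y, a2; rewrite oE /= wp vw; split.
have a1L : (size a1 <= L)%N by move: oL; rewrite oE /= size_cat; clear; lia.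
have [[xv yw]|[xw yv']] := new2 vw xy.
  have := nbpath_gball h1; rewrite xl xv => /(gball_sym esym).
  by rewrite (negbTE (new_far vw _))//; move: a1L; clear; lia.
have h1' := nbpath_start eirr h1.
have := etree (o' := [::]) a1L (leq0n L) h1' isT; rewrite xl xw => /(_ erefl) a10.
by have := yv a10; rewrite yv' eqxx.
Qed.

(** A short path uses the new edge at most once. Two short paths from [v] with the same end that
    used it differently would link its endpoints by a walk of length at most 3 L in the old graph,
    which [far] forbids. *)
Lemma treelike_add v : treelike e' L v.
Proof.
move=> o o' oL o'L ho ho' oo'.
have endL q : (size q <= L)%N -> forall p w, nbpath e p w q -> last w q \in gball e L w.
  by move=> qL p w /nbpath_gball; exact: gballW.
have far1 q q' : (size q <= L)%N -> (size q' <= L)%N -> nbpath e v v q' ->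
   (exists a1 x y a2, [/\ q = a1 ++ y :: a2, new x y, last v a1 = x,
    nbpath e v v a1 & nbpath e x y a2 /\ (a1 = [::] -> y != v)]) -> last v q = last v q' -> False.
  move=> qL q'L hq' [a1 [x [y [a2 [qE xy xl h1 [h2 _]]]]]]; rewrite qE last_cat /= => e2.
  move: qL; rewrite qE size_cat /= => qL.
  have g1 : x \in gball e L v by rewrite -xl; apply: endL h1; move: qL; clear; lia.
  have g2 : last y a2 \in gball e L y by apply: endL h2; move: qL; clear; lia.
  have g3 : last y a2 \in gball e L v by rewrite e2; apply: endL hq'.
  have := gball_trans (gball_trans (gball_sym esym g1) g3) (gball_sym esym g2).
  by rewrite (negbTE (new_far xy _))//; clear; lia.
have [h|h] := nbpath_split oL ho; have [h'|h'] := nbpath_split o'L ho'.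
- exact: etree oL o'L h h' oo'.
- by case: (far1 o' o o'L oL h h').
- by case: (far1 o o' oL o'L h' h).
case: h => a1 [x [y [a2 [oE xy xl h1 [h2 _]]]]].
case: h' => a1' [x' [y' [a2' [ooE xy' xl' h1' [h2' _]]]]].
have [a1L a2L] : (size a1 <= L)%N /\ (size a2 <= L)%N by move: oL; rewrite oE size_cat /=; clear; lia.
have [a1'L a2'L] : (size a1' <= L)%N /\ (size a2' <= L)%N by move: o'L; rewrite ooE size_cat /=; clear; lia.
have [[xx yy]|[xx yy]] := new2 xy xy'.
  subst x' y'; have -> : o = a1 ++ y :: a2 by []; rewrite ooE.
  rewrite (etree a1L a1'L h1 h1'); last by rewrite xl xx.
  congr (_ ++ _ :: _); apply: (etree (v := y)) => //.
  - exact: nbpath_start eirr h2.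
  - exact: nbpath_start eirr h2'.
  - by move: oo'; rewrite oE ooE !last_cat.
have g1 : x \in gball e L v by rewrite -xl; exact: endL h1.
have g2 : y \in gball e L v by rewrite -xx -xl'; exact: endL h1'.
have := gball_trans (gball_sym esym g1) g2.
by rewrite (negbTE (new_far xy _))//; clear; lia.
Qed.

End add_edge.

End nonbacktracking.

(** * Partial matchings: joining, cutting and switching *)

Section partial_matchings.
Variables (d n : nat).
Hypothesis d3 : (3 <= d)%N.
Local Notation V := 'I_n.+1.
Local Notation H := ('I_n.+1 * 'I_d)%type.
Implicit Types (s k : {perm H}) (v w : V) (i j : 'I_d) (h g : H).

(* A partial matching of the half-edges, the unmatched ones being fixed, whose
   graph is simple. *)
Record partial_matching k : Prop := PartialMatching {
  pmK : forall h, k (k h) = h;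
  pm_loop : forall h, k h != h -> (k h).1 != h.1;
  pm_simple : forall h g, k h != h -> k g != g -> h.1 = g.1 -> (k h).1 = (k g).1 -> h = g }.

Definition unmatched k : {set H} := [set h | k h == h].

Definition pjoin k h g : {perm H} := (k * tperm h g)%g.

Section join.
Variables (k : {perm H}) (h g : H).
Hypotheses (kh : k h = h) (kg : k g = g) (hg : h != g).

Lemma pjoinL : pjoin k h g h = g. Proof. by rewrite permM kh tpermL. Qed.
Lemma pjoinR : pjoin k h g g = h. Proof. by rewrite permM kg tpermR. Qed.
Lemma pjoinD x : x != h -> x != g -> pjoin k h g x = k x.
Proof.
by move=> xh xg; rewrite permM tpermD//; rewrite eq_sym; [rewrite -kh|rewrite -kg]; rewrite (inj_eq perm_inj).
Qed.

Lemma pjoinE x : pjoin k h g x = if x == h then g else if x == g then h else k x.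
Proof.
have [->|xh] := eqVneq x h; first exact: pjoinL.
by have [->|xg] := eqVneq x g; [exact: pjoinR|exact: pjoinD].
Qed.

Lemma pjoinK : (forall x, k (k x) = x) -> forall x, pjoin k h g (pjoin k h g x) = x.
Proof.
move=> kK x; rewrite [pjoin k h g x]pjoinE; have [->|xh] := eqVneq x h; first exact: pjoinR.
have [->|xg] := eqVneq x g; first exact: pjoinL.
by rewrite pjoinD// -1?[h]kh -1?[g]kg (inj_eq perm_inj).
Qed.

Lemma gadj_pjoin : (forall x, k (k x) = x) -> h.1 != g.1 -> forall v w,
  gadj (edges_of (pjoin k h g)) v w =
  gadj (edges_of k) v w || ((v == h.1) && (w == g.1) || (v == g.1) && (w == h.1)).
Proof.
move=> kK hg1 v w; rewrite !gadj_edges_of//; last exact: pjoinK.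
have [<-|vw] /= := eqVneq v w.
  apply/esym/negbTE; rewrite negb_or; apply/andP; split; apply/negP => /andP[/eqP e1 /eqP e2].
    by rewrite -e1 -e2 eqxx in hg1.
  by rewrite -e1 -e2 eqxx in hg1.
rewrite /nbr; apply/existsP/idP => [[i]|].
  rewrite pjoinE; have [vih|vih] := eqVneq (v, i) h.
    by move=> /eqP <-; rewrite -vih /= !eqxx orbT.
  have [vig|vig] := eqVneq (v, i) g; first by move=> /eqP <-; rewrite -vig /= !eqxx !orbT.
  by move=> ki; apply/orP; left; apply/existsP; exists i.
case/orP => [/existsP[i ki]|]; last first.
  case/orP=> /andP[/eqP -> /eqP ->]; [exists h.2|exists g.2]; rewrite -surjective_pairing.
    by rewrite pjoinL.
  by rewrite pjoinR.
exists i; rewrite pjoinD//; apply: contraNneq vw => e.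
  by rewrite -(eqP ki) e kh -e.
by rewrite -(eqP ki) e kg -e.
Qed.

Lemma pjoin_partial : partial_matching k -> h.1 != g.1 -> ~~ gadj (edges_of k) h.1 g.1 ->
  partial_matching (pjoin k h g).
Proof.
move=> [kK kl ks] hg1 nadj.
have nadj' x : k x != x -> x.1 = h.1 -> (k x).1 != g.1.
  move=> kx xh; apply: contra nadj => /eqP xg; rewrite gadj_edges_of// hg1 /=.
  by apply/existsP; exists x.2; rewrite /nbr -xh -surjective_pairing xg.
have nadj2 x : k x != x -> x.1 = g.1 -> (k x).1 != h.1.
  move=> kx xh; apply: contra nadj => /eqP xg; rewrite gadj_sym gadj_edges_of// eq_sym hg1 /=.
  by apply/existsP; exists x.2; rewrite /nbr -xh -surjective_pairing xg.
split; first exact: pjoinK.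
  move=> x; rewrite pjoinE; have [->|xh] := eqVneq x h; first by move=> _; rewrite eq_sym.
  by have [->|xg] := eqVneq x g => //; exact: kl.
move=> x y; rewrite !pjoinE.
have [->|xh] := eqVneq x h; have [->|yh] := eqVneq y h => //.
- have [->|yg] := eqVneq y g; first by move=> _ _ e; rewrite e eqxx in hg1.
  by move=> _ ky /esym yh1 /esym e; have := nadj' y ky yh1; rewrite e eqxx.
- have [->|xg] := eqVneq x g; first by move=> _ _ e; rewrite e eqxx in hg1.
  by move=> kx _ xh1 e; have := nadj' x kx xh1; rewrite e eqxx.
have [->|xg] := eqVneq x g; have [->|yg] := eqVneq y g => //.
- by move=> _ ky /esym yh1 /esym e; have := nadj2 y ky yh1; rewrite e eqxx.
- by move=> kx _ xh1 e; have := nadj2 x kx xh1; rewrite e eqxx.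
exact: ks.
Qed.

End join.

Section cut.
Variables (k : {perm H}) (g : H).
Hypothesis kP : partial_matching k.
Let kK := pmK kP.

Definition pcut : {perm H} := (k * tperm g (k g))%g.

Lemma pcutE x : pcut x = if (x == g) || (x == k g) then x else k x.
Proof.
rewrite permM; have [->|xg] := eqVneq x g; first by rewrite tpermR.
have [->|xg'] := eqVneq x (k g); first by rewrite kK tpermL.
have kx : k x != g by rewrite -[X in _ != X]kK (inj_eq perm_inj).
have kx' : k x != k g by rewrite (inj_eq perm_inj).
by rewrite tpermD// eq_sym.
Qed.

Lemma pcutK x : pcut (pcut x) = x.
Proof.
rewrite [pcut x]pcutE; case: ifP => [h|]; first by rewrite pcutE h.
move=> /negbT; rewrite negb_or => /andP[xg xg']; rewrite pcutE kK (inj_eq perm_inj).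
by rewrite (negbTE xg) -[X in _ == X](kK g) (inj_eq perm_inj) (negbTE xg').
Qed.

Lemma pcut_partial : partial_matching pcut.
Proof.
split; first exact: pcutK.
  by move=> x; rewrite pcutE; case: ifP => [_|_]; [rewrite eqxx|exact: pm_loop].
move=> x y; rewrite !pcutE; case: ifP => _; first by rewrite eqxx.
by case: ifP => _; [rewrite eqxx|exact: pm_simple].
Qed.

Lemma gadj_pcut v w : gadj (edges_of pcut) v w -> gadj (edges_of k) v w.
Proof.
rewrite !gadj_edges_of//; last exact: pcutK.
case/andP=> vw /existsP[i]; rewrite vw /nbr pcutE; case: ifP => _; last by move=> ?; apply/existsP; exists i.
by rewrite (negbTE vw).
Qed.

End cut.

Lemma partial_matching_gball k r v : partial_matching k ->
  (#|[set h : H | h.1 \in gball (gadj (edges_of k)) r v]| <= d.+1 ^ r * d)%N.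
Proof.
move=> kP; have := card_gball (card_gadj_edges_of (pmK kP)) r v.
set B := gball _ _ _ => Bd; rewrite (_ : [set h | _] = finset.setX B finset.setT); last first.
  by apply/setP => -[x i]; rewrite !inE andbT.
by rewrite cardsX cardsT card_ord leq_mul2r Bd orbT.
Qed.

(* Two unmatched half-edges are matched to the two halves of a far away edge. *)
Lemma partial_matching_complete k : ~~ odd (n.+1 * d) -> partial_matching k ->
  (4 * d.+1 ^ 1 * d + #|unmatched k| < n.+1 * d)%N ->
  exists2 s, s \in simple_matchings d n & (#|[set h | s h != k h]| <= 2 * #|unmatched k|)%N.
Proof.
move=> ev; move: {2}#|unmatched k| (leqnn #|unmatched k|) => m; elim: m k => [|m IH] k km kP big.
  have u0 : unmatched k = finset.set0 by apply/eqP; rewrite -cards_eq0 -leqn0.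
  have kn h : k h != h.
    by move/setP: u0 => /(_ h); rewrite !inE => /negbT.
  exists k; last by rewrite u0 cards0 leqn0 cards_eq0; apply/eqP/setP => h; rewrite !inE eqxx.
  apply/simple_matchingsP; split; first exact: pmK kP.
    by move=> v i; exact: pm_loop kP _ (kn (v, i)).
  by move=> v i j e; have [] := pm_simple kP (kn (v, i)) (kn (v, j)) erefl e.
have [u0|[h1 h1U]] := set_0Vmem (unmatched k).
  by apply: IH => //; rewrite u0 cards0.
have kM : k \in matchings (~: unmatched k).
  by apply/matchingsP; split; [exact: pmK kP|move=> h; rewrite !inE].
have Uev : ~~ odd #|unmatched k|.
  have : ~~ odd #|~: unmatched k|.
    apply/negP => /mcount_odd; rewrite -card_matchings => /eqP; rewrite cards_eq0 => /eqP k0.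
    by rewrite k0 inE in kM.
  have := cardsC (unmatched k); rewrite card_prod !card_ord => e.
  by move: ev; rewrite -e oddD; case: (odd #|unmatched k|); case: (odd #|~: _|).
have [h2 h2U] : exists h2, h2 \in unmatched k :\ h1.
  apply/card_gt0P; move: Uev; rewrite (cardsD1 h1) h1U; by case: #|_ :\ _|.
have [h12 kh2] : h2 != h1 /\ k h2 = h2 by move: h2U; rewrite !inE => /andP[-> /eqP].
have kh1 : k h1 = h1 by move: h1U; rewrite inE => /eqP.
pose Z x := [set h : H | h.1 \in gball (gadj (edges_of k)) 1 x].
have ZB x : (#|Z x| <= d.+1 ^ 1 * d)%N by exact: partial_matching_gball.
(* Neither end of the edge of [g] may be equal or adjacent to the vertices of [h1] and [h2], so that
   the new edges create neither loops nor double edges. This excludes four sets of half-edges around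
   two unit balls. *)
have [g] : exists g, g \in ~: (unmatched k :|: (Z h1.1 :|: Z h2.1) :|: (k @: Z h1.1 :|: k @: Z h2.1)).
  apply/card_gt0P; set W := _ :|: _; have cW := cardsC W; rewrite card_prod !card_ord in cW.
  suff : (#|W| <= #|unmatched k| + 4 * d.+1 ^ 1 * d)%N by rewrite -(ltn_add2l #|W|) addn0 cW => /leq_ltn_trans; apply; rewrite addnC.
  have c2 (A B : {set H}) a b : (#|A| <= a -> #|B| <= b -> #|A :|: B| <= a + b)%N.
    by move=> Aa Bb; apply: leq_trans (leq_card_setU A B) (leq_add Aa Bb).
  have ZB' x : (#|[set k h | h in Z x]| <= d.+1 ^ 1 * d)%N.
    exact: leq_trans (leq_imset_card _ _) (ZB x).
  have := c2 _ _ _ _ (c2 _ _ _ _ (leqnn #|unmatched k|) (c2 _ _ _ _ (ZB h1.1) (ZB h2.1))) (c2 _ _ _ _ (ZB' h1.1) (ZB' h2.1)).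
  by move/leq_trans; apply; rewrite -mulnA; set P := (_ ^ _ * _)%N; clearbody P; clear; lia.
have kK := pmK kP.
have Zk x h : (h \in [set k h | h in Z x]) = (k h \in Z x).
  by rewrite -[h in LHS]kK mem_imset//; exact: perm_inj.
rewrite finset.in_setC !finset.in_setU !Zk !negb_or => /andP[/andP[gU /andP[gZ1 gZ2]] /andP[g'Z1 g'Z2]].
have kg : k g != g by move: gU; rewrite inE.
set g' := k g in kg g'Z1 g'Z2.
have ZP x h : h \notin Z x -> x != h.1 /\ ~~ gadj (edges_of k) x h.1.
  rewrite inE => hx; split; first by apply: contraNneq hx => ->; exact: gball_self.
  by apply: contra hx => /(gball_step (gball_self _ 0 x)).
have [e1 n1] := ZP _ _ gZ1; have [e2 n2] := ZP _ _ gZ2.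
have [e1' n1'] := ZP _ _ g'Z1; have [e2' n2'] := ZP _ _ g'Z2.
have neq (x y : H) : x.1 != y.1 -> x != y by apply: contraNneq => ->.
pose k0 := pcut k g; pose k1 := pjoin k0 h1 g; pose k2 := pjoin k1 h2 g'.
have k0P : partial_matching k0 by exact: pcut_partial.
have k0h1 : k0 h1 = h1 by rewrite pcutE// kh1; case: ifP.
have k0h2 : k0 h2 = h2 by rewrite pcutE// kh2; case: ifP.
have k0g : k0 g = g by rewrite pcutE// eqxx.
have k0g' : k0 g' = g' by rewrite pcutE// eqxx orbT.
have h1g := neq _ _ e1; have h2g := neq _ _ e2; have h1g' := neq _ _ e1'; have h2g' := neq _ _ e2'.
have k1P : partial_matching k1.
  by apply: pjoin_partial => //; apply: contra n1; exact: gadj_pcut.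
have k1h2 : k1 h2 = h2 by rewrite /k1 pjoinD.
have k1g' : k1 g' = g' by rewrite /k1 pjoinD// eq_sym.
have k2P : partial_matching k2.
  apply: pjoin_partial => //; rewrite /k1 gadj_pjoin//; last exact: pmK.
  rewrite !negb_or; apply/and3P; split.
  - by apply: contra n2'; exact: gadj_pcut.
  - apply: contra (pm_loop kP kg) => /andP[_ /eqP ->]; rewrite eqxx.
    by [].
  - by rewrite negb_and e2.
have k2E x : k2 x = if x == h2 then g' else if x == g' then h2 else if x == h1 then g else if x == g then h1 else
    if (x == g) || (x == g') then x else k x.
  by rewrite /k2 pjoinE// /k1 pjoinE// /k0 pcutE.
have U2 : unmatched k2 = unmatched k :\ h1 :\ h2.
  apply/setP => x; rewrite !inE k2E.
  have [->|xh2] /= := eqVneq x h2; first by rewrite eq_sym (negbTE h2g').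
  have [->|xg'] := eqVneq x g'; first by rewrite (negbTE h2g') kK [g == _]eq_sym (negbTE kg) andbF.
  have [->|xh1] /= := eqVneq x h1; first by rewrite eq_sym (negbTE h1g).
  have [->|xg] //= := eqVneq x g; first by rewrite (negbTE h1g) (negbTE kg).
have cU : #|unmatched k| = #|unmatched k2|.+2.
  by rewrite U2 (cardsD1 h1) h1U (cardsD1 h2) h2U.
have [s sM sk2] : exists2 s, s \in simple_matchings d n & (#|[set h | s h != k2 h]| <= 2 * #|unmatched k2|)%N.
  apply: IH => //; first by move: km; rewrite cU; clear; lia.
  by apply: leq_ltn_trans big; rewrite leq_add2l cU -addn2 leq_addr.
exists s => //; rewrite cU.
apply: (@leq_trans (#|[set h | s h != k2 h]| + #|[set h | k2 h != k h]|)).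
  apply: leq_trans (leq_card_setU _ _); apply/subset_leq_card/fintype.subsetP => x; rewrite !inE.
  by apply: contraR; rewrite negb_or !negbK => /andP[/eqP -> /eqP ->].
(* Four changes for two half-edges that become matched: this is the factor 2 of the statement. *)
suff : (#|[set h | k2 h != k h]| <= 4)%N by move: sk2; clear; lia.
apply: (@leq_trans #|[set h1; h2] :|: [set g; g']|).
  apply/subset_leq_card/fintype.subsetP => x; rewrite !inE k2E.
  have [->|xh2] := eqVneq x h2; first by rewrite orbT.
  have [->|xg'] := eqVneq x g'; first by rewrite !orbT.
  have [->|xh1] //= := eqVneq x h1; have [->|xg] //= := eqVneq x g.
  by rewrite eqxx.
by apply: leq_trans (leq_card_setU _ _) _; rewrite !cards2; case: (h1 != h2); case: (g != g').
Qed.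

End partial_matchings.

Lemma fact_le_exp a k K : (a <= K)%N -> (0 < K)%N -> (a`! <= K ^ k * (a - k)`!)%N.
Proof.
move=> aK K0; elim: k => [|k IH]; first by rewrite expn0 mul1n subn0.
apply: leq_trans IH _; rewrite expnSr -mulnA leq_mul2l subnS; apply/orP; right.
case: (a - k)%N (leq_subr k a) => [|b] ba; first by rewrite muln1.
by rewrite factS leq_mul2r (leq_trans ba aK) orbT.
Qed.

(** * Greedy construction of typed treelike matchings *)

Section greedy.
Variables (d n : nat).
Hypothesis d3 : (3 <= d)%N.
Local Notation V := 'I_n.+1.
Local Notation H := ('I_n.+1 * 'I_d)%type.
Implicit Types (s k : {perm H}) (v w : V) (i j : 'I_d) (h g : H).
Variables (Y : finType) (flip : Y -> Y) (yt : H -> Y).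
Hypothesis flipK : involutive flip.
Variables (L B : nat).

Definition typed_treelike k : Prop := [/\ partial_matching k,
  forall v, treelike (gadj (edges_of k)) L v &
  forall h, k h != h -> yt (k h) = flip (yt h)].

(** Bound on the number of half-edges within 3 L of a vertex, those that may not be matched to
    it. *)
Definition greedy_cap : nat := (d.+1 ^ (3 * L) * d)%N.
Local Notation D := greedy_cap.

Local Notation cnt k := (ycount yt (unmatched k)).

Lemma typed_treelike1 : typed_treelike 1%g.
Proof.
split; last by move=> h; rewrite perm1 eqxx.
  by split => h; rewrite ?perm1 ?eqxx// => g; rewrite perm1 eqxx.
move=> v o o' _ _; suff nil q : nbpath (gadj (edges_of (1%g : {perm H}))) v v q -> q = [::].
  by move=> /nil -> /nil ->.
case: q => // w q /= /and3P[_ + _]; rewrite gadj_edges_of; last by move=> h; rewrite !perm1.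
by case/andP=> vw /existsP[i]; rewrite /nbr perm1 (negbTE vw).
Qed.

Lemma far_nadj k (a b : V) : b \notin gball (gadj (edges_of k)) (3 * L) a -> (0 < L)%N ->
  a != b /\ ~~ gadj (edges_of k) a b.
Proof.
move=> far L0; split; first by apply: contraNneq far => <-; exact: gball_self.
apply: contra far => ab; have := gball_step (gball_self _ 0 a) ab.
by apply: gballW; move: L0; clear; lia.
Qed.

Lemma typed_treelike_join k h g : (0 < L)%N -> typed_treelike k -> k h = h -> k g = g -> h != g ->
  yt g = flip (yt h) -> g.1 \notin gball (gadj (edges_of k)) (3 * L) h.1 ->
  typed_treelike (pjoin k h g).
Proof.
move=> L0 [kP kt ky] kh kg hg yg far; have [hg1 nadj] := far_nadj far L0.
split; first exact: pjoin_partial.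
  apply: (treelike_add (e := gadj (edges_of k)) (a := h.1) (b := g.1)) => //.
  - exact: gadj_sym.
  - exact: gadj_irr.
  - by move=> v w; exact: gadj_pjoin (pmK kP) hg1 v w.
move=> x; rewrite pjoinE//; have [->|xh] := eqVneq x h; first by [].
by have [->|xg] := eqVneq x g; [rewrite yg flipK|exact: ky].
Qed.

Lemma unmatched_join k h g : k h = h -> k g = g -> h != g ->
  unmatched (pjoin k h g) = unmatched k :\ h :\ g.
Proof.
move=> kh kg hg; apply/setP => x; rewrite !inE pjoinE//.
have [->|xh] /= := eqVneq x h; first by rewrite eq_sym (negbTE hg) andbF.
by have [->|xg] //= := eqVneq x g; rewrite (negbTE hg).
Qed.

(** A half-edge [h] is matched to each far half-edge of the opposite type in turn; the resulting
    families are disjoint, as the partner of [h] tells them apart. Removing one half-edge of each of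
    two opposite types preserves the balance [B], which controls what remains when no step is
    possible. *)
Lemma greedy_matchings k : (0 < L)%N -> typed_treelike k ->
  (forall y, cnt k y <= cnt k (flip y) + B)%N ->
  exists F : {set {perm H}},
    (forall s, s \in F -> [/\ typed_treelike s, (#|unmatched s| <= #|Y| * (D + B))%N &
       forall h, k h != h -> s h = k h]) /\
    (\prod_y (cnt k y - D)`! <= #|F| ^ 2 * B`! ^ #|Y|)%N.
Proof.
move=> L0; move: {2}#|unmatched k| (leqnn #|unmatched k|) => m.
elim: m k => [|m IH] k km kT bal.
  have c0 y : cnt k y = 0%N.
    apply/eqP; rewrite -leqn0; apply: leq_trans km.
    by apply/subset_leq_card/fintype.subsetP => h; rewrite inE => /andP[].
  exists [set k]; split.
    move=> s; rewrite inE => /eqP ->; split => //.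
    by rewrite (leq_trans km).
  rewrite cards1 exp1n mul1n -(prod_nat_const (mem Y)).
  by apply: leq_prod => y _; rewrite c0 sub0n fact_gt0.
(* When the construction stops, a nonempty class faces a class of at most [D] half-edges, so by
   balance it has at most [D + B]. *)
have [/existsP[y0 /andP[y0p y0D]]|] := boolP [exists y, (0 < cnt k y)%N && (D < cnt k (flip y))%N]; last first.
  rewrite negb_exists => /forallP stop; have cB y : (cnt k y <= D + B)%N.
    have := stop y; rewrite negb_and -leqNgt leqn0 -leqNgt => /orP[/eqP ->//|yD].
    by apply: leq_trans (bal y) _; rewrite leq_add2r.
  exists [set k]; split.
    move=> s; rewrite inE => /eqP ->; split => //.
    rewrite -sum1_card (partition_big yt xpredT)//=.
    rewrite -[#|Y|]sum1_card big_distrl /=; apply: leq_sum => y _; rewrite mul1n.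
    by apply: leq_trans (cB y); rewrite sum1_card; apply: eq_leq; apply: eq_card => h; rewrite [RHS]inE.
  rewrite cards1 exp1n mul1n -(prod_nat_const (mem Y)).
  apply: leq_prod => y _; apply: leq_fact; rewrite leq_subLR; exact: cB.
(* Here the smaller of the two opposite classes is chosen: the number of partners in the other one
   then dominates both factors lost by the factorials. *)
have {y0 y0p y0D}[y [yp yD ycmp]] : exists y, [/\ (0 < cnt k y)%N, (D < cnt k (flip y))%N & (cnt k y <= cnt k (flip y))%N].
  have [le|lt] := leqP (cnt k y0) (cnt k (flip y0)); first by exists y0.
  exists (flip y0); rewrite flipK; split; [exact: leq_ltn_trans y0D|exact: ltn_trans lt|exact: ltnW].
have [kP kt ky] := kT.
have [h] := card_gt0P yp; rewrite finset.in_set => /andP[hU /eqP yh]; subst y.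
have kh : k h = h by move: hU; rewrite inE => /eqP.
pose N := [set g : H | g.1 \in gball (gadj (edges_of k)) (3 * L) h.1].
pose T := [set g in unmatched k | yt g == flip (yt h)] :\: N.
have TD : (cnt k (flip (yt h)) - D <= #|T|)%N.
  rewrite leq_subLR; have := cardsID N [set g in unmatched k | yt g == flip (yt h)].
  rewrite -/T -[X in _ = X]/(cnt k _) => <-; rewrite leq_add2r.
  by apply: leq_trans (partial_matching_gball _ _ kP); exact/subset_leq_card/subsetIr.
have TP g : g \in T -> [/\ k g = g, yt g = flip (yt h), h != g &
    g.1 \notin gball (gadj (edges_of k)) (3 * L) h.1].
  rewrite !inE => /andP[far /andP[/eqP kg /eqP yg]]; split => //.
  by apply: contraNneq far => <-; exact: gball_self.
have [g0 g0T] : exists g, g \in T by apply/card_gt0P; apply: leq_trans TD; rewrite subn_gt0.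
pose c y := (cnt k y - ((y == yt h) + (y == flip (yt h))))%N.
have cE g y : g \in T -> cnt (pjoin k h g) y = c y.
  move=> /TP[kg yg hg _]; rewrite unmatched_join// ycountD1; last first.
    by rewrite !inE eq_sym hg kg eqxx.
  by rewrite (ycountD1 _ _ hU) yg /c subnDA.
have c1 y : (c y <= c (flip y) + B)%N.
  rewrite /c (can2_eq flipK flipK) (inj_eq (can_inj flipK)) [in X in (_ - X + _)%N]addnC.
  by move: (bal y); move: (cnt k y) (cnt k (flip y)) ((y == yt h) + (y == flip (yt h)))%N => a b e; clear; lia.

have FT g : exists F : {set {perm H}}, g \in T ->
    (forall s, s \in F -> [/\ typed_treelike s, (#|unmatched s| <= #|Y| * (D + B))%N &
       forall x, pjoin k h g x != x -> s x = pjoin k h g x]) /\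
    (\prod_y (c y - D)`! <= #|F| ^ 2 * B`! ^ #|Y|)%N.
  have [gT|] := boolP (g \in T); last by exists finset.set0.
  have [kg yg hg far] := TP g gT.
  have [|||F [F1 F2]] := IH (pjoin k h g).
  - rewrite unmatched_join//; have gU : g \in unmatched k :\ h by rewrite !inE eq_sym hg kg eqxx.
    by move: km; rewrite (cardD2 hU gU) ltnS => /ltnW.
  - exact: typed_treelike_join.
  - by move=> y; rewrite !cE.
  exists F => _; split => //; apply: leq_trans F2; apply: eq_leq.
  by apply: eq_bigr => y _; rewrite cE.
have [F FP] := fin_all_exists FT.
have [g1 g1T g1min] : exists2 g1, g1 \in T & forall g, g \in T -> (#|F g1| <= #|F g|)%N.
  by case: (@arg_minnP _ g0 (mem T) (fun g => #|F g|) g0T) => g1 ? ?; exists g1.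
exists (\bigcup_(g in T) F g); split.
  move=> s /bigcupP[g gT sF]; have [/(_ s sF)[sT sU sk] _] := FP g gT; split => // x kx.
  have [kg _ hg _] := TP g gT.
  have xh : x != h by apply: contraNneq kx => ->; rewrite kh.
  have xg : x != g by apply: contraNneq kx => ->; rewrite kg.
  by have := sk x; rewrite pjoinD//; apply.
have Fh g s : g \in T -> s \in F g -> s h = g.
  move=> gT sF; have [/(_ s sF)[_ _ sk] _] := FP g gT; have [kg _ hg _] := TP g gT.
  by have := sk h; rewrite pjoinL// eq_sym => /(_ hg).
have cF : (#|T| * #|F g1| <= #|\bigcup_(g in T) F g|)%N.
  rewrite -sum_nat_const -[leqRHS]sum1_card [leqRHS](partition_big (fun s : {perm H} => s h) (mem T)) /=; last first.
    by move=> s /bigcupP[g gT /(Fh g s gT) ->].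
  apply: leq_sum => g gT; apply: leq_trans (g1min g gT) _; rewrite sum1_card.
  apply/subset_leq_card/fintype.subsetP => s sF; rewrite unfold_in; apply/andP; split.
    by apply/bigcupP; exists g.
  by rewrite (Fh g).
have [_ g1P] := FP g1 g1T.
set K := (cnt k (flip (yt h)) - D)%N in TD.
have K0 : (0 < K)%N by rewrite subn_gt0.
apply: (@leq_trans (K ^ 2 * \prod_y (c y - D)`!)); last first.
  apply: leq_trans (_ : (K ^ 2 * (#|F g1| ^ 2 * B`! ^ #|Y|) <= _)%N); first by rewrite leq_mul2l g1P orbT.
  rewrite mulnA -expnMn leq_mul2r leq_sqr; apply/orP; right.
  by apply: leq_trans cF; rewrite leq_mul2r TD orbT.
(* Each choice of a partner pays for one factor of each of the two types, or for two factors of a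
   type that is its own flip. *)
have -> : (K ^ 2 = \prod_y K ^ ((y == yt h) + (y == flip (yt h))))%N.
  rewrite -expn_sum big_split /=; congr (_ ^ _)%N.
  have s1 a : (\sum_(i : Y) (i == a) = 1)%N.
    by rewrite (bigD1 a)//= eqxx big1// => i /negbTE ->.
  by rewrite !s1.
rewrite -big_split /=; apply: leq_prod => y _.
have -> : (c y - D = (cnt k y - D) - ((y == yt h) + (y == flip (yt h))))%N by rewrite /c subnAC.
have [yy|] := boolP ((y == yt h) || (y == flip (yt h))); last first.
  by rewrite negb_or => /andP[/negbTE -> /negbTE ->]; rewrite expn0 mul1n subn0.
apply: fact_le_exp => //; rewrite /K; apply: leq_sub2r.
by case/orP: yy => /eqP ->.
Qed.

End greedy.

(** * Walks in treelike matchings *)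

Section treelike_walks.
Variables (d n : nat).
Hypothesis d3 : (3 <= d)%N.
Local Notation V := 'I_n.+1.
Local Notation H := ('I_n.+1 * 'I_d)%type.
Implicit Types (v w : V) (i j : 'I_d) (h : H) (u : seq nat).

Section simple.
Variable s : {perm H}.
Hypothesis sM : s \in simple_matchings d n.
Local Notation e := (gadj (edges_of s)).
Local Notation later := (all (fun k => 0 < k < d)%N).

Let sK : forall h, s (s h) = h. Proof. by case/simple_matchingsP: sM. Qed.
Let si v : injective (nbr s v). Proof. by case/simple_matchingsP: sM. Qed.

Let step_index h (k : nat) : 'I_d := ordd d3 (bump h.2 k.-1).

Let step_indexE h k : (0 < k < d)%N -> step_index h k = bump h.2 k.-1 :> nat.
Proof.
move=> kd; rewrite /step_index ordd_val// /bump; have := ltn_ord h.2; move: kd.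
by clear; case: leqP => /=; lia.
Qed.

Let step_index_neq h k : (0 < k < d)%N -> step_index h k != h.2.
Proof.
move=> kd; apply/eqP => /(congr1 val) /=; rewrite step_indexE// => /eqP.
by rewrite eq_sym (negbTE (neq_bump _ _)).
Qed.

Let step_index_inj h k k' : (0 < k < d)%N -> (0 < k' < d)%N -> step_index h k = step_index h k' -> k = k'.
Proof.
move=> kd kd' /(congr1 val) /=; rewrite !step_indexE// => /(can_inj (bumpK _)).
by move: kd kd'; clear; lia.
Qed.

Let eS v i : e v (s (v, i)).1.
Proof. by rewrite gadj_simple//; apply/existsP; exists i. Qed.

Definition vertex_seq h u : seq V := map fst (scanl (wstep d3 s) h u).

Let nbpath_vertex_seq h u : later u -> nbpath e (s h).1 h.1 (vertex_seq h u).
Proof.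
elim: u h => [//|k u IH] h /= /andP[kd /IH] {}IH.
rewrite {1 2}/wstep -/(step_index h k) eS /=; apply/andP; split.
  apply: contra (step_index_neq h kd) => /eqP sh; apply/eqP/(@si h.1).
  by rewrite /nbr sh -surjective_pairing.
by have := IH (wstep d3 s h k); rewrite {1}/wstep sK.
Qed.

Let vertex_seq_inj h u u' : later u -> later u' -> vertex_seq h u = vertex_seq h u' -> u = u'.
Proof.
elim: u u' h => [|k u IH] [|k' u'] h //= /andP[kd ul] /andP[kd' ul'] [e1 e2].
have kk' : k = k' by apply: (step_index_inj kd kd'); exact: (@si h.1) e1.
by subst k'; congr cons; exact: IH e2.
Qed.

Definition walk_path v u : seq V :=
  if u is i :: u' then let h := s (v, ordd d3 i.-1) in h.1 :: vertex_seq h u' else [::].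

Lemma size_walk_path v u : size (walk_path v u) = size u.
Proof. by case: u => //= i u; rewrite size_map size_scanl. Qed.

Lemma last_walk_path v u : last v (walk_path v u) = walk d3 s v u.
Proof.
case: u => //= i u; set h := s _; move: h => h.
by elim: u h => //= k u IH h; rewrite IH.
Qed.

Lemma nbpath_walk_path v u : tree_label d u -> nbpath e v v (walk_path v u).
Proof.
case: u => //= i u /andP[id ul]; rewrite eS /=; apply/andP; split.
  by case/simple_matchingsP: sM => _ /(_ v (ordd d3 i.-1)).
by have := nbpath_vertex_seq (s (v, ordd d3 i.-1)) ul; rewrite sK.
Qed.

Lemma walk_path_inj v u u' : tree_label d u -> tree_label d u' ->
  walk_path v u = walk_path v u' -> u = u'.
Proof.
case: u u' => [|i u] [|i' u'] //= /andP[id ul] /andP[id' ul'] [e1 e2].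
have /(congr1 val) /= := @si v _ _ e1; rewrite !ordd_val; [|by move: id id'; clear; lia..].
move=> ii; have {ii}ii : i = i' by move: id id' ii; clear; lia.
by subst i'; congr cons; exact: vertex_seq_inj e2.
Qed.

Variables (t : nat) (v : V).
Hypothesis vT : treelike e t.+1 v.

Lemma treelike_walk_inj u u' : tree_label d u -> tree_label d u' -> (size u <= t.+1)%N -> (size u' <= t.+1)%N ->
  walk d3 s v u = walk d3 s v u' -> u = u'.
Proof.
move=> ul ul' ut ut'; rewrite -!last_walk_path => ww; apply: (walk_path_inj (v := v)) => //.
by apply: vT ww; rewrite ?size_walk_path//; exact: nbpath_walk_path.
Qed.

Definition walk_ball : {ffun S_ball d t -> V} := [ffun u => walk d3 s v (tree_val (val u))].

Lemma walk_rcons u k : tree_label d (rcons u k) ->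
  exists2 i, walk d3 s v (rcons u k) = nbr s (walk d3 s v u) i &
   (if u is j :: u' then i = step_index (foldl (wstep d3 s) (s (v, ordd d3 j.-1)) u') k else i = ordd d3 k.-1).
Proof.
case: u => [|j u] /=; first by exists (ordd d3 k.-1).
by rewrite foldl_rcons_step => _; eexists; last by [].
Qed.

Lemma walk_child u k : tree_label d (rcons u k) -> e (walk d3 s v u) (walk d3 s v (rcons u k)).
Proof. by move=> /walk_rcons[i -> _]; exact: eS. Qed.

(** The half-edge of arrival leads back to the parent; any other one leads to the child whose label
    is obtained by [unbump]. *)
Lemma walk_nbr u i : tree_label d u -> exists u', [/\ tree_label d u', is_child u u' || is_child u' u &
  walk d3 s v u' = nbr s (walk d3 s v u) i].
Proof.
case: u => [_|j u].
  exists [:: i.+1]; split => //=; first by rewrite ltn_ord.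
  by rewrite /nbr ordd_ord.
move=> ul; rewrite /=; set h := foldl _ _ u.
have [ih|ih] := eqVneq i h.2.
  exists (belast j u); case/lastP: u ul @h ih => [|u k] ul h ih.
    by split => //; rewrite /nbr ih -surjective_pairing sK.
  rewrite belast_rcons; split.
  - by move: ul; rewrite -rcons_cons tree_label_rcons => /andP[].
  - by rewrite eqxx orbT.
  rewrite /nbr ih -surjective_pairing /h foldl_rcons_step /wstep sK.
  by [].
pose k := (unbump h.2 i).+1.
have kd : (0 < k < d)%N.
  rewrite /k /=; have := ltn_ord i; have := ltn_ord h.2; move: ih; rewrite -(inj_eq val_inj) /= /unbump.
  by clear; case: ltnP => /=; lia.
have ul' : tree_label d (rcons (j :: u) k) by rewrite tree_label_rcons ul.
exists (rcons (j :: u) k); split => //; first by rewrite is_child_rcons eqxx.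
rewrite /= foldl_rcons_step -/h; have -> : i = step_index h k.
  by apply: val_inj; rewrite /= step_indexE// unbumpK.
by [].
Qed.

(** The level [t.+1] in the hypothesis is what excludes edges between two vertices at distance t
    from the center, so that the copy is induced. *)
Lemma walk_ball_embedding : walk_ball \in embeddings (edges_of s).
Proof.
have uS (u : S_ball d t) : (size (val u) <= t)%N by have := valP u; rewrite /= in_S_ball.
have ul (u : S_ball d t) : tree_label d (val u) by exact: tree_valP.
apply/embeddingsP; split=> [u w|u w]; rewrite !ffunE.
  by move/treelike_walk_inj => uw; apply/val_inj/tree_inj/uw => //; exact: leq_trans (uS _) _.
apply/idP/idP; last first.
  case/orP=> /is_childP[k uk]; rewrite ?uk; last rewrite gadj_sym.
    by apply: walk_child; rewrite -uk.
  by apply: walk_child; rewrite -uk.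
rewrite gadj_simple// => /existsP[i /eqP iw].
have [u' [ul' uu' u'E]] := walk_nbr i (ul u); rewrite iw in u'E.
have u't : (size u' <= t.+1)%N.
  by case/orP: uu' => /is_child_size; have := uS u => /=; clear; lia.
have u'w := treelike_walk_inj ul' (ul w) u't (leq_trans (uS w) (leqnSn t)) u'E.
by rewrite /tadj -u'w.
Qed.

Lemma walk_ball_increasing tau : sorted_by s tau -> increasing walk_ball tau.
Proof.
move=> so; apply/increasingP => u w w' /is_childP[k wk] /is_childP[k' wk'].
rewrite wk wk' !last_rcons !ffunE wk wk' => kk'.
have lk : tree_label d (rcons (val u) k) by rewrite -wk; exact: tree_valP.
have lk' : tree_label d (rcons (val u) k') by rewrite -wk'; exact: tree_valP.
have [i -> iE] := walk_rcons lk; have [i' -> iE'] := walk_rcons lk'.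
rewrite sorted_by_lt//.
move: lk lk'; rewrite !tree_label_rcons => /andP[_ kd] /andP[_ kd'].
case: (tree_val (val u)) iE iE' kd kd' => [|j u'] -> -> kd kd'.
  by rewrite !ordd_val//; move: kd kd' kk'; clear; lia.
rewrite !step_indexE// /bump; move: kd kd' kk'; clear.
by case: leqP; case: leqP => /=; lia.
Qed.

Lemma walk_ball_root : walk_ball (rootS t d3) = v.
Proof. by rewrite ffunE. Qed.

End simple.

Section colors.
Variables (r : nat) (M : finType).
Hypothesis r0 : (0 < r)%N.
Local Notation X := {ffun S_ball d r -> M}.

(* A coloring read along walks in a ball where all half-edges are typed by [x]. *)
Lemma typed_xwalk (s : {perm H}) (e : rel V) (x : {ffun V -> X}) (f : {ffun V -> M}) v :
  (forall h, s (s h) = h) -> (forall w i, (s (w, i)).1 != w -> e w (s (w, i)).1) ->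
  (forall w, f w = x w (rootS r d3)) ->
  (forall h, h.1 \in gball e r v ->
     ytype d3 (s h).2 (x (s h).1) = yflip d3 r0 (ytype d3 h.2 (x h.1))) ->
  xwalk r d3 s f v = x v.
Proof.
move=> sK se fx typ; apply/ffunP => u; rewrite ffunE.
(* Induction on the length of the word: its first letter crosses one edge, the agreement of types
   there identifies the color prescribed from both ends, and the rest of the word is read from the
   neighbor. *)
suff main m : (m <= r)%N -> forall w, (forall h, h.1 \in gball e m w ->
     ytype d3 (s h).2 (x (s h).1) = yflip d3 r0 (ytype d3 h.2 (x h.1))) ->
    forall u : tree d, (size u <= m)%N -> f (walk d3 s w (tree_val u)) = x w (toS r d3 u).
  rewrite (main r (leqnn r) v typ) ?(in_S_ball d3)//; last by have := valP u; rewrite /= in_S_ball.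
  by congr (x v _); apply: val_inj; rewrite toSK//; have := valP u; rewrite /= in_S_ball.
clear u; elim: m => [|m IH] mr w typw u um.
  have u0 : tree_val u = [::] by apply/eqP; rewrite -size_eq0 -leqn0.
  rewrite u0 /= fx; congr (x w _); apply: val_inj; rewrite toSK ?u0//.
  by apply: tree_inj; rewrite u0.
case uE : (tree_val u) => [|i u'].
  by rewrite /= fx; congr (x w _); apply: val_inj; rewrite toSK ?uE//; apply: tree_inj; rewrite uE.
have ul := tree_valP u; rewrite uE /= in ul; have /andP[/andP[i0 id] u'l] := ul.
have i1 : (i.-1 < d)%N by move: i0 id; clear; lia.
pose j := Ordinal i1; have ij : j.+1 = i by rewrite /= prednK.
pose h := (w, j); have jd : (0 < j.+1 <= d)%N by rewrite ltn_ord.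
(* [u0] is [u] seen from the half-edge [h], so that its first letter is 1 *)
pose u0 : tree d := rotTV j.+1 u.
have u0E : tree_val u0 = 1%N :: u' by rewrite rotTVE// uE /= /rotlV ij eqxx.
have ru0 : rotw j.+1 (tree_val u0) = i :: u' by rewrite u0E /= /rotl /= ij.
have fu0 : (size (flipT u0) <= m)%N.
  rewrite flipTE// u0E /=; move: um; rewrite uE /=; clear.
  by case: u'.
have wE : walk d3 s w (i :: u') = walk d3 s (s h).1 (rotw (s h).2.+1 (flipw (tree_val u0))).
  by rewrite -ru0; have := @walk_flip d n d3 s (s h) (tree_val u0) sK (tree_valP u0); rewrite sK.
rewrite [walk d3 s w (i :: u')]wE.
have typh : ytype d3 (s h).2 (x (s h).1) = yflip d3 r0 (ytype d3 h.2 (x h.1)).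
  by apply: typw; exact: gball_self.
have idS : (0 < (s h).2.+1 <= d)%N by rewrite ltn_ord.
have -> : rotw (s h).2.+1 (flipw (tree_val u0)) = tree_val (rotT (s h).2.+1 (flipT u0)).
  by rewrite rotTE// flipTE.
rewrite IH //; first last.
- by rewrite rotTE//; move: fu0; case: (tree_val (flipT u0)).
- move=> h' hh'; apply: typw; have [wh|wh] := eqVneq (s h).1 w; first by apply: gballS; rewrite -wh.
  by rewrite -[m.+1]add1n; apply: gball_trans hh'; apply: gball_step (gball_self _ 0 w) (se _ _ wh).
- exact: ltnW.
have u0r : (size (tree_val u0) <= r)%N by move: um mr; rewrite u0E uE /=; clear; lia.
have uEb : u0 \in E_ball d r.
  by rewrite in_E_ball// u0E /=; move: um mr; rewrite uE /=; clear; lia.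
have fE : flipT u0 \in E_ball d r.
  by have := flipT_E d3 r0 [` uEb]%fset => /= <-; exact: valP.
have e1 := congr1 (fun y : {ffun E_ball d r -> M} => y [` fE]%fset) typh.
rewrite !ffunE /= in e1; rewrite e1.
have -> : fsval (toE d3 r0 (flipT (flipT u0))) = u0 by rewrite flipTK// insubdK.
congr (x w (toS r d3 _)); apply: tree_inj.
by rewrite -[i.-1.+1]/(j.+1 : nat) rotTE// ru0 uE.
Qed.

End colors.

End treelike_walks.

Lemma gball_sub (V : finType) (e e' : rel V) L k v : (forall x, x \in gball e' L v -> e x =1 e' x) ->
  (k <= L)%N -> gball e k v \subset gball e' k v.
Proof.
move=> ee'; elim: k => [//|k IH] kL; apply/fintype.subsetP => x /bigcupP[w].
move=> /(fintype.subsetP (IH (ltnW kL))) wv; rewrite !inE => /orP[/eqP ->|].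
  exact: gballS.
by rewrite ee'; [exact: gball_step wv|exact: gballW (ltnW kL) wv].
Qed.

(** * Profiles of matchings that are mostly treelike *)

Section rooted_embeddings.
Variables (d t n : nat).
Hypothesis d3 : (3 <= d)%N.
Local Notation V := 'I_n.+1.
Local Notation S := (S_ball d t).
Local Notation rt := (rootS t d3).

Definition rooted_auts : {set {perm S}} :=
  locked [set phi : {perm S} | `[< ball_aut phi >] && (phi rt == rt)].

Lemma rooted_autsP (phi : {perm S}) : reflect (ball_aut phi /\ phi rt = rt) (phi \in rooted_auts).
Proof. by rewrite /rooted_auts -lock inE; apply: (iffP andP) => [[/asboolP h /eqP]|[h ->]]; split => //; exact/asboolP. Qed.

Variable E : graph n.
Hypothesis degE : forall v, (#|[set w | gadj E v w]| <= d)%N.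

(** From the center outwards, [b] stays inside the image of [b0], because interior vertices have all
    their neighbors there. *)
Lemma rooted_embedding_aut (b0 b : {ffun S -> V}) : b0 \in embeddings E -> b \in embeddings E ->
  b rt = b0 rt -> exists2 phi, phi \in rooted_auts & b = [ffun u => b0 (phi u)].
Proof.
move=> b0E bE brt; have [b0i b0a] := embeddingsP _ _ b0E; have [bi ba] := embeddingsP _ _ bE.
have img (u : S) : exists u', b u = b0 u' /\ (size (val u') <= size (val u))%N.
  elim/(@S_ind d t d3): u => [|u w uw [u' [uu' su']]]; first by exists rt; rewrite brt.
  have ut : (size (val u') < t)%N.
    have := valP w; rewrite /= in_S_ball// (is_child_size uw).
    by move: su' => /=; clear; lia.
  have : gadj E (b0 u') (b w) by rewrite -uu' ba /tadj uw.
  move=> /(embedding_nbrs d3 degE b0E ut)[w' uw' ->]; exists w'; split => //.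
  rewrite (is_child_size uw); case/orP: uw' => /is_child_size; move: su' => /=; clear; lia.
have [phi phiE] := fin_all_exists img.
have phii : injective phi by move=> u w uw; apply: bi; rewrite (phiE u).1 (phiE w).1 uw.
exists (perm phii); last by apply/ffunP => u; rewrite ffunE permE; exact: (phiE u).1.
apply/rooted_autsP; split; last by rewrite permE; apply: b0i; rewrite -(phiE rt).1.
by move=> u w; rewrite !permE -[LHS]b0a -(phiE u).1 -(phiE w).1 ba.
Qed.

Lemma card_rooted_embeddings v (b0 : {ffun S -> V}) : b0 \in embeddings E -> b0 rt = v ->
  (#|[set b in embeddings E | b rt == v]| <= #|rooted_auts|)%N.
Proof.
move=> b0E b0v; pose F (phi : {perm S}) : {ffun S -> V} := [ffun u => b0 (phi u)].
apply: leq_trans (leq_imset_card F (mem rooted_auts)).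
apply/subset_leq_card/fintype.subsetP => b; rewrite finset.in_set => /andP[bE /eqP bv].
have [phi phiA ->] := rooted_embedding_aut b0E bE (etrans bv (esym b0v)).
by apply/imsetP; exists phi.
Qed.

Lemma embedding_rooted_aut b0 phi : b0 \in embeddings E -> phi \in rooted_auts ->
  ([ffun u => b0 (phi u)] : {ffun S -> V}) \in embeddings E.
Proof.
move=> /embeddingsP[b0i b0a] /rooted_autsP[phiA _]; apply/embeddingsP; split.
  by move=> u w; rewrite !ffunE => /b0i /perm_inj.
by move=> u w; rewrite !ffunE b0a phiA.
Qed.

End rooted_embeddings.

Section profile_estimate.
Variables (R : realType) (d r n : nat) (M : pointedFinType).
Hypothesis d3 : (3 <= d)%N.
Local Notation V := 'I_n.+1.
Local Notation H := ('I_n.+1 * 'I_d)%type.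
Local Notation X := {ffun S_ball d r -> M}.
Local Notation N := (n.+1%:R : R).
Variables (s : {perm H}) (f : {ffun V -> M}) (g : {ffun V -> X}) (W : {set V}).
Hypothesis sM : s \in simple_matchings d n.
Hypothesis treeW : forall v, v \notin W -> treelike (gadj (edges_of s)) r.+1 v.
Hypothesis gW : forall v, v \notin W -> xwalk r d3 s f v = g v.
Variables (q : mass R M (S_ball d r)) (K : R).
Hypothesis q_aut : aut_invariant q.
Hypothesis q1 : \sum_x q x = 1.
Hypothesis gq : forall x, N * q x - K <= (xcount g x)%:R.
Hypothesis W_lt : (#|W| < n.+1)%N.

Local Notation E := (edges_of s).
Let degE : forall v, (#|[set w | gadj E v w]| <= d)%N.
Proof. by apply: card_gadj_edges_of; case/simple_matchingsP: sM. Qed.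
Local Notation A := (rooted_auts r d3).
Local Notation b0 v := (walk_ball d3 s r v).

Let v0 : exists v, v \notin W.
Proof.
have : (0 < #|~: W|)%N by rewrite -(ltn_add2l #|W|) addn0 cardsC card_ord.
by case/card_gt0P => v; rewrite inE => vW; exists v.
Qed.

Let b0E v : v \notin W -> b0 v \in embeddings E.
Proof. by move=> vW; apply: walk_ball_embedding => //; exact: treeW. Qed.

Let kapE (b : {ffun S_ball d r -> V}) : b \in embeddings E -> #|[set tau | increasing b tau]| = #|[set tau | increasing (b0 (xchoose v0)) tau]|.
Proof.
move=> /embeddingsP[bi _]; apply: card_increasing => //.
by have /embeddingsP[] := b0E (xchooseP v0).
Qed.

Local Notation kappa := #|[set tau | increasing (b0 (xchoose v0)) tau]|.

(** Every order sorts some matching of the same graph, and the walks of that matching from [v] form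
    an increasing embedding; so the embeddings centered at [v], at most [#|A|] many, cover all
    orders. *)
Let kappa_auts : (ntau n <= kappa * #|A|)%N.
Proof.
set v := xchoose v0; have vW : v \notin W := xchooseP v0.
apply: (@leq_trans (\sum_(b in [set b in embeddings E | b (rootS r d3) == v]) #|[set tau | increasing b tau]|)).
  rewrite /ntau -sum1_card; under [leqRHS]eq_bigr do rewrite -sum1_card.
  rewrite [leqRHS](exchange_big_dep xpredT)//=; apply: leq_sum => tau _.
  have [s' s'M /andP[/eqP s'E so]] := sorted_by_ex tau (edges_of_regular sM).
  have vT : treelike (gadj (edges_of s')) r.+1 v by rewrite s'E; exact: treeW.
  rewrite sum1_card; apply/card_gt0P; exists (walk_ball d3 s' r v).
  rewrite unfold_in /= finset.in_set -s'E walk_ball_embedding// walk_ball_root eqxx /=.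
  by rewrite inE walk_ball_increasing.
rewrite (eq_bigr (fun=> kappa)) => [|b]; last by rewrite inE => /andP[/kapE].
rewrite sum_nat_const mulnC leq_mul2l (card_rooted_embeddings degE (b0E vW)) ?orbT//.
by rewrite walk_ball_root.
Qed.

Let ginv (x : X) (phi : {perm S_ball d r}) : X := [ffun u => x ((phi^-1)%g u)].

Let ball_aut_inv (phi : {perm S_ball d r}) : ball_aut phi -> ball_aut (phi^-1)%g.
Proof. by move=> phiA u w; rewrite -{2}[u](permKV phi) -{2}[w](permKV phi) phiA. Qed.

(** A vertex outside [W] whose ball is colored by [x] moved by [phi] yields, after composition with
    [phi], an embedding colored by [x]. *)
Let count_colored (x : X) : (\sum_(phi in A) (xcount g (ginv x phi) - #|W|) <=
  #|[set b in embeddings E | color f b == x]|)%N.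
Proof.
pose bb (z : {perm S_ball d r} * V) : {ffun S_ball d r -> V} := [ffun u => b0 z.2 (z.1 u)].
pose Z := [set z : {perm S_ball d r} * V | [&& z.1 \in A, z.2 \notin W & g z.2 == ginv x z.1]].
have bi : {in Z &, injective bb}.
  move=> [phi v] [phi' v']; rewrite !finset.in_set /= => /and3P[phiA vW _] /and3P[phiA' vW' _] bb'.
  have [_ rphi] := rooted_autsP _ _ phiA; have [_ rphi'] := rooted_autsP _ _ phiA'.
  have e u : bb (phi, v) u = bb (phi', v') u by rewrite bb'.
  have vv' : v = v'.
    by have := e (rootS r d3); rewrite !ffunE /= rphi rphi'.
  subst v'; congr pair; apply/permP => u.
  have [b0i _] := embeddingsP _ _ (b0E vW).
  by apply: b0i; have := e u; rewrite /bb !(ffunE (fun u => b0 _ _)).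
apply: (@leq_trans #|bb @: Z|); last first.
  apply/subset_leq_card/fintype.subsetP => _ /imsetP[[phi v] + ->].
  rewrite [_ \in Z]finset.in_set /= => /and3P[phiA vW /eqP gv]; rewrite finset.in_set embedding_rooted_aut ?b0E//.
  apply/eqP/ffunP => u; rewrite !ffunE /=.
  have := gW vW; rewrite gv => /ffunP/(_ (phi u)); rewrite !ffunE permK.
  by [].
rewrite card_in_imset//.
rewrite -[leqRHS]sum1_card [leqRHS](partition_big (fun z : {perm S_ball d r} * V => z.1) (mem A)) /=; last first.
  by move=> z; rewrite finset.in_set => /and3P[].
apply: leq_sum => phi phiA; rewrite sum1_card leq_subLR.
have pinj : injective (fun v : V => (phi, v)) by move=> v v' [].
rewrite /xcount; set U := [set v | _]; rewrite -(cardsID W U); apply: leq_add.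
  exact/subset_leq_card/subsetIr.
rewrite -(card_imset _ pinj); apply/subset_leq_card/fintype.subsetP => _ /imsetP[v + ->].
move=> /finset.setDP[vU vW]; rewrite finset.in_set in vU.
by rewrite unfold_in /= finset.in_set /= phiA vW vU eqxx.
Qed.

Let profile_ge0 (x : X) : 0 <= profile E f R x.
Proof. by rewrite /profile divr_ge0. Qed.

Let profile_ge (x : X) : q x - (K + #|W|%:R) / N <= profile E f R x.
Proof.
have N0 : 0 < N by rewrite ltr0n.
have nt : (0 : R) < (ntau n)%:R by rewrite ltr0n ntau_gt0.
set K' := K + _; have [le0|gt0] := leP (q x - K' / N) 0; first exact: le_trans le0 (profile_ge0 _).
have gt1 : 0 <= N * q x - K'.
  have : 0 < N * (q x - K' / N) by rewrite mulr_gt0.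
  by rewrite mulrBr mulrCA divff ?gt_eqF// mulr1 => /ltW.
rewrite /profile (sum_tau_count) natrM ler_pdivlMr ?mulr_gt0//.
rewrite (eq_bigr (fun=> kappa)) => [|b /andP[/kapE]//].
rewrite sum_nat_const natrM.
have h1 : #|A|%:R * (N * q x - K') <= #|[set b in embeddings E | color f b == x]|%:R.
  apply: le_trans (_ : _ <= (\sum_(phi in A) (xcount g (ginv x phi) - #|W|))%:R) _; last first.
    by rewrite ler_nat; exact: count_colored.
  rewrite natr_sum [leLHS]mulr_natl -sumr_const; apply: ler_sum => phi phiA.
  have [phiB _] := rooted_autsP _ _ phiA.
  have := gq (ginv x phi); rewrite (q_aut (ball_aut_inv phiB)) => h.
  have h2 : (xcount g (ginv x phi))%:R <= (xcount g (ginv x phi) - #|W|)%:R + #|W|%:R :> R.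
    by rewrite -natrD ler_nat; case: leqP; lia.
  by rewrite /K'; lra.
have -> : (q x - K' / N) * ((ntau n)%:R * N) = (ntau n)%:R * (N * q x - K').
  by rewrite mulrCA; congr (_ * _); rewrite mulrBl divfK ?gt_eqF// mulrC.
apply: le_trans (_ : (kappa * #|A|)%:R * (N * q x - K') <= _).
  by rewrite ler_wpM2r// ler_nat.
rewrite natrM -mulrA [leRHS]mulrC ler_wpM2l//.
by apply: le_trans h1 _; rewrite ler_nat; apply: eq_leq; apply: eq_card => b; rewrite inE unfold_in.
Qed.

(** Only lower bounds come from the count of embeddings; the upper bound follows because [profile]
    has total mass at most 1 and [q] has mass 1. *)
Lemma profile_estimate (x : X) : `|profile E f R x - q x| <= #|{: X}|%:R * ((K + #|W|%:R) / N).
Proof.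
have N0 : 0 < N by rewrite ltr0n.
have nt : (0 : R) < (ntau n)%:R by rewrite ltr0n ntau_gt0.
set e := (K + _) / N.
have prof1 : \sum_(x' : X) profile E f R x' <= 1.
  rewrite /profile -mulr_suml -natr_sum exchange_big /= ler_pdivrMr ?ltr0n ?muln_gt0 ?ntau_gt0// mul1r ler_nat.
  by rewrite -sum_nat_const; apply: leq_sum => tau _; exact: (sum_tau_count_le r d3 degE f tau).
have D0 (x' : X) : 0 <= profile E f R x' - q x' + e by rewrite addrAC subr_ge0 -lerBlDr; exact: profile_ge.
have Dsum : \sum_x' (profile E f R x' - q x' + e) <= #|{: X}|%:R * e.
  rewrite big_split /= sumrB q1 sumr_const -[X in _ + X]mulr_natl.
  by rewrite -[leRHS]add0r lerD2r subr_le0.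
have D1 : profile E f R x - q x + e <= #|{: X}|%:R * e.
  by apply: le_trans Dsum; rewrite (bigD1 x)//= lerDl sumr_ge0.
have X1 : (1 : R) <= #|{: X}|%:R by rewrite ler1n; apply/card_gt0P; exists x.
have Xe0 : 0 <= #|{: X}|%:R * e by apply: le_trans Dsum; exact: sumr_ge0.
have e0 : 0 <= e by move: Xe0; rewrite pmulr_rge0// (lt_le_trans _ X1).
have := D0 x; have := ler_wpM2r e0 X1; rewrite mul1r => h1 h2.
clear prof1 D0 Dsum X1 Xe0; rewrite ler_norml; apply/andP; move: h1 h2 D1 e0; clearbody e; move: (_ * e) (profile E f R x) => Xe p h1 h2 D1 e0.
by split; lra.
Qed.

End profile_estimate.

Lemma leq_card_fibers (A B : finType) (D : {set A}) (T : {set B}) (F : A -> B) k :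
  (forall a, a \in D -> F a \in T) ->
  (forall b, b \in T -> #|[set a in D | F a == b]| <= k)%N -> (#|D| <= #|T| * k)%N.
Proof.
move=> DT Tk; rewrite -sum_nat_const -[leqLHS]sum1_card (partition_big F (mem T))//=.
apply: leq_sum => b bT; rewrite sum1_card; apply: leq_trans (Tk b bT); apply: eq_leq.
by apply: eq_card => a; rewrite !inE.
Qed.

(** * Completing greedy matchings *)

Section completions.
Variables (d L B cY : nat).
Hypothesis d3 : (3 <= d)%N.
Hypothesis L0 : (0 < L)%N.

(** Number of half-edges that the greedy construction may leave unmatched. *)
Definition completion_cap : nat := (cY * (greedy_cap d L + B))%N.
Local Notation C := completion_cap.

Section count.
Variables (n : nat) (Y : finType) (flip : Y -> Y).
Local Notation H := ('I_n.+1 * 'I_d)%type.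
Variable yt : H -> Y.

Definition completions : {set {perm H}} :=
  [set s in simple_matchings d n | `[< exists2 k, typed_treelike flip yt L k &
     (#|[set h | s h != k h]| <= 2 * C)%N >]].

Hypothesis flipK : involutive flip.
Hypothesis YC : #|Y| = cY.
Hypothesis ev : ~~ odd (n.+1 * d).
Hypothesis big : (4 * d.+1 ^ 1 * d + C < n.+1 * d)%N.
Hypothesis bal : forall y, (ycount yt finset.setT y <= ycount yt finset.setT (flip y) + B)%N.

(** The greedy construction is started from the empty matching. Two partial matchings with the same
    completion are close to it in Hamming distance, so completing them loses a polynomial factor
    only. *)
Lemma card_completions :
  (\prod_y (ycount yt finset.setT y)`! <= #|completions| ^ 2 *
     ((n.+1 * d) ^ (greedy_cap d L * cY) *
      ((((n.+1 * d) * (n.+1 * d)).+1 ^ (2 * C)) ^ 2 * B`! ^ cY)))%N.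
Proof.
have cH : #|{: H}| = (n.+1 * d)%N by rewrite card_prod !card_ord.
have m0 : (0 < n.+1 * d)%N by rewrite muln_gt0 (leq_trans _ d3).
have U1 : unmatched (1%g : {perm H}) = finset.setT by apply/setP => h; rewrite !inE perm1 eqxx.
have [|F [FP Fc]] := greedy_matchings flipK (B := B) L0 (typed_treelike1 flip yt L).
  by move=> y; rewrite U1.
rewrite U1 YC in Fc.
have ex (k : {perm H}) : exists s, k \in F -> s \in completions /\ (#|[set h | s h != k h]| <= 2 * C)%N.
  have [kF|] := boolP (k \in F); last by exists 1%g.
  have [kT kU _] := FP k kF; rewrite YC in kU; have [kP _ _] := kT.
  have [|s sM sk] := partial_matching_complete ev kP.
    by apply: leq_ltn_trans big; rewrite leq_add2l.
  have skC : (#|[set h | s h != k h]| <= 2 * C)%N by apply: leq_trans sk _; rewrite leq_mul2l kU orbT.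
  exists s => _; split => //; rewrite finset.in_set sM; apply/asboolP; by exists k.
have [phi phiP] := fin_all_exists ex.
have cF : (#|F| <= #|completions| * (((n.+1 * d) * (n.+1 * d)).+1 ^ (2 * C)))%N.
  apply: (leq_card_fibers (F := phi)) => [k /phiP[]//|s _].
  rewrite -cH; apply: leq_trans (card_ffun_near (pval s) (2 * C)).
  pose P (k : {perm H}) : {ffun H -> H} := pval k.
  have Pi : injective P by exact: val_inj.
  rewrite -(card_imset _ Pi); apply/subset_leq_card/fintype.subsetP => _ /imsetP[k + ->].
  rewrite finset.in_set => /andP[kF /eqP ks]; rewrite finset.in_set.
  apply: leq_trans (phiP k kF).2; rewrite ks; apply: eq_leq; apply: eq_card => h.
  by rewrite !finset.in_set eq_sym /P -!pvalE.
apply: (@leq_trans ((n.+1 * d) ^ (greedy_cap d L * cY) * \prod_y (ycount yt finset.setT y - greedy_cap d L)`!)).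
  rewrite expnM -YC -(prod_nat_const (mem Y)) -big_split /=; apply: leq_prod => y _.
  apply: fact_le_exp => //; rewrite -cH -cardsT; exact/subset_leq_card/finset.subsetT.
rewrite [leqRHS]mulnCA leq_mul2l; apply/orP; right; apply: leq_trans Fc _.
rewrite mulnA leq_mul2r -expnMn leq_sqr cF orbT.
by [].
Qed.

End count.

(* Around a vertex outside [W], the matching [s] agrees with the typed partial
   matching of which it is a completion. *)
Lemma completion_good n (r : nat) (r0 : (0 < r)%N) (M : finType) (g : {ffun 'I_n.+1 -> {ffun S_ball d r -> M}})
    (s : {perm 'I_n.+1 * 'I_d}) : (r < L)%N ->
  s \in completions (yflip d3 r0) (fun h : 'I_n.+1 * 'I_d => ytype d3 h.2 (g h.1)) ->
  exists2 W : {set 'I_n.+1}, (#|W| <= 2 * C * d.+1 ^ L)%N & forall v, v \notin W ->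
    treelike (gadj (edges_of s)) r.+1 v /\
    xwalk r d3 s [ffun v => g v (rootS r d3)] v = g v.
Proof.
move=> rL; rewrite finset.in_set => /andP[sM /asboolP[k [kP kt ky] sk]].
have [sK sl si] := simple_matchingsP _ sM.
set ek := gadj (edges_of k).
pose W := \bigcup_(h in [set h | s h != k h]) gball ek L h.1.
exists W.
  apply: (@leq_trans (\sum_(h in [set h | s h != k h]) d.+1 ^ L)); last first.
    by rewrite sum_nat_const leq_mul2r sk orbT.
  apply: leq_trans (_ : (\sum_(h in [set h | s h != k h]) #|gball ek L h.1| <= _)%N); last first.
    by apply: leq_sum => h _; apply: card_gball; exact: card_gadj_edges_of (pmK kP).
  rewrite /W; elim/big_rec2: _ => [|h m A _ mA]; first by rewrite cards0.
  by apply: leq_trans (leq_card_setU _ _) _; rewrite leq_add2l.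
move=> v vW.
have agree h : h.1 \in gball ek L v -> s h = k h.
  move=> hv; apply/eqP; apply: contraNT vW => shk; apply/bigcupP; exists h; first by rewrite inE.
  by apply: gball_sym hv; exact: gadj_sym.
have eE x : x \in gball ek L v -> gadj (edges_of s) x =1 ek x.
  move=> xv w; rewrite /ek !gadj_edges_of//; last exact: pmK kP.
  by congr (_ && _); apply: eq_existsb => i; rewrite /nbr agree.
split.
  apply: (treelike_sub (e' := ek)) => [x xv|o o' oL o'L]; first by apply: eE; exact: gballW xv.
  by apply: kt; [exact: leq_trans oL rL|exact: leq_trans o'L rL].
apply: (typed_xwalk (r0 := r0) (e := gadj (edges_of s))) => //.
- move=> w i wi; rewrite gadj_edges_of//; rewrite eq_sym wi /=.
  by apply/existsP; exists i.
- by move=> w; rewrite ffunE.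
move=> h hv; have hk : s h = k h.
  apply: agree; apply: gballW (ltnW rL) _.
  exact: (fintype.subsetP (gball_sub eE (ltnW rL))).
have kh : k h != h.
  by rewrite -hk; apply: contraNneq (sl h.1 h.2) => e; rewrite /nbr -surjective_pairing e.
by rewrite hk ky.
Qed.

End completions.

(** * First moment: lower bound *)

Section rounding.
Variable R : realType.

(** The values are rounded down, and the deficit, at most [#|X|], is given to one element. *)
Lemma integer_counts (X : finType) (q : X -> R) (N : nat) : (forall x, 0 <= q x) -> \sum_x q x = 1 ->
  exists2 c : X -> nat, (\sum_x c x = N)%N &
    forall x, `|(c x)%:R - N%:R * q x| <= #|X|%:R.
Proof.
move=> q0 q1; pose a x := Num.truncn (N%:R * q x).
have aP x : (a x)%:R <= N%:R * q x < (a x).+1%:R by rewrite truncn_itv// mulr_ge0.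
have [x0 _] : exists x0 : X, true.
  case: (pickP X) => [x _|X0]; first by exists x.
  by move: q1; rewrite big_pred0// => /eqP; rewrite eq_sym oner_eq0.
have Nq : N%:R = \sum_x N%:R * q x by rewrite -mulr_sumr q1 mulr1.
have sa : (\sum_x a x <= N)%N.
  rewrite -(ler_nat R) natr_sum [leRHS]Nq; apply: ler_sum => x _.
  by have /andP[] := aP x.
have sr : (N - \sum_x a x)%:R <= #|X|%:R :> R.
  rewrite natrB// lerBlDr [X in X <= _]Nq natr_sum -sum1_card natr_sum -big_split /=.
  by apply: ler_sum => x _; rewrite [1 + _]addrC natr1; have /andP[_ /ltW] := aP x.
exists (fun x => a x + (x == x0) * (N - \sum_x a x))%N.
  have s1 : (\sum_(x : X) (x == x0) = 1)%N by rewrite (bigD1 x0)//= eqxx big1// => x /negbTE ->.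
  by rewrite big_split /= -big_distrl /= s1 mul1n subnKC.
move=> x; have X1 : 1 <= #|X|%:R :> R by rewrite ler1n; apply/card_gt0P; exists x.
have /andP[a1] := aP x; rewrite -natr1 => a2.
rewrite natrD natrM; have : 0 <= (N - \sum_x a x)%:R :> R by [].
move: sr a1 a2 X1; move: (N - \sum_x a x)%:R (N%:R * q x) (a x)%:R #|X|%:R => u v w z h1 h2 h3 h4 h5.
by rewrite ler_norml; apply/andP; case: (x == x0); rewrite /= ?mul1r ?mul0r; split; lra.
Qed.

Lemma min_pos (I : finType) (F : I -> R) : (forall i, 0 < F i) -> exists2 e : R, 0 < e & forall i, e <= F i.
Proof.
move=> F0; suff h (s : seq I) : exists2 e : R, 0 < e & {in s, forall i, e <= F i}.
  by have [e e0 eP] := h (enum I); exists e => // i; apply: eP; rewrite mem_enum.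
elim: s => [|i s [e e0 eP]]; first by exists 1.
exists (Num.min e (F i)) => [|j]; first by rewrite lt_min e0 F0.
by rewrite inE => /orP[/eqP ->|/eP]; rewrite ge_min ?lexx ?orbT// => ->.
Qed.

Lemma entropy_near d (M : finType) (B : {fset tree d}) (p : mass R M B) (delta : R) : 0 < delta ->
  exists2 e : R, 0 < e & forall p' : mass R M B, (forall x, `|p' x - p x| <= e) -> `|entropy p' - entropy p| <= delta.
Proof.
move=> d0; pose c : R := #|{: {ffun B -> M}}|.+1%:R.
have c0 : 0 < c by rewrite ltr0n.
have ex (x : {ffun B -> M}) : exists e : R, 0 < e /\ forall y : R, `|y - p x| <= e -> `|y * ln y - p x * ln (p x)| <= delta / c.
  have /cvgrPdist_le/(_ (delta / c))/(_ (divr_gt0 d0 c0)) := @xlnx_continuous R (p x).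
  case/nbhs_ballP => e /= e0 he; exists (e / 2); split; first by rewrite divr_gt0.
  move=> y yx; rewrite distrC; apply: he.
  rewrite /ball /= distrC; apply: le_lt_trans yx _; rewrite ltr_pdivrMr// mulr_natr mulr2n ltrDl.
  by [].
have [F FP] := fin_all_exists ex; have [e e0 eF] := min_pos (fun x => (FP x).1).
exists e => // p' pp'; rewrite /entropy -opprB normrN opprK -sumrN -big_split /=.
apply: le_trans (_ : _ <= \sum_(x : {ffun B -> M}) delta / c) _.
  apply: le_trans (ler_norm_sum _ _ _) _; apply: ler_sum => x _.
  rewrite addrC; apply: (FP x).2; exact: le_trans (pp' x) (eF x).
rewrite sumr_const -[leLHS]mulr_natl mulrCA ler_piMr ?(ltW d0)// ler_pdivrMr// mul1r ler_nat.
exact: leqnSn.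
Qed.

Lemma edge_Sigma_near d r (M : finType) (d3 : (3 <= d)%N) (p : mass R M (S_ball d r)) (delta : R) : 0 < delta ->
  exists2 e : R, 0 < e & forall p' : mass R M (S_ball d r), (forall x, `|p' x - p x| <= e) -> `|edge_Sigma d3 p' - edge_Sigma d3 p| <= delta.
Proof.
move=> d0; have d2 : 0 < delta / 2 by rewrite divr_gt0.
have dd : 0 < delta / d%:R by rewrite divr_gt0// ltr0n; lia.
have [e1 e10 h1] := entropy_near p d2; have [e2 e20 h2] := entropy_near (edge_mass d3 p) dd.
pose c : R := #|{: {ffun S_ball d r -> M}}|.+1%:R; have c0 : 0 < c by rewrite ltr0n.
have dn0 : (0 : R) < d%:R by rewrite ltr0n; lia.
exists (Num.min e1 (e2 / c)) => [|p' pp']; first by rewrite lt_min e10 divr_gt0.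
have {}h1 : `|entropy p' - entropy p| <= delta / 2.
  by apply: h1 => x; have := pp' x; rewrite le_min => /andP[].
have {}h2 : `|entropy (edge_mass d3 p') - entropy (edge_mass d3 p)| <= delta / d%:R.
  apply: h2 => y; rewrite !ffunE -mulrBr -sumrN -big_split /= normrM ger0_norm ?invr_ge0//.
  rewrite mulrC ler_pdivrMr//; apply: le_trans (ler_norm_sum _ _ _) _.
  rewrite mulrC -[d in leRHS]card_ord [leRHS]mulr_natl -sumr_const; apply: ler_sum => i _.
  rewrite -sumrN -big_split /=; apply: le_trans (ler_norm_sum _ _ _) _.
  apply: le_trans (_ : _ <= \sum_(x : {ffun S_ball d r -> M}) e2 / c) _.
    rewrite big_mkcond /=; apply: ler_sum => x _; case: ifP => _.
      by have := pp' x; rewrite le_min => /andP[].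
    by rewrite divr_ge0// ltW.
  rewrite sumr_const -[leLHS]mulr_natl mulrCA ler_piMr ?(ltW e20)// ler_pdivrMr// mul1r ler_nat.
  exact: leqnSn.
rewrite /edge_Sigma; move: h2; rewrite ler_pdivlMr// -[X in _ * X]gtr0_norm// -normrM.
move: h1; rewrite !ler_norml => /andP[a1 a2] /andP[b1 b2].
by move: a1 a2 b1 b2; move: (entropy p') (entropy p) (entropy (edge_mass _ _)) (entropy (edge_mass _ _)) => u v w z h1 h2 h3 h4; apply/andP; split; lra.
Qed.

(** Extracts the square root in [card_completions], with [MM] the number of all matchings: the
    exponent m becomes m / 2. *)
Lemma square_count_ge (Y : finType) (e : Y -> nat) (m T P MM : nat) :
  (\sum_y e y = m)%N -> (\prod_y (e y)`! <= T ^ 2 * P)%N -> (MM ^ 2 <= m`!)%N -> (0 < P)%N ->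
  MM%:R * expR (2^-1 * (m%:R * (\sum_y (e y)%:R / m%:R * ln ((e y)%:R / m%:R)) - (2 * ln m.+1%:R + 1) - ln P%:R))
    <= T%:R :> R.
Proof.
move=> em eT Mm P0; rewrite -ler_sqr ?nnegrE ?mulr_ge0 ?expR_ge0// exprMn -expRM_natl mulrA divff ?pnatr_eq0// mul1r.
have p0 : (0 : R) < P%:R by rewrite ltr0n.
have m0 : (0 : R) < m`!%:R by rewrite ltr0n fact_gt0.
rewrite expRB lnK ?posrE// mulrA ler_pdivrMr//.
apply: le_trans (_ : (\prod_y (e y)`!)%:R <= _); last by rewrite -natrX -natrM ler_nat.
have -> : (\prod_y (e y)`!)%:R = expR (\sum_y ln (e y)`!%:R) :> R.
  by rewrite natr_prod expR_sum; apply: eq_bigr => y _; rewrite lnK// posrE ltr0n fact_gt0.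
apply: le_trans (_ : m`!%:R * expR (m%:R * (\sum_y (e y)%:R / m%:R * ln ((e y)%:R / m%:R)) - (2 * ln m.+1%:R + 1)) <= _).
  by rewrite ler_wpM2r ?expR_ge0// -natrX ler_nat.
rewrite -[X in X * _](lnK m0) -expRD ler_expR; have := sum_lnfact_ge R em.
by rewrite addrA.
Qed.

End rounding.

Section lower_bound.
Variables (R : realType) (d : nat).
Hypothesis d3 : (3 <= d)%N.

(** The typed bound with a single type. Up to a polynomial factor, [mcount_even] is the converse. *)
Lemma card_matchings_le n : (#|matchings [set: 'I_n.+1 * 'I_d]%SET| ^ 2 <= (n.+1 * d)`!)%N.
Proof.
have := @card_typed_matchings _ unit id (fun=> tt) (fun u => erefl) [set: 'I_n.+1 * 'I_d]%SET.
rewrite (eq_bigr (fun=> (n.+1 * d)`!)) => [|[] _]; last first.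
  congr factorial; rewrite /ycount (_ : [set h in _ | _] = finset.setT) ?cardsT ?card_prod ?card_ord//.
  by apply/setP => h; rewrite !inE.
rewrite prod_nat_const card_unit expn1; apply: leq_trans.
rewrite leq_sqr; apply/subset_leq_card/fintype.subsetP => s sM; rewrite finset.in_set sM /=.
by apply/forall_inP.
Qed.

Section bounds.
Variables (L B cY : nat).
Local Notation C := (completion_cap d L B cY).

Definition completion_loss (n : nat) : nat :=
  ((n.+1 * d) ^ (greedy_cap d L * cY) *
      ((((n.+1 * d) * (n.+1 * d)).+1 ^ (2 * C)) ^ 2 * B`! ^ cY))%N.

Lemma completion_loss_gt0 n : (0 < completion_loss n)%N.
Proof. by rewrite !muln_gt0 !expn_gt0 fact_gt0 muln_gt0 /= (leq_trans _ d3). Qed.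

Definition loss_slope : R := (greedy_cap d L * cY)%:R + 8 * C%:R.

Lemma ln_m_le n : ln (n.+1 * d).+1%:R <= ln d.+1%:R + ln n.+1%:R :> R.
Proof.
rewrite -lnM ?posrE ?ltr0n// ler_ln ?posrE ?mulr_gt0 ?ltr0n// -natrM ler_nat.
by rewrite (mulSn d) [ltnLHS]mulnC -[ltnLHS]add0n ltn_add2r.
Qed.

Lemma ln_completion_loss n : ln (completion_loss n)%:R <=
  loss_slope * (ln d.+1%:R + ln n.+1%:R) + cY%:R * ln B`!%:R :> R.
Proof.
have lnX x k : (0 < x)%N -> ln (x ^ k)%:R = k%:R * ln x%:R :> R.
  by move=> x0; rewrite natrX lnXn ?ltr0n// mulr_natl.
have lnMn x y : (0 < x)%N -> (0 < y)%N -> ln (x * y)%:R = ln x%:R + ln y%:R :> R.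
  by move=> x0 y0; rewrite natrM lnM ?posrE ?ltr0n.
rewrite /completion_loss; set m := (n.+1 * d)%N.
have m0 : (0 < m)%N by rewrite muln_gt0 (leq_trans _ d3).
rewrite lnMn ?muln_gt0 ?expn_gt0 ?fact_gt0 ?m0// lnMn ?expn_gt0 ?fact_gt0//.
rewrite !lnX ?expn_gt0 ?fact_gt0//.
set l := ln d.+1%:R + _.
have l1 : ln m%:R <= l.
  by apply: le_trans (ln_m_le n); rewrite ler_ln ?posrE ?ltr0n// ler_nat leqnSn.
have l2 : ln (m * m).+1%:R <= 2 * l :> R.
  apply: le_trans (_ : _ <= 2 * ln m.+1%:R) _; last by rewrite ler_wpM2l// ln_m_le.
  rewrite mulr_natl -lnXn ?ltr0n// ler_ln ?posrE ?exprn_gt0 ?ltr0n// -natrX ler_nat.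
  by rewrite -mulnn mulSn mulnS; clear; lia.
rewrite /loss_slope addrA lerD2r [leRHS]mulrDl; apply: lerD; first by rewrite ler_wpM2l.
have h := ler_wpM2l (ler0n R C) l2; rewrite natrM; move: h; clearbody l.
by move: (ln _) (C%:R : R) => a b h; lra.
Qed.

End bounds.

(** The greedy construction with a single type, perfect balance and [L = 1]: the edge entropy is
    then 0 and the loss is polynomial. *)
Lemma simple_matchings_ge (delta : R) : 0 < delta -> exists n0, forall n, (n0 <= n)%N ->
  ~~ odd (n.+1 * d) ->
  #|matchings [set: 'I_n.+1 * 'I_d]%SET|%:R * expR (- (n.+1%:R * delta)) <= #|simple_matchings d n|%:R :> R.
Proof.
move=> d0; pose S := loss_slope 1 0 1.
have [n1 n1P] := log_poly_le ((1 + 2^-1 * S) * ln d.+1%:R + 1) (1 + 2^-1 * S) d0.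
exists (n1 + (4 * d.+1 ^ 1 * d + completion_cap d 1 0 1).+1)%N => n n0n ev.
have big : (4 * d.+1 ^ 1 * d + completion_cap d 1 0 1 < n.+1 * d)%N.
  apply: (@leq_trans n); first by apply: leq_trans n0n; rewrite leq_addl.
  by apply: leq_trans (leqnSn n) _; rewrite leq_pmulr// (leq_trans _ d3).
have h := n1P n (leq_trans (leq_addr _ _) n0n).
have := @card_completions d 1 0 1 d3 erefl n unit id (fun=> tt) (fun=> erefl) card_unit ev big.
set A := completions _ _ _ _ _; rewrite -/(completion_loss 1 0 1 n) => /(_ _)/wrap[|cA]; first by move=> y; rewrite addn0.
have em : (\sum_(y : unit) ycount (fun=> tt) [set: 'I_n.+1 * 'I_d]%SET y = n.+1 * d)%N.
  rewrite (eq_bigr (fun=> n.+1 * d)%N) ?sum_nat_const ?card_unit ?mul1n// => -[] _.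
  rewrite /ycount (_ : [set h in _ | _] = finset.setT) ?cardsT ?card_prod ?card_ord//.
  by apply/setP => x; rewrite !inE.
have := square_count_ge R em cA (card_matchings_le n) (completion_loss_gt0 _ _ _ n).
have -> : \sum_(y : unit) (ycount (fun=> tt) [set: 'I_n.+1 * 'I_d]%SET y)%:R / (n.+1 * d)%:R *
    ln ((ycount (fun=> tt) [set: 'I_n.+1 * 'I_d]%SET y)%:R / (n.+1 * d)%:R) = 0 :> R.
  apply: big1 => -[] _; have := em; rewrite (bigD1 tt)//= big1 => [|[]//]; rewrite addn0 => ->.
  rewrite divff ?ln1 ?mulr0// pnatr_eq0 muln_eq0 /=; move: d3; clear; lia.
rewrite mulr0 sub0r => low.
apply: le_trans (_ : _ <= #|A|%:R) _; last first.
  by rewrite ler_nat; apply/subset_leq_card/fintype.subsetP => s; rewrite finset.in_set => /andP[].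
apply: le_trans low; rewrite ler_wpM2l// ler_expR.
have := ln_completion_loss 1 0 1 n; have := ln_m_le n; move: h.
rewrite -/S fact0 ln1 mulr0 addr0 [n.+1%:R * delta]mulrC.
move: (ln _) (ln _) (ln _) (ln _) (delta * _) => a b c e f.
by move=> h1 h2 h3; lra.
Qed.

End lower_bound.

Section first_moment_ge.
Variables (R : realType) (d r : nat) (M : pointedFinType).
Hypothesis d3 : (3 <= d)%N.
Hypothesis r0 : (0 < r)%N.
Local Notation X := {ffun S_ball d r -> M}.
Local Notation Y := {ffun E_ball d r -> M}.
Variable q : mass R M (S_ball d r).
Hypothesis qI : invariant_mass q.

Local Notation cX := #|{: X}|.
Local Notation cY := #|{: Y}|.
(** Twice the rounding error in [ecount_near]: a type and its flip have the same marginal under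
    [q]. *)
Let B : nat := (2 * (d * (cX * cX)))%N.
(** One more than r, as an induced tree of radius r requires. *)
Let L : nat := r.+1.
Local Notation C := (completion_cap d L B cY).
Let C' : nat := (2 * C * d.+1 ^ L)%N.

Let qaut : aut_invariant q. Proof. exact: mass_aut qI. Qed.

Section size.
Variable n : nat.
Local Notation V := 'I_n.+1.
Local Notation H := ('I_n.+1 * 'I_d)%type.
Local Notation N := (n.+1%:R : R).
Variable c : X -> nat.
Hypothesis cN : (\sum_x c x = n.+1)%N.
Hypothesis cq : forall x, `|(c x)%:R - N * q x| <= cX%:R.

Let ecount_near y : `|(ecount d3 c y)%:R - N * d%:R * marginal (E_ball d r) q y| <= (d * (cX * cX))%:R.
Proof.
have -> : N * d%:R * marginal (E_ball d r) q y = \sum_(i < d) \sum_(x : X | ytype d3 i x == y) N * q x.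
  under eq_bigr do rewrite -mulr_sumr (marginal_ytype d3 r0 _ _ qaut).
  by rewrite sumr_const card_ord -[RHS]mulr_natl mulrCA mulrA.
rewrite /ecount natr_sum -sumrB; apply: le_trans (ler_norm_sum _ _ _) _.
apply: le_trans (_ : _ <= \sum_(i < d) (cX * cX)%:R) _; last first.
  by rewrite sumr_const card_ord [leRHS]natrM [leRHS]mulr_natl.
apply: ler_sum => i _; rewrite natr_sum -sumrB; apply: le_trans (ler_norm_sum _ _ _) _.
apply: le_trans (_ : _ <= \sum_(x : X) cX%:R) _.
  by rewrite big_mkcond /=; apply: ler_sum => x _; case: ifP.
by rewrite sumr_const -[leLHS]mulr_natl natrM.
Qed.

Let ecount_bal y : (ecount d3 c y <= ecount d3 c (yflip d3 r0 y) + B)%N.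
Proof.
rewrite -(ler_nat R) natrD; have := ecount_near y; have := ecount_near (yflip d3 r0 y).
rewrite invariant_mass_yflip// /B (natrM _ 2) !ler_norml.
move: (N * _ * _) (d * (cX * cX))%:R => a b /andP[h1 h2] /andP[h3 h4].
by lra.
Qed.

Hypothesis ev : ~~ odd (n.+1 * d).
Hypothesis big : (4 * d.+1 ^ 1 * d + C < n.+1 * d)%N.

Definition xcolorings : {set {ffun V -> X}} := [set g | [forall x, xcount g x == c x]].

Let ctyped (g : {ffun V -> X}) : {set {perm H}} :=
  completions L B cY (yflip d3 r0) (fun h : H => ytype d3 h.2 (g h.1)).

Local Notation MM := (#|matchings [set: H]%SET|).

Let card_ctyped g : g \in xcolorings ->
  MM%:R * expR (- (N * (d%:R / 2 * entropy (edge_mass d3 (count_mass R n c)))) -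
    2^-1 * (2 * ln (n.+1 * d).+1%:R + 1 + ln (completion_loss d L B cY n)%:R)) <= #|ctyped g|%:R.
Proof.
move=> gG; have gc : xcount g =1 c by move: gG; rewrite inE => /forallP gc x; exact/eqP.
have ye y : ycount (fun h : H => ytype d3 h.2 (g h.1)) finset.setT y = ecount d3 c y.
  by rewrite ycount_xcount /ecount; apply: eq_bigr => i _; apply: eq_bigr => x _.
have := @card_completions d L B cY d3 erefl n Y (yflip d3 r0) (fun h : H => ytype d3 h.2 (g h.1))
  (yflipK d3 r0) erefl ev big.
move=> /(_ _)/wrap[|cT']; first by move=> y; rewrite !ye; exact: ecount_bal.
have cT : (\prod_y (ecount d3 c y)`! <= #|ctyped g| ^ 2 * completion_loss d L B cY n)%N.
  by under eq_bigr do rewrite -ye.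
have lp : (0 < completion_loss d L B cY n)%N by exact: completion_loss_gt0.
have := square_count_ge R (sum_ecount d3 cN) cT (card_matchings_le d n) lp.
apply: le_trans; rewrite ler_wpM2l// ler_expR.
have -> : \sum_y (ecount d3 c y)%:R / (n.+1 * d)%:R * ln ((ecount d3 c y)%:R / (n.+1 * d)%:R) =
    - entropy (edge_mass d3 (count_mass R n c)).
  by rewrite /entropy opprK; apply: eq_bigr => y _; rewrite edge_count_mass.
rewrite natrM; move: (entropy _) (ln _) (ln _) => a b e; lra.
Qed.

Let card_xcolorings : expR (N * entropy (count_mass R n c) - cX%:R * (2 * ln n.+2%:R + 1)) <= #|xcolorings|%:R.
Proof.
have cG := card_ffun_count cN.
have p0 : (0 : R) < (\prod_x (c x)`!)%:R by rewrite ltr0n prodn_gt0// => x; rewrite fact_gt0.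
have -> : #|xcolorings|%:R = n.+1`!%:R / (\prod_x (c x)`!)%:R :> R.
  by rewrite -cG natrM mulfK// gt_eqF.
rewrite ler_pdivlMr// -[leRHS]lnK ?posrE ?ltr0n ?fact_gt0//.
have -> : (\prod_x (c x)`!)%:R = expR (\sum_x ln (c x)`!%:R) :> R.
  by rewrite natr_prod expR_sum; apply: eq_bigr => x _; rewrite lnK// posrE ltr0n fact_gt0.
rewrite -expRD ler_expR; have := sum_lnfact_le R cN.
have -> : \sum_y (c y)%:R / N * ln ((c y)%:R / N) = - entropy (count_mass R n c).
  by rewrite /entropy opprK; apply: eq_bigr => y _; rewrite !ffunE.
move: (entropy _) (cX%:R * _) (ln _) => a b e; move: (\sum_y _) => s; lra.
Qed.

Hypothesis bigC' : (C' < n.+1)%N.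

Definition typical_pairs (eta : R) : {set {perm H} * {ffun V -> M}} :=
  [set z | (z.1 \in simple_matchings d n) &&
     [forall x : X, `|profile (edges_of z.1) z.2 R x - q x| <= eta]].

Variable eta : R.
Hypothesis eta_big : cX%:R * ((cX%:R + C'%:R) / N) <= eta.

(** Pairs of prescribed balls [g] and of a completion [s] typed by them are mapped to [s] and the
    colors at the roots. Outside at most [C'] vertices, [g] is recovered by reading the colors along
    walks, so that fibers are within Hamming balls, and the pair obtained has the right profile. *)
Lemma card_typical_pairs :
  MM%:R * expR (N * edge_Sigma d3 (count_mass R n c) - (cX%:R * (2 * ln n.+2%:R + 1) +
    2^-1 * (2 * ln (n.+1 * d).+1%:R + 1 + ln (completion_loss d L B cY n)%:R)))
  <= #|typical_pairs eta|%:R * ((n.+1 * cX).+1 ^ C')%:R.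
Proof.
pose P := [set z : {ffun V -> X} * {perm H} | (z.1 \in xcolorings) && (z.2 \in ctyped z.1)].
have cP : \sum_(g in xcolorings) #|ctyped g|%:R <= #|P|%:R :> R.
  rewrite -natr_sum ler_nat -[leqRHS]sum1_card [leqRHS](partition_big (fun z : {ffun V -> X} * {perm H} => z.1) (mem xcolorings))/=; last first.
    by move=> z; rewrite finset.in_set => /andP[].
  apply: leq_sum => g gG; rewrite sum1_card.
  have pinj : injective (fun s : {perm H} => (g, s)) by move=> s s' [].
  rewrite -(card_imset _ pinj); apply/subset_leq_card/fintype.subsetP => _ /imsetP[s sg ->].
  by rewrite unfold_in /= finset.in_set /= gG sg eqxx.
pose F (z : {ffun V -> X} * {perm H}) : {perm H} * {ffun V -> M} :=
  (z.2, [ffun v => z.1 v (rootS r d3)]).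
have FP : (#|P| <= #|typical_pairs eta| * (n.+1 * cX).+1 ^ C')%N.
  apply: (leq_card_fibers (F := F)) => [[g s]|[s f] _].
    rewrite finset.in_set /= => /andP[gG sg].
    have sM : s \in simple_matchings d n by move: sg; rewrite finset.in_set => /andP[].
    have [W WC WP] := completion_good (ltnSn r) sg.
    rewrite finset.in_set /= sM /=; apply/forallP => x; apply: le_trans eta_big.
    have gc y : N * q y - cX%:R <= (xcount g y)%:R.
      have -> : xcount g y = c y by move: gG; rewrite finset.in_set => /forallP/(_ y)/eqP.
      by have := cq y; rewrite ler_norml => /andP[h _]; move: h; move: (N * _) (c y)%:R cX%:R => a1 a2 a3 h; lra.
    have := @profile_estimate R d r n M d3 s [ffun v => g v (rootS r d3)] g W sM (fun v vW => (WP v vW).1)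
       (fun v vW => (WP v vW).2) q cX%:R qaut (mass_sum1 qI) gc (leq_ltn_trans WC bigC') x.
    move/le_trans; apply; rewrite ler_wpM2l// ler_wpM2r// lerD2l ler_nat.
    exact: WC.
  apply: leq_trans (_ : (#|[set g : {ffun V -> X} | #|[set v | g v != [ffun v => xwalk r d3 s f v] v]| <= C']| <= _)%N); last first.
    by have := card_ffun_near [ffun v => xwalk r d3 s f v] C'; rewrite card_ord.
  have finj : {in [set a in P | F a == (s, f)] &, injective (fun z : {ffun V -> X} * {perm H} => z.1)}.
    move=> [g1 s1] [g2 s2]; rewrite !finset.in_set => /andP[_ /eqP[e1 _]] /andP[_ /eqP[e2 _]] /= e.
    by rewrite e e1 e2.
  rewrite -(card_in_imset finj); apply/subset_leq_card/fintype.subsetP => _ /imsetP[[g s1] + ->].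
  rewrite finset.in_set => /andP[zP /eqP[e1 e2]]; subst s1.
  move: zP; rewrite [_ \in P]finset.in_set /= => /andP[gG sg].
  have [W WC WP] := completion_good (ltnSn r) sg.
  rewrite finset.in_set; apply: leq_trans WC; apply/subset_leq_card/fintype.subsetP => v; rewrite finset.in_set ffunE.
  by apply: contraNT => /WP[_]; rewrite e2 => ->.
apply: le_trans (_ : _ <= #|P|%:R) _; last by rewrite -natrM ler_nat.
apply: le_trans cP; apply: le_trans (ler_sum _ (fun g gG => card_ctyped gG)).
rewrite sumr_const -[leRHS]mulr_natl mulrCA ler_wpM2l//.
apply: le_trans (ler_wpM2r (expR_ge0 _) card_xcolorings).
rewrite -expRD ler_expR /edge_Sigma.
move: (entropy _) (entropy _) (ln _) (ln _) (cX%:R * _) => a b e h k; lra.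
Qed.

End size.

Lemma first_moment_ge (delta eta : R) : 0 < delta -> 0 < eta -> exists n0, forall n, (n0 <= n)%N ->
  ~~ odd (n.+1 * d) ->
  #|matchings [set: 'I_n.+1 * 'I_d]%SET|%:R * expR (n.+1%:R * (Sigma q - delta)) <=
  #|typical_pairs n eta|%:R.
Proof.
move=> d0 e0; have d2 : 0 < delta / 2 by rewrite divr_gt0.
have [e1 e10 e1P] := edge_Sigma_near d3 q d2.
pose S := loss_slope R d L B cY.
pose cx : R := cX%:R; pose c' : R := C'%:R; pose ld : R := ln d.+1%:R.
pose Cst := cx * (2 * ln 2 + 1) + (1 + 2^-1 * S) * ld + 2^-1 * (1 + cY%:R * ln B`!%:R) + c' * ln (cX.+1)%:R.
have [n1 n1P] := log_poly_le Cst (2 * cx + 1 + 2^-1 * S + c') d2.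
pose n2 := Num.bound (cx * (cx + c') / eta); pose n3 := Num.bound (cx / e1).
exists (n1 + (n2 + (n3 + ((4 * d.+1 ^ 1 * d + C).+1 + C'.+1))))%N => n n0n ev.
have [h1 h2 h3 h4] : [/\ (n1 <= n)%N, (n2 <= n)%N, (n3 <= n)%N & (4 * d.+1 ^ 1 * d + C).+1 + C'.+1 <= n]%N.
  by move: n0n; move: (_ + C'.+1)%N; clear => k; split; lia.
have big : (4 * d.+1 ^ 1 * d + C < n.+1 * d)%N.
  apply: leq_trans (leq_trans (leq_addr _ _) h4) _.
  by apply: leq_trans (leqnSn n) _; rewrite leq_pmulr// (leq_trans _ d3).
have bigC' : (C' < n.+1)%N.
  by apply: leq_trans (leq_trans (leq_addl _ _) h4) (leqnSn n).
have N0 : (0 : R) < n.+1%:R by rewrite ltr0n.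
have archi (x : R) : 0 <= x -> (Num.bound x <= n)%N -> x <= n.+1%:R.
  move=> x0 xn; apply: le_trans (ltW (archi_boundP x0)) _; rewrite ler_nat; exact: leq_trans xn _.
have cx0 : 0 <= cx by []. have c'0 : 0 <= c' by [].
have [c cN cq] := integer_counts n.+1 (mass_ge0 qI) (mass_sum1 qI).
have hS : Sigma q - delta / 2 <= edge_Sigma d3 (count_mass R n c).
  rewrite -(edge_Sigma_Sigma d3 r0 qaut).
  suff : `|edge_Sigma d3 (count_mass R n c) - edge_Sigma d3 q| <= delta / 2.
    by rewrite ler_norml => /andP[h _]; move: h; move: (edge_Sigma _ _) (edge_Sigma _ _) => a b h; lra.
  apply: e1P => x; rewrite ffunE.
  have -> : (c x)%:R / n.+1%:R - q x = ((c x)%:R - n.+1%:R * q x) / n.+1%:R.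
    by rewrite mulrBl mulrAC divff ?gt_eqF// mul1r.
  rewrite normrM [X in _ * X]ger0_norm ?invr_ge0// ler_pdivrMr//.
  apply: le_trans (cq x) _; rewrite mulrC -ler_pdivrMr//; apply: archi => //.
  by rewrite divr_ge0// ltW.
have etaN : cx * ((cx + c') / n.+1%:R) <= eta.
  rewrite mulrA ler_pdivrMr// [leRHS]mulrC -ler_pdivrMr//; apply: archi => //.
  by rewrite divr_ge0 ?mulr_ge0 ?addr_ge0// ltW.
have := card_typical_pairs cN cq ev big bigC' etaN.
have -> : ((n.+1 * cX).+1 ^ C')%:R = expR (c' * ln (n.+1 * cX).+1%:R) :> R.
  by rewrite natrX expRM_natl lnK// posrE ltr0n.
rewrite -ler_pdivrMr ?expR_gt0// -expRN -mulrA -expRD.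
apply: le_trans; rewrite ler_wpM2l// ler_expR.
have l1 : ln (n.+1 * cX).+1%:R <= ln cX.+1%:R + ln n.+1%:R :> R.
  rewrite -lnM ?posrE ?ltr0n// ler_ln ?posrE ?mulr_gt0 ?ltr0n// -natrM ler_nat.
  by rewrite (mulSn cX) [ltnLHS]mulnC -[ltnLHS]add0n ltn_add2r.
have l2 : ln n.+2%:R <= ln 2 + ln n.+1%:R :> R.
  by rewrite -lnM ?posrE ?ltr0n// ler_ln ?posrE ?mulr_gt0 ?ltr0n// -natrM ler_nat; clear; lia.
have l3 := ler_wpM2l c'0 l1; have l4 := ler_wpM2l cx0 l2.
have l5 := ln_completion_loss R d3 L B cY n; have l6 := ln_m_le R d n.
have := n1P n h1; have := ler_wpM2l (ltW N0) hS.
rewrite -/ld -/S in l5 l6 *; rewrite -/cx /Cst; clear -l3 l4 l5 l6.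
move: l3 l4 l5 l6; move: (ln n.+1%:R : R) => lN; move: (n.+1%:R : R) => N.
move: (ln (n.+1 * cX).+1%:R : R) (ln n.+2%:R : R) (ln (completion_loss d L B cY n)%:R : R) (ln (n.+1 * d).+1%:R : R).
move: (cY%:R * ln B`!%:R : R) (ln 2 : R) (ln cX.+1%:R : R) => a1 a2 a3 a4 a5 a6 a7.
move: (edge_Sigma _ _) (Sigma q) => u v; move: S cx c' ld => S' cx' c'' ld'.
by lra.
Qed.

End first_moment_ge.

(** * Second moment *)

Section transfer.
Variables (R : realType) (d r : nat) (M : finType).
Hypothesis d3 : (3 <= d)%N.
Local Notation X := {ffun S_ball d r -> M}.
Local Notation cX := #|{: X}|.

Lemma sum_walk_mass n (s : {perm 'I_n.+1 * 'I_d}) (f : {ffun 'I_n.+1 -> M}) :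
  \sum_x walk_mass R r d3 s f x = 1.
Proof.
under eq_bigr do rewrite ffunE; rewrite -mulr_suml -natr_sum.
rewrite (_ : (\sum_x _)%N = n.+1) ?divff ?pnatr_eq0//.
rewrite -[RHS](sum_xcount [ffun v => xwalk r d3 s f v]); apply: eq_bigr => x _.
by apply: eq_card => v; rewrite !inE ffunE.
Qed.

Lemma tau_count_walk_mass n (s : {perm 'I_n.+1 * 'I_d}) (f : {ffun 'I_n.+1 -> M}) tau (x : X) :
  s \in simple_matchings d n -> sorted_by s tau ->
  (tau_count (edges_of s) f tau x)%:R / n.+1%:R <= walk_mass R r d3 s f x.
Proof.
move=> sM so; rewrite ffunE ler_wpM2r// ler_nat /tau_count.
rewrite -(card_in_imset (f := fun b : {ffun S_ball d r -> 'I_n.+1} => b (rootS r d3))) => [|b b'].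
  apply/subset_leq_card/fintype.subsetP => _ /imsetP[b + ->]; rewrite !finset.in_set => /and3P[bE binc /eqP bx].
  rewrite -bx; apply/eqP/ffunP => u; rewrite !ffunE; congr (f _).
  by rewrite -(increasing_walk d3 sM so bE binc).
rewrite !finset.in_set => /and3P[bE binc _] /and3P[bE' binc' _] /= bb'; apply/ffunP => u.
by rewrite (increasing_walk d3 sM so bE binc) (increasing_walk d3 sM so bE' binc') bb'.
Qed.

(** For at least half of the orders, all counts are near [profile]. Such an order sorts a matching
    of the graph, whose [walk_mass] dominates the counts; as it has mass 1 and the profile nearly 1,
    they are close. Orders sorting a simple matching being equally numerous, half of the orders
    become half of the pairs. *)
Lemma transfer (eps : R) : 0 < eps -> exists n0, forall n, (n0 <= n)%N ->
  forall A : graph n -> {ffun 'I_n.+1 -> M} -> bool,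
  (forall E f, A E f -> 1 - eps <= \sum_(x : X) profile E f R x) ->
  (#|[set z : {perm 'I_n.+1 * 'I_d} * {ffun 'I_n.+1 -> M} |
      (z.1 \in simple_matchings d n) && A (edges_of z.1) z.2]| <=
   2 * #|[set z : {perm 'I_n.+1 * 'I_d} * {ffun 'I_n.+1 -> M} |
      [&& z.1 \in simple_matchings d n, A (edges_of z.1) z.2 &
       [forall x : X, (`|walk_mass R r d3 z.1 z.2 x - profile (edges_of z.1) z.2 R x| <= cX.+1%:R * eps)%R]]]|)%N.
Proof.
move=> e0; pose K : R := 2 * (cX%:R * (meet_bound d r)%:R / eps ^+ 2).
have K0 : 0 <= K by rewrite mulr_ge0// divr_ge0 ?mulr_ge0 ?exprn_ge0 ?(ltW e0).
exists (Num.bound K) => n nK A A1.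
have N0 : (0 : R) < n.+1%:R by rewrite ltr0n.
have KN : K <= n.+1%:R.
  apply: le_trans (ltW (archi_boundP K0)) _; rewrite ler_nat; exact: leq_trans nK _.
pose near (E : graph n) (f : {ffun 'I_n.+1 -> M}) (tau : {ffun 'I_n.+1 -> {perm 'I_n.+1}}) := [forall x : X, `|(tau_count E f tau x)%:R / n.+1%:R - profile E f R x| <= eps].
pose Anear (E : graph n) (tau : {ffun 'I_n.+1 -> {perm 'I_n.+1}}) := #|[set f : {ffun 'I_n.+1 -> M} | A E f && near E f tau]|.
have half E : E \in regular_graphs d n ->
    (ntau n * #|[set f : {ffun 'I_n.+1 -> M} | A E f]| <= 2 * \sum_tau Anear E tau)%N.
  move=> Er; have [s sM /andP[/eqP sE _]] := sorted_by_ex [ffun=> 1%g] Er.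
  have degE v : (#|[set w | gadj E v w]| <= d)%N.
    by rewrite -sE; apply: card_gadj_edges_of; case/simple_matchingsP: sM.
  rewrite /Anear; under eq_bigr do rewrite -sum1_card big_mkcond /=.
  rewrite exchange_big /= big_distrr /= -sum1_card big_mkcond /= big_distrr /=.
  apply: leq_sum => f _; rewrite inE; case Af: (A E f); last by rewrite muln0.
  rewrite muln1; under eq_bigr do rewrite inE Af /=.
  rewrite -big_mkcond /= sum1_card.
  pose G := [set tau | near E f tau]; have -> : #|(fun tau => near E f tau)| = #|G|.
    by apply: eq_card => tau; rewrite inE.
  have cG := cardsC G; rewrite -/(ntau n) in cG; rewrite -cG.
  rewrite mul2n -addnn leq_add2l -(ler_nat R).
  pose Bad (x : X) := [set tau | eps < `|(tau_count E f tau x)%:R / n.+1%:R - profile E f R x|].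
  have far : #|~: G|%:R <= (ntau n)%:R / 2 :> R.
    apply: le_trans (_ : _ <= \sum_(x : X) #|Bad x|%:R) _.
      rewrite -natr_sum ler_nat; apply: (@leq_trans #|\bigcup_(x : X) Bad x|).
        apply/subset_leq_card/fintype.subsetP => tau; rewrite !inE => /forallPn[x]; rewrite -ltNge => h.
        by apply/bigcupP; exists x; rewrite ?inE.
      elim/big_rec2: _ => [|x m B _ mB]; first by rewrite cards0.
      by apply: leq_trans (leq_card_setU _ _) _; rewrite leq_add2l.
    apply: le_trans (_ : _ <= \sum_(x : X) (ntau n)%:R * ((meet_bound d r)%:R / (eps ^+ 2 * n.+1%:R))) _.
      by apply: ler_sum => x _; apply: card_tau_far.
    rewrite sumr_const -[leLHS]mulr_natl mulrCA ler_wpM2l// invfM mulrA mulrA ler_pdivrMr// -/(cX).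
    by move: KN; rewrite /K; move: (_ / _ : R) (n.+1%:R : R) => a b; lra.
  by move: far; rewrite -cG natrD; move: (#|G|%:R) (#|~: G|%:R) => a b; lra.
pose F (E : graph n) := #|[set f : {ffun 'I_n.+1 -> M} | A E f]|.
pose good (s : {perm 'I_n.+1 * 'I_d}) (f : {ffun 'I_n.+1 -> M}) :=
  A (edges_of s) f && [forall x : X, `|walk_mass R r d3 s f x - profile (edges_of s) f R x| <= cX.+1%:R * eps].
have near_good s tau f : s \in simple_matchings d n -> sorted_by s tau ->
    A (edges_of s) f -> near (edges_of s) f tau -> good s f.
  move=> sM so Af /forallP nr; rewrite /good Af; apply/forallP => x.
  have ge (y : X) : profile (edges_of s) f R y - eps <= walk_mass R r d3 s f y.
    apply: le_trans (tau_count_walk_mass f y sM so); have := nr y; rewrite ler_norml => /andP[+ _].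
    by move: (_ / _) (profile _ _ _ _) => a b h; lra.
  have D0 (y : X) : 0 <= walk_mass R r d3 s f y - profile (edges_of s) f R y + eps.
    by have := ge y; lra.
  have Ds : \sum_(y : X) (walk_mass R r d3 s f y - profile (edges_of s) f R y + eps) <= cX.+1%:R * eps.
    rewrite big_split /= sumrB sum_walk_mass sumr_const -[X in _ + X]mulr_natl -natr1 mulrDl mul1r addrC lerD2l.
    by have := A1 _ _ Af; lra.
  have := D0 x; have : walk_mass R r d3 s f x - profile (edges_of s) f R x + eps <= cX.+1%:R * eps.
    by apply: le_trans Ds; rewrite (bigD1 x)//= lerDl sumr_ge0.
  have : 1 * eps <= cX.+1%:R * eps by rewrite ler_wpM2r ?(ltW e0)// ler1n.
  rewrite ler_norml mul1r; move: (_ * eps) (walk_mass _ _ _ _ _ _) (profile _ _ _ _) => a b c h1 h2 h3.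
  by apply/andP; split; lra.
have key : (nsorted d n * \sum_(s in simple_matchings d n) F (edges_of s) <=
    2 * (nsorted d n * \sum_(s in simple_matchings d n) #|[set f | good s f]|))%N.
  rewrite -sum_regular_graphs big_distrr /=; apply: (@leq_trans (\sum_(E in regular_graphs d n) 2 * \sum_tau Anear E tau)).
    by apply: leq_sum => E Er; exact: half.
  rewrite -big_distrr /= leq_mul2l /=.
  rewrite (@sum_graph_tau d n nat 0%N addn Anear) /= big_distrr /=; apply: leq_sum => s sM.
  rewrite -(card_sorted sM) -sum_nat_const /= [leqRHS](eq_bigl (fun tau => sorted_by s tau)) => [|tau]; last by rewrite inE.
  apply: leq_sum => tau so; apply/subset_leq_card/fintype.subsetP => f; rewrite !inE => /andP[].
  exact: near_good.
have toset (P : {perm 'I_n.+1 * 'I_d} -> {ffun 'I_n.+1 -> M} -> bool) :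
    #|[set z : {perm 'I_n.+1 * 'I_d} * {ffun 'I_n.+1 -> M} | (z.1 \in simple_matchings d n) && P z.1 z.2]| =
    (\sum_(s in simple_matchings d n) #|[set f | P s f]|)%N.
  rewrite -sum1_card (partition_big (fun z : {perm 'I_n.+1 * 'I_d} * {ffun 'I_n.+1 -> M} => z.1) (mem (simple_matchings d n)))/=; last first.
    by move=> z; rewrite finset.in_set => /andP[].
  apply: eq_bigr => s sM; rewrite sum1_card.
  have pinj : injective (fun f : {ffun 'I_n.+1 -> M} => (s, f)) by move=> f f' [].
  rewrite -(card_imset _ pinj); apply: eq_card => -[s' f]; rewrite unfold_in /= finset.in_set /=.
  apply/andP/imsetP => [[/andP[_ P1] /eqP e]|[f' + [-> ->]]]; first by exists f; rewrite ?inE -?e.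
  by rewrite inE => ->; rewrite sM eqxx.
rewrite (toset (fun s f => A (edges_of s) f)) (toset good).
have [s0 s0M|no] := pickP (mem (simple_matchings d n)); last by rewrite big_pred0.
have : (0 < nsorted d n)%N.
  have [s sM /andP[_ so]] := sorted_by_ex [ffun=> 1%g] (edges_of_regular s0M).
  by rewrite -(card_sorted sM); apply/card_gt0P; exists [ffun=> 1%g]; rewrite inE.
by move=> ns; move: key; rewrite mulnCA leq_pmul2l.
Qed.

End transfer.

(** * Near-couplings, by continuity and compactness *)

Section continuity.
Variables (R : realType) (T : topologicalType).

Lemma continuous_sum_fin (I : finType) (P : pred I) (F : I -> T -> R) :
  (forall i, continuous (F i)) -> continuous (fun t => \sum_(i | P i) F i t).
Proof.
move=> cF; elim: (index_enum I) => [|i s IH].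
  rewrite (_ : (fun t => _) = fun=> 0); first by move=> t; exact: cvg_cst.
  by apply/funext => t; rewrite big_nil.
case Pi : (P i).
  rewrite (_ : (fun t => _) = fun t => F i t + \sum_(j <- s | P j) F j t).
    by move=> t; apply: cvgD; [exact: cF|exact: IH].
  by apply/funext => t; rewrite big_cons Pi.
rewrite (_ : (fun t => _) = fun t => \sum_(j <- s | P j) F j t)//.
by apply/funext => t; rewrite big_cons Pi.
Qed.


Lemma continuous_cst_fun (c : R) : continuous (fun _ : T => c).
Proof. by move=> t; exact: cvg_cst. Qed.

Lemma continuous_norm_fun (g : T -> R) : continuous g -> continuous (fun t => `|g t|).
Proof.
move=> cg t; apply: (@continuous_comp T R R g (fun x => `|x|) t); first exact: cg.
exact: norm_continuous.
Qed.

Lemma continuous_sub_fun (g g' : T -> R) : continuous g -> continuous g' -> continuous (fun t => g t - g' t).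
Proof. by move=> cg cg' t; apply: cvgB; [exact: cg|exact: cg']. Qed.

Lemma continuous_add_fun (g g' : T -> R) : continuous g -> continuous g' -> continuous (fun t => g t + g' t).
Proof. by move=> cg cg' t; apply: cvgD; [exact: cg|exact: cg']. Qed.

Lemma continuous_scale_fun c (g : T -> R) : continuous g -> continuous (fun t => c * g t).
Proof. by move=> cg t; apply: cvgM; [exact: cvg_cst|exact: cg]. Qed.

Lemma continuous_xlnx_fun (g : T -> R) : continuous g -> continuous (fun t => g t * ln (g t)).
Proof.
move=> cg t; apply: (@continuous_comp T R R g (fun x => x * ln x) t); first exact: cg.
exact: xlnx_continuous.
Qed.

End continuity.

Section compactness.
Variables (R : realType) (d r : nat) (M : finType).
Hypothesis d3 : (3 <= d)%N.
Hypothesis r0 : (0 < r)%N.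
Local Notation S := (S_ball d r).
Local Notation X := {ffun S -> M}.
Local Notation Z := {ffun S -> M * M}.
Local Notation Y2 := {ffun E_ball d r -> M * M}.

Definition aut_defect (w : mass R (M * M)%type S) : R :=
  \sum_(phi : {perm S} | `[< ball_aut phi >]) \sum_(z : Z) `|w [ffun u => z (phi u)] - w z|.

Definition flip_defect (w : mass R (M * M)%type S) : R :=
  \sum_(y : Y2) `|edge_mass d3 w (yflip d3 r0 y) - edge_mass d3 w y|.

Definition coupling_defect (q : mass R M S) (w : mass R (M * M)%type S) : R :=
  \sum_(x : X) `|\sum_(z : Z | [ffun u => (z u).1] == x) w z - q x| +
  \sum_(x : X) `|\sum_(z : Z | [ffun u => (z u).2] == x) w z - q x|.

(** Continuous in [w]; a nonnegative [w] at which it vanishes is an invariant coupling of [q] with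
    itself ([defect0]). The flip is tested on [edge_mass], as [w] need not be invariant. *)
Definition defect (q : mass R M S) (w : mass R (M * M)%type S) : R :=
  `|\sum_z w z - 1| + flip_defect w + aut_defect w + coupling_defect q w.

Let sum_norm0 (I : finType) (P : pred I) (F : I -> R) :
  \sum_(i | P i) `|F i| <= 0 -> forall i, P i -> F i = 0.
Proof.
move=> le0 i Pi; have : \sum_(i | P i) `|F i| = 0 by apply/eqP; rewrite eq_le le0 sumr_ge0.
by move/eqP; rewrite psumr_eq0// => /allP/(_ i (mem_index_enum i)); rewrite Pi normr_eq0 => /eqP.
Qed.

Lemma defect0 (q : mass R M S) (w : mass R (M * M)%type S) : (forall z, 0 <= w z) -> defect q w <= 0 -> invariant_mass w /\ self_coupling q w.
Proof.
move=> w0; rewrite /defect /coupling_defect.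
set a := `|_|; set b := flip_defect w; set c := aut_defect w; set e := \sum_(x : X) _; set f := \sum_(x : X) _ => le0.
have a0 : 0 <= a := normr_ge0 _. have b0 : 0 <= b by apply: sumr_ge0.
have c0 : 0 <= c by apply: sumr_ge0 => phi _; exact: sumr_ge0.
have e0 : 0 <= e by apply: sumr_ge0. have f0 : 0 <= f by apply: sumr_ge0.
have [ha hb hc he hf] : [/\ a <= 0, b <= 0, c <= 0, e <= 0 & f <= 0].
  by move: le0 a0 b0 c0 e0 f0; clear; move: a b c e f => a b c e f *; split; lra.
have waut : aut_invariant w.
  move=> phi phiA z; apply/eqP; rewrite -subr_eq0; apply/eqP.
  have cge : \sum_(z : Z) `|w [ffun u => z (phi u)] - w z| <= 0.
    apply: le_trans hc; rewrite /c /aut_defect (bigD1 phi) ?asboolT//= lerDl.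
    by apply: sumr_ge0 => ? _; exact: sumr_ge0.
  exact: (sum_norm0 cge).
split; last first.
  by split=> x; apply/eqP; rewrite -subr_eq0; apply/eqP; [exact: (sum_norm0 he)|exact: (sum_norm0 hf)].
have w1 : \sum_z w z = 1 by apply/eqP; rewrite -subr_eq0 -normr_eq0 eq_le ha a0.
have wflip y : marginal (E_ball d r) w (yflip d3 r0 y) = marginal (E_ball d r) w y.
  apply/eqP; rewrite -subr_eq0 -!(edge_mass_marginal d3 r0 waut); apply/eqP; exact: (sum_norm0 hb).
exact: (invariant_mass_flip w0 w1 waut wflip).
Qed.

(** [compact_defect] on the cube of all functions with values in [0, 1], compact by Tychonoff. *)
Lemma coupling_compact (q : mass R M S) (s : R) :
  (forall w : mass R (M * M)%type S, invariant_mass w -> self_coupling q w -> Sigma w <= s) ->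
  forall delta, 0 < delta -> exists2 eta, 0 < eta & forall w : mass R (M * M)%type S,
    (forall z, 0 <= w z <= 1) -> defect q w <= eta -> edge_Sigma d3 w <= s + delta.
Proof.
move=> hs delta delta0.
pose W : topologicalType := prod_topology (fun _ : Z => R : topologicalType).
pose m (f : W) : mass R (M * M)%type S := [ffun z => f z].
pose K : set W := [set f | forall z, `[0, 1]%classic (f z)]%classic.
have cK : compact K := @tychonoff Z (fun _ => R : topologicalType) (fun _ => `[0, 1]%classic) (fun _ => @segment_compact R 0 1).
have cp z : continuous (fun f : W => m f z : R).
  rewrite (_ : (fun f : W => m f z) = proj z); first exact: proj_continuous.
  by apply/funext => f; rewrite /m ffunE.
have cent (B : {fset tree d}) (h : W -> mass R (M * M)%type B) : (forall z, continuous (fun f => h f z)) ->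
    continuous (fun f => entropy (h f)).
  move=> ch; rewrite /entropy (_ : (fun f => _) = (fun f => -1 * \sum_x h f x * ln (h f x))); last first.
    by apply/funext => f; rewrite mulN1r.
  by apply: continuous_scale_fun; apply: continuous_sum_fin => x; apply: continuous_xlnx_fun; exact: ch.
have cem y : continuous (fun f => edge_mass d3 (m f) y).
  rewrite (_ : (fun f => _) = (fun f => d%:R^-1 * \sum_(i < d) \sum_(x : Z | ytype d3 i x == y) m f x)).
    by apply: continuous_scale_fun; apply: continuous_sum_fin => i; apply: continuous_sum_fin => x; exact: cp.
  by apply/funext => f; rewrite ffunE.
have cS : continuous (fun f => edge_Sigma d3 (m f)).
  by apply: continuous_sub_fun; [apply: cent => z; exact: cp|apply: continuous_scale_fun; apply: cent; exact: cem].
have cD : continuous (fun f => defect q (m f)).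
  apply: continuous_add_fun; [apply: continuous_add_fun; [apply: continuous_add_fun|]|apply: continuous_add_fun].
  - apply: continuous_norm_fun; apply: continuous_sub_fun; last exact: continuous_cst_fun.
    by apply: continuous_sum_fin => z; exact: cp.
  - by apply: continuous_sum_fin => y; apply: continuous_norm_fun; apply: continuous_sub_fun; exact: cem.
  - by apply: continuous_sum_fin => phi; apply: continuous_sum_fin => z; apply: continuous_norm_fun; apply: continuous_sub_fun; exact: cp.
  - apply: continuous_sum_fin => x; apply: continuous_norm_fun; apply: continuous_sub_fun; last exact: continuous_cst_fun.
    by apply: continuous_sum_fin => z; exact: cp.
  - apply: continuous_sum_fin => x; apply: continuous_norm_fun; apply: continuous_sub_fun; last exact: continuous_cst_fun.
    by apply: continuous_sum_fin => z; exact: cp.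
have Km f : K f -> forall z, 0 <= m f z <= 1.
  by move=> Kf z; rewrite ffunE; have := Kf z; rewrite /= in_itv.
have [|eta eta0 etaP] := compact_defect cK cS cD _ delta0 (s := s).
  move=> f Kf D0; have w0 z : 0 <= m f z by have /andP[] := Km f Kf z.
  have [wI wC] := defect0 w0 D0.
  by rewrite (edge_Sigma_Sigma d3 r0 (mass_aut wI)); exact: hs.
exists eta => // w w01 wD; have e : m (fun z => w z) = w by apply/ffunP => z; rewrite ffunE.
by have := etaP (fun z => w z); rewrite e; apply => // z; rewrite /= in_itv; exact: w01.
Qed.

End compactness.

Lemma defect_constant (R : realType) (a b c x : R) : 0 <= x ->
  c * (b * (2 * ((b + 1) * ((a + 1) * x)))) + 2 * (a * (b * ((b + 1) * ((a + 1) * x)) + x)) <=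
  (2 * c * b * ((b + 1) * (a + 1)) + 2 * a * (b * ((b + 1) * (a + 1)) + 1) + 1) * x.
Proof. by move=> x0; lra. Qed.

Section upper_bounds.
Variables (R : realType) (d r : nat).
Hypothesis d3 : (3 <= d)%N.
Hypothesis r0 : (0 < r)%N.
Local Notation S := (S_ball d r).

(** Exact, because [s] is a bijection of the half-edges that flips their types. *)
Lemma edge_walk_mass_flip (M : finType) n (s : {perm 'I_n.+1 * 'I_d}) (f : {ffun 'I_n.+1 -> M}) y :
  (forall h, s (s h) = h) ->
  edge_mass d3 (walk_mass R r d3 s f) (yflip d3 r0 y) = edge_mass d3 (walk_mass R r d3 s f) y.
Proof.
move=> sK; pose g := [ffun v => xwalk r d3 s f v].
have -> : walk_mass R r d3 s f = count_mass R n (xcount g).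
  by apply/ffunP => x; rewrite !ffunE; congr (_%:R / _); apply: eq_card => v; rewrite !inE ffunE.
rewrite !edge_count_mass -!ycount_xcount; congr (_%:R / _); rewrite /ycount.
rewrite -[LHS](card_imset _ (@perm_inj _ s)); apply: eq_card => h; rewrite -{1}[h]sK mem_imset; last exact: perm_inj.
rewrite !inE !ffunE (ytype_flip d3 r0 f h sK).
by rewrite (inj_eq (can_inj (yflipK d3 r0))).
Qed.

(** Copies of the tree do not depend on the colors. With [h] a projection, the profile of a pair of
    colorings has the profiles of both as marginals. *)
Lemma profile_image (M M' : finType) n (E : graph n) (F : {ffun 'I_n.+1 -> M'}) (h : M' -> M) (x : {ffun S -> M}) :
  \sum_(z : {ffun S -> M'} | [ffun u => h (z u)] == x) profile E F R z =
  profile E [ffun v => h (F v)] R x.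
Proof.
rewrite /profile -mulr_suml -natr_sum; congr (_%:R / _); rewrite exchange_big /=; apply: eq_bigr => tau _.
rewrite /tau_count -[RHS]sum1_card [RHS](partition_big (color F) (fun z => [ffun u => h (z u)] == x)) /=; last first.
  move=> b; rewrite finset.in_set => /and3P[_ _ /eqP <-]; apply/eqP/ffunP => u; rewrite !ffunE.
  by [].
apply: eq_bigr => z /eqP zx; rewrite [RHS]sum1_card; apply: eq_card => b.
rewrite [LHS]finset.in_set [RHS]unfold_in /= finset.in_set -!andbA; congr [&& _, _ & _].
have [cz|_] := eqVneq (color F b) z; last by rewrite andbF.
by rewrite andbT; apply/esym/eqP/ffunP => u; rewrite -zx !ffunE -cz ffunE.
Qed.

Lemma sum_profile_image (M M' : finType) n (E : graph n) (F : {ffun 'I_n.+1 -> M'}) (h : M' -> M) :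
  \sum_(z : {ffun S -> M'}) profile E F R z = \sum_(x : {ffun S -> M}) profile E [ffun v => h (F v)] R x.
Proof.
rewrite (partition_big (fun z : {ffun S -> M'} => [ffun u => h (z u)] : {ffun S -> M}) xpredT)//=.
by apply: eq_bigr => x _; exact: profile_image.
Qed.

Lemma sum_near (I : finType) (p q : I -> R) (eta : R) : \sum_i q i = 1 ->
  (forall i, `|p i - q i| <= eta) -> 1 - #|I|%:R * eta <= \sum_i p i.
Proof.
move=> q1 pq; have -> : 1 - #|I|%:R * eta = \sum_i (q i - eta).
  by rewrite sumrB q1 sumr_const [in LHS]mulr_natl.
apply: ler_sum => i _.
by have := pq i; rewrite ler_norml => /andP[+ _]; move: (p i) (q i) => a b; lra.
Qed.

Variable M : pointedFinType.
Local Notation X := {ffun S -> M}.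
Local Notation Z := {ffun S -> M * M}.
Variable q : mass R M S.
Hypothesis qI : invariant_mass q.

Definition near_profile n (eta : R) (E : graph n) (f : {ffun 'I_n.+1 -> M}) : bool :=
  [forall x : X, `|profile E f R x - q x| <= eta].

Let near_sum n eta (E : graph n) (f : {ffun 'I_n.+1 -> M}) : near_profile eta E f ->
  1 - #|{: X}|%:R * eta <= \sum_(x : X) profile E f R x.
Proof. by move=> /forallP h; apply: (sum_near (mass_sum1 qI)). Qed.

Let absorb2 (delta : R) : 0 < delta -> exists n0, forall n, (n0 <= n)%N -> 2 <= expR (n.+1%:R * delta).
Proof.
move=> d0; have [n0 n0P] := log_poly_le (ln 2) 0 d0; exists n0 => n /n0P; rewrite mul0r addr0 mulrC => h.
by rewrite -[leLHS](lnK (_ : 2 \is Num.pos)) ?posrE// ler_expR.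
Qed.

(** [transfer] reduces the count to pairs whose [walk_mass] is close to the profile, which
    [first_moment_le] counts; its factor 2 goes into [delta]. *)
Let upper (M' : finType) (eps s0 : R) (delta : R) : 0 < eps -> 0 < delta ->
  exists n0, forall n, (n0 <= n)%N -> ~~ odd (n.+1 * d) ->
  forall A : graph n -> {ffun 'I_n.+1 -> M'} -> bool,
  (forall E f, A E f -> 1 - eps <= \sum_(x : {ffun S -> M'}) profile E f R x) ->
  (forall s f, s \in simple_matchings d n -> A (edges_of s) f ->
     (forall x : {ffun S -> M'}, `|walk_mass R r d3 s f x - profile (edges_of s) f R x| <= #|{: {ffun S -> M'}}|.+1%:R * eps) ->
     edge_Sigma d3 (walk_mass R r d3 s f) <= s0) ->
  #|[set z : {perm 'I_n.+1 * 'I_d} * {ffun 'I_n.+1 -> M'} |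
      (z.1 \in simple_matchings d n) && A (edges_of z.1) z.2]|%:R <=
  #|matchings [set: 'I_n.+1 * 'I_d]%SET|%:R * expR (n.+1%:R * (s0 + delta)).
Proof.
move=> e0 d0; have d2 : 0 < delta / 2 by rewrite divr_gt0.
have [n1 n1P] := @transfer R d r M' d3 eps e0.
have [n2 n2P] := @first_moment_le R d r M' d3 r0 (delta / 2) d2.
have [n3 n3P] := absorb2 d2.
exists (n1 + n2 + n3)%N => n nn ev A A1 A2.
have [h1 h2 h3] : [/\ (n1 <= n)%N, (n2 <= n)%N & (n3 <= n)%N] by move: nn; clear; split; lia.
have := n1P n h1 A A1; set B := [set z | [&& _, _ & _]] => AB.
have := n2P n h2 ev B s0; rewrite -/B => /(_ _)/wrap[|hB].
  move=> [s f]; rewrite finset.in_set => /and3P[/= sM As /forallP near]; split.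
    by move: sM; rewrite finset.in_set => /andP[].
  exact: A2.
rewrite -(ler_nat R) natrM in AB; apply: le_trans AB _.
apply: le_trans (ler_pM _ _ (n3P n h3) hB) _ => //.
rewrite mulrCA -expRD; apply: ler_wpM2l => //; rewrite ler_expR -mulrDr ler_wpM2l//; lra.
Qed.

Lemma first_moment_upper (delta : R) : 0 < delta -> exists2 eta, 0 < eta & exists n0, forall n, (n0 <= n)%N ->
  ~~ odd (n.+1 * d) ->
  #|typical_pairs q n eta|%:R <=
  #|matchings [set: 'I_n.+1 * 'I_d]%SET|%:R * expR (n.+1%:R * (Sigma q + delta)) :> R.
Proof.
move=> d0; have d2 : 0 < delta / 2 by rewrite divr_gt0.
have [e e0 eP] := edge_Sigma_near d3 q d2.
pose c : R := #|{: X}|.+1%:R; have c0 : 0 < c by rewrite ltr0n.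
(* The distance from [walk_mass] to the profile is at most [c * (c * eta)], and from the profile to
   [q] at most [eta]. *)
pose eta := e / (c * c + 1); have cc0 : 0 < c * c + 1 by rewrite addr_gt0// mulr_gt0.
have eta0 : 0 < eta by rewrite divr_gt0.
have [n0 n0P] := @upper M (c * eta) (Sigma q + delta / 2) _ (mulr_gt0 c0 eta0) d2.
exists eta => //; exists n0 => n nn ev; have := n0P n nn ev (@near_profile n eta) _ _.
have -> : Sigma q + delta / 2 + delta / 2 = Sigma q + delta by lra.
apply.
  move=> E f /near_sum; apply: le_trans; rewrite lerD2l lerN2 ler_wpM2r ?(ltW eta0)// ler_nat.
  exact: leqnSn.
move=> s f sM /forallP nf wp.
suff : `|edge_Sigma d3 (walk_mass R r d3 s f) - edge_Sigma d3 q| <= delta / 2.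
  rewrite (edge_Sigma_Sigma d3 r0 (mass_aut qI)) ler_norml => /andP[_].
  by move: (edge_Sigma _ _) (Sigma q) => a b; lra.
apply: eP => x; apply: le_trans (ler_distD (profile (edges_of s) f R x) _ _) _.
apply: le_trans (lerD (wp x) (nf x)) _; rewrite -/c mulrA -{2}[eta]mul1r -mulrDl.
by rewrite /eta mulrC divfK// gt_eqF.
Qed.

Definition pair_coloring n (f f' : {ffun 'I_n.+1 -> M}) : {ffun 'I_n.+1 -> M * M} := [ffun v => (f v, f' v)].

(** A pair of colorings is a coloring by [M * M]. Its [walk_mass] is exactly flip-invariant, and
    almost invariant with almost the right marginals by comparison with its profile, so that
    [coupling_compact] bounds its [edge_Sigma]. *)
Lemma second_moment_upper (delta : R) :
  (forall w : mass R (M * M)%type S, invariant_mass w -> self_coupling q w -> Sigma w <= 2 * Sigma q) ->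
  0 < delta -> exists2 eta, 0 < eta & exists n0, forall n, (n0 <= n)%N ->
  ~~ odd (n.+1 * d) ->
  #|[set z : {perm 'I_n.+1 * 'I_d} * {ffun 'I_n.+1 -> M * M} | (z.1 \in simple_matchings d n) &&
     (near_profile eta (edges_of z.1) [ffun v => (z.2 v).1] && near_profile eta (edges_of z.1) [ffun v => (z.2 v).2])]|%:R <=
  #|matchings [set: 'I_n.+1 * 'I_d]%SET|%:R * expR (n.+1%:R * (2 * Sigma q + delta)) :> R.
Proof.
move=> hq d0; have d2 : 0 < delta / 2 by rewrite divr_gt0.
have [e e0 eP] := coupling_compact d3 r0 hq d2.
pose cX : R := #|{: X}|%:R; pose cZ : R := #|{: Z}|%:R; pose cP : R := #|{: {perm S}}|%:R.
have cX0 : 0 <= cX by []. have cZ0 : 0 <= cZ by []. have cP0 : 0 <= cP by [].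
pose kap eta : R := (cZ + 1) * ((cX + 1) * eta).
(* The factor by which [defect_constant] bounds the sum of the invariance and coupling defects in
   terms of [eta]. *)
pose C : R := 2 * cP * cZ * ((cZ + 1) * (cX + 1)) + 2 * cX * (cZ * ((cZ + 1) * (cX + 1)) + 1) + 1.
have C0 : 0 < C by rewrite ltr_wpDl// addr_ge0// !mulr_ge0// ?addr_ge0// !mulr_ge0// addr_ge0.
pose eta := e / C; have eta0 : 0 < eta by rewrite divr_gt0.
have eps0 : 0 < (cX + 1) * eta by rewrite mulr_gt0// ltr_wpDl.
have [n0 n0P] := @upper (M * M)%type ((cX + 1) * eta) (2 * Sigma q + delta / 2) _ eps0 d2.
exists eta => //; exists n0 => n nn ev.
have := n0P n nn ev (fun E F => near_profile eta E [ffun v => (F v).1] && near_profile eta E [ffun v => (F v).2]) _ _.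
have -> : 2 * Sigma q + delta / 2 + delta / 2 = 2 * Sigma q + delta by lra.
apply.
  move=> E F /andP[/near_sum h _]; rewrite (sum_profile_image E F fst); apply: le_trans h.
  by rewrite lerD2l lerN2 ler_wpM2r ?(ltW eta0)// lerDl.
move=> s F sM /andP[/forallP n1 /forallP n2] wp.
have sK : forall h, s (s h) = h by case/simple_matchingsP: sM.
set w := walk_mass R r d3 s F in wp *; set p2 := profile (edges_of s) F R in wp.
have w1 : \sum_z w z = 1 by exact: sum_walk_mass.
have w0 z : 0 <= w z by rewrite ffunE divr_ge0.
apply: eP.
  by move=> z; rewrite w0 -w1 (bigD1 z)//= lerDl sumr_ge0.
have kapE : #|{: Z}|.+1%:R * ((cX + 1) * eta) = kap eta by rewrite -natr1.
rewrite kapE in wp.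
have wsum (P : pred Z) (k : R) (x : R) : `|\sum_(z | P z) p2 z - x| <= k -> `|\sum_(z | P z) w z - x| <= cZ * kap eta + k.
  move=> h; apply: le_trans (ler_distD (\sum_(z | P z) p2 z) _ _) _; apply: lerD h.
  rewrite -sumrB; apply: le_trans (ler_norm_sum _ _ _) _.
  apply: le_trans (_ : _ <= \sum_(z : Z) kap eta) _; last by rewrite sumr_const -[leLHS]mulr_natl.
  rewrite big_mkcond /=; apply: ler_sum => z _; case: ifP => _; first exact: wp.
  exact: le_trans (normr_ge0 _) (wp z).
have fd : flip_defect d3 r0 w = 0.
  by apply: big1 => y _; rewrite edge_walk_mass_flip// subrr normr0.
have k0 : 0 <= kap eta by rewrite mulr_ge0 ?(ltW eps0)// addr_ge0.
have ad : aut_defect w <= cP * (cZ * (2 * kap eta)).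
  apply: le_trans (_ : _ <= \sum_(phi : {perm S}) cZ * (2 * kap eta)) _; last by rewrite sumr_const -[leLHS]mulr_natl.
  rewrite /aut_defect big_mkcond /=; apply: ler_sum => phi _; case: asboolP => [phiA|_]; last by apply: mulr_ge0 => //; apply: mulr_ge0.
  apply: le_trans (_ : _ <= \sum_(z : Z) 2 * kap eta) _; last by rewrite sumr_const -[leLHS]mulr_natl.
  apply: ler_sum => z _; apply: le_trans (ler_distD (p2 z) _ _) _.
  have e1 : p2 [ffun u => z (phi u)] = p2 z by exact: profile_aut.
  rewrite [leRHS]mulr_natl mulr2n; apply: lerD; last by rewrite distrC; exact: wp.
  by rewrite -e1; exact: wp.
have cd : coupling_defect q w <= 2 * (cX * (cZ * kap eta + eta)).
  have half (h : M * M -> M) : (forall x, `|profile (edges_of s) [ffun v => h (F v)] R x - q x| <= eta) ->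
      \sum_(x : X) `|\sum_(z : Z | [ffun u => h (z u)] == x) w z - q x| <= cX * (cZ * kap eta + eta).
    move=> nh; apply: le_trans (_ : _ <= \sum_(x : X) (cZ * kap eta + eta)) _; last by rewrite sumr_const -[leLHS]mulr_natl.
    by apply: ler_sum => x _; apply: wsum; rewrite profile_image.
  have := lerD (half _ n1) (half _ n2); rewrite /coupling_defect.
  by move=> /le_trans; apply; move: (cX * _) => a; lra.
rewrite /defect w1 subrr normr0 fd !add0r; apply: le_trans (lerD ad cd) _.
have -> : e = C * eta by rewrite /eta mulrC divfK// gt_eqF.
exact: defect_constant (ltW eta0).
Qed.

End upper_bounds.

(** * Markov processes on the tree *)

Section process_cylinders.
Local Open Scope classical_set_scope.

Lemma measure_partition disp (T : measurableType disp) (R : realType) (mu : {measure set T -> \bar R})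
    (I : finType) (h : T -> I) (C : set T) : (forall i, measurable [set t | h t = i]) -> measurable C ->
  mu C = (\sum_i mu (C `&` [set t | h t = i]))%E.
Proof.
move=> mh mC; suff H (s : seq I) : uniq s ->
    mu (C `&` [set t | h t \in s]) = (\sum_(i <- s) mu (C `&` [set t | h t = i]))%E /\
    measurable (C `&` [set t | h t \in s]).
  have [e _] := H _ (index_enum_uniq I); rewrite -e; congr (mu _); apply/seteqP; split=> t /=; last by case.
  by move=> Ct; split => //; rewrite mem_index_enum.
elim: s => [_|i s IH /= /andP[iN /IH[e m]]].
  rewrite big_nil (_ : _ `&` _ = set0) ?measure0; first by split => //; exact: measurable0.
  by apply/seteqP; split=> t //= [].
have -> : C `&` [set t | h t \in i :: s] = (C `&` [set t | h t = i]) `|` (C `&` [set t | h t \in s]).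
  apply/seteqP; split=> t /=; rewrite inE.
    by case=> Ct /orP[/eqP hi|hs]; [left|right].
  by case=> -[Ct]; [move=> ->; rewrite eqxx|move=> ->; rewrite orbT].
have mi : measurable (C `&` [set t | h t = i]) by exact: measurableI.
split; last exact: measurableU.
rewrite big_cons -e measureU//; apply/seteqP; split=> t //= [[_ hi] [_]].
by rewrite hi (negbTE iN).
Qed.

Section configurations.
Variables (R : realType) (d : nat) (M : pointedFinType).
Implicit Types (A B : seq (tree d)) (X Y : tree d -> M).
Variable mu : probability (config d M) R.

(** Cylinders are indexed by lists, with concatenation for intersection; by [agree_mem] only the
    underlying set counts. *)
Definition agree A X : set (config d M) := [set Y | forall u, u \in A -> Y u = X u].

Lemma agree_cons u A X : agree (u :: A) X = [set Y | Y u = X u] `&` agree A X.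
Proof.
apply/seteqP; split=> Y /=.
  move=> h; split=> [|w wA]; apply: h; rewrite inE ?eqxx ?wA ?orbT//.
by move=> [h1 h2] w; rewrite inE => /orP[/eqP ->|/h2].
Qed.

Lemma agree_cat A B X : agree (A ++ B) X = agree A X `&` agree B X.
Proof.
apply/seteqP; split=> Y /=.
  by move=> h; split=> w wA; apply: h; rewrite mem_cat wA ?orbT.
by move=> [h1 h2] w; rewrite mem_cat => /orP[/h1|/h2].
Qed.

Lemma agree_mem A B X : A =i B -> agree A X = agree B X.
Proof. by move=> AB; apply/seteqP; split=> Y /= h u uA; apply: h; rewrite ?AB// -AB. Qed.

Lemma agree_sigma (S : set (tree d)) A X : (forall u, u \in A -> S u) ->
  <<s @coordinate_events d M S >> (agree A X).
Proof.
elim: A => [_|u A IH h].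
  rewrite (_ : agree _ _ = setT); last by apply/seteqP; split.
  exact: (@measurableT _ (g_sigma_algebraType (@coordinate_events d M S))).
rewrite agree_cons; apply: (@measurableI _ (g_sigma_algebraType (@coordinate_events d M S))).
  apply: sub_sigma_algebra; exists u; first by apply: h; rewrite inE eqxx.
  by exists (X u).
by apply: IH => w wA; apply: h; rewrite inE wA orbT.
Qed.

Lemma measurable_agree A X : measurable (agree A X : set (config d M)).
Proof. exact: agree_sigma. Qed.

Definition cylp A X : R := fine (mu (agree A X)).

Lemma cylpE A X : (cylp A X)%:E = mu (agree A X).
Proof. by rewrite fineK// fin_num_measure//; exact: measurable_agree. Qed.

Lemma cylp_ge0 A X : 0 <= cylp A X.
Proof. by rewrite -lee_fin cylpE. Qed.

Lemma cylp_le A B X : {subset A <= B} -> cylp B X <= cylp A X.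
Proof.
move=> AB; rewrite -lee_fin !cylpE; apply: le_measure; rewrite ?inE; try exact: measurable_agree.
by move=> Y h u /AB; exact: h.
Qed.

Lemma cylp_mem A B X : A =i B -> cylp A X = cylp B X.
Proof. by move=> /agree_mem AB; rewrite /cylp AB. Qed.

Lemma cylp_invariant (F : tree d -> tree d) A X : Defs.invariant mu -> tree_aut F ->
  cylp (map F A) X = cylp A (fun u => X (F u)).
Proof.
move=> inv FA; have := inv F FA _ (measurable_agree A (fun u => X (F u))).
rewrite /cylp => <-; congr (fine (mu _)); apply/seteqP; split=> Y /= h u.
  by move=> uA; apply: h; exact: map_f.
by case/mapP => w wA ->; exact: h.
Qed.

Lemma cylinder_agree (B : {fset tree d}) (x : {ffun B -> M}) X :
  (forall u : B, X (val u) = x u) -> cylinder x = agree (enum_fset B) X.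
Proof.
move=> Xx; apply/seteqP; split=> Y /= h u.
  by move=> uB; rewrite (h [` uB]%fset) -Xx.
by rewrite h//; exact: valP.
Qed.

Section markov.
Variables (r : nat) (u v : tree d) (su : pred (tree d)).
Hypothesis mk : r_markov r mu.
Hypothesis uv : tadj u v.
Hypothesis suP : forall w, su w -> side u v w.
Hypothesis svP : forall w, ~~ su w -> side v u w.
Local Notation W := (enum_fset (tree_ball r.-1 [set u; v])).

Let markov_sides A B X : all su A -> all (predC su) B ->
  cylp (A ++ B ++ W) X * cylp W X = cylp (A ++ W) X * cylp (B ++ W) X.
Proof.
move=> /allP Au /allP Bv.
pose x : {ffun tree_ball r.-1 [set u; v] -> M} := [ffun w => X (val w)].
have xE : cylinder x = agree W X by apply: cylinder_agree => w; rewrite ffunE.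
have := mk uv x (agree_sigma X (fun w wA => suP (Au w wA))) (agree_sigma X (fun w wB => svP (Bv w wB))).
rewrite /= xE -!agree_cat -!cylpE -!EFinM => -[].
by rewrite -catA => ->.
Qed.

(* The conditional independence of the two sides of an edge gives that of [A]
   and [B] given their intersection. *)
Lemma markov_factor A B X : {subset W <= A} -> {subset W <= B} ->
  {in A, forall w, ~~ su w -> w \in B} -> {in B, forall w, su w -> w \in A} ->
  cylp (A ++ B) X * cylp [seq w <- A | w \in B] X = cylp A X * cylp B X.
Proof.
move=> WA WB AB BA.
pose lo (C : seq (tree d)) := [seq w <- C | su w]; pose ro (C : seq (tree d)) := [seq w <- C | ~~ su w].
have split_ C : {subset W <= C} -> cylp C X * cylp W X = cylp (lo C ++ W) X * cylp (ro C ++ W) X.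
  move=> WC; rewrite -markov_sides ?filter_all//; congr (_ * _); apply: cylp_mem => w.
  rewrite !mem_cat !mem_filter; case wW : (w \in W); first by rewrite !orbT WC.
  by rewrite orbF; case: (su w); rewrite ?andbF ?orbF ?andbT.
set I := [seq w <- A | w \in B]; set e := cylp W X.
(* If the conditioning event is null, all terms vanish; otherwise the identity is obtained after
   multiplication by the square of its probability. *)
have [e0|e0] := eqVneq e 0.
  have z C : {subset W <= C} -> cylp C X = 0.
    by move=> WC; apply/eqP; rewrite eq_le cylp_ge0 andbT -e0; exact: cylp_le.
  rewrite (z (A ++ B)) ?(z A) ?mul0r// => w /WA wA.
  by rewrite mem_cat wA.
have sAB : cylp (A ++ B) X * e = cylp (lo A ++ W) X * cylp (ro B ++ W) X.
  rewrite split_; last by move=> w /WA wA; rewrite mem_cat wA.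
  congr (_ * _); apply: cylp_mem => w; rewrite !mem_cat !mem_filter mem_cat; congr (_ || _).
    by case sw : (su w) => //=; case wB: (w \in B); rewrite ?orbF ?orbT// BA.
  by case sw : (su w) => //=; case wA: (w \in A) => //=; rewrite AB ?sw.
have sI : cylp I X * e = cylp (lo B ++ W) X * cylp (ro A ++ W) X.
  rewrite split_; last by move=> w wW; rewrite mem_filter WB ?WA.
  congr (_ * _); apply: cylp_mem => w; rewrite !mem_cat !mem_filter; congr (_ || _).
    by case sw : (su w) => //=; case wB: (w \in B) => //=; rewrite BA ?sw.
  by case sw : (su w) => //=; case wA: (w \in A); rewrite ?andbF ?andbT// AB ?sw.
have sA := split_ A WA; have sB := split_ B WB; rewrite -/e in sA sB.
apply: (mulIf e0); apply: (mulIf e0).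
transitivity ((cylp (A ++ B) X * e) * (cylp I X * e)).
  by rewrite -!mulrA; congr (_ * _); rewrite mulrCA.
rewrite sAB sI; transitivity ((cylp A X * e) * (cylp B X * e)); last first.
  by rewrite -!mulrA; congr (_ * _); rewrite mulrCA.
by rewrite sA sB mulrACA [RHS]mulrACA; congr (_ * _); exact: mulrC.
Qed.

End markov.

Section entropies.

Definition mu_mass (B : {fset tree d}) : mass R M B := [ffun x => fine (mu (cylinder x))].

Definition extend (B : {fset tree d}) (x : {ffun B -> M}) : tree d -> M :=
  fun u => if insub u is Some w then x w else point.

Lemma extendE (B : {fset tree d}) (x : {ffun B -> M}) (u : B) : extend x (val u) = x u.
Proof. by rewrite /extend valK. Qed.

Lemma mu_mass_cylp (B : {fset tree d}) (x : {ffun B -> M}) X : (forall u : B, X (val u) = x u) ->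
  mu_mass B x = cylp (enum_fset B) X.
Proof. by move=> Xx; rewrite ffunE (cylinder_agree Xx). Qed.

Lemma mu_mass_ge0 (B : {fset tree d}) x : 0 <= mu_mass B x.
Proof. by rewrite (mu_mass_cylp (extendE x)) cylp_ge0. Qed.

Let restr (S A : {fset tree d}) (x : {ffun S -> M}) : {ffun A -> M} := [ffun u => extend x (val u)].

Let read (S : {fset tree d}) (Y : config d M) : {ffun S -> M} := [ffun u => Y (val u)].

Let read_cylinder (S : {fset tree d}) (x : {ffun S -> M}) : [set Y | read S Y = x] = cylinder x.
Proof.
apply/seteqP; split=> Y /=; first by move=> <- u; rewrite ffunE.
by move=> h; apply/ffunP => u; rewrite ffunE h.
Qed.

Lemma measurable_cylinder (S : {fset tree d}) (x : {ffun S -> M}) : measurable (cylinder x : set (config d M)).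
Proof. by rewrite (cylinder_agree (extendE x)); exact: measurable_agree. Qed.

Lemma mu_mass_restrict (S A : {fset tree d}) (y : {ffun A -> M}) : {subset A <= S} ->
  mu_mass A y = \sum_(x : {ffun S -> M} | [ffun u : A => extend x (val u)] == y) mu_mass S x.
Proof.
move=> AS; rewrite ffunE (@measure_partition _ _ _ mu _ (read S)); first last.
- exact: measurable_cylinder.
- by move=> x; rewrite read_cylinder; exact: measurable_cylinder.
have eqc (x : {ffun S -> M}) : mu (cylinder y `&` [set Y | read S Y = x]) =
    (if [ffun u : A => extend x (val u)] == y then mu_mass S x else 0)%:E.
  rewrite read_cylinder; case: eqP => [<-|ne].
    rewrite ffunE fineK ?fin_num_measure//; last exact: measurable_cylinder.
    congr (mu _); apply/seteqP; split=> Y /=; first by case.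
    move=> h; split=> // u; have uS : val u \in S by apply: AS; exact: valP.
    rewrite ffunE; transitivity (x [` uS]%fset); first exact: (h [` uS]%fset).
    exact: esym (extendE x [` uS]%fset).
  rewrite (_ : _ `&` _ = set0) ?measure0//; apply/seteqP; split=> Y //= [h1 h2]; case: ne.
  apply/ffunP => u; have uS : val u \in S by apply: AS; exact: valP.
  by rewrite ffunE -h1 -[val u]/(val [` uS]%fset) h2 extendE.
rewrite (eq_bigr _ (fun x _ => eqc x)).
by rewrite sumEFin /= -big_mkcond.
Qed.

Lemma mu_mass_sum1 (S : {fset tree d}) : \sum_x mu_mass S x = 1.
Proof.
have := @measure_partition _ _ _ mu _ (read S) setT _ measurableT => /(_ _)/wrap[|h].
  by move=> x; rewrite read_cylinder; exact: measurable_cylinder.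
apply: EFin_inj; rewrite -(@probability_setT _ _ _ mu) h -sumEFin; apply: eq_bigr => x _.
rewrite setTI read_cylinder ffunE fineK ?fin_num_measure//; exact: measurable_cylinder.
Qed.

(** The entropy of the colors on [A], written as a mean over the colorings of a common larger set
    [S], so that the entropies of several sets combine term by term. *)
Definition seq_entropy (S : {fset tree d}) A : R := - \sum_(x : {ffun S -> M}) mu_mass S x * ln (cylp A (extend x)).

Lemma entropy_mu_mass (S B : {fset tree d}) : {subset B <= S} ->
  entropy (mu_mass B) = seq_entropy S (enum_fset B).
Proof.
move=> BS; congr (- _); rewrite [RHS](partition_big (restr B) xpredT)//=; apply: eq_bigr => y _.
rewrite [in X in X * _](mu_mass_restrict y BS) mulr_suml; apply: eq_bigr => x /eqP xy; congr (_ * ln _).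
by apply: mu_mass_cylp => u; rewrite -xy ffunE.
Qed.

Lemma seq_entropy_mem S A B : A =i B -> seq_entropy S A = seq_entropy S B.
Proof. by move=> AB; congr (- _); apply: eq_bigr => x _; rewrite (cylp_mem _ AB). Qed.

Lemma cylp_gt0 (S : {fset tree d}) (x : {ffun S -> M}) A : {subset A <= S} -> 0 < mu_mass S x ->
  0 < cylp A (extend x).
Proof.
by move=> AS; rewrite (mu_mass_cylp (extendE x)) => /lt_le_trans; apply; exact: cylp_le.
Qed.

(** Takes logarithms in a product identity between cylinder probabilities, at the colorings of [S]
    of positive mass; this turns conditional independence into additivity of entropies. *)
Lemma seq_entropy_factor (S : {fset tree d}) A B C D : {subset A <= S} -> {subset B <= S} ->
  {subset C <= S} -> {subset D <= S} ->
  (forall X, cylp A X * cylp B X = cylp C X * cylp D X) ->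
  seq_entropy S A + seq_entropy S B = seq_entropy S C + seq_entropy S D.
Proof.
move=> AS BS CS DS h; rewrite /seq_entropy -!opprD -!big_split /=; congr (- _); apply: eq_bigr => x _.
rewrite -!mulrDr; have [->|x0] := eqVneq (mu_mass S x) 0; first by rewrite !mul0r.
have {}x0 : 0 < mu_mass S x by rewrite lt_neqAle eq_sym x0 mu_mass_ge0.
by rewrite -!lnM ?posrE ?(cylp_gt0 _ x0)// h.
Qed.

Lemma entropy_mu_mass_invariant (A B : {fset tree d}) (F : tree d -> tree d) : Defs.invariant mu -> tree_aut F ->
  enum_fset B =i map F (enum_fset A) -> entropy (mu_mass B) = entropy (mu_mass A).
Proof.
move=> inv FA BA; have Fi := bij_inj FA.1.
have FB (u : A) : F (val u) \in B by rewrite BA; apply: map_f; exact: valP.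
pose G (u : A) : B := [` FB u]%fset.
have Gi : injective G by move=> u w /(congr1 val) /Fi /val_inj.
have Gs (w : B) : exists u, G u = w.
  have : val w \in enum_fset B by exact: valP.
  by rewrite BA => /mapP[u uA e]; exists [` uA]%fset; apply: val_inj.
have [G' G'K] := fin_all_exists Gs.
have GK : cancel G G' by move=> u; apply: Gi; rewrite G'K.
rewrite /entropy; congr (- _).
rewrite (reindex (fun x : {ffun A -> M} => [ffun w : B => x (G' w)])) /=; last first.
  exists (fun y : {ffun B -> M} => [ffun u => y (G u)]) => y _; apply/ffunP => u; rewrite !ffunE ?GK//.
  by rewrite G'K.
apply: eq_bigr => x _; suff -> : mu_mass B [ffun w => x (G' w)] = mu_mass A x by [].
rewrite (mu_mass_cylp (extendE _)) (cylp_mem _ BA) cylp_invariant//; apply/esym/mu_mass_cylp => u.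
by rewrite -[F (val u)]/(val (G u)) extendE ffunE GK.
Qed.

End entropies.

End configurations.

End process_cylinders.

Section ball_center.
Variables (d t : nat).
Hypothesis d3 : (3 <= d)%N.

(* The signed depth, positive in the branch of the image of the root, changes by
   at most one along an edge, but takes values that differ by more than the
   radius at the image of the root and at a leaf of another branch. *)
Lemma ball_aut_root (phi : {perm S_ball d t}) : ball_aut phi -> phi (rootS t d3) = rootS t d3.
Proof.
move=> phiA; set w := phi _; apply/eqP; apply: contraT => wr.
case wE : (tree_val (val w)) => [|i w'].
  by case/eqP: wr; apply: val_inj; apply: tree_inj; rewrite wE.
pose g (u : seq nat) : nat := if head 0%N u == i then (t + size u)%N else (t - size u)%N.
have gstep (u u' : seq nat) : is_child u u' -> (g u <= (g u').+1)%N /\ (g u' <= (g u).+1)%N.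
  case: u' => // j u' /= /eqP ->; rewrite /g size_belast /=.
  case: u' => [|k u'] /=; last by case: (j == i); clear; lia.
  by case: (0 == i)%N; case: (j == i); clear; lia.
have low (u : S_ball d t) : (t + size (val w) <= g (tree_val (val (phi u))) + size (val u))%N.
  elim/(@S_ind d t d3): u => [|u c uc IH]; first by rewrite -/w /g wE /= eqxx addn0.
  have : tadj (val (phi u)) (val (phi c)) by rewrite phiA /tadj uc.
  have := is_child_size uc; move: IH => /= IH sc; rewrite sc.
  by case/orP => /gstep[]; move: IH; clear; lia.
pose j : nat := if i == 1%N then 2%N else 1%N.
have xl : tree_label d (j :: nseq t.-1 1%N).
  rewrite /= all_nseq; apply/andP; split; first by rewrite /j; move: d3; clear; case: eqP; lia.
  by apply/orP; right; move: d3; clear; lia.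
have wt : (size (val w) <= t)%N by have := valP w; rewrite /= in_S_ball.
have t0 : (0 < t)%N by move: wt => /=; rewrite wE /=; clear; lia.
have xS : mkT d (j :: nseq t.-1 1%N) \in S_ball d t.
  by rewrite in_S_ball// mkTK//= size_nseq prednK.
have := low (phi^-1%g [` xS]%fset); rewrite permKV /= mkTK// /g /=.
have -> : (j == i) = false by rewrite /j; have [->//|ne] := eqVneq i 1%N; rewrite eq_sym (negbTE ne).
have := valP (phi^-1%g [` xS]%fset); rewrite /= in_S_ball//.
by rewrite wE size_nseq /=; move: t0; clear; lia.
Qed.

End ball_center.

(** * Invariance of Sigma along levels *)

Section tree_sides.
Variables (d : nat).
Hypothesis d3 : (3 <= d)%N.

Definition branch (i : nat) : tree d := mkT d [:: i].

Lemma branchE i : (0 < i <= d)%N -> tree_val (branch i) = [:: i].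
Proof. by move=> id; rewrite mkTK//= id. Qed.

Lemma branch_adj i : (0 < i <= d)%N -> tadj (root d) (branch i).
Proof. by move=> id; rewrite /tadj branchE. Qed.

Let side_step (a b u w : tree d) : side a b u -> tadj u w ->
  ~~ ((u == a) && (w == b) || (u == b) && (w == a)) -> side a b w.
Proof.
move=> [k [p [pp pl pk]]] uw n; exists k.+1, (rcons p w); split.
- by rewrite rcons_path pp pl uw n.
- by rewrite last_rcons.
- by rewrite size_rcons ltnS.
Qed.

(** The two sides of an edge at the root are told apart by the first letter, which gives the
    decidable predicate that [markov_factor] expects. *)
Lemma side_branch i (w : tree d) : (0 < i <= d)%N ->
  (head 0%N w != i -> side (root d) (branch i) w) /\ (head 0%N w == i -> side (branch i) (root d) w).
Proof.
move=> id; have bE := branchE id; have i0 : (i == 0)%N = false by move: id; clear; case: i.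
have br : (branch i == root d) = false by apply/eqP => /(congr1 (@tree_val d)); rewrite bE.
move: {2}(size w) (leqnn (size w)) => m; elim: m w => [|m IH] w wm.
  have w0 : tree_val w = [::] by apply/eqP; rewrite -size_eq0 -leqn0.
  have -> : w = root d by apply: tree_inj.
  by split => //=; [move=> _; exists 0%N, [::]|rewrite eq_sym i0].
case wE : (tree_val w) => [|j w'].
  have -> : w = root d by apply: tree_inj.
  by split => //=; [move=> _; exists 0%N, [::]|rewrite eq_sym i0].
have wn : tree_val w <> [::] by rewrite wE.
have pw : is_child (parent w) w by exact: is_child_parent.
have pm : (size (parent w) <= m)%N by have := is_child_size pw; move: wm => /=; clear; lia.
have [IH1 IH2] := IH _ pm.
case: w' wE => [|k w'] wE.
  have p0 : parent w = root d.
    by apply: tree_inj; apply/eqP; rewrite -size_eq0; have := is_child_size pw; rewrite /= wE /= => -[<-].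
  rewrite /=; split=> [ji|/eqP ji].
    apply: (side_step (u := root d)); first by exists 0%N, [::].
      by rewrite -p0 /tadj pw.
    rewrite eqxx /= eq_sym negb_or; apply/andP; split; last by rewrite negb_and eq_sym br.
    by apply: contra ji => /eqP wb; move: wE; rewrite -wb bE => -[->].
  have -> : w = branch i by apply: tree_inj; rewrite wE bE ji.
  by exists 0%N, [::].
have hp : head 0%N (parent w) = j.
  have := pw; rewrite /is_child wE /= => /eqP ->.
  by case: (w').
have wr : (w == root d) = false by apply/eqP => /(congr1 (@tree_val d)); rewrite wE.
have wb : (w == branch i) = false by apply/eqP => /(congr1 (@tree_val d)); rewrite wE bE.
rewrite /= -hp; split=> [/IH1|/IH2] h; apply: (side_step h); rewrite ?wr ?wb ?andbF//.
  by rewrite /tadj pw.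
by rewrite /tadj pw.
Qed.

Lemma tree_ball_size k (S : set (tree d)) m (w : tree d) : finite_set S -> (forall s, S s -> (size s <= m)%N) ->
  w \in tree_ball k S -> (size w <= m + k)%N.
Proof.
move=> Sf Sm; rewrite in_fset_set; last exact: finite_ball.
rewrite inE => -[s Ss [p [pp <- pk]]].
apply: leq_trans (_ : (size s + size p <= _)%N); last by apply: leq_add; [exact: Sm|].
elim: p s pp {Ss pk} => [|x p IH] s /=; first by rewrite addn0.
move=> /andP[sx /IH]; have : (size x <= (size s).+1)%N.
  by case/orP: sx => /is_child_size /= ->; clear; lia.
by move=> h /leq_trans; apply; rewrite addnS -addSn leq_add2r.
Qed.

End tree_sides.

Lemma arith_progression (R : realType) (h : nat -> R) (a e : R) n : h 0%N = a ->
  (forall k, (k < n)%N -> h k.+1 + a = h k + e) -> h n = a + n%:R * (e - a).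
Proof.
move=> h0; elim: n => [_|n IH hS]; first by rewrite h0 mul0r addr0.
have -> : h n.+1 = h n + e - a by rewrite -hS// addrK.
by rewrite IH => [|k kn]; [rewrite -natr1 mulrDl mul1r !addrA|exact/hS/leqW].
Qed.

Lemma Sigma_step (R : realType) (a b c x e : R) : x = a + e * (b - a) -> b + c = a + a ->
  x - e / 2 * b = a - e / 2 * c.
Proof. by move=> -> h; have -> : c = a + a - b by [rewrite -h addrAC subrr add0r]; lra. Qed.

Section Sigma_levels.
Variables (R : realType) (d : nat) (M : pointedFinType).
Hypothesis d3 : (3 <= d)%N.
Variables (mu : probability (config d M) R) (r : nat).
Hypothesis r0 : (0 < r)%N.
Hypothesis inv : Defs.invariant mu.
Hypothesis mk : r_markov r mu.
Local Notation H B := (entropy (mu_mass mu B)).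

Lemma marginal_mu_mass t : (0 < t)%N -> marginal (E_ball d t) (mu_mass mu (S_ball d t)) = mu_mass mu (E_ball d t).
Proof.
move=> t0; apply/ffunP => y; rewrite (marginal_E d3 t0) (@mu_mass_restrict _ _ _ mu (S_ball d t)).
  apply: eq_bigl => x; congr (_ == _); apply/ffunP => u; rewrite !ffunE.
  by rewrite -(extendE x) toSK// (E_size d3 t0).
by move=> u uE; rewrite in_S_ball//; exact: (E_size d3 t0 [` uE]%fset).
Qed.

(** An automorphism of the ball fixes the root by [ball_aut_root] and extends to the tree, where
    [mu] is invariant. *)
Lemma mu_mass_invariant t : (0 < t)%N -> invariant_mass (mu_mass mu (S_ball d t)).
Proof.
move=> t0; have maut : aut_invariant (mu_mass mu (S_ball d t)).
  move=> phi phiA x; have proot := ball_aut_root d3 phiA.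
  have [|F [FA F0 FE]] := S_ball_extension d3 phiA.
    by move=> u u0; have -> : u = rootS t d3; [apply: val_inj; rewrite u0|rewrite proot].
  rewrite (mu_mass_cylp mu (X := fun u => extend x (F u))) => [|u]; last first.
    by rewrite FE extendE ffunE.
  rewrite (mu_mass_cylp mu (extendE x)) -(cylp_invariant _ _ inv FA); apply: cylp_mem => u.
  apply/mapP/idP => [[w wS ->]|uS].
    by rewrite -[w]/(val [` wS]%fset) FE; exact: valP.
  exists (val (phi^-1%g [` uS]%fset)); first exact: valP.
  by rewrite FE permKV.
have mflip y : marginal (E_ball d t) (mu_mass mu (S_ball d t)) (yflip d3 t0 y) = marginal (E_ball d t) (mu_mass mu (S_ball d t)) y.
  rewrite marginal_mu_mass//; have FA := flipT_aut d3.
  rewrite (mu_mass_cylp mu (X := fun u => extend y (flipT u))) => [|u]; last first.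
    by rewrite -(flipT_E d3 t0) extendE ffunE.
  rewrite (mu_mass_cylp mu (extendE y)) -(cylp_invariant _ _ inv FA); apply: cylp_mem => u.
  have EB (w : tree d) : w \in E_ball d t -> flipT w \in E_ball d t.
    by move=> wE; have := flipT_E d3 t0 [` wE]%fset => /= <-; exact: valP.
  apply/mapP/idP => [[w wS ->]|uS]; first exact: EB.
  by exists (flipT u); [exact: EB|rewrite flipTK].
exact: (invariant_mass_flip (@mu_mass_ge0 _ _ _ mu (S_ball d t)) (mu_mass_sum1 mu (S_ball d t)) maut mflip).
Qed.

Section level.
Variable t : nat.
Hypothesis rt : (r <= t)%N.
Let t0 : (0 < t)%N. Proof. exact: leq_trans r0 rt. Qed.
Local Notation St := (enum_fset (S_ball d t)).
Local Notation SS := (S_ball d t.+1).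
Local Notation h := (seq_entropy mu SS).

Let hd (w : tree d) : nat := head 0%N w.

Let in_St w : (w \in St) = (size w <= t)%N. Proof. exact: in_S_ball. Qed.

Let W_size i w : (0 < i <= d)%N -> w \in enum_fset (tree_ball r.-1 [set root d; branch d i]%classic) -> (size w <= t)%N.
Proof.
move=> id wW; apply: leq_trans rt; rewrite -(prednK r0) -add1n; apply: tree_ball_size wW => //.
by move=> s [->|->] //; rewrite branchE.
Qed.

(** Interpolates between [S_ball d t] for [k = 0] and [S_ball d t.+1] for [k = d], by lengthening
    the first [k] branches by one. *)
Let A (k : nat) : seq (tree d) := [seq w : tree d <- enum_fset SS | (size w <= t + ((0 < hd w) && (hd w <= k)))%N].

Let in_A k w : (k <= d)%N -> (w \in A k) = (size w <= t + (0 < hd w <= k))%N.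
Proof.
move=> kd; rewrite mem_filter -[w \in enum_fset _]/(w \in SS) in_S_ball//.
by apply: andb_idr => h1; apply: leq_trans h1 _; rewrite -(addn1 t) leq_add2l leq_b1.
Qed.

Let rotE k := map (@rotT d k.+1) (enum_fset (E_ball d t.+1)).

Let in_rotE k w : (k < d)%N -> (w \in rotE k) = (size w <= t + (hd w == k.+1))%N.
Proof.
move=> kd; have id : (0 < k.+1 <= d)%N by [].
have key (u : tree d) : (u \in E_ball d t.+1) = (size (rotT k.+1 u) <= t + (hd (rotT k.+1 u) == k.+1))%N.
  rewrite in_E_ball// /hd rotTE//; case: (tree_val u) => [|j u'] //=.
  rewrite /rotl; have [j1|j1] := eqVneq j 1%N; first by rewrite eqxx.
  have -> : ((if (j <= k.+1)%N then j.-1 else j) == k.+1) = false; last by [].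
  by apply/eqP; move: j1; clear; case: leqP; lia.
apply/mapP/idP => [[u uE ->]|wE]; first by rewrite -key.
have rK : rotT k.+1 (rotTV k.+1 w) = w.
  by apply: tree_inj; rewrite rotTE// rotTVE//; have [] := rotwVP d3 id (tree_valP w).
by exists (rotTV k.+1 w); rewrite ?rK//; rewrite -[_ \in _]/(_ \in E_ball d t.+1) key rK.
Qed.

(** [A k.+1] is the union of [A k] and of the ball [rotE k] around the edge from the root to k + 1.
    They meet in the ball of radius t and are conditionally independent given it; [rotE k] has the
    entropy of [E_ball d t.+1] by invariance. *)
Let step k : (k < d)%N -> h (A k.+1) + H (S_ball d t) = h (A k) + H (E_ball d t.+1).
Proof.
move=> kd; have id : (0 < k.+1 <= d)%N by [].
have sub_S (C : seq (tree d)) : (forall w, w \in C -> (size w <= t.+1)%N) -> {subset C <= SS}.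
  by move=> Cs w /Cs; rewrite in_S_ball.
have A1 j : (j <= d)%N -> {subset A j <= SS}.
  by move=> jd; apply: sub_S => w; rewrite in_A//; case: (_ && _); clear; lia.
have B1 : {subset rotE k <= SS}.
  by apply: sub_S => w; rewrite in_rotE//; case: (_ == _); clear; lia.
have StSS : {subset S_ball d t <= SS} by move=> w; rewrite !in_S_ball// => /leqW.
have ESS : {subset E_ball d t.+1 <= SS}.
  by move=> w; rewrite in_E_ball// in_S_ball//=; case: under1; clear; lia.
have -> : H (S_ball d t) = h St by rewrite (entropy_mu_mass mu StSS).
have -> : H (E_ball d t.+1) = h (rotE k).
  pose B : {fset tree d} := seq_fset tt (rotE k).
  have BE : enum_fset B =i rotE k by move=> w; rewrite -[w \in enum_fset _]/(w \in B) seq_fsetE.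
  have BSS : {subset B <= SS} by move=> w; rewrite seq_fsetE => /B1.
  rewrite -(entropy_mu_mass_invariant inv (rotT_aut d3 id) BE) (entropy_mu_mass mu BSS).
  exact: seq_entropy_mem.
apply: seq_entropy_factor => //; [exact: A1|exact: (A1 k (ltnW kd))|].
move=> X; have AB (w : tree d) : (w \in A k) = (size w <= t + (0 < hd w <= k))%N by apply: in_A; exact: ltnW.
rewrite -[RHS](@markov_factor _ _ _ mu r (root d) (branch d k.+1) (fun w => head 0%N w != k.+1) mk).
- congr (_ * _); apply: cylp_mem => w.
    rewrite mem_cat in_A// AB in_rotE//; move: (hd w) (size w) => a b; clear.
    by case: (eqVneq a k.+1) => [->|ak]; rewrite ?ltnn /=; lia.
  rewrite mem_filter AB in_rotE// in_St; move: (hd w) (size w) => a b; clear.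
  by case: (eqVneq a k.+1) => [->|ak]; rewrite ?ltnn /=; lia.
- exact: branch_adj.
- by move=> w; exact: (side_branch w id).1.
- by move=> w /negPn; exact: (side_branch w id).2.
- by move=> w /(W_size id); rewrite AB; clear; lia.
- by move=> w /(W_size id); rewrite in_rotE//; clear; lia.
- by move=> w + /negPn h1; rewrite AB in_rotE// -[head 0%N w]/(hd w) in h1 *; rewrite (eqP h1) ltnn; clear; lia.
- by move=> w + h1; rewrite AB in_rotE// (negbTE (h1 : hd w != k.+1)); clear; lia.
Qed.

Let flips := map (@flipT d) St.

Let in_flips w : (w \in flips) = (size (flipT w) <= t)%N.
Proof.
apply/mapP/idP => [[u uS ->]|wS]; first by rewrite flipTK// -in_St.
by exists (flipT w); [rewrite in_St|rewrite flipTK].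
Qed.

Let size_flip (w : tree d) : size (flipT w) = (if hd w == 1%N then (size w).-1 else (size w).+1).
Proof.
rewrite flipTE// /hd; case: (tree_val w) => [|i u] //=.
by case: (eqVneq i 1%N) => // _; case: u.
Qed.

(** [E_ball d t.+1] is the union of the balls of radius t around both ends of the edge, and
    [E_ball d t] is their intersection. *)
Let flip_step : H (E_ball d t.+1) + H (E_ball d t) = H (S_ball d t) + H (S_ball d t).
Proof.
have StSS : {subset S_ball d t <= SS} by move=> w; rewrite !in_S_ball// => /leqW.
have ESS : {subset E_ball d t.+1 <= SS}.
  by move=> w; rewrite in_E_ball// in_S_ball//=; case: under1; clear; lia.
have EtSS : {subset E_ball d t <= SS}.
  by move=> w; rewrite in_E_ball// in_S_ball//=; case: under1; move: t0; clear; lia.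
have FSS : {subset flips <= SS}.
  by move=> w; rewrite in_flips in_S_ball// size_flip; case: (_ == _); clear; lia.
have eF : H (S_ball d t) = h flips.
  pose B : {fset tree d} := seq_fset tt flips.
  have BE : enum_fset B =i flips by move=> w; rewrite -[w \in enum_fset _]/(w \in B) seq_fsetE.
  have BSS : {subset B <= SS} by move=> w; rewrite seq_fsetE => /FSS.
  rewrite -(entropy_mu_mass_invariant inv (flipT_aut d3) BE) (entropy_mu_mass mu BSS).
  exact: seq_entropy_mem.
rewrite {2}eF (entropy_mu_mass mu ESS) (entropy_mu_mass mu EtSS) (entropy_mu_mass mu StSS).
apply: seq_entropy_factor => // X.
have id : (0 < 1 <= d)%N by move: d3; clear; lia.
have fb : first_nbr d = branch d 1 by apply: tree_inj; rewrite first_nbrE// branchE.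
have u1 (w : tree d) : under1 w = (hd w == 1%N) by rewrite /hd; case: (tree_val w).
rewrite -[RHS](@markov_factor _ _ _ mu r (root d) (branch d 1) (fun w => head 0%N w != 1%N) mk).
- congr (_ * _); apply: cylp_mem => w.
    rewrite mem_cat -[w \in enum_fset _]/(w \in E_ball d t.+1) in_E_ball//= in_St in_flips size_flip u1.
    by case: (_ == _); clear; lia.
  rewrite mem_filter -[w \in enum_fset _]/(w \in E_ball d t) in_E_ball// in_St in_flips size_flip u1.
  by case: (_ == _); move: t0; clear; lia.
- exact: branch_adj.
- by move=> w; exact: (side_branch w id).1.
- by move=> w /negPn; exact: (side_branch w id).2.
- by move=> w /(W_size id); rewrite in_St.
- move=> w wW; rewrite in_flips; have wE : w \in E_ball d r by rewrite /E_ball fb; exact: wW.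
  have := E_size d3 r0 (toE d3 r0 (flipT (val [` wE]%fset))); rewrite flipT_E => /leq_trans; apply.
  exact: rt.
- by move=> w + /negPn h1; rewrite in_St in_flips size_flip (h1 : hd w == 1%N); clear; lia.
- by move=> w + h1; rewrite in_St in_flips size_flip (negbTE (h1 : hd w != 1%N)); clear; lia.
Qed.

(** The d steps give H(S_{t+1}) = H(S_t) + d (H(E_{t+1}) - H(S_t)), and [flip_step] gives H(E_{t+1})
    + H(E_t) = 2 H(S_t); eliminate. *)
Lemma Sigma_mu_massS : Sigma (mu_mass mu (S_ball d t.+1)) = Sigma (mu_mass mu (S_ball d t)).
Proof.
have hA : h (A d) = H (S_ball d t) + d%:R * (H (E_ball d t.+1) - H (S_ball d t)).
  apply: (arith_progression (h := fun k => h (A k))) => [|k kd]; last exact: step.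
  have StSS : {subset S_ball d t <= SS} by move=> w; rewrite !in_S_ball// => /leqW.
  rewrite (entropy_mu_mass mu StSS); apply: seq_entropy_mem => w.
  by rewrite in_A// in_St; congr (_ <= _)%N; case: (hd w) => [|a]; rewrite addn0.
have hd1 : h (A d) = H (S_ball d t.+1).
  rewrite (@entropy_mu_mass _ _ _ mu SS SS)//; apply: seq_entropy_mem => w.
  rewrite in_A// -[w \in enum_fset _]/(w \in SS) in_S_ball// /hd.
  have := tree_valP w; case: (tree_val w) => [|i u] //= /andP[-> _].
  by rewrite addn1.
by rewrite /Sigma !marginal_mu_mass// -hd1; exact: Sigma_step hA flip_step.
Qed.

End level.

Lemma Sigma_mu_mass t : (r <= t)%N -> Sigma (mu_mass mu (S_ball d t)) = Sigma (mu_mass mu (S_ball d r)).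
Proof.
move=> /subnKC <-; elim: (t - r)%N => [|k IH]; first by rewrite addn0.
by rewrite addnS Sigma_mu_massS ?IH// leq_addr.
Qed.

End Sigma_levels.

(** * Concentration *)

Section Lipschitz.
Variables (R : realType) (d t n : nat) (M : finType).
Hypothesis d3 : (3 <= d)%N.
Local Notation S := (S_ball d t).
Local Notation V := 'I_n.+1.
Local Notation H := ('I_n.+1 * 'I_d)%type.
Implicit Types (E : graph n) (f : {ffun V -> M}) (s : {perm H}).

Lemma embeddings_agree E E' (D : {set V}) (b : {ffun S -> V}) :
  (forall u w, u \notin D -> w \notin D -> gadj E u w = gadj E' u w) ->
  (forall u, b u \notin D) -> (b \in embeddings E) = (b \in embeddings E').
Proof.
move=> EE bD; apply/embeddingsP/embeddingsP => -[bi h]; split=> // u w; rewrite -h.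
  by rewrite EE.
by rewrite EE.
Qed.

Lemma card_embeddings_diff E E' (D : {set V}) :
  (forall v, (#|[set w | gadj E v w]| <= d)%N) ->
  (forall u w, u \notin D -> w \notin D -> gadj E u w = gadj E' u w) ->
  (#|[set b : {ffun S -> V} | b \in embeddings E & b \notin embeddings E']| <= #|D| * emb_bound d t)%N.
Proof.
move=> degE EE; apply: (@leq_trans #|\bigcup_(v in D) [set b in embeddings E | [exists u : S, b u == v]]|).
  apply/subset_leq_card/fintype.subsetP => b; rewrite inE => /andP[bE]; apply: contraR => bD.
  rewrite -(@embeddings_agree E E' D)// => u; apply: contra bD => uD.
  by apply/bigcupP; exists (b u) => //; rewrite inE bE; apply/existsP; exists u.
rewrite -sum_nat_const.
elim/big_rec2: _ => [|v m A vD mA]; first by rewrite cards0.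
apply: leq_trans (leq_card_setU _ _) _; apply: leq_add mA.
exact: card_embeddings_through.
Qed.

Let weight E f (x : {ffun S -> M}) (b : {ffun S -> V}) : R :=
  ((b \in embeddings E) && (color f b == x))%:R * #|[set tau | increasing b tau]|%:R.

Let profileE E f x : profile E f R x = (\sum_b weight E f x b) / (ntau n * n.+1)%:R.
Proof.
rewrite /profile sum_tau_count natr_sum big_mkcond /=; congr (_ / _); apply: eq_bigr => b _.
by rewrite /weight; case: (_ && _); rewrite ?mul1r ?mul0r.
Qed.

(** Only embeddings that meet [D] can differ, at most [emb_bound] through each vertex in either
    graph, and each one weighs at most 1 / n. *)
Lemma profile_dist E E' f (D : {set V}) :
  (forall v, (#|[set w | gadj E v w]| <= d)%N) -> (forall v, (#|[set w | gadj E' v w]| <= d)%N) ->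
  (forall u w, u \notin D -> w \notin D -> gadj E u w = gadj E' u w) ->
  \sum_(x : {ffun S -> M}) `|profile E f R x - profile E' f R x| <= (2 * (#|D| * emb_bound d t))%N%:R / n.+1%:R.
Proof.
move=> degE degE' EE.
pose diff (b : {ffun S -> V}) : R := ((b \in embeddings E) (+) (b \in embeddings E'))%:R.
have w1 (b : {ffun S -> V}) : \sum_(x : {ffun S -> M}) `|weight E f x b - weight E' f x b| <= diff b * (ntau n)%:R.
  rewrite (bigD1 (color f b))//= big1 ?addr0 => [|x xb]; last first.
    by rewrite /weight eq_sym (negbTE xb) !andbF subrr normr0.
  rewrite /weight eqxx !andbT -mulrBl normrM [X in _ * X]ger0_norm//; apply: ler_pM => //.
    by rewrite /diff; case: (_ \in _); case: (_ \in _); rewrite /= ?subrr ?subr0 ?sub0r ?normrN ?normr0 ?normr1.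
  by rewrite ler_nat; exact: max_card.
have N0 : 0 < (ntau n * n.+1)%:R :> R by rewrite ltr0n muln_gt0 ntau_gt0.
apply: (@le_trans _ _ ((\sum_b diff b * (ntau n)%:R) / (ntau n * n.+1)%:R)).
  rewrite ler_pdivlMr// mulr_suml; apply: (@le_trans _ _ (\sum_(x : {ffun S -> M}) \sum_b `|weight E f x b - weight E' f x b|)).
    apply: ler_sum => x _; rewrite !profileE -mulrBl normrM [X in _ * X * _]gtr0_norm ?invr_gt0// divfK ?gt_eqF//.
    by rewrite -sumrB; exact: ler_norm_sum.
  by rewrite exchange_big /=; apply: ler_sum => b _; exact: w1.
rewrite -mulr_suml natrM invfM mulrA mulfK ?gt_eqF ?ltr0n ?ntau_gt0//.
rewrite ler_wpM2r ?invr_ge0// /diff -natr_sum ler_nat mul2n -addnn.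
apply: (@leq_trans (#|[set b : {ffun S -> V} | b \in embeddings E & b \notin embeddings E']| +
                   #|[set b : {ffun S -> V} | b \in embeddings E' & b \notin embeddings E]|)).
  rewrite -!sum1_card [X in (_ <= X + _)%N]big_mkcond /= [X in (_ <= _ + X)%N]big_mkcond /= -big_split /=; apply: leq_sum => b _.
  by rewrite !inE; case: (_ \in _); case: (_ \in _).
apply: leq_add; first exact: card_embeddings_diff.
by apply: card_embeddings_diff => // u w uD wD; rewrite EE.
Qed.

(** The switching affects only edges at the vertices of [a], [b] and of their partners, four
    vertices at most; this gives 8 = 2 * 4. *)
Lemma profile_switch s a b f : s \in matchings [set: H]%SET ->
  \sum_(x : {ffun S -> M}) `|profile (edges_of (s ^ tperm a b)%g) f R x - profile (edges_of s) f R x| <=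
  (8 * emb_bound d t)%N%:R / n.+1%:R.
Proof.
move=> sM; have s'M : (s ^ tperm a b)%g \in matchings [set: H]%SET.
  have := matchingsJ (tperm a b) sM; congr (_ \in matchings _).
  by apply/setP => x; rewrite -{1}[x](tpermK a b) mem_imset ?inE//; exact: perm_inj.
have inv s1 : s1 \in matchings [set: H]%SET -> forall h, s1 (s1 h) = h.
  by move=> /matchingsP[].
pose D : {set V} := [set a.1; b.1; (s a).1; (s b).1]%SET.
have cD : (#|D| <= 4)%N.
  by rewrite /D; apply: leq_trans (leq_card_setU _ _) _; rewrite cards1 addn1 ltnS; apply: leq_trans (leq_card_setU _ _) _; rewrite cards1 addn1 ltnS cards2; case: (_ != _).
apply: le_trans (profile_dist (D := D) _ _ _ _) _.
- by move=> v; exact: card_gadj_edges_of (inv _ s'M) v.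
- by move=> v; exact: card_gadj_edges_of (inv _ sM) v.
- move=> u w uD wD; rewrite !gadj_edges_of; [|exact: inv..]; congr (_ && _); apply: eq_existsb => i.
  rewrite /nbr; have ua : (u, i) != a by apply: contra uD => /eqP h; rewrite /D -h !inE eqxx.
  have ub : (u, i) != b by apply: contra uD => /eqP h; rewrite /D -h !inE eqxx ?orbT.
  have -> : (s ^ tperm a b)%g (u, i) = tperm a b (s (u, i)).
    have tp : tperm a b (u, i) = (u, i) by apply: tpermD; rewrite eq_sym.
    by rewrite conjgE tpermV !permM tp.
  case: tpermP => // e.
    have : u \in D by rewrite /D -e !inE inv// eqxx ?orbT.
    by rewrite (negbTE uD).
  have : u \in D by rewrite /D -e !inE inv// eqxx ?orbT.
  by rewrite (negbTE uD).
by rewrite ler_wpM2r ?invr_ge0// ler_nat mulnA leq_mul2r; apply/orP; right; move: cD; clear; lia.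
Qed.

End Lipschitz.

Lemma concentration_exponent (R : realType) (N e l c th : R) : N * (l * (l * (4 * c ^+ 2 * e))) <= N * (l * th) ->
  N * e * (2 * (l * c) ^+ 2) - l * (N * th) <= - (N * (l * th / 2)).
Proof. by rewrite !expr2 => h; lra. Qed.

(** * The free energy *)

Section partition_function.
Variables (R : realType) (d t : nat) (M : pointedFinType).
Hypothesis d3 : (3 <= d)%N.
Variable q : mass R M (S_ball d t).

Definition deviation n (E : graph n) (f : {ffun 'I_n.+1 -> M}) : R := \sum_x `|profile E f R x - q x|.

Lemma deviation_ge0 n (E : graph n) f : 0 <= deviation E f.
Proof. exact: sumr_ge0. Qed.

(** A soft version of the logarithm of the number of colorings with small deviation. A switching
    changes [n * deviation] by a constant for every coloring, hence this by at most [b] times that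
    constant, whereas the number itself may jump. *)
Definition free_energy n (b : R) (s : {perm 'I_n.+1 * 'I_d}) : R :=
  ln (\sum_(f : {ffun 'I_n.+1 -> M}) expR (- (b * (n.+1%:R * deviation (edges_of s) f)))).

Lemma partition_gt0 n (b : R) (s : {perm 'I_n.+1 * 'I_d}) :
  0 < \sum_(f : {ffun 'I_n.+1 -> M}) expR (- (b * (n.+1%:R * deviation (edges_of s) f))).
Proof.
rewrite (bigD1 [ffun=> point])//= ltr_pwDl ?expR_gt0// sumr_ge0// => f _; exact: expR_ge0.
Qed.

Let K : R := (8 * emb_bound d t)%N%:R.

Lemma deviation_switch n s (a b : 'I_n.+1 * 'I_d) (f : {ffun 'I_n.+1 -> M}) : s \in matchings [set: 'I_n.+1 * 'I_d]%SET ->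
  n.+1%:R * deviation (edges_of (s ^ tperm a b)%g) f <= n.+1%:R * deviation (edges_of s) f + K.
Proof.
move=> sM; have := @profile_switch R d t n M d3 s a b f sM; rewrite ler_pdivlMr ?ltr0n// -/K mulrC => h.
rewrite -lerBlDl -mulrBr; apply: le_trans h; rewrite ler_pM2l ?ltr0n// -sumrB; apply: ler_sum => x _.
by rewrite lerBlDr; apply: le_trans (ler_distD (profile (edges_of s) f R x) _ _) _.
Qed.

Lemma free_energy_switch n (be : R) s (a b : 'I_n.+1 * 'I_d) : 0 <= be -> s \in matchings [set: 'I_n.+1 * 'I_d]%SET ->
  free_energy be s <= free_energy be (s ^ tperm a b)%g + be * K.
Proof.
move=> be0 sM; rewrite /free_energy -[X in _ + X]expRK -lnM ?posrE ?partition_gt0 ?expR_gt0//.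
rewrite ler_ln ?posrE ?mulr_gt0 ?partition_gt0 ?expR_gt0// mulr_suml; apply: ler_sum => f _.
rewrite -expRD ler_expR lerNl opprD opprK lerBlDr -mulrDr ler_wpM2l//.
exact: deviation_switch.
Qed.

Lemma free_energy_lipschitz n (be : R) s (a b : 'I_n.+1 * 'I_d) : 0 <= be -> s \in matchings [set: 'I_n.+1 * 'I_d]%SET ->
  `|free_energy be (s ^ tperm a b)%g - free_energy be s| <= be * K.
Proof.
move=> be0 sM; have s'M : (s ^ tperm a b)%g \in matchings [set: 'I_n.+1 * 'I_d]%SET.
  have := matchingsJ (tperm a b) sM; congr (_ \in matchings _).
  by apply/setP => x; rewrite -{1}[x](tpermK a b) mem_imset ?inE//; exact: perm_inj.
have h1 := free_energy_switch a b be0 sM; have := free_energy_switch a b be0 s'M.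
rewrite -conjgM tperm2 conjg1 => h2; rewrite ler_distl; apply/andP; split; [rewrite lerBlDr; exact: h1|exact: h2].
Qed.

Lemma free_energy_concentration (be th : R) : 0 <= be -> 0 < th -> exists2 kap, 0 < kap & forall n,
  let N := n.+1%:R : R in let U := [set: 'I_n.+1 * 'I_d]%SET in let avg := mavg U (free_energy be) in
  #|[set s in matchings U | N * th <= free_energy be s - avg]|%:R <= #|matchings U|%:R * expR (- (N * kap)) /\
  #|[set s in matchings U | N * th <= avg - free_energy be s]|%:R <= #|matchings U|%:R * expR (- (N * kap)).
Proof.
(* The added 1 keeps [c] positive when [be] is 0. *)
move=> be0 th0; pose c := be * K + 1; have c0 : 0 < c by rewrite ltr_wpDl// mulr_ge0.
have d0 : 0 < d%:R :> R by rewrite ltr0n (leq_trans _ d3).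
(* The first bound is the range of [matchings_tail]; the second makes the quadratic term at most
   half of the linear one. *)
pose lam := Num.min (2^-1 / c) (th / (4 * c ^+ 2 * d%:R)).
have c2 : 0 < 4 * c ^+ 2 * d%:R by rewrite !mulr_gt0// exprn_gt0.
have lam0 : 0 < lam by rewrite lt_min !divr_gt0.
have lam1 : lam * c <= 2^-1 by rewrite -ler_pdivlMr// ge_min lexx.
have lam2 : lam * (4 * c ^+ 2 * d%:R) <= th by rewrite -ler_pdivlMr// ge_min lexx orbT.
exists (lam * th / 2) => [|n N U avg]; first by rewrite divr_gt0// mulr_gt0.
have Um : (#|U| <= (n.+1 * d).*2)%N by rewrite cardsT card_prod !card_ord -addnn leq_addr.
have Lip s : s \in matchings U -> {in U &, forall a b, `|free_energy be (s ^ tperm a b)%g - free_energy be s| <= c}.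
  move=> sM a b _ _; apply: le_trans (free_energy_lipschitz a b be0 sM) _; by rewrite lerDl.
have LipN s : s \in matchings U -> {in U &, forall a b, `|- free_energy be (s ^ tperm a b)%g - - free_energy be s| <= c}.
  by move=> sM a b aU bU; rewrite -opprD normrN; exact: Lip.
have expo : 2 * (lam * c) ^+ 2 *+ (n.+1 * d) - lam * (N * th) <= - (N * (lam * th / 2)).
  rewrite -mulr_natl natrM; apply: concentration_exponent.
  by rewrite ler_pM2l ?ltr0n// ler_pM2l.
have tail F := @matchings_tail _ R U F c lam (N * th) _ Um.
split.
  apply: le_trans (tail _ Lip (ltW lam0) lam1) _; by rewrite ler_wpM2l// ler_expR.
have := tail _ LipN (ltW lam0) lam1; have -> : mavg U (fun s => - free_energy be s) = - avg by rewrite /mavg sumrN mulNr.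
under eq_finset do rewrite opprK addrC.
by move=> /le_trans; apply; rewrite ler_wpM2l// ler_expR.
Qed.

End partition_function.

(** * Weak topology *)

Section copies_of_the_tree.
Local Open Scope classical_set_scope.
Local Open Scope ring_scope.

Lemma step_bound (R : realType) (x a b s c e : R) : x <= c + e + (a + 2 * c * b - c * s) ->
  - (c + e) + (a - 2 * c * b + c * s) <= x -> `|x - a| <= e + 2 * c * b + c * (1 - s).
Proof. by move=> h1 h2; rewrite ler_norml; apply/andP; split; lra. Qed.

Section step_functions.
Context {disp} {T : measurableType disp} {R : realType}.
Variable nu : probability T R.

Lemma bounded_integrable (F : T -> R) C : measurable_fun [set: T] F -> (forall g, `|F g| <= C) ->
  nu.-integrable [set: T] (EFin \o F).
Proof.
move=> mF FC; apply: measurable_bounded_integrable => //; first by rewrite [ltLHS]probability_setT ltry.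
by exists C; split; [exact: num_real|move=> K CK g _; exact: le_trans (FC g) (ltW CK)].
Qed.

Lemma Rintegral_indic A : measurable A -> \int[nu]_g (\1_A g : R) = fine (nu A).
Proof. by move=> mA; rewrite /Rintegral integral_indic// setIT. Qed.

Lemma indic_le1 (A : set T) g : `|\1_A g : R| <= 1.
Proof. by rewrite /indic; case: (_ \in _); rewrite ?normr1 ?normr0. Qed.

Lemma step_integral (I : finType) (P : I -> set T) (c0 : R) (c : I -> R) : (forall i, measurable (P i)) ->
  nu.-integrable [set: T] (EFin \o (fun g => c0 + \sum_i c i * \1_(P i) g)) /\
  \int[nu]_g (c0 + \sum_i c i * \1_(P i) g) = c0 + \sum_i c i * fine (nu (P i)).
Proof.
move=> mP; rewrite -[index_enum I]/(index_enum I); elim: (index_enum I) => [|i s [IH1 IH2]].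
  rewrite big_nil addr0; under eq_fun do rewrite big_nil addr0; split.
    by apply: (@bounded_integrable _ `|c0|); [exact: measurable_cst|].
  by rewrite Rintegral_cst// [X in fine X]probability_setT mulr1.
have e : (fun g => c0 + \sum_(j <- i :: s) c j * \1_(P j) g) =
    (fun g => c i * \1_(P i) g + (c0 + \sum_(j <- s) c j * \1_(P j) g)).
  by apply/funext => g; rewrite big_cons addrCA.
have mi : measurable_fun [set: T] (fun g => \1_(P i) g : R) by exact: measurable_realfun.measurable_indic.
have h1 : nu.-integrable [set: T] (EFin \o (fun g => \1_(P i) g : R)).
  by apply: (@bounded_integrable _ 1) => // g; exact: indic_le1.
have h2 : nu.-integrable [set: T] (EFin \o (fun g => c i * \1_(P i) g)).
  apply: (@bounded_integrable _ `|c i|) => [|g]; first exact: measurable_realfun.measurable_funM.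
  by rewrite normrM ler_piMr// indic_le1.
rewrite e big_cons; split; last first.
  by rewrite RintegralD// RintegralZl// Rintegral_indic// IH2 addrCA.
by have := integrableD measurableT h2 IH1; apply: eq_integrable => // g _; rewrite /= EFinD.
Qed.

(* [bad] cells are those on which the oscillation of [F] is not controlled. *)
Lemma step_approximation (I : finType) (P : I -> set T) (F : T -> R) (a : I -> R) (bad : pred I) (C delta : R) :
  (forall i, measurable (P i)) -> (forall i j g, P i g -> P j g -> i = j) ->
  measurable_fun [set: T] F -> (forall g, `|F g| <= C) -> (forall i, `|a i| <= C) -> 0 <= delta ->
  (forall i g, ~~ bad i -> P i g -> `|F g - a i| <= delta) ->
  `|\int[nu]_g F g - \sum_i a i * fine (nu (P i))| <=
    delta + 2 * C * \sum_(i | bad i) fine (nu (P i)) + C * (1 - \sum_i fine (nu (P i))).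
Proof.
move=> mP dP mF FC aC d0 near.
have FI := bounded_integrable mF FC.
have C0 : 0 <= C by exact: le_trans (FC point).
(* Coefficients relative to the constant [C + delta], the value off the cells: the upper step
   function is [a i + delta] on a good cell and [a i + 2 * C + delta] on a bad one; [cl] is
   symmetric. *)
pose cu (i : I) : R := a i + 2 * C * (bad i)%:R - C.
pose cl (i : I) : R := a i - 2 * C * (bad i)%:R + C.
have [uI uE] := step_integral (C + delta) cu mP.
have [lI lE] := step_integral (- (C + delta)) cl mP.
have cell c0 (c : I -> R) g i : P i g -> c0 + \sum_j c j * \1_(P j) g = c0 + c i.
  move=> Pg; rewrite (bigD1 i)//= big1 => [|j ji].
    by rewrite addr0 indicE mem_set// mulr1.
  by rewrite indicE memNset ?mulr0// => Pj; case/eqP: ji; exact: dP Pj Pg.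
have nocell c0 (c : I -> R) g : (forall i, ~ P i g) -> c0 + \sum_j c j * \1_(P j) g = c0.
  by move=> nP; rewrite big1 ?addr0// => j _; rewrite indicE memNset ?mulr0.
have bnd g : - (C + delta) + \sum_i cl i * \1_(P i) g <= F g <= C + delta + \sum_i cu i * \1_(P i) g.
  have := FC g; rewrite ler_norml => /andP[F1 F2].
  have [[i Pi]|nP] := pselect (exists i, P i g); last first.
    rewrite !nocell; try by move=> i Pi; apply: nP; exists i.
    by apply/andP; split; move: (F g) F1 F2 => f; lra.
  rewrite !(cell _ _ _ _ Pi) /cu /cl; have := aC i; rewrite ler_norml => /andP[a1 a2].
  case b : (bad i); rewrite ?mulr1 ?mulr0.
    by apply/andP; split; move: (F g) (a i) F1 F2 a1 a2 => f x; lra.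
  have := near i g; rewrite b => /(_ isT Pi); rewrite ler_norml => /andP[].
  by move: (F g) (a i) F1 F2 a1 a2 => f x; lra.
have hu := le_Rintegral measurableT FI uI (fun g _ => (andP (bnd g)).2).
have hl := le_Rintegral measurableT lI FI (fun g _ => (andP (bnd g)).1).
rewrite uE in hu; rewrite lE in hl.
have su : \sum_i cu i * fine (nu (P i)) = \sum_i a i * fine (nu (P i)) +
    2 * C * \sum_(i | bad i) fine (nu (P i)) - C * \sum_i fine (nu (P i)).
  rewrite !mulr_sumr -sumrN [X in _ + X + _]big_mkcond -!big_split /=; apply: eq_bigr => i _.
  by rewrite /cu mulrBl mulrDl; case: (bad i); rewrite ?mulr1 ?mulr0 ?mul0r.
have sl : \sum_i cl i * fine (nu (P i)) = \sum_i a i * fine (nu (P i)) -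
    2 * C * \sum_(i | bad i) fine (nu (P i)) + C * \sum_i fine (nu (P i)).
  rewrite !mulr_sumr -sumrN [X in _ + X + _]big_mkcond -!big_split /=; apply: eq_bigr => i _.
  by rewrite /cl mulrDl mulrBl; case: (bad i); rewrite ?mulr1 ?mulr0 ?mul0r ?oppr0.
by rewrite su in hu; rewrite sl in hl; exact: step_bound hu hl.
Qed.

End step_functions.

Lemma expect_close_bound (R : realType) (x y a b s t0 t e e' c k : R) : 0 <= c ->
  `|x - a| <= e + 2 * c * s + c * (1 - t) -> `|y - b| <= e + 2 * c * t0 -> `|a - b| <= c * k ->
  `|s - t0| <= k -> `|t - 1| <= k -> t0 <= e' -> `|x - y| <= 2 * e + 4 * c * e' + 4 * c * k.
Proof.
move=> c0; rewrite !ler_norml => /andP[h1 h2] /andP[h3 h4] /andP[h5 h6] /andP[_ h7] /andP[h8 _] h9.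
have k1 : c * s <= c * (e' + k) by apply: ler_wpM2l => //; lra.
have k2 : c * (1 - t) <= c * k by apply: ler_wpM2l => //; lra.
have k3 : c * t0 <= c * e' by apply: ler_wpM2l.
by move: k1 k2 k3 h1 h2 h3 h4 h5 h6; rewrite mulrDr -!mulrA; move: (c * s) (c * e') (c * k) (c * (1 - t)) (c * t0); clear; move=> p q u v w *; apply/andP; split; lra.
Qed.

Section copies.
Variables (R : realType) (d : nat) (M : pointedFinType).
Hypothesis d3 : (3 <= d)%N.
Local Notation G := (borel_rcgraph R M).
Implicit Types nu : law R M.

Section level.
Variable t : nat.
Local Notation S := (S_ball d t).
Local Notation X := {ffun S -> M}.

Definition copy (x : X) : rcgraph R M := tree_rcgraph R (extend x).

(** The event that the ball of radius t is the tree colored by [x]; the default colors of [copy]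
    outside the ball are cut off by [restrict]. *)
Definition copies (x : X) : set G := [set g | Defs.restrict t (g : rcgraph R M) = Defs.restrict t (copy x)].

Lemma copies_uniq (x y : X) g : copies x g -> copies y g -> x = y.
Proof.
rewrite /copies /= => -> /restrict_eq/lrestrict_eqP -/(_ (rcgraphP _) (rcgraphP _))[h _].
apply/ffunP => u; rewrite -(extendE x) -(extendE y).
have := h (val u); have := valP u; rewrite in_S_ball// => ut /(_ ut) /=.
by rewrite valK => -[].
Qed.

Lemma copies_tree (Y : tree d -> M) : copies [ffun u => Y (val u)] (tree_rcgraph R Y).
Proof.
apply/restrict_eq/lrestrict_eqP; do ?exact: rcgraphP; split=> //= s st.
case: insubP => //= u _ us; have uS : u \in S by rewrite in_S_ball// us.
by rewrite -[u]/(val [` uS]%fset) extendE ffunE.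
Qed.

(** Small balls of the metric refine the classes of graphs with the same ball of radius t. Events
    that depend on that ball are thus open, and so are their complements, which makes their
    indicators continuous. *)
Lemma restrict_open (P : set (rcgraph R M)) : (forall g h, Defs.restrict t g = Defs.restrict t h -> P g -> P h) -> open P.
Proof.
move=> Pt; rewrite openE => g Pg; apply/nbhs_ballP; exists (2^-1 ^+ t); first by rewrite /= exprn_gt0// invr_gt0.
by move=> h; rewrite ballEmdist => /gdist_restrict gh; exact: Pt Pg.
Qed.

Lemma measurable_restrict_closed (P : set (rcgraph R M)) : (forall g h, Defs.restrict t g = Defs.restrict t h -> P g -> P h) ->
  measurable (P : set G).
Proof. by move=> Pt; apply: sub_sigma_algebra; exact: restrict_open. Qed.

Lemma measurable_copies (x : X) : measurable (copies x).
Proof. by apply: measurable_restrict_closed => g h; rewrite /copies /= => ->. Qed.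

Lemma tree_law_copies (mu : probability (config d M) R) (x : X) : fine (tree_law mu (copies x)) = mu_mass mu S x.
Proof.
rewrite ffunE; congr (fine (mu _)); apply/seteqP; split=> Y.
  move=> /(copies_uniq (copies_tree Y)) <- u; by rewrite ffunE.
move=> h; have -> : x = [ffun u => Y (val u)] by apply/ffunP => u; rewrite ffunE; apply/esym/h.
exact: copies_tree.
Qed.

Lemma restrict_idem (g : rcgraph R M) : Defs.restrict t (Defs.restrict t g) = Defs.restrict t g.
Proof.
apply/restrict_eq/lrestrict_eqP; do ?exact: rcgraphP; split=> [s st|s s' st st'].
  by rewrite [LHS](lrestrict_col (rcgraphP g)) st.
by rewrite [LHS](lrestrict_adj (rcgraphP g)) st st' !andbT.
Qed.

Lemma restrict_law_copies nu (x : X) : restrict_law t nu (copies x) = nu (copies x).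
Proof. by congr (nu _); apply/seteqP; split=> g; rewrite /copies /= restrict_idem. Qed.

(** The random labeling produces the tree colored by [x] exactly at the centers of increasing
    embeddings with these colors ([tau_count_bfs]). *)
Lemma distr_copies n (E : graph n) (f : {ffun 'I_n.+1 -> M}) (x : X) :
  (forall v, (#|[set w | gadj E v w]%SET| <= d)%N) ->
  distr R E f (copies x) = (profile E f R x)%:E.
Proof.
move=> degE; have -> : x = [ffun u : S => extend x (val u)] by apply/ffunP => u; rewrite ffunE extendE.
pose c (v : 'I_n.+1) tau : bool := `[< Defs.restrict t (random_labeling R E f v tau) = Defs.restrict t (copy x) >].
have dE v : distr_at R E f v (copies x) = ((ntau n)%:R^-1 * \sum_tau (c v tau)%:R)%:E.
  rewrite /distr_at /= /average -[#|_|]/(ntau n) EFinM -sumEFin; congr (_ * _)%E.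
rewrite -[distr R E f _]/(average ord0 (distr_at R E f) _) /average card_ord.
have -> : [ffun u : S => extend x (val u)] = x by apply/ffunP => u; rewrite ffunE extendE.
under eq_bigr do rewrite dE.
rewrite sumEFin -EFinM -mulr_sumr /profile mulrA natrM invfM mulrC; congr ((_ * _)%:E); last by rewrite mulrC.
rewrite exchange_big /= natr_sum; apply: eq_bigr => tau _.
rewrite -(_ : [ffun u : S => extend x (val u)] = x) ; last by apply/ffunP => u; rewrite ffunE extendE.
rewrite (tau_count_bfs R t d3 degE f (extend x) tau) -sum1_card natr_sum [RHS]big_mkcond /=; apply: eq_bigr => v _.
by rewrite inE /c; case: asbool.
Qed.

Lemma sum_copies_le nu (D : pred X) (B : set G) : measurable B -> (forall x, D x -> copies x `<=` B) ->
  \sum_(x | D x) fine (nu (copies x)) <= fine (nu B).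
Proof.
move=> mB DB; have [sI sE] := step_integral nu 0 (fun x => (D x)%:R) measurable_copies.
have -> : \sum_(x | D x) fine (nu (copies x)) = 0 + \sum_x (D x)%:R * fine (nu (copies x)).
  by rewrite add0r big_mkcond /=; apply: eq_bigr => x _; case: (D x); rewrite ?mul1r ?mul0r.
rewrite -sE -Rintegral_indic//; apply: le_Rintegral => //.
  by apply: (@bounded_integrable _ _ _ _ _ 1) => [|g]; [exact: measurable_realfun.measurable_indic|exact: indic_le1].
move=> g _; rewrite add0r; have [[x [Dx xg]]|no] := pselect (exists x, D x /\ copies x g).
  rewrite (bigD1 x)//= big1 => [|y yx].
    by rewrite addr0 Dx mul1r !indicE !mem_set//; exact: DB xg.
  by rewrite [X in _ * X]indicE memNset ?mulr0// => yg; case/eqP: yx; exact: copies_uniq yg xg.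
rewrite big1 ?indicE// => x _; case Dx : (D x); last by rewrite mul0r.
by rewrite indicE memNset ?mulr0// => xg; apply: no; exists x.
Qed.

Lemma sum_copies_le1 nu : \sum_x fine (nu (copies x)) <= 1.
Proof.
have -> : 1 = fine (nu [set: G]) by rewrite probability_setT.
exact: sum_copies_le.
Qed.

Lemma continuous_restrict (F : rcgraph R M -> R) : (forall g h, Defs.restrict t g = Defs.restrict t h -> F g = F h) ->
  continuous F.
Proof.
by move=> Ft; apply/continuousP => A _; apply: restrict_open => g h gh; rewrite /preimage /= (Ft _ _ gh).
Qed.

Lemma bounded_continuous_indic (x : X) : bounded_continuous (\1_(copies x) : rcgraph R M -> R).
Proof.
split; last by exists 1 => g; exact: indic_le1.
apply: continuous_restrict => g h gh; rewrite !indicE; have -> : (g \in copies x) = (h \in copies x); last by [].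
by apply/idP/idP => /set_mem e; apply: mem_set; move: e; rewrite /copies /= gh.
Qed.

Variable dist : law R M -> law R M -> R.
Hypothesis distP : generates_weak_topology dist.

(** The indicators of [copies] are bounded continuous test functions, finitely many at each
    level. *)
Lemma mass_near_of_dist (nu0 : law R M) (eta : R) : 0 < eta -> exists2 eps, 0 < eps &
  forall nu, dist nu0 nu < eps -> forall x, `|fine (nu (copies x)) - fine (nu0 (copies x))| < eta.
Proof.
move=> e0; pose U : set (law R M) := [set nu | forall x, `|fine (nu (copies x)) - fine (nu0 (copies x))| < eta].
have : weak_nbhs nu0 U.
  exists #|{: X}|, (fun i => \1_(copies (enum_val i))), eta; split=> // [i|nu h x]; first exact: bounded_continuous_indic.
  have := h (enum_rank x); rewrite /expect enum_rankK !Rintegral_indic//; exact: measurable_copies.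
by move=> /(dist_weak_nbhs distP)[eps eps0 epsP]; exists eps.
Qed.

Lemma expect_close (nu nu0 : law R M) (F : rcgraph R M -> R) (bad : pred X) (C delta delta' eta : R) :
  measurable_fun [set: G] (F : G -> R) -> (forall g, `|F g| <= C) -> 0 <= delta ->
  (forall x g, ~~ bad x -> copies x g -> `|F g - F (copy x)| <= delta) ->
  \sum_x fine (nu0 (copies x)) = 1 -> \sum_(x | bad x) fine (nu0 (copies x)) <= delta' ->
  (forall x, `|fine (nu (copies x)) - fine (nu0 (copies x))| <= eta) ->
  `|expect nu F - expect nu0 F| <= 2 * delta + 4 * C * delta' + 4 * C * (#|{: X}|%:R * eta).
Proof.
move=> mF FC d0 osc nu01 bad0 near; have C0 : 0 <= C by exact: le_trans (normr_ge0 _) (FC point).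
have app (m : law R M) := step_approximation m measurable_copies copies_uniq mF FC (fun x => FC (copy x)) d0 osc.
have dsum (D : pred X) : `|\sum_(x | D x) fine (nu (copies x)) - \sum_(x | D x) fine (nu0 (copies x))| <= #|{: X}|%:R * eta.
  rewrite -sumrB mulr_natl -sumr_const; apply: le_trans (ler_norm_sum _ _ _) _; rewrite big_mkcond /=.
  by apply: ler_sum => x _; case: (D x) => //; exact: le_trans (near x).
have dstep : `|\sum_x F (copy x) * fine (nu (copies x)) - \sum_x F (copy x) * fine (nu0 (copies x))| <= C * (#|{: X}|%:R * eta).
  rewrite -sumrB mulrCA mulr_natl -sumr_const; apply: le_trans (ler_norm_sum _ _ _) _.
  by apply: ler_sum => x _; rewrite -mulrBr normrM ler_pM.
have b1 := dsum bad; have b2 := dsum predT; rewrite nu01 in b2.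
have h1 := app nu; have h0 := app nu0; rewrite nu01 subrr mulr0 addr0 in h0.
exact: expect_close_bound C0 h1 h0 dstep b1 b2 bad0.
Qed.

End level.

End copies.

End copies_of_the_tree.

Section weak_topology.
Local Open Scope classical_set_scope.
Local Open Scope ring_scope.

Lemma expect_constants0 (R : realType) (c N eps : R) : 0 <= c -> 0 <= N -> 0 < eps ->
  4 * c * (N * (eps / 4 / (4 * (1 + c) * (1 + N)))) <= eps / 4.
Proof.
move=> c0 N0 e0; have K0 : 0 < 4 * (1 + c) * (1 + N) by rewrite !mulr_gt0// ltr_wpDr.
rewrite mulrA; apply: (@le_trans _ _ (4 * (1 + c) * (1 + N) * (eps / 4 / (4 * (1 + c) * (1 + N))))); last first.
  by rewrite mulrC divfK// gt_eqF.
apply: ler_wpM2r; first by rewrite !divr_ge0// ltW.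
apply: ler_pM; rewrite ?mulr_ge0//; last by rewrite lerDr.
by rewrite ler_pM2l// lerDr.
Qed.

Lemma expect_constants (R : realType) (c N eps : R) : 0 <= c -> 0 <= N -> 0 < eps ->
  2 * (eps / 2 / (4 * (1 + c))) + 4 * c * (eps / 2 / (4 * (1 + c))) +
  4 * c * (N * (eps / 4 / (4 * (1 + c) * (1 + N)))) < eps.
Proof.
move=> c0 N0 e0; have := expect_constants0 c0 N0 e0; set y := _ * (N * _) => hy.
have c1 : 0 < 4 * (1 + c) by rewrite mulr_gt0// ltr_wpDr.
have : eps / 2 / (4 * (1 + c)) * (4 * (1 + c)) = eps / 2 by rewrite divfK// gt_eqF.
have : 0 < eps / 2 / (4 * (1 + c)) by rewrite !divr_gt0.
move: (_ / (4 * _)) => z z0 zE; have -> : 4 * c * z = eps / 2 - 4 * z by rewrite -zE; lra.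
by lra.
Qed.

(** An excess at one index would have to be compensated by deficits elsewhere, which are at most [e]
    each. *)
Lemma near_of_lower (R : realType) (I : finType) (p q : I -> R) (e : R) : \sum_i q i = 1 -> \sum_i p i <= 1 ->
  (forall i, q i - e <= p i) -> forall i, `|p i - q i| <= #|I|%:R * e.
Proof.
move=> q1 p1 h i; have e1 : 0 <= e.
  rewrite leNgt; apply/negP => e0; have : \sum_i q i < \sum_i p i; last by rewrite q1 ltNge p1.
  rewrite [ltLHS](bigD1 i)//= [ltRHS](bigD1 i)//=; apply: ltr_leD.
    by apply: lt_le_trans (h i); rewrite ltrBrDl gtrDr.
  by apply: ler_sum => j _; apply: le_trans (h j); rewrite lerBrDl gerDr ltW.
have card_gt : 1 <= #|I|%:R :> R by rewrite ler1n; apply/card_gt0P; exists i.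
rewrite ler_norml; apply/andP; split.
  rewrite lerBrDl; apply: le_trans (h i); rewrite lerD2l lerN2.
  by rewrite ler_peMl.
have : \sum_(j | j != i) (q j - e) <= \sum_(j | j != i) p j by exact: ler_sum.
rewrite sumrB; move: q1 p1; rewrite (bigD1 i)//= [\sum_i p i](bigD1 i)//= sumr_const => q1 p1 h1.
have : e *+ #|(fun j => j != i)| <= #|I|%:R * e by rewrite mulr_natl; apply: ler_wpMn2l => //; exact: max_card.
move: q1 p1 h1; move: (p i) (q i) (\sum_(j | _) p j) (\sum_(j | _) q j) (e *+ _) (_ * e) => a b x y z w; lra.
Qed.

Section weak_convergence.
Variables (R : realType) (d : nat) (M : pointedFinType).
Hypothesis d3 : (3 <= d)%N.
Local Notation G := (borel_rcgraph R M).
Implicit Types nu : law R M.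

Lemma continuous_measurable (F : rcgraph R M -> R) : continuous F -> measurable_fun [set: G] (F : G -> R).
Proof.
move=> /continuousP Fc; apply: (measurability _ (measurable_realfun.RGenOInfty.measurableE R)) => _ [_ [x ->] <-].
rewrite setTI; apply: sub_sigma_algebra; apply: Fc.
by rewrite set_itvE; exact: open_gt.
Qed.

(** The graphs whose ball of radius t does not determine [F] up to [delta]. These events decrease
    with t, and continuity of [F] makes their intersection empty. *)
Definition oscillation (F : rcgraph R M -> R) (delta : R) (t : nat) : set G :=
  [set g | exists h h', [/\ Defs.restrict t (g : rcgraph R M) = Defs.restrict t h,
     Defs.restrict t (g : rcgraph R M) = Defs.restrict t h' & delta < `|F h - F h'|]].

Lemma measurable_oscillation F delta t : measurable (oscillation F delta t).
Proof.
by apply: (@measurable_restrict_closed _ _ t) => g g' gg' [h [h' [gh gh' hh']]]; exists h, h'; split=> //; rewrite -gg'.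
Qed.

Lemma oscillation0 F delta : 0 < delta -> continuous F -> \bigcap_t oscillation F delta t = set0.
Proof.
move=> d0 Fc; apply/seteqP; split=> // g osc; have d2 : 0 < delta / 2 by rewrite divr_gt0.
have /cvgrPdist_lt/(_ _ d2) := Fc g; move=> /nbhs_ballP[e /= e0 eF].
have [k ke] : exists k, 2^-1 ^+ k < e.
  have [k _ /(_ k (leqnn k))/= h] := near_infty_natSinv_expn_lt (PosNum e0).
  by exists k; rewrite exprVn -div1r.
have [h [h' [gh gh']]] := osc k I; rewrite ltNge => /negP; apply.
have close x : Defs.restrict k (g : rcgraph R M) = Defs.restrict k x -> `|F g - F x| < delta / 2.
  by move=> gx; apply: eF; rewrite ballEmdist /=; apply: le_lt_trans ke; exact: gdist_le.
have := close _ gh; have := close _ gh'; rewrite !ltr_norml ler_norml => /andP[a1 a2] /andP[a3 a4].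
by move: (F g) (F h) (F h') a1 a2 a3 a4 => x y z *; apply/andP; split; lra.
Qed.

Lemma oscillation_small nu F delta : 0 < delta -> continuous F ->
  exists t0, forall t, (t0 <= t)%N -> fine (nu (oscillation F delta t)) < delta.
Proof.
move=> d0 Fc.
have cv : (nu \o oscillation F delta) @ \oo --> nu (\bigcap_t oscillation F delta t).
  apply: nonincreasing_cvg_mu => [|t||j k jk]; [|exact: measurable_oscillation| |].
  - by apply: le_lt_trans (probability_le1 _ (measurable_oscillation _ _ _)) _; rewrite ltry.
  - by rewrite oscillation0.
  - by apply/subsetPset => g [h [h' [gh gh' hh']]]; exists h, h'; split=> //; exact: restrict_eqW jk _.
rewrite oscillation0// measure0 in cv; move/fine_cvgP: cv => [_ /cvgrPdist_lt/(_ _ d0)[t0 _ h]].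
exists t0 => t tt; have := h t tt; rewrite /= sub0r normrN => /le_lt_trans; apply.
exact: ler_norm.
Qed.

Section limit.
Variable mu : probability (config d M) R.
Variable dist : law R M -> law R M -> R.
Hypothesis distP : generates_weak_topology dist.

Definition near_copies nu (t : nat) (eta : R) : Prop := forall x : {ffun S_ball d t -> M},
  `|fine (nu (@copies R d M t x)) - mu_mass mu (S_ball d t) x| <= eta.

(** [F] need not be uniformly continuous: t is chosen first so that the limit law charges little
    oscillation, and then [eta] according to the number of colorings at level t. *)
Lemma expect_near (F : rcgraph R M -> R) (eps : R) : bounded_continuous F -> 0 < eps ->
  exists t0, forall t, (t0 <= t)%N -> exists2 eta, 0 < eta &
    forall nu, near_copies nu t eta -> `|expect nu F - expect (tree_law mu) F| < eps.
Proof.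
move=> [Fc [C FC]] e0; have C0 : 0 <= C by exact: le_trans (normr_ge0 _) (FC point).
have C1 : 0 < 4 * (1 + C) by rewrite mulr_gt0// ltr_wpDr.
pose delta := eps / 2 / (4 * (1 + C)); have d0 : 0 < delta by rewrite !divr_gt0.
have [t0 t0P] := oscillation_small (tree_law mu) d0 Fc; exists t0 => t /t0P osc.
pose N : R := #|{: {ffun S_ball d t -> M}}|%:R; have N0 : 0 <= N by [].
have N1 : 0 < 4 * (1 + C) * (1 + N) by rewrite mulr_gt0// ltr_wpDr.
exists (eps / 4 / (4 * (1 + C) * (1 + N))); first by rewrite !divr_gt0.
move=> nu near; pose bad (x : {ffun S_ball d t -> M}) : bool := `[< copies x `<=` oscillation F delta t >].
apply: le_lt_trans (@expect_close _ _ _ d3 t nu (tree_law mu) F bad C delta delta _ _ FC (ltW d0) _ _ _ _) _.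
- exact: continuous_measurable.
- move=> x g xb xg; rewrite leNgt; apply: contra xb => lt; apply/asboolP => h hx.
  by exists g, (copy R x); split=> //; rewrite xg; exact: hx.
- by under eq_bigr do rewrite tree_law_copies//; exact: mu_mass_sum1.
- apply: le_trans (ltW osc); apply: sum_copies_le => //; first exact: measurable_oscillation.
  by move=> x /asboolP.
- by move=> x; rewrite tree_law_copies//; exact: near.
rewrite -/N; exact: expect_constants C0 N0 e0.
Qed.

Lemma expect_restrict nu F t : continuous F -> (exists C, forall g, `|F g| <= C) ->
  expect (restrict_law t nu) F = expect nu (F \o Defs.restrict t).
Proof.
move=> Fc [C FC]; congr fine; rewrite integral_pushforward//=.
- by apply/measurable_realfun.measurable_EFinP; exact: continuous_measurable.
- apply: (@bounded_integrable _ _ _ _ _ C) => // .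
  by apply: continuous_measurable; apply: (@continuous_restrict _ _ t) => g h /= ->.
Qed.

Lemma expect_restrict_near (F : rcgraph R M -> R) t (eps : R) : bounded_continuous F -> 0 < eps ->
  exists2 eta, 0 < eta & forall nu, near_copies nu t eta ->
    `|expect (restrict_law t nu) F - expect (restrict_law t (tree_law mu)) F| < eps.
Proof.
move=> [Fc [C FC]] e0; have C0 : 0 <= C by exact: le_trans (normr_ge0 _) (FC point).
pose N : R := #|{: {ffun S_ball d t -> M}}|%:R; have N0 : 0 <= N by [].
have N1 : 0 < 4 * (1 + C) * (1 + N) by rewrite !mulr_gt0// ltr_wpDr.
exists (eps / 4 / (4 * (1 + C) * (1 + N))); first by rewrite !divr_gt0.
move=> nu near; rewrite !expect_restrict//; try by exists C.
apply: le_lt_trans (@expect_close _ _ _ d3 t nu (tree_law mu) (F \o Defs.restrict t) pred0 C 0 0 _ _ _ (lexx 0) _ _ _ _) _.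
- by apply: continuous_measurable; apply: (@continuous_restrict _ _ t) => g h /= ->.
- by move=> g; exact: FC.
- by move=> x g _ /= ->; rewrite subrr normr0.
- by under eq_bigr do rewrite tree_law_copies//; exact: mu_mass_sum1.
- by rewrite big_pred0.
- by move=> x; rewrite tree_law_copies//; exact: near.
rewrite -/N !mulr0 !add0r; apply: le_lt_trans (expect_constants0 C0 N0 e0) _.
by rewrite ltr_pdivrMr// ltr_pMr// ltr1n.
Qed.

Let nbhs_of_dist nu0 eps : 0 < eps -> weak_nbhs nu0 [set nu | dist nu0 nu < eps].
Proof. by move=> e0; apply/(dist_weak_nbhs distP); exists eps. Qed.

Lemma dist_restrict_near t eps : 0 < eps -> exists2 eta, 0 < eta & forall nu, near_copies nu t eta ->
  dist (restrict_law t nu) (restrict_law t (tree_law mu)) <= eps.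
Proof.
move=> e0; have [k [F [delta [d0 Fb FU]]]] := nbhs_of_dist (restrict_law t (tree_law mu)) e0.
have ex (i : 'I_k) : exists eta : R, 0 < eta /\ forall nu, near_copies nu t eta ->
    `|expect (restrict_law t nu) (F i) - expect (restrict_law t (tree_law mu)) (F i)| < delta.
  by have [eta eta0 etaP] := expect_restrict_near t (Fb i) d0; exists eta.
have [eta etaP] := fin_all_exists ex; have [e e1 eF] := min_pos (fun i => (etaP i).1).
exists e => // nu near; rewrite (dist_sym distP); apply/ltW/FU => i.
by apply: (etaP i).2 => x; exact: le_trans (near x) (eF i).
Qed.

Lemma dist_near eps : 0 < eps -> exists t0, forall t, (t0 <= t)%N -> exists2 eta, 0 < eta &
  forall nu, near_copies nu t eta -> dist nu (tree_law mu) <= eps.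
Proof.
move=> e0; have [k [F [delta [d0 Fb FU]]]] := nbhs_of_dist (tree_law mu) e0.
have [t0 t0P] := fin_all_exists (fun i : 'I_k => expect_near (Fb i) d0).
exists (\max_(i < k) t0 i)%N => t tt.
have ex (i : 'I_k) : exists eta : R, 0 < eta /\ forall nu, near_copies nu t eta ->
    `|expect nu (F i) - expect (tree_law mu) (F i)| < delta.
  have [|eta eta0 etaP] := t0P i t; last by exists eta.
  by apply: leq_trans tt; exact: leq_bigmax.
have [eta etaP] := fin_all_exists ex; have [e e1 eF] := min_pos (fun i => (etaP i).1).
exists e => // nu near; rewrite (dist_sym distP); apply/ltW/FU => i.
by apply: (etaP i).2 => x; exact: le_trans (near x) (eF i).
Qed.

Lemma near_copies_of_dist t eta : 0 < eta -> exists2 eps, 0 < eps & forall nu,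
  dist (restrict_law t nu) (restrict_law t (tree_law mu)) <= eps -> near_copies nu t eta.
Proof.
move=> e0; have [eps eps0 epsP] := mass_near_of_dist d t distP (restrict_law t (tree_law mu)) e0.
exists (eps / 2) => [|nu h x]; first by rewrite divr_gt0.
have := epsP (restrict_law t nu) _ x; rewrite !restrict_law_copies// tree_law_copies// => /(_ _)/ltW; apply.
by rewrite (dist_sym distP); apply: le_lt_trans h _; rewrite ltr_pdivrMr// ltr_pMr// ltr1n.
Qed.

(** A copy at level t is a copy of its restriction at level r, which gives lower bounds;
    [near_of_lower] makes them two-sided. *)
Lemma near_copies_level r t eta nu : (r <= t)%N -> near_copies nu t eta ->
  near_copies nu r (#|{: {ffun S_ball d r -> M}}|%:R * (#|{: {ffun S_ball d t -> M}}|%:R * eta)).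
Proof.
move=> rt near; apply: near_of_lower; [exact: mu_mass_sum1|exact: sum_copies_le1|].
move=> y; have SS : {subset S_ball d r <= S_ball d t} by move=> u; rewrite !in_S_ball// => /leq_trans; exact.
pose D (x : {ffun S_ball d t -> M}) := [ffun u : S_ball d r => extend x (val u)] == y.
rewrite (mu_mass_restrict mu y SS); apply: (@le_trans _ _ (\sum_(x | D x) fine (nu (copies x)))).
  rewrite lerBlDr -lerBlDl -sumrB mulr_natl -sumr_const big_mkcond /=; apply: ler_sum => x _.
  have := near x; rewrite ler_norml => /andP[h h'].
  have e0 : 0 <= eta by exact: le_trans (normr_ge0 _) (near x).
  case: eqP => // _.
  by move: h; rewrite lerNl opprB.
apply: sum_copies_le => //; first exact: measurable_copies.
move=> x /eqP Dx g; rewrite /copies /= => /(restrict_eqW rt) ->.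
by have := @copies_tree R d M d3 r (extend x); rewrite Dx.
Qed.

End limit.
End weak_convergence.

End weak_topology.

(** * Number of typical colorings *)

Lemma half_bound (R : realType) (S B T p : R) : 2 * T * p <= S -> S <= B + T * p -> S <= 2 * B.
Proof. by move=> h1 h2; lra. Qed.

Lemma eighth_bound (R : realType) (x k : R) : x <= k / 8 -> k <= 4 * x -> 0 < k -> False.
Proof. by lra. Qed.

Lemma expR_square (R : realType) (N s e : R) : expR (N * s) ^+ 2 * expR (N * e) = expR (N * (2 * s + e)).
Proof. by rewrite expr2 -!expRD; congr (expR _); lra. Qed.

Lemma expR_split (R : realType) (N s e : R) : expR (N * s) = expR (N * (s - e)) * expR (N * e).
Proof. by rewrite -expRD -mulrDr subrK. Qed.

Lemma expR_two (R : realType) (N s e : R) : expR (N * (s - 2 * e)) = expR (N * s) / expR (N * e) ^+ 2.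
Proof. by rewrite -expRM_natl -expRN -expRD; congr (expR _); lra. Qed.

Lemma no_room (R : realType) (x y g : R) : 2 <= x -> 0 < y -> g < y -> y * x <= g + y -> False.
Proof.
move=> x2 y0 gy h; have : y * 2 <= y * x by rewrite ler_pM2l.
lra.
Qed.

Lemma tail_absorb (R : realType) (m N k S z : R) : 0 < z -> 0 <= m -> m * expR (- (N * (k / 2))) <= S ->
  - ln z <= N * (k / 2) -> m * expR (- (N * k)) <= z * S.
Proof.
move=> z0 m0 mS zk; have -> : - (N * k) = - (N * (k / 2)) - N * (k / 2) by lra.
rewrite expRD mulrA mulrC; apply: ler_pM; rewrite ?expR_ge0 ?mulr_ge0 ?expR_ge0//.
by rewrite -[leRHS](lnK (_ : z \is Num.pos)) ?posrE// ler_expR lerNl.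
Qed.

Lemma upper_exponent (R : realType) (N s e : R) : 0 < N -> 0 < e -> N * (s + e / 4) <= - (N * (e / 2)) + N * (s + e).
Proof. by move=> N0 e0; have := mulr_gt0 N0 e0; lra. Qed.

(** At least half of the sum comes from terms at least [T], to which the Cauchy-Schwarz inequality
    applies. *)
Lemma paley_zygmund (R : realType) (I : finType) (P : {set I}) (A : I -> R) (T : R) : (forall i, 0 <= A i) -> 0 <= T ->
  2 * T * #|P|%:R <= \sum_(i in P) A i ->
  (\sum_(i in P) A i) ^+ 2 <= 4 * (#|[set i in P | (T <= A i)%R]%SET|%:R * \sum_(i in P) A i ^+ 2).
Proof.
move=> A0 T0; set S := \sum_(i in P) A i; set Q := \sum_(i in P) A i ^+ 2 => TS.
set B := [set i in P | _]%SET; set b : R := #|B|%:R; pose SB := \sum_(i in B) A i.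
have b0 : 0 <= b by []. have SB0 : 0 <= SB by exact: sumr_ge0.
have S0 : 0 <= S by exact: sumr_ge0.
have S2 : S <= 2 * SB.
  have : S <= SB + T * #|P|%:R.
    rewrite /S /SB mulr_natr -sumr_const [X in _ <= X + _]big_mkcond /= big_mkcond /= [X in _ <= _ + X]big_mkcond /= -big_split /=.
    apply: ler_sum => i _; rewrite !finset.in_set; case: (i \in P) => //=.
    by have [h|/ltW h] := leP T (A i); rewrite ?lerDl ?add0r.
  exact: half_bound TS.
have SBQ : SB ^+ 2 <= b * Q.
  (* Cauchy-Schwarz in polynomial form, used below at the minimizing value [c = SB / b]. *)
  have key c : 2 * c * SB <= Q + c ^+ 2 * b.
    rewrite -lerBlDr /SB mulr_sumr /b mulr_natr -sumr_const -sumrB /Q [leRHS](big_setID B) /= -[leLHS]addr0.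
    apply: lerD; last by apply: sumr_ge0 => i _; exact: sqr_ge0.
    have -> : (P :&: B = B)%SET by apply/setP => i; rewrite !finset.in_set; case: (i \in P).
    apply: ler_sum => i _; have := sqr_ge0 (A i - c); rewrite sqrrB -mulr_natr.
    by move: (A i) => x; rewrite expr2; lra.
  have [b1|b1] := eqVneq b 0.
    have B0 : B = finset.set0 by apply/eqP; rewrite -cards_eq0; move/eqP: b1; rewrite pnatr_eq0.
    by rewrite b1 mul0r /SB B0 big_set0 expr0n.
  have {}b1 : 0 < b by rewrite lt_neqAle eq_sym b1.
  have := key (SB / b); rewrite exprMn [X in _ + X]mulrC -[X in X + _]/Q.
  have -> : b * (SB ^+ 2 * b^-1 ^+ 2) = SB ^+ 2 / b by rewrite mulrCA [b^-1 ^+ 2]expr2 (mulrA b) divff ?mul1r// gt_eqF.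
  have -> : 2 * (SB / b) * SB = 2 * (SB ^+ 2 / b) by rewrite expr2 -!mulrA [b^-1 * _]mulrC.
  rewrite -ler_pdivrMl// [b^-1 * _]mulrC; lra.
apply: (@le_trans _ _ ((2 * SB) ^+ 2)); first by rewrite ler_sqr ?nnegrE// mulr_ge0.
by rewrite exprMn; move: SBQ; rewrite [2 ^+ 2]expr2; move: (SB ^+ 2) (b * Q) => x y; lra.
Qed.

Lemma moment_ratio (R : realType) (m b S Q x y : R) : 0 <= m -> 0 <= b -> 4 <= x -> 0 < y -> m * (y / x) <= S ->
  Q <= m * (y ^+ 2 * x) -> S ^+ 2 <= 4 * (b * Q) -> m / x ^+ 4 <= b.
Proof.
move=> m0 b0 x4 y0 mS Qm SQ; have x0 : 0 < x by exact: lt_le_trans x4.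
move: m0; rewrite le_eqVlt => /orP[/eqP <-|m0]; first by rewrite mul0r.
have p0 : 0 <= m * (y / x) by rewrite mulr_ge0 ?divr_ge0// ltW.
have h : (m * (y / x)) ^+ 2 <= 4 * (b * (m * (y ^+ 2 * x))).
  apply: (@le_trans _ _ (S ^+ 2)); first by rewrite ler_sqr ?nnegrE// (le_trans p0).
  by apply: le_trans SQ _; rewrite ler_pM2l// ler_wpM2l.
have {}h : m <= 4 * b * x ^+ 3.
  have k0 : 0 < m * y ^+ 2 / x ^+ 2 by rewrite divr_gt0// ?mulr_gt0 ?exprn_gt0.
  rewrite -(ler_pM2r k0); move: h; rewrite exprMn exprMn exprVn.
  have -> : m * (m * y ^+ 2 / x ^+ 2) = m ^+ 2 * (y ^+ 2 / x ^+ 2) by rewrite !expr2 !mulrA.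
  move=> /le_trans; apply; rewrite le_eqVlt; apply/orP; left; apply/eqP.
  have xx : x = x ^+ 3 / x ^+ 2 by rewrite exprS mulfK// gt_eqF// exprn_gt0.
  rewrite {1}xx; move: (x ^+ 3) (x ^+ 2)^-1 (y ^+ 2) => u w z; lra.
rewrite ler_pdivrMr ?exprn_gt0//; apply: le_trans h _.
rewrite [x ^+ 4]exprS (mulrA b x) (mulrC b x); apply: ler_wpM2r; first by rewrite exprn_ge0 ?(ltW x0).
exact: ler_wpM2r.
Qed.

Section typical_colorings.
Variables (R : realType) (d : nat) (M : pointedFinType).
Hypothesis d3 : (3 <= d)%N.
Variables (mu : probability (config d M) R) (r : nat).
Hypothesis r0 : (0 < r)%N.
Hypothesis inv : Defs.invariant mu.
Hypothesis mk : r_markov r mu.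
Local Notation q t := (mu_mass mu (S_ball d t)).
Local Notation sigma := (Sigma (q r)).
Local Notation MM n := (#|matchings [set: 'I_n.+1 * 'I_d]%SET|%:R : R).

Lemma exp_large (C delta : R) : 0 < delta -> exists n0, forall n, (n0 <= n)%N -> C <= n.+1%:R * delta.
Proof.
by move=> d0; have [n0 n0P] := log_poly_le C 0 d0; exists n0 => n /n0P; rewrite mul0r addr0 mulrC.
Qed.

Lemma near_copies_distr n t (eta : R) s (f : {ffun 'I_n.+1 -> M}) : s \in simple_matchings d n ->
  near_copies mu (distr R (edges_of s) f) t eta <-> near_profile (q t) eta (edges_of s) f.
Proof.
move=> /simple_matchingsP[sK _ _].
have copyE (x : {ffun S_ball d t -> M}) : fine (distr R (edges_of s) f (copies x)) = profile (edges_of s) f R x.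
  by rewrite distr_copies// => v; exact: card_gadj_edges_of.
split=> [h|/forallP h x]; last by rewrite copyE; exact: h.
by apply/forallP => x; rewrite -copyE; exact: h.
Qed.

Lemma near_profile_level t eta n s (f : {ffun 'I_n.+1 -> M}) : (r <= t)%N -> s \in simple_matchings d n ->
  near_profile (q t) eta (edges_of s) f ->
  near_profile (q r) (#|{: {ffun S_ball d r -> M}}|%:R * (#|{: {ffun S_ball d t -> M}}|%:R * eta)) (edges_of s) f.
Proof. by move=> rt sM /(near_copies_distr _ _ _ sM)/(near_copies_level d3 rt)/(near_copies_distr _ _ _ sM). Qed.

Lemma sum_typical t (eta : R) n :
  \sum_(s in simple_matchings d n) #|[set f | near_profile (q t) eta (edges_of s) f]|%:R = #|typical_pairs (q t) n eta|%:R :> R.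
Proof.
rewrite -natr_sum; congr _%:R; rewrite -[RHS]sum1_card (partition_big (fun z => z.1) (mem (simple_matchings d n)))/=; last first.
  by move=> z; rewrite finset.in_set => /andP[].
apply: eq_bigr => s sM; rewrite sum1_card -[LHS](card_imset (f := fun f => (s, f))); last by move=> f f' [].
apply: eq_card => -[s' f]; apply/imsetP/idP => [[f']|].
  by rewrite finset.in_set => nf -[-> ->]; rewrite unfold_in /= finset.in_set /= sM eqxx andbT.
rewrite unfold_in /= finset.in_set /= => /andP[/andP[_ nf] /eqP e]; exists f; last by rewrite e.
by rewrite finset.in_set -e.
Qed.

(** The first moment is taken at level t, where [Sigma_mu_mass] gives the same rate, and the second
    at level r, where the hypothesis on couplings applies; being near at t implies being near at
    r. *)
Lemma many_typical t (delta eta0 : R) : (r <= t)%N -> 0 < delta -> 0 < eta0 ->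
  (forall w : mass R (M * M)%type (S_ball d r), invariant_mass w -> self_coupling (q r) w -> Sigma w <= 2 * sigma) ->
  exists2 eta, 0 < eta <= eta0 & exists n0, forall n, (n0 <= n)%N -> ~~ odd (n.+1 * d) ->
  MM n * expR (- (n.+1%:R * (4 * delta))) <=
  #|[set s in simple_matchings d n | (expR (n.+1%:R * (sigma - 2 * delta)) <=
     #|[set f | near_profile (q t) eta (edges_of s) f]|%:R)%R]|%:R.
Proof.
move=> rt d0 e0 hq; have t0 : (0 < t)%N by exact: leq_trans rt.
have [etar etar0 [n1 n1P]] := second_moment_upper d3 r0 (mu_mass_invariant d3 inv r0) hq d0.
pose c : R := #|{: {ffun S_ball d r -> M}}|%:R * #|{: {ffun S_ball d t -> M}}|%:R.
have c0 : 0 <= c by rewrite mulr_ge0.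
pose eta := Num.min eta0 (etar / (c + 1)).
have eta1 : 0 < eta by rewrite lt_min e0 divr_gt0// ltr_wpDl.
have eta2 : c * eta <= etar.
  apply: (@le_trans _ _ ((c + 1) * eta)); first by rewrite ler_wpM2r ?lerDl// ltW.
  by rewrite mulrC -ler_pdivlMr ?ge_min ?lexx ?orbT// ltr_wpDl.
have [n2 n2P] := first_moment_ge d3 t0 (mu_mass_invariant d3 inv t0) d0 eta1.
have [n3 n3P] := exp_large (ln 4) d0.
exists eta; first by rewrite eta1 ge_min lexx.
exists (n1 + n2 + n3)%N => n nn ev.
have [h1 h2 h3] : [/\ (n1 <= n)%N, (n2 <= n)%N & (n3 <= n)%N] by move: nn; clear; split; lia.
have {}n1P := n1P n h1 ev; have {}n2P := n2P n h2 ev; have {}n3P := n3P n h3.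
rewrite (Sigma_mu_mass d3 r0 inv mk rt) in n2P.
pose x : R := expR (n.+1%:R * delta); pose y : R := expR (n.+1%:R * sigma).
have x4 : 4 <= x by rewrite -[leLHS](lnK (_ : 4 \is Num.pos)) ?posrE// ler_expR.
have x0 : 0 < x by exact: expR_gt0.
pose A (s : {perm 'I_n.+1 * 'I_d}) : R := #|[set f | near_profile (q t) eta (edges_of s) f]|%:R.
have sumA : \sum_(s in simple_matchings d n) A s = #|typical_pairs (q t) n eta|%:R by exact: sum_typical.
have sumA2 : \sum_(s in simple_matchings d n) A s ^+ 2 <= MM n * (y ^+ 2 * x).
  have -> : y ^+ 2 * x = expR (n.+1%:R * (2 * sigma + delta)).
    exact: expR_square.
  apply: le_trans n1P; rewrite /A; under eq_bigr do rewrite -natrX; rewrite -natr_sum ler_nat.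
  rewrite -[leqRHS]sum1_card (partition_big (fun z => z.1) (mem (simple_matchings d n)))/=; last first.
    by move=> z; rewrite finset.in_set => /andP[].
  apply: leq_sum => s sM; rewrite sum1_card expnS expn1 -cardsX.
  rewrite -(card_in_imset (f := fun z : {ffun 'I_n.+1 -> M} * {ffun 'I_n.+1 -> M} => (s, pair_coloring z.1 z.2))); last first.
    move=> [f1 f2] [g1 g2] _ _ /= -[e]; congr pair; apply/ffunP => v.
      by have := congr1 (fun F : {ffun 'I_n.+1 -> M * M} => (F v).1) e; rewrite !ffunE.
    by have := congr1 (fun F : {ffun 'I_n.+1 -> M * M} => (F v).2) e; rewrite !ffunE.
  apply/subset_leq_card/fintype.subsetP => -[s' F] /imsetP[[f1 f2]]; rewrite finset.in_setX !finset.in_set /= => /andP[nf1 nf2] -[-> ->].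
  rewrite unfold_in /= finset.in_set /= sM eqxx andbT /=.
  have near_r f : near_profile (q t) eta (edges_of s) f -> near_profile (q r) etar (edges_of s) f.
    move=> /(near_profile_level rt sM)/forallP h; apply/forallP => z; apply: le_trans (h z) _.
    by rewrite mulrA.
  have e1 : [ffun v => (pair_coloring f1 f2 v).1] = f1 by apply/ffunP => v; rewrite !ffunE.
  have e2 : [ffun v => (pair_coloring f1 f2 v).2] = f2 by apply/ffunP => v; rewrite !ffunE.
  by rewrite e1 e2 !near_r.
have yx : expR (n.+1%:R * (sigma - delta)) = y / x by rewrite mulrBr expRD expRN.
have yx2 : expR (n.+1%:R * (sigma - 2 * delta)) = y / x ^+ 2.
  exact: expR_two.
have x4E : expR (- (n.+1%:R * (4 * delta))) = (x ^+ 4)^-1.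
  by rewrite -expRM_natl -expRN; congr expR; rewrite mulrCA.
rewrite x4E; apply: (moment_ratio (S := \sum_(s in simple_matchings d n) A s) (y := y) _ _ x4 (expR_gt0 _) _ sumA2) => //.
  by rewrite sumA -yx.
apply: paley_zygmund => //.
rewrite sumA; apply: le_trans n2P; rewrite yx yx2.
have yxE : y / x = x * (y / x ^+ 2) by rewrite exprS invfM [in RHS]mulrCA !mulrA mulfK ?gt_eqF// mulrC.
have z0 : 0 < y / x ^+ 2 by rewrite divr_gt0 ?expR_gt0// exprn_gt0.
rewrite yxE [leRHS]mulrA [leLHS]mulrAC; apply: ler_wpM2r; first exact: ltW.
rewrite [leLHS]mulrC; apply: ler_pM => //; last by move: x4; lra.
by rewrite ler_nat; apply/subset_leq_card/fintype.subsetP => s; rewrite finset.in_set => /andP[].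
Qed.

Definition good (t : nat) (rho : R) n (s : {perm 'I_n.+1 * 'I_d}) : {set {ffun 'I_n.+1 -> M}} :=
  [set f | deviation (q t) (edges_of s) f <= rho].

(** There are [#|M|] to the power n colorings in all, and this choice of [be * rho] cancels that
    number against the weight of each coloring that is not good. *)
Lemma partition_split t n (be rho c : R) (s : {perm 'I_n.+1 * 'I_d}) : 0 <= be -> be * rho = ln #|M|%:R + c ->
  expR (free_energy (q t) be s) <= #|good t rho s|%:R + expR (- (n.+1%:R * c)).
Proof.
move=> be0 brho; rewrite /free_energy lnK ?posrE ?partition_gt0//.
have M0 : (0 < #|M|)%N by apply/card_gt0P; exists point.
rewrite (bigID (mem (good t rho s))) /=; apply: lerD.
  rewrite -sumr_const; apply: ler_sum => f _.
  by rewrite -expR0 ler_expR oppr_le0 !mulr_ge0// deviation_ge0.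
apply: (@le_trans _ _ (\sum_(f : {ffun 'I_n.+1 -> M}) expR (- (n.+1%:R * (be * rho))))).
  rewrite [leLHS]big_mkcond /=; apply: ler_sum => f _; case: ifP => [|_]; last exact: expR_ge0.
  rewrite finset.in_set -ltNge => h; rewrite ler_expR lerN2 mulrCA ler_wpM2l// ler_wpM2l//.
  exact: ltW.
rewrite sumr_const card_ffun card_ord -[leLHS]mulr_natl brho mulrDr opprD expRD mulrA.
rewrite -[leRHS]mul1r ler_wpM2r ?expR_ge0// natrX expRN expRM_natl lnK ?posrE ?ltr0n//.
by rewrite divff// expf_neq0// pnatr_eq0 -lt0n.
Qed.

Lemma near_free_energy t n (be eta : R) (s : {perm 'I_n.+1 * 'I_d}) : 0 <= be ->
  #|[set f | near_profile (q t) eta (edges_of s) f]%SET|%:R * expR (- (be * (n.+1%:R * (#|{: {ffun S_ball d t -> M}}|%:R * eta)))) <= expR (free_energy (q t) be s).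
Proof.
move=> be0; rewrite /free_energy lnK ?posrE ?partition_gt0// mulr_natl -sumr_const.
rewrite big_mkcond /=; apply: ler_sum => f _; case: ifP => [|_]; last exact: expR_ge0.
rewrite finset.in_set => /forallP near; rewrite ler_expR lerN2 ler_wpM2l// ler_wpM2l//.
by rewrite mulr_natl -sumr_const; apply: ler_sum => x _; exact: near.
Qed.


Section coupled.
Hypothesis hq : forall w : mass R (M * M)%type (S_ball d r),
  invariant_mass w -> self_coupling (q r) w -> Sigma w <= 2 * sigma.

(** By [many_typical], the free energy is large on a set of matchings too big for its upper tail, so
    its mean is large; the lower tail then gives the claim. *)
Lemma free_energy_ge t (be th : R) : (r <= t)%N -> 0 <= be -> 0 < th ->
  exists2 kap, 0 < kap & exists n0, forall n, (n0 <= n)%N -> ~~ odd (n.+1 * d) ->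
  #|[set s in simple_matchings d n | free_energy (q t) be s < n.+1%:R * (sigma - 4 * th)]%SET|%:R <=
  MM n * expR (- (n.+1%:R * kap)).
Proof.
move=> rt be0 th0; have [kap k0 conc] := free_energy_concentration d3 (q t) be0 th0.
pose c : R := be * #|{: {ffun S_ball d t -> M}}|%:R; have c0 : 0 <= c by rewrite mulr_ge0.
(* [kap / 8] makes the rate [4 * delta] of [many_typical] smaller than [kap]; [th / 2] keeps the
   loss on the free energy within [th]. *)
pose delta := Num.min (kap / 8) (th / 2).
have dl0 : 0 < delta by rewrite lt_min !divr_gt0.
have [dk dth] : delta <= kap / 8 /\ delta <= th / 2 by rewrite !ge_min !lexx orbT.
have eta0 : 0 < th / (c + 1) by rewrite divr_gt0// ltr_wpDl.
have [eta /andP[eta1 eta2] [n0 n0P]] := many_typical rt dl0 eta0 hq.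
exists kap => //; exists n0 => n nn ev; have {}n0P := n0P n nn ev.
set N : R := n.+1%:R; have N0 : 0 < N by rewrite ltr0n.
have [] := conc n; rewrite -/N; set avg := mavg _ _ => up low.
have [M0|M0] := posnP #|matchings [set: 'I_n.+1 * 'I_d]%SET|.
  rewrite M0 mul0r lern0 cards_eq0; apply/eqP/setP => s; rewrite finset.in_set finset.in_set0.
  apply/negP => /andP[]; rewrite finset.in_set => /andP[+ _].
  by rewrite (cards0_eq M0) finset.in_set0.
have ceta : c * eta <= th.
  apply: (@le_trans _ _ ((c + 1) * eta)); first by rewrite ler_wpM2r ?lerDl// ltW.
  by rewrite mulrC -ler_pdivlMr// ltr_wpDl.
have avg_ge : N * (sigma - 3 * th) <= avg.
  rewrite leNgt; apply/negP => lt.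
  have : MM n * expR (- (N * (4 * delta))) <= MM n * expR (- (N * kap)).
    apply: le_trans n0P (le_trans _ up); rewrite ler_nat; apply/subset_leq_card/fintype.subsetP => s.
    rewrite !finset.in_set => /andP[/andP[-> _] many] /=.
    have := near_free_energy t eta s be0; set A := [set f | _]%SET in many * => h.
    have : expR (N * (sigma - 2 * delta) - N * (c * eta)) <= expR (free_energy (q t) be s).
      apply: le_trans h; rewrite expRD ler_pM ?expR_ge0//.
      by rewrite ler_expR lerN2 [leLHS]mulrCA /c !mulrA.
    rewrite ler_expR => h2; rewrite lerBrDl.
    apply: (@le_trans _ _ (N * (sigma - 2 * delta) - N * (c * eta))) => //.
    have a1 : N * (c * eta) <= N * th by rewrite ler_pM2l.
    have a2 : N * delta <= N * th / 2 by rewrite -mulrA ler_pM2l.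
    have a3 : avg < N * sigma - 3 * (N * th) by move: lt; rewrite mulrBr mulrCA.
    have -> : N * (sigma - 2 * delta) = N * sigma - 2 * (N * delta) by rewrite mulrBr mulrCA.
    by move: a1 a2 a3; move: (N * (c * eta)) (N * delta) (N * sigma) (N * th) => x y z w; lra.
  rewrite ler_pM2l ?ltr0n// ler_expR lerN2 ler_pM2l// => h.
  exact: eighth_bound dk h k0.
apply: le_trans low; rewrite ler_nat; apply/subset_leq_card/fintype.subsetP => s.
rewrite !finset.in_set => /andP[/andP[-> _] h] /=; rewrite lerBrDl -lerBrDr.
apply: ltW; apply: lt_le_trans h _; apply: le_trans (lerB avg_ge (lexx _)).
rewrite -mulrBr ler_pM2l//; lra.
Qed.

(** At large inverse temperature [be], the colorings that are not good weigh less than exp(n (sigma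
    - e)), so a large free energy forces many good ones. The exceptional fraction decays at rate
    [kap], which beats the rate [kap / 2] at which simple matchings are compared with all
    matchings. *)
Lemma whp_lower t (rho e zeta : R) : (r <= t)%N -> 0 < rho -> 0 < e -> 0 < zeta ->
  exists n0, forall n, (n0 <= n)%N -> ~~ odd (n.+1 * d) ->
  #|[set s in simple_matchings d n | (#|good t rho s|%:R < expR (n.+1%:R * (sigma - e)))%R]%SET|%:R <=
  zeta * #|simple_matchings d n|%:R.
Proof.
move=> rt rho0 e0 z0; pose c := `|sigma| + e.
have lnM : 0 <= ln #|M|%:R :> R by rewrite ln_ge0// ler1n; apply/card_gt0P; exists point.
(* Since [c] is at least [e - sigma], the remainder [expR (- (n * c))] of [partition_split] is at
   most [expR (n * (sigma - e))]. *)
pose be := (ln #|M|%:R + c) / rho; have be0 : 0 <= be by rewrite divr_ge0 ?(ltW rho0)// addr_ge0// addr_ge0// ltW.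
have beE : be * rho = ln #|M|%:R + c by rewrite divfK// gt_eqF.
have th0 : 0 < e / 8 by rewrite divr_gt0.
have [kap k0 [n1 n1P]] := free_energy_ge rt be0 th0.
have k2 : 0 < kap / 2 by rewrite divr_gt0.
have [n2 n2P] := simple_matchings_ge d3 k2.
have e2 : 0 < e / 2 by rewrite divr_gt0.
have [n3 n3P] := exp_large (ln 2) e2.
have [n4 n4P] := exp_large (- ln zeta) k2.
exists (n1 + n2 + n3 + n4)%N => n nn ev.
have [h1 h2 h3 h4] : [/\ (n1 <= n)%N, (n2 <= n)%N, (n3 <= n)%N & (n4 <= n)%N] by move: nn; clear; split; lia.
have {}n1P := n1P n h1 ev; have {}n2P := n2P n h2 ev; have {}n3P := n3P n h3; have {}n4P := n4P n h4.
set N : R := n.+1%:R in n1P n2P n3P n4P *; have N0 : 0 < N by rewrite ltr0n.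
apply: (@le_trans _ _ (MM n * expR (- (N * kap)))).
  apply: le_trans n1P; rewrite ler_nat; apply/subset_leq_card/fintype.subsetP => s.
  rewrite !finset.in_set => /andP[-> few] /=; rewrite ltNge; apply/negP => big.
  have := @partition_split t n be rho c s be0 beE; rewrite -/N => split.
  have {}split : expR (N * (sigma - e / 2)) <= #|good t rho s|%:R + expR (N * (sigma - e)).
    apply: le_trans (le_trans split _); last first.
      rewrite lerD2l ler_expR -mulrN ler_pM2l// /c opprD lerB//.
      by rewrite lerNl -normrN ler_norm.
    by rewrite ler_expR; apply: le_trans big; rewrite ler_pM2l//; lra.
  have two : 2 <= expR (N * (e / 2)) by rewrite -[leLHS](lnK (_ : 2 \is Num.pos)) ?posrE// ler_expR.
  move: split; rewrite (expR_split N (sigma - e / 2) (e / 2)).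
  have -> : sigma - e / 2 - e / 2 = sigma - e by lra.
  exact: no_room two (expR_gt0 _) few.
by apply: tail_absorb.
Qed.

End coupled.

(** Markov's inequality for the first moment at level r; [eta] is chosen before [zeta] because it
    fixes how fine the profile must be. *)
Lemma whp_upper (e : R) : 0 < e -> exists2 eta, 0 < eta & forall zeta : R, 0 < zeta ->
  exists n0, forall n, (n0 <= n)%N -> ~~ odd (n.+1 * d) ->
  #|[set s in simple_matchings d n | (expR (n.+1%:R * (sigma + e)) <
     #|[set f | near_profile (q r) eta (edges_of s) f]|%:R)%R]%SET|%:R <= zeta * #|simple_matchings d n|%:R.
Proof.
move=> e0; have e4 : 0 < e / 4 by rewrite divr_gt0.
have [eta eta0 [n1 n1P]] := first_moment_upper d3 r0 (mu_mass_invariant d3 inv r0) e4.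
exists eta => // zeta z0; have [n2 n2P] := simple_matchings_ge d3 e4.
have [n3 n3P] := exp_large (- ln zeta) e4.
exists (n1 + n2 + n3)%N => n nn ev.
have [h1 h2 h3] : [/\ (n1 <= n)%N, (n2 <= n)%N & (n3 <= n)%N] by move: nn; clear; split; lia.
have {}n1P := n1P n h1 ev; have {}n2P := n2P n h2 ev; have {}n3P := n3P n h3.
set N : R := n.+1%:R in n1P n2P n3P *; have N0 : 0 < N by rewrite ltr0n.
set B := [set s in _ | _]%SET.
have : #|B|%:R * expR (N * (sigma + e)) <= #|typical_pairs (q r) n eta|%:R.
  rewrite -sum_typical mulr_natl -sumr_const [leRHS](bigID (mem B)) /=.
  apply: (@le_trans _ _ (\sum_(s in B) #|[set f | near_profile (q r) eta (edges_of s) f]|%:R)).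
    by apply: ler_sum => s; rewrite finset.in_set => /andP[_ /ltW].
  rewrite -[leLHS]addr0; apply: lerD; last exact: sumr_ge0.
  rewrite le_eqVlt; apply/orP; left; apply/eqP/eq_bigl => s.
  by rewrite !finset.in_set; case: (_ && simple_matching _).
move=> /le_trans/(_ n1P) hB; apply: (@le_trans _ _ (MM n * expR (- (N * (e / 2))))).
  rewrite -(ler_pM2r (expR_gt0 (N * (sigma + e)))); apply: le_trans hB _.
  rewrite -mulrA -expRD ler_wpM2l// ler_expR; exact: upper_exponent.
have e24 : e / 2 / 2 = e / 4 by lra.
by apply: tail_absorb; rewrite ?e24.
Qed.

End typical_colorings.

(** * Sofic entropies and strong typicality *)

Local Open Scope classical_set_scope.
Local Open Scope ring_scope.

Section filters.
Variable R : realType.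

Lemma limf_esup_bounds (F : set_system nat) (f : nat -> \bar R) (a b : \bar R) : ProperFilter F ->
  F [set n | (a <= f n <= b)%E] -> (a <= limf_esup f F <= b)%E.
Proof.
move=> PF fab; rewrite limf_esupE; apply/andP; split.
  apply: le_ereal_inf_tmp => _ [V FV <-].
  have [n [/andP[an _] Vn]] := filter_ex (filterI fab FV).
  by apply: le_trans an _; apply: ereal_sup_ubound; exists n.
apply: (@le_trans _ _ (ereal_sup [set f x | x in [set n | (a <= f n <= b)%E]])).
  by apply: ereal_inf_lbound; exists [set n | (a <= f n <= b)%E].
by apply: ge_ereal_sup => _ [n /andP[_ nb] <-].
Qed.

Lemma limf_einf_bounds (F : set_system nat) (f : nat -> \bar R) (a b : \bar R) : ProperFilter F ->
  F [set n | (a <= f n <= b)%E] -> (a <= limf_einf f F <= b)%E.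
Proof.
move=> PF fab; have := @limf_esup_bounds F (\- f)%E (- b)%E (- a)%E PF.
rewrite limf_esupN !leeN2 andbC; apply; apply: filterS fab => n /= /andP[h1 h2].
by rewrite !leeN2 h1 h2.
Qed.

Lemma lim_right_near (g : R -> \bar R) (l : R) :
  (forall e, 0 < e -> exists2 eps0, 0 < eps0 & forall eps, 0 < eps -> eps <= eps0 ->
     ((l - e)%:E <= g eps <= (l + e)%:E)%E) -> lim (g eps @[eps --> 0^'+]) = l%:E.
Proof.
move=> h; apply: cvg_lim => //; apply/fine_cvgP; split.
  have [e e0 eP] := h 1 ltr01; near=> eps.
  have /andP[h1 h2] : ((l - 1)%:E <= g eps <= (l + 1)%:E)%E by apply: eP; near: eps; [exact: nbhs_right_gt|exact: nbhs_right_le].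
  by rewrite fin_numElt (lt_le_trans _ h1) ?ltNyr// (le_lt_trans h2) ?ltry.
apply/cvgrPdist_le => e e0; have [e1 e10 eP] := h e e0; near=> eps.
have : ((l - e)%:E <= g eps <= (l + e)%:E)%E by apply: eP; near: eps; [exact: nbhs_right_gt|exact: nbhs_right_le].
rewrite /=; case: (g eps) => [x| |] /andP[] //=; rewrite !lee_fin => h1 h2.
by rewrite distrC ler_distl h1.
Unshelve. all: by end_near. Qed.

Lemma lim_eventually (u : nat -> \bar R) (l : \bar R) n0 : (forall n, (n0 <= n)%N -> u n = l) -> limn u = l.
Proof.
move=> h; apply: cvg_lim => //; apply: cvg_near_cst; exists n0 => // n /= nn; exact: h.
Qed.

End filters.

Section regular_graph_proba.
Variables (R : realType) (d : nat).
Hypothesis d3 : (3 <= d)%N.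

Lemma near_admissible (A : set nat) : (exists n0, forall n, (n0 <= n)%N -> ~~ odd (n.+1 * d) -> A n) -> admissible d A.
Proof. by move=> [n0 h]; exists n0 => // n /= nn /andP[_]; exact: h. Qed.

Lemma admissible_proper : ProperFilter (admissible d).
Proof.
split; last exact: within_filter.
(* An odd [n] gives an even number n + 1 of vertices, admissible for every [d]. *)
move=> [n0 _ h]; apply: (h (n0 + d).*2.+1) => /=.
  by clear; lia.
apply/andP; split; first by clear; lia.
by rewrite oddM /= odd_double.
Qed.

Lemma card_set_sum (T : finType) (A : {set T}) (P : pred T) : #|[set x in A | P x]%SET| = (\sum_(x in A) P x)%N.
Proof.
rewrite -sum1_card big_mkcond [RHS]big_mkcond; apply: eq_bigr => x _; rewrite finset.in_set.
by case: (x \in A); case: (P x).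
Qed.

(** Each regular graph comes from equally many pairs of a simple matching and an order sorting it,
    so the factors in [sum_regular_graphs] cancel in the ratio. *)
Lemma regular_proba_matchings n (Q : pred (graph n)) : regular_proba R d Q =
  #|[set s in simple_matchings d n | Q (edges_of s)]%SET|%:R / #|simple_matchings d n|%:R.
Proof.
have card_sum (P : pred (graph n)) : (ntau n * #|[set E in regular_graphs d n | P E]%SET| =
    nsorted d n * #|[set s in simple_matchings d n | P (edges_of s)]%SET|)%N.
  by rewrite !card_set_sum; exact: sum_regular_graphs.
have full (T : finType) (A : {set T}) : #|[set x in A | predT x]%SET| = #|A|.
  by apply: eq_card => x; rewrite finset.in_set andbT.
have h1 := card_sum Q; have h2 := card_sum predT; rewrite (full _ (regular_graphs d n)) in h2.
have fullM : #|[set s in simple_matchings d n | predT (edges_of s)]%SET| = #|simple_matchings d n| by exact: full.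
rewrite fullM in h2; have t0 := ntau_gt0 n.
have [S0|/card_gt0P[s sM]] := posnP #|simple_matchings d n|.
  have b0 : #|regular_graphs d n| = 0%N by move/eqP: h2; rewrite S0 muln0 muln_eq0 gtn_eqF//= => /eqP.
  by rewrite /regular_proba S0 b0 !invr0 !mulr0.
have S0 : (0 < #|simple_matchings d n|)%N by apply/card_gt0P; exists s.
have b0 : (0 < #|regular_graphs d n|)%N by apply/card_gt0P; exists (edges_of s); exact: edges_of_regular.
have ns0 : (0 < nsorted d n)%N.
  by have := muln_gt0 (ntau n) #|regular_graphs d n|; rewrite h2 t0 b0 muln_gt0 => /andP[].
apply/eqP; rewrite eqr_div ?pnatr_eq0 -?lt0n// -!natrM eqr_nat.
rewrite -(eqn_pmul2l t0) -(eqn_pmul2l ns0); apply/eqP.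
by rewrite mulnCA mulnA mulnACA h1 -h2 mulnACA -mulnA.
Qed.

Lemma regular_proba_mono n (Q Q' : pred (graph n)) : (forall s, s \in simple_matchings d n -> Q (edges_of s) -> Q' (edges_of s)) ->
  regular_proba R d Q <= regular_proba R d Q'.
Proof.
move=> QQ; rewrite !regular_proba_matchings ler_wpM2r ?invr_ge0// ler_nat.
apply/subset_leq_card/fintype.subsetP => s; rewrite [_ \in [set _ in _ | _]%SET]finset.in_set => /andP[sM Qs].
by rewrite [_ \in [set _ in _ | _]%SET]finset.in_set sM; exact: QQ.
Qed.

Lemma simple_matchings_gt0 : exists n0, forall n, (n0 <= n)%N -> ~~ odd (n.+1 * d) -> (0 < #|simple_matchings d n|)%N.
Proof.
have [n0 n0P] := simple_matchings_ge (R := R) d3 ltr01; exists n0 => n nn ev.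
rewrite -(ltr0n R); apply: lt_le_trans (n0P n nn ev); rewrite mulr_gt0 ?expR_gt0// ltr0n card_matchings.
have := mcount_even ev; rewrite cardsT card_prod !card_ord; case: (mcount _) => // .
by rewrite muln0 leqn0 -(negbK (_ == _)) -lt0n fact_gt0.
Qed.

Lemma regular_proba_compl n (Q : pred (graph n)) : (0 < #|simple_matchings d n|)%N ->
  regular_proba R d Q = 1 - regular_proba R d (predC Q).
Proof.
move=> s0; rewrite !regular_proba_matchings; apply/eqP; rewrite eq_sym subr_eq -mulrDl -natrD.
have -> : (#|[set s in simple_matchings d n | Q (edges_of s)]%SET| +
  #|[set s in simple_matchings d n | predC Q (edges_of s)]%SET| = #|simple_matchings d n|)%N.
  rewrite -[RHS](cardsID [set s | Q (edges_of s)]%SET); congr (_ + _)%N; apply: eq_card => s.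
    by rewrite finset.in_setI ![_ \in [set _ | _]%SET]finset.in_set.
  by rewrite finset.in_setD ![_ \in [set _ | _]%SET]finset.in_set andbC.
by rewrite divff// pnatr_eq0 -lt0n.
Qed.

End regular_graph_proba.

Section final.
Variables (R : realType) (d : nat) (M : pointedFinType).
Hypothesis d3 : (3 <= d)%N.
Variables (mu : probability (config d M) R) (r : nat).
Hypothesis r0 : (0 < r)%N.
Hypothesis inv : Defs.invariant mu.
Hypothesis mk : r_markov r mu.
Local Notation q t := (mu_mass mu (S_ball d t)).
Local Notation sigma := (Sigma (q r)).
Hypothesis hq : forall w : mass R (M * M)%type (S_ball d r),
  invariant_mass w -> self_coupling (q r) w -> Sigma w <= 2 * sigma.
Variable dist : law R M -> law R M -> R.
Hypothesis distP : generates_weak_topology dist.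

Lemma near_profile_of_good n t (rho : R) s (f : {ffun 'I_n.+1 -> M}) : f \in good mu t rho s ->
  near_profile (q t) rho (edges_of s) f.
Proof.
rewrite finset.in_set => h; apply/forallP => x; apply: le_trans h.
by rewrite /deviation (bigD1 x)//= lerDl sumr_ge0.
Qed.

Lemma proba_few t (e rho zeta : R) (Q : forall n, pred (graph n)) : (r <= t)%N -> 0 < rho -> 0 < e -> 0 < zeta ->
  (forall n s, s \in simple_matchings d n -> Q n (edges_of s) ->
     #|good mu t rho s|%:R < expR (n.+1%:R * (sigma - e))) ->
  exists n0, forall n, (n0 <= n)%N -> ~~ odd (n.+1 * d) -> regular_proba R d (Q n) <= zeta.
Proof.
move=> rt rho0 e0 z0 Qf; have [n0 n0P] := whp_lower d3 r0 inv mk hq rt rho0 e0 z0.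
have [n1 n1P] := simple_matchings_gt0 R d3; exists (n0 + n1)%N => n nn ev.
have s0 : (0 < #|simple_matchings d n|)%N by apply: n1P => //; move: nn; clear; lia.
rewrite regular_proba_matchings ler_pdivrMr ?ltr0n//; apply: le_trans (n0P n _ ev); last by move: nn; clear; lia.
rewrite ler_nat; apply/subset_leq_card/fintype.subsetP => s.
rewrite [_ \in [set _ in _ | _]%SET]finset.in_set => /andP[sM Qs].
by rewrite [_ \in [set _ in _ | _]%SET]finset.in_set sM; exact: Qf.
Qed.

Let few_colorings t eps h n (E : graph n) : bool := #|good_colorings dist mu E t eps|%:R < expR (n.+1%:R * h) :> R.

Lemma good_colorings_lower t (eps e zeta : R) : (r <= t)%N -> 0 < eps -> 0 < e -> 0 < zeta ->
  exists n0, forall n, (n0 <= n)%N -> ~~ odd (n.+1 * d) ->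
  regular_proba R d (@few_colorings t eps (sigma - e) n) <= zeta.
Proof.
move=> rt eps0 e0 z0; have [eta eta0 etaP] := dist_restrict_near d3 mu distP t eps0.
apply: (proba_few (Q := fun n => @few_colorings t eps (sigma - e) n) rt eta0 e0 z0) => n s sM.
apply: le_lt_trans; rewrite ler_nat; apply/subset_leq_card/fintype.subsetP => f fg.
rewrite finset.in_set; apply: etaP; apply/(near_copies_distr d3) => //; exact: near_profile_of_good.
Qed.

Lemma good_colorings_upper t (e : R) : (r <= t)%N -> 0 < e -> exists2 eps0, 0 < eps0 &
  forall eps zeta, eps <= eps0 -> 0 < zeta -> exists n0, forall n, (n0 <= n)%N -> ~~ odd (n.+1 * d) ->
  regular_proba R d (fun E : graph n => expR (n.+1%:R * (sigma + e)) < #|good_colorings dist mu E t eps|%:R) <= zeta.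
Proof.
move=> rt e0; have [eta eta0 etaP] := whp_upper d3 r0 inv e0.
pose c : R := #|{: {ffun S_ball d r -> M}}|%:R * #|{: {ffun S_ball d t -> M}}|%:R.
have c1 : 0 < c + 1 by rewrite ltr_wpDl// mulr_ge0.
have [eps0 eps00 epsP] := near_copies_of_dist d3 mu distP t (divr_gt0 eta0 c1).
exists eps0 => // eps zeta le z0; have [n0 n0P] := etaP zeta z0.
have [n1 n1P] := simple_matchings_gt0 R d3; exists (n0 + n1)%N => n nn ev.
have s0 : (0 < #|simple_matchings d n|)%N by apply: n1P => //; move: nn; clear; lia.
rewrite regular_proba_matchings ler_pdivrMr ?ltr0n//; apply: le_trans (n0P n _ ev); last by move: nn; clear; lia.
rewrite ler_nat; apply/subset_leq_card/fintype.subsetP => s.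
rewrite [_ \in [set _ in _ | _]%SET]finset.in_set => /andP[sM many].
rewrite [_ \in [set _ in _ | _]%SET]finset.in_set sM /=; apply: lt_le_trans many _.
rewrite ler_nat; apply/subset_leq_card/fintype.subsetP => f; rewrite !finset.in_set => fd.
apply/(near_copies_distr d3) => // x.
have := near_copies_level d3 rt (epsP _ (le_trans fd le)) x; move=> /le_trans; apply.
by rewrite mulrA -/c mulrA ler_pdivrMr// mulrC ler_pM2l// lerDl.
Qed.

Lemma h_bounds t alpha (eps e : R) : (r <= t)%N -> 0 < alpha < 1 -> 0 < eps -> 0 < e ->
  (forall zeta, 0 < zeta -> exists n0, forall n, (n0 <= n)%N -> ~~ odd (n.+1 * d) ->
    regular_proba R d (fun E : graph n => expR (n.+1%:R * (sigma + e)) < #|good_colorings dist mu E t eps|%:R) <= zeta) ->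
  admissible d [set n | ((sigma - e)%:E <= h_ dist mu t eps alpha n <= (sigma + e)%:E)%E].
Proof.
move=> rt /andP[a0 a1] eps_gt0 e0 upper; apply: near_admissible.
have a2 : 0 < alpha / 2 by rewrite divr_gt0.
have [n0 n0P] := upper _ a2.
have a3 : 0 < 1 - alpha by rewrite subr_gt0.
have [n1 n1P] := good_colorings_lower rt eps_gt0 e0 a3.
have [n2 n2P] := simple_matchings_gt0 R d3.
exists (n0 + n1 + n2)%N => n nn ev.
have [h0 h1 h2] : [/\ (n0 <= n)%N, (n1 <= n)%N & (n2 <= n)%N] by move: nn; clear; split; lia.
have {}n0P := n0P n h0 ev; have {}n1P := n1P n h1 ev; have s0 := n2P n h2 ev.
have N0 : 0 < n.+1%:R :> R by rewrite ltr0n.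
apply/andP; split.
  (* The supremum ranges over minus infinity and nonnegative reals, so the witness is the positive
     part of [sigma - e]. *)
  apply: (@le_trans _ _ (Num.max 0 (sigma - e))%:E); first by rewrite lee_fin le_max lexx orbT.
  apply: ereal_sup_ubound; split; first by right; rewrite lee_fin le_max lexx ltry.
  apply: (@le_trans _ _ (regular_proba R d (predC (@few_colorings t eps (sigma - e) n)))).
    rewrite regular_proba_compl// lerBrDr -lerBrDl; apply: le_trans n1P.
    by apply: regular_proba_mono => s _; rewrite /= negbK.
  apply: regular_proba_mono => s _; rewrite /= /few_colorings -leNgt => many.
  have F0 : (0 < #|good_colorings dist mu (edges_of s) t eps|)%N.
    by rewrite -(ltr0n R); apply: lt_le_trans many; exact: expR_gt0.
  rewrite /graph_entropy gtn_eqF//= lee_fin ge_max; apply/andP; split.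
    by rewrite divr_ge0// ln_ge0// ler1n.
  by rewrite ler_pdivlMr// mulrC -ler_expR lnK// posrE ltr0n.
apply: ge_ereal_sup => h [[->|/andP[h_ge0 h_fin]] ah]; first by rewrite leNye.
(* A value above [sigma + e] is reached with probability at most [alpha / 2], less than [alpha]. *)
rewrite leNgt; apply/negP => lt; suff : alpha <= alpha / 2 by rewrite ler_pdivlMr// ger_pMr//; lra.
apply: le_trans ah (le_trans _ n0P); apply: regular_proba_mono => s _.
rewrite /graph_entropy; case: ifP => [_ hh|/negbT F0 hh].
  by move: (lt_le_trans lt hh); rewrite ltNge leNye.
have F1 : 0 < #|good_colorings dist mu (edges_of s) t eps|%:R :> R by rewrite ltr0n lt0n.
have := lt_le_trans lt hh; rewrite lte_fin ltr_pdivlMr// [X in X < _ -> _]mulrC => h3.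
by rewrite -[ltRHS](lnK (_ : _ \is Num.pos)) ?posrE// ltr_expR.
Qed.

Lemma sofic_at t alpha : (r <= t)%N -> 0 < alpha < 1 ->
  upper_sofic_at dist mu t alpha = sigma%:E /\ lower_sofic_at dist mu t alpha = sigma%:E.
Proof.
move=> rt a01; have P := admissible_proper d.
split; apply: lim_right_near => e e0; have [eps0 eps00 epsP] := good_colorings_upper rt e0;
  exists eps0 => // eps eps1 eps2; [apply: limf_esup_bounds|apply: limf_einf_bounds];
  apply: h_bounds => // zeta z0; exact: epsP.
Qed.

Lemma sofic_entropies alpha : 0 < alpha < 1 ->
  lower_sofic dist mu alpha = sigma%:E /\ upper_sofic dist mu alpha = sigma%:E.
Proof.
(* The entropies at level t are constant from t = r on. *)
by move=> a01; split; apply: (@lim_eventually _ _ _ r) => t rt; have [] := sofic_at rt a01.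
Qed.

Lemma typical : strongly_typical dist mu.
Proof.
exists (fun=> 1); split; last exact: cvg_cst.
move=> eps eps0; have [t0 t0P] := dist_near d3 mu distP eps0.
have rt : (r <= maxn t0 r)%N by rewrite leq_maxr.
have [eta eta0 etaP] := t0P (maxn t0 r) (leq_maxl _ _).
apply/cvgrPdist_le => zeta z0; apply: near_admissible.
(* A single good coloring is enough here: the lower bound matters only through the positivity of
   [expR], so [e] is arbitrary. *)
have [|n0 n0P] := proba_few (e := 1) (Q := fun n => predC (fun E : graph n => [exists f, dist (distr R E f) (tree_law mu) <= eps])) rt eta0 ltr01 z0.
  move=> n s sM /existsPn no; rewrite [X in X%:R](_ : _ = 0%N) ?expR_gt0//.
  apply/eqP; rewrite cards_eq0; apply/eqP/setP => f; rewrite finset.in_set0; apply/negP => fg.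
  have := no f; rewrite etaP//; apply/(near_copies_distr d3) => //; exact: near_profile_of_good.
have [n1 n1P] := simple_matchings_gt0 R d3.
exists (n0 + n1)%N => n nn ev.
have [h0 h1] : [/\ (n0 <= n)%N & (n1 <= n)%N] by move: nn; clear; split; lia.
rewrite regular_proba_compl ?n1P// opprB addrC subrK ger0_norm ?n0P//.
by rewrite regular_proba_matchings divr_ge0.
Qed.

End final.

Theorem theorem1p11 (R : realType) (d : nat) (M : pointedFinType) (r : nat)
    (p : mass R M (S_ball d r))
    (dist : law R M -> law R M -> R) (mu : probability (config d M) R) :
  (3 <= d)%N -> (1 <= r)%N -> invariant_mass p ->
  generates_weak_topology dist -> markov_extension p mu ->
  (forall q : mass R (M * M)%type (S_ball d r),
     invariant_mass q -> self_coupling p q -> Sigma q <= 2 * Sigma p) ->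
  (forall alpha : R, 0 < alpha < 1 ->
     lower_sofic dist mu alpha = (Sigma p)%:E /\
     upper_sofic dist mu alpha = (Sigma p)%:E) /\
  strongly_typical dist mu.
Proof.
move=> d3 r1 _ distP [inv mk marg].
have -> : p = mu_mass mu (S_ball d r) by apply/ffunP => x; rewrite ffunE marg.
move=> hq; split=> [alpha|]; first exact: sofic_entropies.
exact: (typical d3 r1 inv mk hq distP).
Qed.
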